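(* Assume the quantized Cartan matrix $C(z)$ is invertible (i.e. $\det C(z)\neq 0$). Then the image $\mathrm{Im}(\chi_q)$ of the morphism of $q$-characters $\chi_q:\mathrm{Rep}(\mathcal{U}_q(\hat{\mathfrak{g}}))\to\mathcal{Y}$ is a subring of $\mathcal{Y}$.
   Context: $q\in\mathbb{C}^*$ is not a root of unity; a logarithm of $q$ is fixed so that $q^a$ makes sense for $a\in\mathbb{Q}$. $C=(C_{i,j})_{i,j\in I}$, $I=\{1,\dots,n\}$, is a generalized Cartan matrix: $C_{i,j}\in\mathbb{Z}$, $C_{i,i}=2$, $C_{i,j}\le 0$ for $i\neq j$, $C_{i,j}=0\Leftrightarrow C_{j,i}=0$. It is symmetrizable: positive integers $r_1,\dots,r_n$ are fixed such that $B=(B_{i,j})$, $B_{i,j}=r_iC_{i,j}$, is symmetric. $q_i=q^{r_i}$, $[m]_z=\frac{z^m-z^{-m}}{z-z^{-1}}$, and $\begin{bmatrix}s\\k\end{bmatrix}_z$ is the corresponding symmetric Gaussian binomial coefficient. The quantized Cartan matrix $C(z)$ has entries $C_{i,i}(z)=z^{r_i}+z^{-r_i}$ and $C_{i,j}(z)=[C_{i,j}]_z$ for $i\ne j$. A realization of $C$ is fixed: $\mathfrak{h}$ is a $\mathbb{Q}$-vector space of dimension $2n-\mathrm{rank}(C)$, with linearly independent families $\alpha_1,\dots,\alpha_n\in\mathfrak{h}^*$ and $\alpha_1^\vee,\dots,\alpha_n^\vee\in\mathfrak{h}$ satisfying $\alpha_j(\alpha_i^\vee)=C_{i,j}$. A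 non-degenerate symmetric bilinear form $(\,,)$ on $\mathfrak{h}^*$ with $(\alpha_i,\lambda)=\lambda(r_i\alpha_i^\vee)$ is fixed; $\nu:\mathfrak{h}^*\to\mathfrak{h}$ is the isomorphism with $\lambda(\nu(\mu))=(\lambda,\mu)$. $P=\{\lambda\in\mathfrak{h}^*:\lambda(\alpha_i^\vee)\in\mathbb{Z}\ \forall i\}$, $P^+=\{\lambda\in P:\lambda(\alpha_i^\vee)\ge0\ \forall i\}$, $Q^+=\sum_i\mathbb{N}\alpha_i$, $\mu\le\lambda$ means $\lambda-\mu\in Q^+$, $D(\lambda)=\{\omega\in\mathfrak{h}^*:\omega\le\lambda\}$. The quantum affinization $\mathcal{U}_q(\hat{\mathfrak{g}})$ is the $\mathbb{C}$-algebra with generators $x_{i,r}^{\pm}$ ($i\in I,r\in\mathbb{Z}$), $k_h$ ($h\in\mathfrak{h}$), $h_{i,m}$ ($i\in I$, $m\in\mathbb{Z}\setminus\{0\}$) and relations (R1) $k_hk_{h'}=k_{h+h'}$, $k_0=1$, $[k_h,h_{j,m}]=0$, $[h_{i,m},h_{j,m'}]=0$; (R2) $k_hx_{j,r}^{\pm}k_{-h}=q^{\pm\alpha_j(h)}x_{j,r}^{\pm}$; (R3) $[h_{i,m},x_{j,r}^{\pm}]=\pm\frac1m[mB_{i,j}]_q\,x_{j,m+r}^{\pm}$; (R4) $[x_{i,r}^+,x_{j,r'}^-]=\delta_{i,j}\frac{\phi^+_{i,r+r'}-\phi^-_{i,r+r'}}{q_i-q_i^{-1}}$; (R5) $x_{i,r+1}^{\pm}x_{j,r'}^{\pm}-q^{\pm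 B_{i,j}}x_{j,r'}^{\pm}x_{i,r+1}^{\pm}=q^{\pm B_{i,j}}x_{i,r}^{\pm}x_{j,r'+1}^{\pm}-x_{j,r'+1}^{\pm}x_{i,r}^{\pm}$; (R6) $\sum_{\pi\in\Sigma_s}\sum_{k=0}^{s}(-1)^k\begin{bmatrix}s\\k\end{bmatrix}_{q_i}x_{i,r_{\pi(1)}}^{\pm}\cdots x_{i,r_{\pi(k)}}^{\pm}x_{j,r'}^{\pm}x_{i,r_{\pi(k+1)}}^{\pm}\cdots x_{i,r_{\pi(s)}}^{\pm}=0$ for all $i\neq j$, $s=1-C_{i,j}$, and all $r_1,\dots,r_s,r'\in\mathbb{Z}$. Here $\phi_{i,m}^{\pm}$ is defined by $\sum_{m\ge0}\phi_{i,\pm m}^{\pm}z^{\pm m}=k_{\pm r_i\alpha_i^\vee}\exp\big(\pm(q-q^{-1})\sum_{m'\ge1}h_{i,\pm m'}z^{\pm m'}\big)$, with $\phi^+_{i,m}=0$ for $m<0$ and $\phi^-_{i,m}=0$ for $m>0$. Modules. $V_\omega=\{v\in V:k_h.v=q^{\omega(h)}v\ \forall h\}$ for $\omega\in\mathfrak{h}^*$. $\mathcal{O}_{\mathrm{int}}(\mathcal{U}_q(\hat{\mathfrak{g}}))$ is the category of modules $V$ with $V=\bigoplus_\omega V_\omega$, all $V_\omega$ finite dimensional, weights contained in a finite union of sets $D(\lambda_j)$, and such that for all $\mu\in\mathfrak{h}^*,i\in I$, $V_{\mu\pm r\alpha_i}=0$ for all large $r$. An $l$-weight is a pair $(\lambda,\Psi)$,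 $\lambda\in\mathfrak{h}^*$, $\Psi=(\Psi_{i,\pm m}^{\pm})_{i\in I,m\ge0}$ complex numbers with $\Psi_{i,0}^{\pm}=q_i^{\pm\lambda(\alpha_i^\vee)}$; $P_l$ is the set of $l$-weights. For $V\in\mathcal{O}_{\mathrm{int}}(\mathcal{U}_q(\hat{\mathfrak{g}}))$ and $(\mu,\gamma)\in P_l$, $V_{\mu,\gamma}=\{x\in V_\mu:\exists p\ \forall i\ \forall m\ge0,\ (\phi_{i,\pm m}^{\pm}-\gamma_{i,\pm m}^{\pm})^p.x=0\}$; $V$ is the direct sum of these spaces. If $V_{\mu,\gamma}\neq0$ then $(\mu,\gamma)\in QP_l^+$, the set of $(\mu,\gamma)\in P_l$ such that $\mu\in P^+-Q^+$ and there are $Q_i,R_i\in\mathbb{C}[z]$ of constant term $1$ with $\sum_{m\ge0}\gamma_{i,\pm m}^{\pm}z^{\pm m}=q_i^{\deg Q_i-\deg R_i}\frac{Q_i(zq_i^{-1})R_i(zq_i)}{Q_i(zq_i)R_i(zq_i^{-1})}$ in $\mathbb{C}[[z^{\pm1}]]$. $q$-characters. $\tilde A$ is the commutative group of monomials $m=k_{\omega(m)}\prod_{i\in I,a\in\mathbb{C}^*}Y_{i,a}^{u_{i,a}(m)}$ (finitely many $u_{i,a}(m)\in\mathbb{Z}$ nonzero, $\omega(m)\in\mathfrak{h}$ the coweight of $m$) with $\alpha_i(\omega(m))=r_i\sum_au_{i,a}(m)$ for all $i$; exponents and coweights add under product. For $(\mu,\gamma)\in QP_l^+$ with $Q_i(z)=\prod_a(1-za)^{\beta_{i,a}}$,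 $R_i(z)=\prod_a(1-za)^{\gamma_{i,a}}$, put $Y_{\mu,\gamma}=k_{\nu(\mu)}\prod_{i,a}Y_{i,a}^{\beta_{i,a}-\gamma_{i,a}}\in\tilde A$. $\mathcal{Y}$ is the ring (convolution product) of functions $\chi:\tilde A\to\mathbb{Z}$, written $\sum_m\chi(m)m$, such that the coweights of the monomials of $\chi$ (those $m$ with $\chi(m)\ne0$) lie in a finite union of sets $\nu(D(\lambda_j))$ and for each $\omega\in\mathfrak{h}$ only finitely many monomials of $\chi$ have coweight $\omega$. $\chi_q(V)=\sum_{(\mu,\gamma)\in QP_l^+}\dim(V_{\mu,\gamma})Y_{\mu,\gamma}\in\mathcal{Y}$. $\mathrm{Rep}(\mathcal{U}_q(\hat{\mathfrak{g}}))$ is the Grothendieck group generated by the modules $V\in\mathcal{O}_{\mathrm{int}}(\mathcal{U}_q(\hat{\mathfrak{g}}))$ having a composition series (a possibly infinite sequence $V=V_0\supset V_1\supset V_2\supset\cdots$ with simple successive quotients and zero intersection), the class of such a $V$ being determined by the multiplicities of the simple modules in it; $\chi_q$ induces a group morphism $\mathrm{Rep}(\mathcal{U}_q(\hat{\mathfrak{g}}))\to\mathcal{Y}$. *)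

(* Defs.v *)
From HB Require Import structures.
From mathcomp Require Import all_boot all_order all_algebra.
From mathcomp Require Import finmap perm generic_quotient complex freeg.
From mathcomp Require Import all_classical all_reals all_analysis.

Set Implicit Arguments.
Unset Strict Implicit.
Unset Printing Implicit Defensive.

Import Order.TTheory GRing.Theory Num.Theory.
Local Open Scope quotient_scope.
Local Open Scope classical_set_scope.
Local Open Scope ring_scope.

Section Presentation.
Variables (K : fieldType) (G : Type).

Inductive term :=
| TGen of G
| TCst of K
| TAdd of term & term
| TMul of term & term.

HB.instance Definition _ := gen_eqMixin term.
HB.instance Definition _ := gen_choiceMixin term.

Section Quotient.
Variable rel : term -> term -> Prop.

(* The least congruence containing [rel] whose quotient is a K-algebra. *)
Inductive teq : term -> term -> Prop :=
| teq_rel a b : rel a b -> teq a b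
| teq_refl a : teq a a
| teq_sym a b : teq a b -> teq b a
| teq_trans b a c : teq a b -> teq b c -> teq a c
| teq_add a a' b b' : teq a a' -> teq b b' -> teq (TAdd a b) (TAdd a' b')
| teq_mul a a' b b' : teq a a' -> teq b b' -> teq (TMul a b) (TMul a' b')
| teq_addA a b c : teq (TAdd a (TAdd b c)) (TAdd (TAdd a b) c)
| teq_addC a b : teq (TAdd a b) (TAdd b a)
| teq_add0 a : teq (TAdd (TCst 0) a) a
| teq_addN a : teq (TAdd (TMul (TCst (-1)) a) a) (TCst 0)
| teq_mulA a b c : teq (TMul a (TMul b c)) (TMul (TMul a b) c)
| teq_mul1l a : teq (TMul (TCst 1) a) a
| teq_mul1r a : teq (TMul a (TCst 1)) a
| teq_mulDl a b c : teq (TMul (TAdd a b) c) (TAdd (TMul a c) (TMul b c))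
| teq_mulDr a b c : teq (TMul a (TAdd b c)) (TAdd (TMul a b) (TMul a c))
| teq_cstD x y : teq (TCst (x + y)) (TAdd (TCst x) (TCst y))
| teq_cstM x y : teq (TCst (x * y)) (TMul (TCst x) (TCst y))
| teq_cstC x a : teq (TMul (TCst x) a) (TMul a (TCst x)).

Definition teqb (a b : term) : bool := `[< teq a b >].

Lemma teqb_refl : reflexive teqb.
Proof. by move=> a; apply/asboolP; apply: teq_refl. Qed.
Lemma teqb_sym : symmetric teqb.
Proof.
by move=> a b; apply/asboolP/asboolP => h; apply: teq_sym.
Qed.
Lemma teqb_trans : transitive teqb.
Proof.
by move=> b a c /asboolP h1 /asboolP h2; apply/asboolP; apply: teq_trans h2.
Qed.

Canonical teq_equiv := EquivRel teqb teqb_refl teqb_sym teqb_trans.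

Definition presented := {eq_quot teq_equiv}.
HB.instance Definition _ := Quotient.on presented.
HB.instance Definition _ := Choice.on presented.

Definition tclass (t : term) : presented := \pi_presented t.

Lemma tclassP a b : tclass a = tclass b <-> teq a b.
Proof.
split=> [/eqquotP/asboolP//|h]; apply/eqquotP; exact/asboolP.
Qed.

Lemma teq_repr a : teq (repr (tclass a)) a.
Proof. by apply/tclassP; rewrite /tclass reprK. Qed.

Lemma tclass_repr u : tclass (repr u) = u.
Proof. exact: reprK. Qed.

Definition p_add (u v : presented) := tclass (TAdd (repr u) (repr v)).
Definition p_mul (u v : presented) := tclass (TMul (repr u) (repr v)).
Definition p_cst (x : K) := tclass (TCst x).

Lemma p_addE a b : p_add (tclass a) (tclass b) = tclass (TAdd a b).
Proof. by apply/tclassP; apply: teq_add; apply: teq_repr. Qed.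
Lemma p_mulE a b : p_mul (tclass a) (tclass b) = tclass (TMul a b).
Proof. by apply/tclassP; apply: teq_mul; apply: teq_repr. Qed.

Lemma p_addA : associative p_add.
Proof.
move=> u v w; rewrite -(tclass_repr u) -(tclass_repr v) -(tclass_repr w).
by rewrite !p_addE; apply/tclassP; apply: teq_addA.
Qed.
Lemma p_addC : commutative p_add.
Proof.
move=> u v; rewrite -(tclass_repr u) -(tclass_repr v).
by rewrite !p_addE; apply/tclassP; apply: teq_addC.
Qed.
Lemma p_add0 : left_id (p_cst 0) p_add.
Proof.
by move=> u; rewrite -(tclass_repr u) p_addE; apply/tclassP; apply: teq_add0.
Qed.
Lemma p_addN : left_inverse (p_cst 0) (p_mul (p_cst (-1))) p_add.
Proof.
move=> u; rewrite -(tclass_repr u) p_mulE p_addE.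
by apply/tclassP; apply: teq_addN.
Qed.
Lemma p_mulA : associative p_mul.
Proof.
move=> u v w; rewrite -(tclass_repr u) -(tclass_repr v) -(tclass_repr w).
by rewrite !p_mulE; apply/tclassP; apply: teq_mulA.
Qed.
Lemma p_mul1l : left_id (p_cst 1) p_mul.
Proof.
by move=> u; rewrite -(tclass_repr u) p_mulE; apply/tclassP; apply: teq_mul1l.
Qed.
Lemma p_mul1r : right_id (p_cst 1) p_mul.
Proof.
by move=> u; rewrite -(tclass_repr u) p_mulE; apply/tclassP; apply: teq_mul1r.
Qed.
Lemma p_mulDl : left_distributive p_mul p_add.
Proof.
move=> u v w; rewrite -(tclass_repr u) -(tclass_repr v) -(tclass_repr w).
by rewrite !(p_addE, p_mulE); apply/tclassP; apply: teq_mulDl.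
Qed.
Lemma p_mulDr : right_distributive p_mul p_add.
Proof.
move=> u v w; rewrite -(tclass_repr u) -(tclass_repr v) -(tclass_repr w).
by rewrite !(p_addE, p_mulE); apply/tclassP; apply: teq_mulDr.
Qed.

HB.instance Definition _ := GRing.isPzRing.Build presented
  p_addA p_addC p_add0 p_addN p_mulA p_mul1l p_mul1r p_mulDl p_mulDr.

Definition p_scale (x : K) (u : presented) : presented := p_cst x * u.

Lemma p_cstD x y : p_cst (x + y) = p_cst x + p_cst y.
Proof.
by rewrite [RHS]p_addE; apply/tclassP; apply: teq_cstD.
Qed.
Lemma p_cstM x y : p_cst (x * y) = p_cst x * p_cst y.
Proof.
by rewrite [RHS]p_mulE; apply/tclassP; apply: teq_cstM.
Qed.

Lemma p_scaleA x y u : p_scale x (p_scale y u) = p_scale (x * y) u.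
Proof. by rewrite /p_scale p_cstM mulrA. Qed.
Lemma p_scale1 : left_id 1 p_scale.
Proof. exact: p_mul1l. Qed.
Lemma p_scaleDr : right_distributive p_scale +%R.
Proof. by move=> x u v; rewrite /p_scale mulrDr. Qed.
Lemma p_scaleDl u : {morph p_scale^~ u : x y / x + y}.
Proof. by move=> x y; rewrite /p_scale p_cstD mulrDl. Qed.

HB.instance Definition _ := GRing.Zmodule_isLmodule.Build K presented
  p_scaleA p_scale1 p_scaleDr p_scaleDl.

(* [presented] may be the zero ring, which is why it is not an [algType]; the
   next two lemmas are the remaining algebra axioms. *)
Lemma p_scaleAl (x : K) (u v : presented) : x *: (u * v) = (x *: u) * v.
Proof. exact: mulrA. Qed.
Lemma p_scaleAr (x : K) (u v : presented) : x *: (u * v) = u * (x *: v).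
Proof.
rewrite -[LHS]/(p_cst x * (u * v)) -[x *: v]/(p_cst x * v) !mulrA.
congr (_ * _); rewrite -(tclass_repr u) [LHS]p_mulE [RHS]p_mulE.
by apply/tclassP; apply: teq_cstC.
Qed.

Definition pgen (g : G) : presented := tclass (TGen g).

End Quotient.

Definition free_alg := presented (fun _ _ => False).

(* The quotient of the free algebra by the two-sided ideal generated by the
   elements u - v with [rel u v]. *)
Definition alg_of_rel (rel : free_alg -> free_alg -> Prop) :=
  presented (fun a b => rel (tclass _ a) (tclass _ b)).

End Presentation.

Section Series.

Definition ser_mul (A : pzRingType) (f g : nat -> A) (m : nat) : A :=
  \sum_(k < m.+1) f k * g (m - k)%N.

Definition ser_pow (A : pzRingType) (f : nat -> A) (k : nat) : nat -> A :=
  iter k (ser_mul f) (fun m => (m == 0%N)%:R).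

(* The coefficient of z^m in exp(f(z)), for f without constant term: the terms
   f(z)^k / k! with k > m do not contribute. *)
Definition exp_coef (K : fieldType) (G : Type) rel
    (f : nat -> @presented K G rel) (m : nat) : presented rel :=
  \sum_(k < m.+1) (k`!%:R)^-1 *: ser_pow f k m.

End Series.

(* Signs are booleans, [true] standing for +. *)
Definition pm (e : bool) : int := if e then 1 else -1.

(* A family indexed by m >= 0, seen as the coefficients of z^(pm e * m) of a
   series in z^(pm e), extended by 0 to all integer exponents. *)
Definition zext (e : bool) (M : zmodType) (f : nat -> M) (k : int) : M :=
  if 0 <= pm e * k then f `|k|%N else 0.

(* sum_(m >= 0) f m z^(pm e * m) = N(z) / D(z) as Laurent series in z^(pm e),
   written as an equality of the coefficients of z^k after multiplication
   by D(z). *)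
Definition expands_as (F : fieldType) (e : bool) (f : nat -> F)
    (N D : {poly F}) : Prop :=
  forall k : int,
    \sum_(j < size D) D`_j * zext e f (k - j%:Z) = zext true (nth 0 N) k.

Definition qnum (F : fieldType) (z : F) (m : int) : F :=
  (z ^ m - z ^ (- m)) / (z - z^-1).
Definition qfact (F : fieldType) (z : F) (s : nat) : F :=
  \prod_(1 <= j < s.+1) qnum z j%:Z.
Definition qbinom (F : fieldType) (z : F) (s k : nat) : F :=
  qfact z s / (qfact z k * qfact z (s - k)).

Definition cexp (R : realType) (z : R[i]) : R[i] :=
  (expR (complex.Re z) * cos (complex.Im z)
   +i* (expR (complex.Re z) * sin (complex.Im z)))%C.

(* q ^ a for the determination of the logarithm of q given by [lq]. *)
Definition qpow (R : realType) (lq : R[i]) (a : rat) : R[i] :=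
  cexp (ratr a * lq).

Section Convolution.
Variable M : zmodType.

Definition fsupp (f : M -> int) : set M := [set m | f m != 0].

Definition conv (f g : M -> int) (m : M) : int :=
  \sum_(a \in [set: M]) f a * g (m - a).

Definition delta0 (m : M) : int := (m == 0)%:R.

Lemma conv_term (f g : M -> int) m a :
  ~ (fsupp f a /\ fsupp g (m - a)) -> f a * g (m - a) = 0.
Proof.
move=> nfg; have [->|fa] := eqVneq (f a) 0; first by rewrite mul0r.
have [->|ga] := eqVneq (g (m - a)) 0; first by rewrite mulr0.
by case: nfg.
Qed.

Lemma conv_sub (X : set M) f g m :
  [set a | fsupp f a /\ fsupp g (m - a)] `<=` X ->
  conv f g m = \sum_(a \in X) f a * g (m - a).
Proof.
move=> sX; apply/esym; apply: fsbig_widen => // a [_ /= nXa].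
by apply: conv_term => fga; apply: nXa; apply: sX.
Qed.

Lemma fsupp_conv f g m : fsupp (conv f g) m ->
  exists a, fsupp f a /\ fsupp g (m - a).
Proof.
rewrite /fsupp /= /conv => h; apply: contrapT => no; move/eqP: h; apply.
by rewrite fsbig1 // => a _; apply: conv_term => fga; apply: no; exists a.
Qed.

Lemma conv1l f : conv delta0 f = f.
Proof.
apply/funext => m; rewrite (@conv_sub [set 0]) // /=.
  by rewrite fsbig_set1 /delta0 eqxx mul1r subr0.
by move=> a [] /=; rewrite /fsupp /delta0 /=; case: (a =P 0).
Qed.

Lemma convC f g : conv f g = conv g f.
Proof.
apply/funext => m; rewrite /conv.
rewrite (@reindex_fsbig _ _ _ _ _ (fun a => m - a) setT setT).
  by apply: eq_fsbigr => a _; rewrite subKr mulrC.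
split=> // [a b _ _ /= /addrI /oppr_inj //|a _].
by exists (m - a) => //; rewrite subKr.
Qed.

Lemma convDl f g h :
  (forall m, finite_set [set a | fsupp f a /\ fsupp h (m - a)]) ->
  (forall m, finite_set [set a | fsupp g a /\ fsupp h (m - a)]) ->
  conv (f + g) h = conv f h + conv g h.
Proof.
move=> sf sg; apply/funext => m.
pose X := [set a | fsupp f a /\ fsupp h (m - a)]
  `|` [set a | fsupp g a /\ fsupp h (m - a)].
have fX : finite_set X by rewrite finite_setU.
rewrite (@conv_sub X) // => [|a [/= fga ha]]; last first.
  have [fa|fa] := eqVneq (f a) 0; last by left.
  right; split=> //; move: fga; rewrite /fsupp /=.
  by rewrite -[(f + g) a]/(f a + g a) fa add0r.
rewrite -[RHS]/(conv f h m + conv g h m).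
rewrite (@conv_sub X f) => [|a]; last by left.
rewrite (@conv_sub X g) => [|a]; last by right.
by rewrite -fsbig_split //; apply: eq_fsbigr => a _; rewrite -[(f + g) a]/(f a + g a) mulrDl.
Qed.

Lemma convA f g h :
  (forall m, finite_set [set ab : M * M |
     [/\ fsupp f ab.1, fsupp g ab.2 & fsupp h (m - (ab.1 + ab.2))]]) ->
  conv f (conv g h) = conv (conv f g) h.
Proof.
move=> fin3; apply/funext => m.
pose T := [set ab : M * M |
     [/\ fsupp f ab.1, fsupp g ab.2 & fsupp h (m - (ab.1 + ab.2))]].
pose A := [set ab.1 | ab in T].
pose S := [set ab.1 + ab.2 | ab in T].
have fA : finite_set A by apply: finite_image; apply: fin3.
have fS : finite_set S by apply: finite_image; apply: fin3.
transitivity (\sum_(a \in A) \sum_(c \in S) f a * g (c - a) * h (m - c)).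
  rewrite (@conv_sub A) => [|a [/= fa /fsupp_conv[b [gb hb]]]]; last first.
    by exists (a, b) => //; split=> //=; rewrite opprD addrA.
  apply: eq_fsbigr => a _; rewrite mulr_fsumr; apply/esym.
  rewrite (@fsbig_widen _ _ _ _ S setT) // => [|c [_ /= nS]]; last first.
    apply: (@conv_term (fun c => f a * g (c - a)) h m c) => -[].
    rewrite /fsupp /= mulf_eq0 negb_or => /andP[fa ga] hc; apply: nS.
    exists (a, c - a); last by rewrite /= addrC subrK.
    by split=> //=; rewrite [a + _]addrC subrK.
  rewrite (@reindex_fsbig _ _ _ _ _ (fun b => b + a) setT setT); last first.
    by split=> // [b b' _ _ /= /addIr //|c _]; exists (c - a); rewrite ?subrK.
  by apply: eq_fsbigr => b _; rewrite addrK mulrA opprD [- b - a]addrC addrA.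
rewrite exchange_fsbig //; apply/esym.
rewrite (@conv_sub S) => [|c [/= /fsupp_conv[a [fa ga]] hc]]; last first.
  exists (a, c - a); last by rewrite /= addrC subrK.
    by split=> //=; rewrite [a + _]addrC subrK.
apply: eq_fsbigr => c _; rewrite mulr_fsuml; apply/esym.
apply: fsbig_widen => // a [_ /= nA].
have [hc|hc] := eqVneq (h (m - c)) 0; first by rewrite hc mulr0.
rewrite (@conv_term f g) ?mul0r // => -[fa ga]; apply: nA.
by exists (a, c - a) => //; split=> //=; rewrite [a + _]addrC subrK.
Qed.

End Convolution.

Record cartan_datum (n : nat) := CartanDatum {
  cmat :> 'M[int]_n;
  symz : 'I_n -> nat;
  cmat_diag : forall i, cmat i i = 2;
  cmat_offdiag : forall i j, i != j -> cmat i j <= 0;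
  cmat_eq0 : forall i j, cmat i j = 0 <-> cmat j i = 0;
  symz_gt0 : forall i, (0 < symz i)%N;
  symz_sym : forall i j,
    (symz i)%:Z * cmat i j = (symz j)%:Z * cmat j i
}.

Definition bmat n (D : cartan_datum n) (i j : 'I_n) : int :=
  (symz D i)%:Z * D i j.

Definition zvar : {fraction {poly rat}} := tofrac 'X.

Definition qcartan n (D : cartan_datum n) : 'M[{fraction {poly rat}}]_n :=
  \matrix_(i, j) if i == j then zvar ^+ symz D i + zvar ^- symz D i
                 else qnum zvar (D i j).

Record realization n (D : cartan_datum n) := Realization {
  hh : vectType rat;
  scoroot : 'I_n -> hh;
  sroot : 'I_n -> 'Hom(hh, rat^o);
  hh_dim : \dim {:hh} = (2 * n - \rank (map_mx intr D : 'M[rat]_n))%N;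
  scoroot_free : free [seq scoroot i | i <- enum 'I_n];
  sroot_free : free [seq sroot i | i <- enum 'I_n];
  sroot_scoroot : forall i j, sroot j (scoroot i) = (D i j)%:~R;
  form : 'Hom(hh, rat^o) -> 'Hom(hh, rat^o) -> rat;
  form_linear : forall a u u' v,
    form (a *: u + u') v = a * form u v + form u' v;
  form_sym : forall u v, form u v = form v u;
  form_nondeg : forall u, (forall v, form u v = 0) -> u = 0;
  form_sroot : forall i (u : 'Hom(hh, rat^o)),
    form (sroot i) u = u ((symz D i)%:R *: scoroot i);
  nu : 'Hom(hh, rat^o) -> hh;
  nuP : forall u v : 'Hom(hh, rat^o), v (nu u) = form v u
}.
Arguments form {n D} r u v : rename.
Arguments nu {n D} r u : rename.

Section Weights.
Variables (n : nat) (D : cartan_datum n) (H : realization D).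
Local Notation hdual := 'Hom(hh H, rat^o).

Definition Qplus : set hdual :=
  [set x | exists a : 'I_n -> nat, x = \sum_i sroot H i *+ a i].
Definition leQ (mu la : hdual) : Prop := Qplus (la - mu).
Definition Pplus : set hdual :=
  [set la | forall i, (la (scoroot H i) : rat) \is a Num.nat].

End Weights.

Section Affinization.
Variables (R : realType) (q lq : R[i]).
Variables (n : nat) (D : cartan_datum n) (H : realization D).

Inductive qgen :=
| GenX of bool & 'I_n & int
| GenK of hh H
| GenH of 'I_n & {m : int | m != 0}.

Section Elements.
Variable rel : term R[i] qgen -> term R[i] qgen -> Prop.
Local Notation A := (presented rel).

Definition xg (e : bool) (i : 'I_n) (r : int) : A := pgen rel (GenX e i r).
Definition kg (h : hh H) : A := pgen rel (GenK h).
(* There is no generator h_{i,0}; [hg i 0] is 0. *)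
Definition hg (i : 'I_n) (m : int) : A :=
  oapp (fun m' => pgen rel (GenH i m')) 0 (insub m).

(* [phi e i m] is phi^{+}_{i,m} for e = true, phi^{-}_{i,-m} for e = false. *)
Definition phi (e : bool) (i : 'I_n) (m : nat) : A :=
  kg ((pm e * (symz D i)%:Z)%:~R *: scoroot H i) *
  exp_coef (fun m' => ((pm e)%:~R * (q - q^-1)) *: hg i (pm e * m'%:Z)) m.

End Elements.

Definition qi (i : 'I_n) : R[i] := q ^+ symz D i.

Local Notation F := (free_alg R[i] qgen).
Local Notation x := (xg (fun _ _ => False)).
Local Notation k := (kg (fun _ _ => False)).
Local Notation h := (hg (fun _ _ => False)).
Local Notation ph e i := (zext e (phi (fun _ _ => False) e i)).
Local Notation B := (bmat D).

Inductive qaff_rel : F -> F -> Prop :=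
| R1_kk a b : qaff_rel (k a * k b) (k (a + b))
| R1_k0 : qaff_rel (k 0) 1
| R1_kh a j m : m != 0 -> qaff_rel (k a * h j m) (h j m * k a)
| R1_hh i m j m' : m != 0 -> m' != 0 ->
    qaff_rel (h i m * h j m') (h j m' * h i m)
| R2 e a j r :
    qaff_rel (k a * x e j r * k (- a))
             (qpow lq ((pm e)%:~R * sroot H j a) *: x e j r)
| R3 e i j m r : m != 0 ->
    qaff_rel (h i m * x e j r - x e j r * h i m)
             (((pm e)%:~R / m%:~R * qnum q (m * B i j)) *: x e j (m + r))
| R4 i j r r' :
    qaff_rel (x true i r * x false j r' - x false j r' * x true i r)
             (if i == j then
                (qi i - (qi i)^-1)^-1 *:
                  (ph true i (r + r') - ph false i (r + r'))
              else 0)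
| R5 e i j r r' :
    qaff_rel (x e i (r + 1) * x e j r'
                - q ^ (pm e * B i j) *: (x e j r' * x e i (r + 1)))
             (q ^ (pm e * B i j) *: (x e i r * x e j (r' + 1))
                - x e j (r' + 1) * x e i r)
| R6 e i j (s : nat) (r : 'I_s -> int) r' : i != j -> s%:Z = 1 - D i j ->
    qaff_rel
      (\sum_(p : 'S_s) \sum_(t < s.+1)
         ((-1) ^+ t * qbinom (qi i) s t) *:
           ((\prod_(u < s | (u < t)%N) x e i (r (p u))) * x e j r' *
            (\prod_(u < s | (t <= u)%N) x e i (r (p u)))))
      0.

Definition qaff := alg_of_rel qaff_rel.

Record qmod := QMod {
  mcar :> lmodType R[i];
  act : qaff -> mcar -> mcar;
  act_linear : forall u, linear (act u);
  act_linearl : forall c u u' v,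
    act (c *: u + u') v = c *: act u v + act u' v;
  act1 : forall v, act 1 v = v;
  actM : forall u u' v, act (u * u') v = act u (act u' v)
}.

Local Notation hdual := 'Hom(hh H, rat^o).
Local Notation kU := (kg _ : hh H -> qaff).
Local Notation phiU := (phi _ : bool -> 'I_n -> nat -> qaff).

Section LinearAlgebra.
Variable V : lmodType R[i].

Definition has_dim (W : set V) (d : nat) : Prop :=
  exists b : 'I_d -> V, (forall i, W (b i)) /\
    forall v, W v -> exists! c : 'rV[R[i]]_d, v = \sum_i c 0 i *: b i.

Definition sdim (W : set V) : nat := xget 0%N [set d | has_dim W d].

Definition direct_sum (I : eqType) (W : I -> set V) : Prop :=
  (forall v, exists (s : seq I) (f : I -> V),
     (forall i, W i (f i)) /\ v = \sum_(i <- s) f i) /\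
  (forall (s : seq I) (f : I -> V), uniq s -> (forall i, W i (f i)) ->
     \sum_(i <- s) f i = 0 -> forall i, i \in s -> f i = 0).

End LinearAlgebra.

Definition wspace (V : qmod) (om : hdual) : set V :=
  [set v | forall a, act (kU a) v = qpow lq (om a) *: v].

Definition O_int (V : qmod) : Prop :=
  [/\ direct_sum (wspace (V := V)),
      forall om, exists d, has_dim (wspace (V := V) om) d,
      exists s : seq hdual, forall om,
        (exists2 v : V, wspace om v & v != 0) ->
        exists2 la, la \in s & leQ om la
    & forall (mu : hdual) i, exists N : nat, forall r : nat, (N <= r)%N ->
        wspace (V := V) (mu + sroot H i *+ r) `<=` [set 0] /\
        wspace (V := V) (mu - sroot H i *+ r) `<=` [set 0]].

Definition submodule (V : qmod) (W : set V) : Prop :=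
  [/\ W 0, forall (c : R[i]) u v, W u -> W v -> W (c *: u + v)
    & forall (a : qaff) v, W v -> W (act a v)].

Definition simple (S : qmod) : Prop :=
  (exists v : S, v != 0) /\
  forall W : set S, submodule W -> W = [set 0] \/ W = setT.

(* W / W' is isomorphic to S: there is a surjective morphism p : W -> S with
   kernel W'. The values of p outside of W are irrelevant. *)
Definition subquot_iso (V : qmod) (W W' : set V) (S : qmod) : Prop :=
  exists p : V -> S,
    [/\ forall (c : R[i]) u v, W u -> W v -> p (c *: u + v) = c *: p u + p v,
        forall (a : qaff) u, W u -> p (act a u) = act a (p u),
        forall s, exists2 u, W u & p u = s
      & forall u, W u -> (p u = 0 <-> W' u)].

(* A finite sequence, ending with V_k = 0, is continued by 0. *)
Definition composition_series (V : qmod) (F : nat -> set V) : Prop :=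
  [/\ F 0%N = setT,
      forall k, submodule (F k) /\ F k.+1 `<=` F k,
      forall k, F k = [set 0] \/
        exists2 S, simple S & subquot_iso (F k) (F k.+1) S
    & \bigcap_k F k = [set 0]].

Record simple_mod := SimpleMod { smod :> qmod; smod_simple : simple smod }.

Record rep_mod := RepMod {
  rmod :> qmod;
  rmod_int : O_int rmod;
  rmod_series : exists F, composition_series (V := rmod) F
}.

Definition series_of (V : rep_mod) : nat -> set V :=
  projT1 (cid (rmod_series V)).
Arguments series_of : clear implicits.

(* The number of composition factors of V isomorphic to S; it does not depend
   on the chosen composition series. *)
Definition mult (V : rep_mod) (S : simple_mod) : int :=
  #|` fset_set [set k | subquot_iso (series_of V k) (series_of V k.+1) S] |%:Z.

(* The class of the formal integral combination sum_j c_j [V_j]. *)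
Definition rep_class (c : seq (int * rep_mod)) (S : simple_mod) : int :=
  \sum_(p <- c) p.1 * mult p.2 S.

(* The Grothendieck group: the group of functions generated by the classes [V],
   the class of V being its function of multiplicities. *)
Record Rep := MkRep {
  rep_val : simple_mod -> int;
  rep_valP : exists c, rep_val = rep_class c
}.

(* Psi e i m stands for Psi^{+}_{i,m} or Psi^{-}_{i,-m}. *)
Definition lweight : Type := (hdual * (bool -> 'I_n -> nat -> R[i]))%type.
HB.instance Definition _ := Choice.on lweight.

Definition Pl : set lweight :=
  [set l : lweight | forall e i,
     l.2 e i 0%N =
       qpow lq ((pm e)%:~R * (symz D i)%:R * l.1 (scoroot H i))].

Definition lspace (V : qmod) (l : lweight) : set V :=
  [set v | wspace l.1 v /\
     exists p : nat, forall e i m,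
       act ((phiU e i m - l.2 e i m *: (1 : qaff)) ^+ p) v = 0].

Definition pscale (a : R[i]) (p : {poly R[i]}) : {poly R[i]} :=
  p \Po (a *: 'X).
Definition pdeg (p : {poly R[i]}) : int := (size p).-1%:Z.

Definition QR_for (l : lweight) (Q P : 'I_n -> {poly R[i]}) : Prop :=
  forall i, [/\ (Q i)`_0 = 1, (P i)`_0 = 1 &
    forall e, expands_as e (l.2 e i)
      (qi i ^ (pdeg (Q i) - pdeg (P i)) *:
         (pscale (qi i)^-1 (Q i) * pscale (qi i) (P i)))
      (pscale (qi i) (Q i) * pscale (qi i)^-1 (P i))].

Definition QPl : set lweight :=
  [set l : lweight | [/\ Pl l, exists2 la, Pplus la & leQ l.1 la
             & exists Q P, QR_for l Q P]].

Definition Cstar := {a : R[i] | a != 0}.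

(* A pair (coweight, exponents); {freeg Cstar} is the group of finitely
   supported functions Cstar -> int, and [deg] is the sum of the values. The
   product of monomials is written additively. *)
Local Notation premono := (hh H * {ffun 'I_n -> {freeg Cstar}})%type.

Definition mono_pred : {pred premono} :=
  fun m => [forall i, (sroot H i m.1 : rat) ==
                       (symz D i)%:R * (deg (m.2 i))%:~R].

Lemma mono_pred_zmod : zmod_closed mono_pred.
Proof.
split=> [|u v /forallP hu /forallP hv]; apply/forallP => i /=.
  by rewrite linear0 ffunE raddf0 mulr0.
rewrite linearB /= (eqP (hu i)) (eqP (hv i)) !ffunE raddfB /=.
by rewrite rmorphB mulrBr.
Qed.

HB.instance Definition _ :=
  GRing.isZmodClosed.Build premono mono_pred mono_pred_zmod.

Record mono := Mono { mono_val : premono; _ : mono_val \in mono_pred }.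
HB.instance Definition _ := [isSub for mono_val].
HB.instance Definition _ := [Choice of mono by <:].
HB.instance Definition _ := [SubChoice_isSubZmodule of mono by <:].

Definition cowt (m : mono) : hh H := (mono_val m).1.
Definition expo (m : mono) (i : 'I_n) (a : Cstar) : int :=
  coeff a ((mono_val m).2 i).

(* The condition on the set of monomials of an element of Y. *)
Definition adm (A : set mono) : Prop :=
  (exists s : seq hdual, forall m, A m ->
     exists la om, [/\ la \in s, leQ om la & cowt m = nu H om]) /\
  forall w : hh H, finite_set [set m | A m /\ cowt m = w].

Lemma nuD (u v : hdual) : nu H (u + v) = nu H u + nu H v.
Proof.
have sep (w w' : hh H) : (forall f : hdual, f w = f w') -> w = w'.
  move=> hf; apply/eqP; rewrite -subr_eq0; apply/eqP.
  pose L (i : 'I_(\dim {:hh H})) : hdual :=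
    linfun (coord (vbasis {:hh H}) i : hh H -> rat^o).
  rewrite [w - w'](coord_vbasis (memvf _)) big1 // => i _.
  have := hf (L i); rewrite !lfunE /= => e.
  by rewrite linearB /= e subrr scale0r.
apply: sep => f; rewrite linearD /= !nuP.
by have := form_linear 1 u v f; rewrite scale1r mul1r !(form_sym _ f) => ->.
Qed.

Lemma nu_inj : injective (nu H).
Proof.
have nuN u : nu H (- u) = - nu H u.
  have n0 : nu H 0 = 0 by apply: (addrI (nu H 0)); rewrite -nuD !addr0.
  by apply: (addrI (nu H u)); rewrite -nuD !subrr.
move=> u v e; apply/eqP; rewrite -subr_eq0; apply/eqP.
by apply: form_nondeg => w; rewrite form_sym -nuP nuD nuN e subrr linear0.
Qed.

Lemma sroot_comb_inj (c c' : 'I_n -> nat) :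
  \sum_i sroot H i *+ c i = \sum_i sroot H i *+ c' i -> c =1 c'.
Proof.
move=> e; pose X := [tuple sroot H i | i < n].
have /freeP fX : free X by exact: (sroot_free H).
have := fX (fun i => (c i)%:R - (c' i)%:R) _.
have -> : \sum_(i < n) ((c i)%:R - (c' i)%:R) *: X`_i = 0 :> hdual.
  apply/eqP; under eq_bigr => i _ do
    rewrite (nth_map i) ?size_enum_ord // nth_ord_enum scalerBl !scaler_nat.
  by rewrite sumrB e subrr.
move=> /(_ erefl) h i; have /eqP := h i.
by rewrite subr_eq0 eqr_nat => /eqP.
Qed.

Lemma cowt_fin (s t : seq hdual) (w0 : hh H) : finite_set
  [set w | (exists la om, [/\ la \in s, leQ om la & w = nu H om]) /\
     exists la om, [/\ la \in t, leQ om la & w0 - w = nu H om]].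
Proof.
pose Z la la' := [set w : hh H |
  (exists om, leQ om la /\ w = nu H om) /\
  (exists om, leQ om la' /\ w0 - w = nu H om)].
apply: (@sub_finite_set _ _
  (\bigcup_(la in [set` s]) \bigcup_(la' in [set` t]) Z la la')).
  move=> w [[la [om [ls lo ->]]] [la' [om' [lt' lo' e]]]].
  by exists la => //; exists la' => //; split; [exists om|exists om'].
apply: bigcup_finite => // la _; apply: bigcup_finite => // la' _.
have [[w1 Zw1]|no] := pselect (exists w, Z la la' w); last first.
  by rewrite (_ : Z la la' = set0) // -subset0 => w Zw; apply: no; exists w.
case: Zw1 => -[u1 [[a1 ea1] ew1]] [v1 [[b1 eb1] ev1]].
pose N := \max_i (a1 i + b1 i)%N.
pose g (a : {ffun 'I_n -> 'I_N.+1}) := nu H (la - \sum_i sroot H i *+ a i).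
apply: (@sub_finite_set _ _ [set g a | a in setT]); last exact: finite_image.
move=> w [[u [[a ea] ew]] [v [[b eb] ev]]].
have euv : u1 + v1 = u + v.
  by apply: nu_inj; rewrite !nuD -ew -ew1 -ev -ev1 !addrA ![_ + w0]addrC !addrK.
have eab : \sum_i sroot H i *+ (a1 i + b1 i) = \sum_i sroot H i *+ (a i + b i).
  under eq_bigr do rewrite mulrnDr.
  under [RHS]eq_bigr do rewrite mulrnDr.
  by rewrite !big_split /= -ea -eb -ea1 -eb1 addrACA -opprD euv opprD addrACA.
have {}eab := sroot_comb_inj eab.
have la_N i : (a i < N.+1)%N.
  by rewrite ltnS (leq_trans (leq_addr (b i) _)) // -eab;
     apply: (leq_bigmax (F := fun i => (a1 i + b1 i)%N)).
exists [ffun i => Ordinal (la_N i)] => //.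
rewrite /g ew; congr (nu H _); under eq_bigr do rewrite ffunE /=.
by rewrite -ea opprB addrC subrK.
Qed.

Lemma cowtB (a b : mono) : cowt (a - b) = cowt a - cowt b.
Proof. by []. Qed.
Lemma cowtD (a b : mono) : cowt (a + b) = cowt a + cowt b.
Proof. by []. Qed.

Lemma leQD (a b c d : hdual) : leQ a c -> leQ b d -> leQ (a + b) (c + d).
Proof.
move=> [x ex] [y ey]; exists (fun i => (x i + y i)%N).
under eq_bigr do rewrite mulrnDr.
by rewrite big_split /= -ex -ey opprD addrACA.
Qed.

Lemma adm_pairs (A B : set mono) (w : hh H) : adm A -> adm B ->
  finite_set [set ab : mono * mono |
    [/\ A ab.1, B ab.2 & cowt ab.1 + cowt ab.2 = w]].
Proof.
move=> [[s As] fA] [[t Bt] fB].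
pose W := [set w' | (exists la om, [/\ la \in s, leQ om la & w' = nu H om]) /\
     exists la om, [/\ la \in t, leQ om la & w - w' = nu H om]].
have fW : finite_set W := cowt_fin s t w.
apply: (@sub_finite_set _ _ (\bigcup_(w' in W)
  ([set m | A m /\ cowt m = w'] `*` [set m | B m /\ cowt m = w - w']))).
  move=> [a b] /= [Aa Bb e]; exists (cowt a); last first.
    by split=> /=; split=> //; rewrite -e addrC addKr.
  split; first exact: As.
  by have [la [om [h1 h2 h3]]] := Bt _ Bb; exists la, om; split=> //;
     rewrite -h3 -e addrC addKr.
by apply: bigcup_finite => // w' _; apply: finite_setX.
Qed.

Lemma admS A B : A `<=` B -> adm B -> adm A.
Proof.
move=> AB [[s hs] fB]; split; first by exists s => m /AB; apply: hs.
by move=> w; apply: sub_finite_set (fB w) => m [/AB].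
Qed.

Lemma admU A B : adm A -> adm B -> adm (A `|` B).
Proof.
move=> [[s hs] fA] [[t ht] fB]; split.
  exists (s ++ t) => m [/hs|/ht] [la [om [h1 h2 h3]]]; exists la, om;
  by rewrite mem_cat h1 ?orbT.
move=> w; apply: (@sub_finite_set _ _
  ([set m | A m /\ cowt m = w] `|` [set m | B m /\ cowt m = w])).
  by move=> m [[?|?] ?]; [left|right].
by rewrite finite_setU.
Qed.

Lemma adm0 : adm [set 0].
Proof.
split=> [|w]; last by apply: (@sub_finite_set _ _ [set 0]) => // m [].
exists [:: 0] => m ->; exists 0, 0; split; rewrite ?inE //.
  by exists (fun _ => 0%N); rewrite subrr big1.
have n0 : nu H 0 = 0 by apply: (addrI (nu H 0)); rewrite -nuD !addr0.
by rewrite n0.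
Qed.

Lemma admD A B : adm A -> adm B ->
  adm [set ab.1 + ab.2 | ab in [set ab : mono * mono | A ab.1 /\ B ab.2]].
Proof.
move=> aA aB; split.
  have [[s hs] _] := aA; have [[t ht] _] := aB.
  exists [seq x + y | x <- s, y <- t] => _ [[a b] /= [Aa Bb] <-].
  have [la [om [h1 h2 h3]]] := hs _ Aa; have [la' [om' [k1 k2 k3]]] := ht _ Bb.
  exists (la + la'), (om + om'); split; first exact: allpairs_f.
    exact: leQD.
  by rewrite cowtD h3 k3 nuD.
move=> w; apply: (@sub_finite_set _ _ [set ab.1 + ab.2 | ab in
  [set ab : mono * mono | [/\ A ab.1, B ab.2 & cowt ab.1 + cowt ab.2 = w]]]).
  by move=> _ [[[a b] /= [Aa Bb] <-] e]; exists (a, b).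
by apply: finite_image; apply: adm_pairs.
Qed.

Lemma adm_fin A B m : adm A -> adm B -> finite_set [set a | A a /\ B (m - a)].
Proof.
move=> aA aB; apply: (@sub_finite_set _ _ [set ab.1 | ab in
  [set ab : mono * mono |
    [/\ A ab.1, B ab.2 & cowt ab.1 + cowt ab.2 = cowt m]]]).
  by move=> a [Aa Ba]; exists (a, m - a) => //; split=> //=;
     rewrite cowtB addrC subrK.
by apply: finite_image; apply: adm_pairs.
Qed.

Definition Y_pred : {pred (mono -> int)} := fun f => `[< adm (fsupp f) >].

Lemma Y_pred_zmod : zmod_closed Y_pred.
Proof.
split=> [|f g /asboolP af /asboolP ag]; apply/asboolP.
  by apply: admS adm0 => m /eqP[].
apply: admS (admU af ag) => m; rewrite /fsupp /= => fgm.
have [fm|] := eqVneq (f m) 0; last by left.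
right; apply: contraNN fgm => /eqP gm.
by rewrite -[(f - g) m]/(f m - g m) fm gm subrr.
Qed.

HB.instance Definition _ :=
  GRing.isZmodClosed.Build (mono -> int) Y_pred Y_pred_zmod.

Record Y := MkY { Y_val : mono -> int; _ : Y_val \in Y_pred }.
HB.instance Definition _ := [isSub for Y_val].
HB.instance Definition _ := [Choice of Y by <:].
HB.instance Definition _ := [SubChoice_isSubZmodule of Y by <:].

Lemma Y_adm (f : Y) : adm (fsupp (Y_val f)).
Proof. exact/asboolP/(valP f). Qed.

Lemma adm_conv (f g : mono -> int) :
  adm (fsupp f) -> adm (fsupp g) -> adm (fsupp (conv f g)).
Proof.
move=> af ag; apply: admS (admD af ag) => m /fsupp_conv[a [fa ga]].
by exists (a, m - a) => //=; rewrite addrC subrK.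
Qed.

Lemma Y_mul_subproof (f g : Y) : conv (Y_val f) (Y_val g) \in Y_pred.
Proof. by apply/asboolP/adm_conv; apply: Y_adm. Qed.
Lemma Y_one_subproof : @delta0 mono \in Y_pred.
Proof.
apply/asboolP; apply: admS adm0 => m; rewrite /fsupp /delta0 /=.
by case: (m =P 0).
Qed.

Definition Y_mul (f g : Y) : Y := MkY (Y_mul_subproof f g).
Definition Y_one : Y := MkY Y_one_subproof.

Lemma Y_mulC : commutative Y_mul.
Proof. by move=> f g; apply: val_inj; apply: convC. Qed.
Lemma Y_mul1 : left_id Y_one Y_mul.
Proof. by move=> f; apply: val_inj; apply: conv1l. Qed.
Lemma Y_mulDl : left_distributive Y_mul +%R.
Proof.
move=> f g h; apply: val_inj => /=.
by apply: convDl => m; apply: adm_fin; apply: Y_adm.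
Qed.
Lemma Y_mulA : associative Y_mul.
Proof.
move=> f g h; apply: val_inj => /=; apply: convA => m.
have afg := admD (Y_adm f) (Y_adm g).
apply: (@sub_finite_set _ _ (\bigcup_(c in
    [set c | [set ab.1 + ab.2 | ab in [set ab : mono * mono |
        fsupp (Y_val f) ab.1 /\ fsupp (Y_val g) ab.2]] c /\
      fsupp (Y_val h) (m - c)])
  [set (a, c - a) | a in
     [set a | fsupp (Y_val f) a /\ fsupp (Y_val g) (c - a)]])).
  move=> [a b] /= [fa gb hab]; exists (a + b).
    by split=> //; exists (a, b).
  exists a; last by rewrite [a + b]addrC addrK.
  by split=> //=; rewrite [a + b]addrC addrK.
apply: bigcup_finite => [|c _]; first by apply: adm_fin => //; apply: Y_adm.
by apply: finite_image; apply: adm_fin; apply: Y_adm.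
Qed.

HB.instance Definition _ := GRing.Zmodule_isComPzRing.Build Y
  Y_mulA Y_mulC Y_mul1 Y_mulDl.

(* m = Y_{mu,gamma} for l = (mu, gamma). The multiplicity of 1 - z a in Q i is
   that of the root 1 / a. As q is not a root of unity, [l] determines the
   quotients Q_i / R_i, hence m. *)
Definition is_Ymon (l : lweight) (m : mono) : Prop :=
  cowt m = nu H l.1 /\
  exists Q P, QR_for l Q P /\
    forall i a, expo m i a =
      (mup (val a)^-1 (Q i))%:Z - (mup (val a)^-1 (P i))%:Z.

(* The coefficient of m in chi_q(V). *)
Definition qchar (V : qmod) (m : mono) : int :=
  \sum_(l \in [set l : lweight | QPl l /\ is_Ymon l m]) (sdim (lspace (V := V) l))%:Z.

(* The value on x of the morphism induced on the Grothendieck group; it does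
   not depend on the chosen expression of x as a combination of classes. *)
Definition chi_q (x : Rep) (m : mono) : int :=
  \sum_(p <- projT1 (cid (rep_valP x))) p.1 * qchar p.2 m.

Definition Im_chi_q : {pred Y} :=
  fun y => `[< exists x : Rep, Y_val y = chi_q x >].

End Affinization.
Arguments qchar {R} q lq {n D H} V m.
Arguments chi_q {R} q lq {n D H} x m.
Arguments Im_chi_q {R} q lq {n D} H _ : rename.

(* Main.v *)
(* Let V, W be integrable.  The Drinfeld coproduct, deformed by a
  spectral parameter u, acts on families of W-valued Laurent series in u
  depending linearly on V.  Every operator involved satisfies linear
  recurrences, so matrix coefficients are rational in u with poles of bounded
  order at u = 1; hence there is a stable lattice L whose weight spaces have
  finite rank, and L / (1 - u) L is an integrable module whose l-weights are the
  products of those of V and W: its q-character is chi_q(V) chi_q(W).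
  L / (1 - u) L need not have a composition series, but the direct sum of the
  simple jumps of a maximal chain of submodules has one, with the same
  q-character. *)
Require Import Defs.
From HB Require Import structures.
From mathcomp Require Import all_boot all_order all_algebra.
From mathcomp Require Import finmap perm generic_quotient complex freeg.
From mathcomp Require Import all_classical all_reals all_analysis.
From mathcomp Require Import ring lra zify.
Set Implicit Arguments.
Unset Strict Implicit.
Unset Printing Implicit Defensive.
Import Order.TTheory GRing.Theory Num.Theory.
Local Open Scope classical_set_scope.
Local Open Scope ring_scope.

(** On x^+ and x^- the Drinfeld coproduct is an infinite sum without meaning at u = 1, whence the
    parameter. Hom(V, W) replaces a tensor product: V acts through the anti-involution exchanging
    x^+_{i,r} and x^-_{i,r} and fixing k, h and phi, so its weights and l-weights are kept, and
    convergence becomes a matter of coefficients of powers of u. The Serre relations are not checked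
    on the coproduct; on integrable objects they follow from the other relations by quantum sl2
    theory, so they are recovered after specialization. As there are infinitely many weights, no
    single power of 1 - u controls all poles; a bound for pairs of weights is split into a sum of
    two functions of one weight, using that weights are countable. Multiplicities of l-weights are
    read from flags stable under phi, which can be cut, lifted and compared between lattices.
    Finally [qchar] sums over QP_l^+ only, so every l-weight of an integrable module must be shown
    to lie there: an excess of poles over zeros of an eigenvalue series in one orbit of q_i^2 would
    produce an infinite root string. *)

Local Notation fcons a c := (fun i => if unlift ord0 i is Some j then c j else a).

(** * Reflective proofs of linear identities in modules *)

Section LinearExpressions.
Variables (F : comNzRingType) (E : lmodType F).

Inductive lexp :=
| LVar of nat | LZero | LAdd of lexp & lexp | LOpp of lexp | LScale of F & lexp.

Fixpoint leval (env : seq E) (e : lexp) : E :=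
  match e with
  | LVar k => nth 0 env k
  | LZero => 0
  | LAdd a b => leval env a + leval env b
  | LOpp a => - leval env a
  | LScale c a => c *: leval env a
  end.

Fixpoint lcoef (e : lexp) (i : nat) : F :=
  match e with
  | LVar k => if Nat.eqb i k then 1 else 0
  | LZero => 0
  | LAdd a b => lcoef a i + lcoef b i
  | LOpp a => - lcoef a i
  | LScale c a => c * lcoef a i
  end.

(** Coefficients are compared by a conjunction that [cbn] unfolds, leaving ring identities over [F];
    [lcoef] uses [Nat.eqb] for the same reason. *)
Fixpoint lagree (a b : lexp) (n : nat) : Prop :=
  if n is m.+1 then lcoef a m = lcoef b m /\ lagree a b m else True.

Lemma levalE env e : leval env e = \sum_(i < size env) lcoef e i *: nth 0 env i.
Proof.
elim: e => [k||a IHa b IHb|a IHa|c a IHa] /=; rewrite ?IHa ?IHb.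
- have eqbE i j : Nat.eqb i j = (i == j) by elim: i j => [|i IH] [|j].
  have [ks|ks] := ltnP k (size env).
  rewrite (bigD1 (Ordinal ks)) //= eqbE eqxx scale1r big1 ?addr0 // => i.
  by rewrite -val_eqE eqbE => /negbTE ->; rewrite scale0r.
  rewrite nth_default // big1 // => i _; rewrite eqbE.
  by rewrite ltn_eqF ?scale0r //; apply: leq_trans ks.
- by rewrite big1 // => i _; rewrite scale0r.
- by rewrite -big_split; apply: eq_bigr => i _; rewrite scalerDl.
- by rewrite -sumrN; apply: eq_bigr => i _; rewrite scaleNr.
- by rewrite scaler_sumr; apply: eq_bigr => i _; rewrite scalerA.
Qed.
Lemma leval_eq env a b : lagree a b (size env) -> leval env a = leval env b.
Proof.
rewrite !levalE => h; apply: eq_bigr => i _; congr (_ *: _).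
suff H m : lagree a b m -> forall i, (i < m)%N -> lcoef a i = lcoef b i.
  exact: H h _ (ltn_ord i).
elim: m => // m IH [e /IH h'] j; rewrite ltnS leq_eqVlt => /orP[/eqP->|] //.
exact: h'.
Qed.

End LinearExpressions.

Ltac lmod_index x l :=
  lazymatch l with
  | x :: _ => constr:(0%N)
  | _ :: ?t => let k := lmod_index x t in constr:(S k)
  end.
Ltac lmod_add x l :=
  lazymatch l with
  | [::] => constr:([:: x])
  | x :: _ => l
  | ?y :: ?t => let t' := lmod_add x t in constr:(y :: t')
  end.
Ltac lmod_atoms t l :=
  lazymatch t with
  | (?a + ?b)%R => let l' := lmod_atoms a l in lmod_atoms b l'
  | (- ?a)%R => lmod_atoms a l
  | (_ *: ?a)%R => lmod_atoms a l
  | (0)%R => l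
  | _ => lmod_add t l
  end.
Ltac lmod_reify F t l :=
  lazymatch t with
  | (?a + ?b)%R => let a' := lmod_reify F a l in let b' := lmod_reify F b l in
  constr:(@LAdd F a' b')
  | (- ?a)%R => let a' := lmod_reify F a l in constr:(@LOpp F a')
  | (?c *: ?a)%R => let a' := lmod_reify F a l in constr:(@LScale F c a')
  | (0)%R => constr:(@LZero F)
  | _ => let k := lmod_index t l in constr:(@LVar F k)
  end.
Ltac lmod_close := cbn [lagree lcoef size Nat.eqb]; repeat split; try ring.
Ltac lmod_in F :=
  lazymatch goal with
  | |- @eq ?T ?a ?b =>
  let l := lmod_atoms a (@nil T) in let l := lmod_atoms b l in
  let a' := lmod_reify F a l in let b' := lmod_reify F b l in
  apply: (@leval_eq F _ l a' b'); lmod_close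
  end.

(** * Subspaces as predicates and relative dimension *)

Section Subspaces.
Variables (F : fieldType) (E : lmodType F).

Definition lsub (X : set E) : Prop :=
  X 0 /\ forall (c : F) u v, X u -> X v -> X (c *: u + v).

(** Linearity is asked on a subset only, because the operators of the deformed coproduct are total
    functions that behave linearly on summable families alone. *)
Definition linon (E' : lmodType F) (X : set E) (f : E -> E') : Prop :=
  forall (c : F) u v, X u -> X v -> f (c *: u + v) = c *: f u + f v.

Section One.
Variables (X : set E) (hX : lsub X).
Lemma subsp0 : X 0. Proof. by case: hX. Qed.
Lemma subspD u v : X u -> X v -> X (u + v).
Proof. by move=> Xu Xv; rewrite -[u]scale1r; apply: hX.2. Qed.
Lemma subspZ c u : X u -> X (c *: u).
Proof. by move=> Xu; rewrite -[_ *: _]addr0; apply: hX.2 => //; apply: subsp0. Qed.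
Lemma subspN u : X u -> X (- u).
Proof. by move=> Xu; rewrite -scaleN1r; apply: subspZ. Qed.
Lemma subspB u v : X u -> X v -> X (u - v).
Proof. by move=> Xu Xv; apply: subspD => //; apply: subspN. Qed.
Lemma subsp_sum (J : Type) (r : seq J) (P : pred J) (f : J -> E) :
  (forall j, P j -> X (f j)) -> X (\sum_(j <- r | P j) f j).
Proof. by move=> h; apply: big_ind => //; [apply: subsp0|apply: subspD]. Qed.

Variables (E' : lmodType F) (f : E -> E') (hf : linon X f).
Lemma linonD u v : X u -> X v -> f (u + v) = f u + f v.
Proof. by move=> Xu Xv; rewrite -{1}[u]scale1r hf // scale1r. Qed.
Lemma linon0 : f 0 = 0.
Proof.
by apply: (addrI (f 0)); rewrite -linonD ?addr0 //; apply: subsp0.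
Qed.
Lemma linonZ c u : X u -> f (c *: u) = c *: f u.
Proof.
by move=> Xu; rewrite -[c *: u]addr0 hf ?linon0 ?addr0 //; apply: subsp0.
Qed.
Lemma linonN u : X u -> f (- u) = - f u.
Proof. by move=> Xu; rewrite -scaleN1r linonZ // scaleN1r. Qed.
Lemma linonB u v : X u -> X v -> f (u - v) = f u - f v.
Proof. by move=> Xu Xv; rewrite linonD ?linonN //; apply: subspN. Qed.
Lemma linon_sum (J : Type) (r : seq J) (P : pred J) (g : J -> E) :
  (forall j, P j -> X (g j)) ->
  f (\sum_(j <- r | P j) g j) = \sum_(j <- r | P j) f (g j).
Proof.
move=> h; suff [] : X (\sum_(j <- r | P j) g j) /\
  f (\sum_(j <- r | P j) g j) = \sum_(j <- r | P j) f (g j) by [].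
apply: (big_rec2 (fun a b => X a /\ f a = b)); first by split; [apply: subsp0|apply: linon0].
by move=> j a b Pj [Xa <-]; split; [apply: subspD => //; apply: h|rewrite linonD //; apply: h].
Qed.
End One.

Lemma lsub0 : lsub [set 0].
Proof. by split=> // c u v -> ->; rewrite scaler0 addr0. Qed.
Lemma lsubT : lsub setT. Proof. by []. Qed.
Lemma lsubI X Y : lsub X -> lsub Y -> lsub (X `&` Y).
Proof.
move=> hX hY; split; first by split; apply: subsp0.
by move=> c u v [? ?] [? ?]; split; [apply: hX.2|apply: hY.2].
Qed.
Lemma lin0T (E' : lmodType F) (f : E -> E') : linon setT f -> f 0 = 0.
Proof. by move=> h; rewrite (linon0 lsubT h). Qed.
Lemma linZT (E' : lmodType F) (f : E -> E') : linon setT f -> forall c u, f (c *: u) = c *: f u.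
Proof. by move=> h c u; rewrite (linonZ lsubT h). Qed.
Lemma linBT (E' : lmodType F) (f : E -> E') : linon setT f -> forall u v, f (u - v) = f u - f v.
Proof. by move=> h u v; rewrite (linonB lsubT h). Qed.
Lemma linsT (E' : lmodType F) (f : E -> E') : linon setT f ->
  forall (J : Type) (r : seq J) (P : pred J) (g : J -> E), f (\sum_(j <- r | P j) g j) = \sum_(j <- r | P j) f (g j).
Proof. by move=> h J r P g; rewrite (linon_sum lsubT h). Qed.
Lemma linon_sub (E' : lmodType F) X Y (f : E -> E') :
  Y `<=` X -> linon X f -> linon Y f.
Proof. by move=> YX hf c u v /YX Xu /YX Xv; apply: hf. Qed.
(** For subspaces this bounds by [n] the dimension of the image of [X] in the quotient by [Z].
    Phrasing it by linear dependence avoids choosing bases and passes at once to smaller [X] and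
    larger [Z]. *)
Definition fd (Z X : set E) (n : nat) : Prop :=
  forall m (b : 'I_m -> E), (n < m)%N -> (forall i, X (b i)) ->
  exists2 c : 'I_m -> F, (exists i, c i != 0) & Z (\sum_i c i *: b i).

Lemma fd_sub Z Z' X X' n : fd Z X n -> X' `<=` X -> Z `<=` Z' -> fd Z' X' n.
Proof.
move=> h XX ZZ m b nm Xb; have [c c0 /ZZ Zc] := h m b nm (fun i => XX _ (Xb i)).
by exists c.
Qed.
Lemma fd_span Z X n (s : 'I_n -> E) : lsub Z ->
  (forall x, X x -> exists c : 'I_n -> F, Z (x - \sum_i c i *: s i)) ->
  fd Z X n.
Proof.
move=> hZ sp m b nm Xb.
have /choice [A hA] i := sp _ (Xb i).
pose M := \matrix_(i < m, j < n) A i j.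
(* There are more vectors than generators, so the coefficient matrix has a nonzero left kernel
   vector; it gives the relation modulo [Z]. *)
have : kermx M != 0.
  rewrite -mxrank_eq0 mxrank_ker -lt0n subn_gt0.
  exact: leq_ltn_trans (rank_leq_col M) nm.
case/rowV0Pn => v /sub_kermxP vM v0.
exists (fun i => v 0 i).
  apply: contrapT => nc; case/eqP: v0; apply/rowP => i; rewrite mxE.
  by apply/eqP/negPn/negP => vi; apply: nc; exists i.
have -> : \sum_i v 0 i *: b i =
  \sum_i v 0 i *: (b i - \sum_j A i j *: s j).
  under [RHS]eq_bigr do rewrite scalerBr.
  rewrite sumrB [X in _ - X](_ : _ = 0) ?subr0 //.
  under eq_bigr do rewrite scaler_sumr.
  rewrite exchange_big big1 // => j _.
  under eq_bigr do rewrite scalerA.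
  rewrite -scaler_suml; have /rowP/(_ j) := vM.
  by rewrite !mxE => e; rewrite [X in X *: _](_ : _ = 0) ?scale0r // -[RHS]e;
  apply: eq_bigr => i _; rewrite mxE.
by apply: subsp_sum => // i _; apply: subspZ.
Qed.
Lemma fd0 Z X : lsub Z -> fd Z X 0 -> X `<=` Z.
Proof.
move=> hZ h x Xx; have [|c [i ci]] := h 1%N (fun=> x) isT; first by [].
rewrite big_ord1 => Zc; rewrite (ord1 i) in ci.
by rewrite -[x](scalerK ci); apply: subspZ.
Qed.
Lemma sum_ord_unlift (m : nat) (c : 'I_m.+1 -> F) (x : E) (b : 'I_m -> E) :
  \sum_i c i *: (if unlift ord0 i is Some j then b j else x) =
  c ord0 *: x + \sum_j c (fintype.lift ord0 j) *: b j.
Proof.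
rewrite big_ord_recl unlift_none; congr (_ + _).
by apply: eq_bigr => j _; rewrite liftK.
Qed.
(** A family in [X'] is enlarged by [x] before the bound for [X] is applied. The disjunction covers
    two uses: shrinking [X] to a subspace that avoids [x] modulo [Z], and enlarging [Z] by the line
    of [x], where a relation involving [x] becomes a relation modulo [Z']. *)
Lemma fd_drop Z X Z' X' n x : lsub Z -> fd Z X n.+1 -> X x ->
  X' `<=` X -> Z `<=` Z' ->
  (forall a y, a != 0 -> X' y -> ~ Z (a *: x + y) \/ Z' y) ->
  lsub X' -> (forall a : F, a != 0 -> ~ Z (a *: x)) -> fd Z' X' n.
Proof.
move=> hZ h Xx XX ZZ hx hX' nx m b nm Xb.
pose b' (i : 'I_m.+1) := if unlift ord0 i is Some j then b j else x.
have [|i|c [i ci]] := h m.+1 b'; first by rewrite ltnS.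
  by rewrite /b'; case: unliftP => // j _; apply/XX/Xb.
rewrite sum_ord_unlift => Zc.
have [c0|c0] := eqVneq (c ord0) 0.
  exists (fun j => c (fintype.lift ord0 j)).
  move: ci; case: (unliftP ord0 i) => [j ->|->]; last by rewrite c0 eqxx.
  by exists j.
  by move: Zc; rewrite c0 scale0r add0r => /ZZ.
have Xs : X' (\sum_j c (fintype.lift ord0 j) *: b j).
  by apply: subsp_sum => // j _; apply: subspZ.
have [//|Z'y] := hx _ _ c0 Xs.
exists (fun j => c (fintype.lift ord0 j)) => //.
apply: contrapT => all0; apply: (nx (c ord0) c0).
rewrite big1 ?addr0 // in Zc => j _.
have [->|cj] := eqVneq (c (fintype.lift ord0 j)) 0; first by rewrite scale0r.
by case: all0; exists j.
Qed.

(** The exact relative dimension, as opposed to the bound [fd]; that [d] is unique is shown in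
    [rdim_uniq]. *)
Inductive rdim (Z : set E) : set E -> nat -> Prop :=
| rdim0 : rdim Z Z 0
| rdimS Y X d e : lsub X -> rdim Z Y d -> X e -> ~ Y e -> Y `<=` X ->
  (forall x, X x -> exists a : F, Y (x - a *: e)) -> rdim Z X d.+1.

End Subspaces.

(** * Polynomials in an operator *)

Section PolyAction.
Variables (F : fieldType) (E : lmodType F) (T : E -> E).

Definition pap (p : {poly F}) (x : E) : E :=
  \sum_(j < size p) p`_j *: iter j T x.

Lemma papE n (p : {poly F}) x : (size p <= n)%N ->
  pap p x = \sum_(j < n) p`_j *: iter j T x.
Proof.
move=> pn; rewrite /pap (big_ord_widen n (fun j => p`_j *: iter j T x) pn).
rewrite big_mkcond; apply: eq_bigr => j _; case: ltnP => // pj.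
by rewrite nth_default ?scale0r.
Qed.
Lemma pap_lin c (p r : {poly F}) x : pap (c *: p + r) x = c *: pap p x + pap r x.
Proof.
pose n := maxn (size (c *: p + r)) (maxn (size p) (size r)).
rewrite !(@papE n) ?leq_max ?leqnn ?orbT // scaler_sumr -big_split.
by apply: eq_bigr => j _; rewrite coefD coefZ scalerDl scalerA.
Qed.
Lemma pap0 x : pap 0 x = 0. Proof. by rewrite /pap size_poly0 big_ord0. Qed.
Lemma papD (p r : {poly F}) x : pap (p + r) x = pap p x + pap r x.
Proof. by rewrite -[p]scale1r pap_lin !scale1r. Qed.
Lemma papZ c (p : {poly F}) x : pap (c *: p) x = c *: pap p x.
Proof. by rewrite -[c *: p]addr0 pap_lin pap0 addr0. Qed.
Lemma papN (p : {poly F}) x : pap (- p) x = - pap p x.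
Proof. by rewrite -[- p]scaleN1r papZ scaleN1r. Qed.
Lemma papC c x : pap c%:P x = c *: x.
Proof.
by rewrite (@papE 1) ?size_polyC_leq1 // big_ord1 coefC.
Qed.
Lemma pap1 x : pap 1 x = x. Proof. by rewrite papC scale1r. Qed.

Variables (X : set E) (hX : lsub X) (sT : forall v, X v -> X (T v))
  (lT : linon X T).

Lemma iterX j x : X x -> X (iter j T x).
Proof. by move=> Xx; elim: j => // j; apply: sT. Qed.
Lemma papX p x : X x -> X (pap p x).
Proof. by move=> Xx; apply: subsp_sum => // j _; apply/(subspZ hX)/iterX. Qed.
Lemma pap_mulX p x : X x -> pap ('X * p) x = T (pap p x).
Proof.
move=> Xx; rewrite (@papE (size p).+1); last first.
  by rewrite mulrC; have [->|p0] := eqVneq p 0; rewrite ?mul0r ?size_mulX.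
rewrite big_ord_recl coefXM scale0r add0r.
rewrite (linon_sum hX lT); last by move=> j _; apply: subspZ => //; apply: iterX.
apply: eq_bigr => j _; rewrite coefXM (linonZ hX lT) //; exact: iterX.
Qed.
Lemma pap_lin2 p : linon X (pap p).
Proof.
move=> c u v Xu Xv; rewrite scaler_sumr -big_split /=.
apply: eq_bigr => j _; rewrite [_ *: (_ *: _)]scalerA mulrC -scalerA -scalerDr.
congr (_ *: _); elim: (val j) => //= k ->; apply: lT; exact: iterX.
Qed.
Lemma papM p r x : X x -> pap (p * r) x = pap p (pap r x).
Proof.
move=> Xx; elim/poly_ind: p => [|p c IH]; first by rewrite mul0r !pap0.
rewrite mulrDl !papD -mulrA [in X in X + _]mulrC -mulrA pap_mulX // [r * p]mulrC IH.
rewrite [p * 'X]mulrC pap_mulX; last exact: papX.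
by congr (_ + _); rewrite mul_polyC papZ papC.
Qed.
End PolyAction.

(** * Simultaneous triangularization and generalized eigenspaces *)

Section Flags.
Variables (F : closedFieldType) (E : lmodType F) (I : Type) (Phi : I -> E -> E).

Definition stab (X : set E) : Prop :=
  lsub X /\ forall i v, X v -> X (Phi i v).

Definition comfam (X : set E) : Prop :=
  [/\ stab X, forall i, linon X (Phi i) &
  forall i j v, X v -> Phi i (Phi j v) = Phi j (Phi i v)].

Lemma comfam_sub X Y : comfam X -> stab Y -> Y `<=` X -> comfam Y.
Proof.
move=> [_ lX cX] sY YX; split=> // [i|i j v /YX]; last exact: cX.
exact: linon_sub YX (lX i).
Qed.

(** A simultaneous triangular form on the quotient of [X] by [Z], with [cs] the list of diagonal
    characters from the top down. Being inductive, it can be concatenated, pulled back and pushed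
    forward without quotient types. *)
Inductive flag (Z : set E) : set E -> seq (I -> F) -> Prop :=
| flag0 : flag Z Z [::]
| flagS Y X c cs e : flag Z Y cs -> stab X -> X e -> ~ Y e -> Y `<=` X ->
  (forall x, X x -> exists a : F, Y (x - a *: e)) ->
  (forall i, Y (Phi i e - c i *: e)) -> flag Z X (c :: cs).

Lemma flag_sub Z X cs : flag Z X cs -> Z `<=` X.
Proof. by elim=> // Y X' c cs' e _ ZY _ _ _ YX _ _; apply: subset_trans YX. Qed.
Lemma flag_stab Z X cs : stab Z -> flag Z X cs -> stab X.
Proof. by move=> sZ; case. Qed.
Lemma flag_cat Z Y X cs cs' :
  flag Z Y cs -> flag Y X cs' -> flag Z X (cs' ++ cs).
Proof. by move=> fY; elim=> // *; apply: flagS; eauto. Qed.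
Lemma flag_fd Z X cs : lsub Z -> flag Z X cs ->
  exists n (s : 'I_n -> E), forall x, X x ->
  exists c : 'I_n -> F, Z (x - \sum_i c i *: s i).
Proof.
move=> hZ; elim=> [|Y X' c cs' e _ [n [s hs]] _ Xe _ _ hX _].
  exists 0%N, (fun=> 0) => x Zx; exists (fun=> 0); rewrite big_ord0 subr0 //.
exists n.+1, (fcons e s) => x Xx.
have [a Ya] := hX x Xx; have [d Zd] := hs _ Ya.
exists (fcons a d).
rewrite sum_ord_unlift unlift_none opprD addrA.
by under eq_bigr do rewrite liftK.
Qed.
(** The first n + 1 iterates of x are dependent modulo [Z], so some nonzero polynomial in [Phi i]
    sends x into [Z]. It splits over a closed field, and linear factors are removed one at a time
    until the vector leaves [Z]. *)
Lemma eigen1 X Z i n x : comfam X -> stab Z -> Z `<=` X -> fd Z X n ->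
  X x -> ~ Z x ->
  exists2 y, X y /\ ~ Z y & exists a, Z (Phi i y - a *: y).
Proof.
move=> [[hX sX] lX cX] [hZ sZ] ZX fdX Xx Zx.
pose pp := pap (Phi i).
have Xp p : X (pp p x) by apply: papX => //; exact: sX.
have [p p0 Zp] : exists2 p, p != 0 & Z (pp p x).
  have [j|c [j cj] Zc] := fdX n.+1 (fun j : 'I_n.+1 => iter j (Phi i) x) (ltnSn n).
  by apply: iterX => //; exact: sX.
  exists (\poly_(k < n.+1) c (inord k)).
  apply/eqP => /polyP/(_ j); rewrite coef_poly ltn_ord inord_val coef0 => e.
  by rewrite e eqxx in cj.
  rewrite /pp (@papE _ _ _ n.+1) //.
  suff -> : \sum_(k < n.+1) (\poly_(k0 < n.+1) c (inord k0))`_k *: iter k (Phi i) x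
  = \sum_(k < n.+1) c k *: iter k (Phi i) x by [].
  by apply: eq_bigr => k _; rewrite coef_poly ltn_ord inord_val.
have [r] := closed_field_poly_normal p.
move: Zp => /[swap] {1}->; rewrite /pp papZ => Zp.
have {Zp} : Z (pp (\prod_(z <- r) ('X - z%:P)) x).
  by rewrite -[X in Z X](scalerK (_ : lead_coef p != 0)) ?lead_coef_eq0 //; apply: subspZ.
elim: r => [|z r IH]; first by rewrite big_nil /pp pap1.
have [Zr _|Zr] := pselect (Z (pp (\prod_(z <- r) ('X - z%:P)) x)); first exact: IH.
rewrite big_cons mulrBl /pp papD papN mul_polyC papZ (@pap_mulX _ _ _ X) //; last exact: sX.
by move=> h; exists (pp (\prod_(z <- r) ('X - z%:P)) x); [split|exists z].
Qed.
(** The index set may be infinite, so operators are not treated one after the other. Either all of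
    them are scalar modulo [Z], or one of them has an eigenspace modulo [Z] that is proper, stable
    by commutation and of smaller dimension, and induction applies there. *)
Lemma eigenall Z n X : comfam X -> stab Z -> Z `<=` X -> fd Z X n ->
  (exists2 x, X x & ~ Z x) ->
  exists2 e, X e /\ ~ Z e & exists c : I -> F, forall i, Z (Phi i e - c i *: e).
Proof.
elim: n X => [|n IH] X cX sZ ZX fdX [x Xx Zx].
  by case: Zx; apply: (fd0 sZ.1 fdX).
have [sc|] := pselect (forall i, exists a, forall y, X y -> Z (Phi i y - a *: y)).
  by have [c hc] := choice sc; exists x => //; exists c => i; apply: hc.
move=> /asboolPn/existsp_asboolPn[i nsc].
have [y [Xy Zy] [a Za]] := eigen1 i cX sZ ZX fdX Xx Zx.
pose X' := [set y | X y /\ Z (Phi i y - a *: y)].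
have XX' : X' `<=` X by move=> ? [].
have [[hX stX] lX comX] := cX; have [hZ stZ] := sZ.
have sX' : stab X'.
  split; [split|].
  by split; [exact: subsp0|rewrite (linon0 hX (lX i)) scaler0 subr0; exact: subsp0].
  move=> c u v [Xu Zu] [Xv Zv]; split; first exact: hX.2.
  rewrite lX // scalerDr opprD addrACA scalerA mulrC -scalerA -scalerBr.
  exact: hZ.2.
  move=> j v [Xv Zv]; split; first exact: stX.
  rewrite comX // -(linonZ hX (lX j)) // -(linonB hX (lX j)).
  - exact: stZ.
  - exact: stX.
  - exact: subspZ.
have ZX' : Z `<=` X'.
  by move=> z Zz; split; [exact: ZX|apply: subspB => //; [exact: stZ|exact: subspZ]].
have [z Xz nX'z] : exists2 z, X z & ~ X' z.
  apply: contrapT => no; apply: nsc; exists a => z Xz.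
  by have [[]//|nz] := pselect (X' z); case: no; exists z.
have fdX' : fd Z X' n.
  apply: (@fd_drop _ _ Z X Z X' n z) => //; last 2 first.
  - exact: sX'.1.
  - move=> b b0 Zb; apply: nX'z; apply: ZX'.
  by rewrite -[z](scalerK b0); apply: subspZ.
  move=> b w b0 X'w; left => Zbw; apply: nX'z.
  rewrite -[z](scalerK b0); apply: (subspZ sX'.1).
  have -> : b *: z = (b *: z + w) - w by rewrite addrK.
  by apply: (subspB sX'.1) => //; apply: ZX'.
have [e [[Xe _] Ze] [c hc]] : exists2 e, X' e /\ ~ Z e & exists c : I -> F, forall i, Z (Phi i e - c i *: e).
  apply: IH => //; first exact: comfam_sub cX sX' XX'.
  by exists y.
by exists e => //; exists c.
Qed.
Lemma flag_ex Z n X : comfam X -> stab Z -> Z `<=` X -> fd Z X n ->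
  exists cs, flag Z X cs.
Proof.
elim: n Z => [|n IH] Z cX sZ ZX fdX.
  exists [::]; have -> : X = Z by apply/seteqP; split => //; exact: fd0 sZ.1 fdX.
  exact: flag0.
have [sub|/asboolPn/existsp_asboolPn[x]] := pselect (forall x, X x -> Z x).
  exists [::]; have -> : X = Z by apply/seteqP.
  exact: flag0.
move=> /asboolPn; rewrite asbool_imply negb_imply => /andP[/asboolP Xx /asboolPn Zx].
have [e [Xe Ze] [c hc]] := eigenall cX sZ ZX fdX (ex_intro2 _ _ x Xx Zx).
have [hZ stZ] := sZ; have [[hX stX] lX comX] := cX.
pose Z' := [set y | exists a : F, Z (y - a *: e)].
have ZZ' : Z `<=` Z' by move=> z Zz; exists 0; rewrite scale0r subr0.
have Z'e : Z' e by exists 1; rewrite scale1r subrr; apply: subsp0.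
have hZ' : lsub Z'.
  split; first by apply: ZZ'; apply: subsp0.
  move=> d u v [a Za] [b Zb]; exists (d * a + b).
  rewrite scalerDl opprD addrACA -scalerA -scalerBr; exact: hZ.2.
have Z'X : Z' `<=` X.
  move=> y [a /ZX Xa]; rewrite -[y](subrK (a *: e)).
  by apply: (subspD hX) => //; apply: subspZ.
have sZ' : stab Z'.
  split=> // i v Zv; have [a Za] := Zv; exists (a * c i).
  have Xae : X (a *: e) by apply: subspZ.
  have Xv := Z'X _ Zv.
  have -> : Phi i v = Phi i (v - a *: e) + a *: Phi i e.
  by rewrite (linonB hX (lX i)) // (linonZ hX (lX i)) // subrK.
  rewrite -addrA -scalerA -scalerBr; apply: (subspD hZ); first exact: stZ.
  exact: subspZ.
have fdX' : fd Z' X n.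
  apply: (@fd_drop _ _ Z X Z' X n e) => //.
  move=> a y a0 Xy; have [Zy|] := pselect (Z (a *: e + y)); last by left.
  by right; exists (- a); rewrite scaleNr opprK addrC.
  by move=> a a0 Za; apply: Ze; rewrite -[e](scalerK a0); apply: subspZ.
have [cs fcs] := IH Z' cX sZ' Z'X fdX'.
exists (cs ++ [:: c]); apply: flag_cat fcs.
exact: flagS (flag0 Z) sZ' Z'e Ze ZZ' _ hc.
Qed.
Definition geneig (g : I -> F) (X Z : set E) : set E :=
  [set x | X x /\ exists p, forall i,
  Z (iter p (fun y => Phi i y - g i *: y) x)].

Definition chcount (g : I -> F) (cs : seq (I -> F)) : nat :=
  count (fun c => `[< c = g >]) cs.

Lemma chcount_cat g cs cs' : chcount g (cs ++ cs') = (chcount g cs + chcount g cs')%N.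
Proof. exact: count_cat. Qed.

Section GenEig.
Variables (g : I -> F) (X0 : set E) (cX0 : comfam X0).
Let Dg i y := Phi i y - g i *: y.

Lemma stabD X i p x : stab X -> X x -> X (iter p (Dg i) x).
Proof.
move=> [hX sX] Xx; elim: p => // p IH.
by apply: subspB => //; [exact: sX|exact: subspZ].
Qed.
Lemma linD X i p : stab X -> X `<=` X0 -> linon X (iter p (Dg i)).
Proof.
move=> sX XX c u v Xu Xv; elim: p => //= p ->.
have [_ lX0 _] := cX0.
have Xi w : X w -> X0 (iter p (Dg i) w) by move=> Xw; apply: XX; apply: stabD.
rewrite /Dg (lX0 i); [|exact: Xi|exact: Xi].
lmod_in F.
Qed.
Lemma comD i j p r x : X0 x ->
  iter p (Dg i) (iter r (Dg j) x) = iter r (Dg j) (iter p (Dg i) x).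
Proof.
have [sX0 lX0 com0] := cX0; have [hX0 _] := sX0.
have com1 r' y : X0 y -> Dg i (iter r' (Dg j) y) = iter r' (Dg j) (Dg i y).
  move=> Xy; elim: r' => //= r' <-; set z := iter r' _ _.
  have Xz : X0 z by apply: stabD.
  rewrite /Dg !(linonB hX0 (lX0 _)) ?(linonZ hX0 (lX0 _)) //; try exact: subspZ;
  try exact: sX0.2.
  rewrite com0 //; lmod_in F.
by move=> Xx; elim: p => //= p ->; apply: com1; apply: stabD.
Qed.
Lemma iterD_le Z i p r x : stab Z -> (p <= r)%N -> Z (iter p (Dg i) x) ->
  Z (iter r (Dg i) x).
Proof.
by move=> sZ pr Zp; rewrite -(subnK pr) iterD; apply: stabD.
Qed.
Lemma geneig_subsp X Z : stab X -> stab Z -> X `<=` X0 -> lsub (geneig g X Z).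
Proof.
move=> sX sZ XX; split.
  split; first exact: subsp0 sX.1.
  by exists 0%N => i; apply: subsp0 sZ.1.
move=> c u v [Xu [p hp]] [Xv [r hr]]; split; first exact: sX.1.2.
exists (maxn p r) => i; rewrite (linD _ _ sX XX) //; apply: sZ.1.2.
  by apply: iterD_le (hp i) => //; apply: leq_maxl.
by apply: iterD_le (hr i) => //; apply: leq_maxr.
Qed.
Lemma iterD_eig Y e c i p : stab Y -> Y `<=` X0 -> X0 e -> Y (Phi i e - c *: e) ->
  Y (iter p (Dg i) e - (c - g i) ^+ p *: e).
Proof.
move=> sY YX Xe Ye; elim: p => [|p IH]; first by rewrite scale1r subrr; apply: subsp0 sY.1.
have [hY _] := sY; have [sX0 lX0 _] := cX0; have [hX0 _] := sX0.
set z := iter p _ _ in IH *; have Xz : X0 z by apply: stabD.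
rewrite iterSr -iterSr.
have -> : Dg i z - (c - g i) ^+ p.+1 *: e =
  Dg i (z - (c - g i) ^+ p *: e) + (c - g i) ^+ p *: (Phi i e - c *: e).
  rewrite /Dg (linonB hX0 (lX0 i)) ?(linonZ hX0 (lX0 i)) //; last exact: subspZ.
  rewrite exprSr; lmod_in F.
apply: subspD => //; last exact: subspZ.
exact: (@stabD Y i 1).
Qed.
(** Induction along the flag of [Y]. At a step of character g the vector is kept and the exponent
    grows by one. At a step whose character differs from g at some [i0], a multiple of [e1] is
    subtracted so that the power of Phi i0 - g i0 lands one step lower; commutation then forces the
    same for every other operator. *)
Lemma geneig_lift Z Y cs X e : stab Z -> flag Z Y cs -> stab X -> X `<=` X0 ->
  Y `<=` X -> X e -> (exists p, forall i, Y (iter p (Dg i) e)) ->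
  exists2 x, geneig g X Z x & Y (e - x).
Proof.
move=> sZ fl; elim: fl e X => [|Y' Y1 c cs' e1 fl IH sY1 Y1e nY'e Y'Y1 sp hc] e X sX XX YX Xe [p hp].
  by exists e; [split=> //; exists p|rewrite subrr; apply: subsp0 sZ.1].
have sY' := flag_stab sZ fl.
suff [e' Ye' [p' hp']] : exists2 e', Y1 (e - e') & exists p, forall i, Y' (iter p (Dg i) e').
  have Xe' : X e'.
  by rewrite -[e'](subKr e); apply: (subspB sX.1) => //; apply: YX.
  have [x Gx Yx] := IH e' X sX XX (subset_trans Y'Y1 YX) Xe' (ex_intro _ p' hp').
  exists x => //; rewrite -[e](subrK e') -addrA; apply: (subspD sY1.1) => //.
  exact: Y'Y1.
have Y1X0 : Y1 `<=` X0 by exact: subset_trans XX.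
have Y'X0 : Y' `<=` X0 by exact: subset_trans Y1X0.
have eigp i r : Y' (iter r (Dg i) e1 - (c i - g i) ^+ r *: e1).
  by apply: iterD_eig => //; apply: Y1X0.
have [eqc|nc] := pselect (c = g).
  exists e; first by rewrite subrr; apply: subsp0 sY1.1.
  exists p.+1 => i; rewrite iterS; have [a Ya] := sp _ (hp i).
  set z := iter p _ _ in Ya *.
  have -> : z = (z - a *: e1) + a *: e1 by rewrite subrK.
  have Y1z : Y1 (z - a *: e1) by apply: Y'Y1.
  rewrite -[Dg i _]/(iter 1 (Dg i) _) (linonD (linD i 1 sY1 Y1X0)) //; last exact: (subspZ sY1.1).
  apply: (subspD sY'.1); first exact: stabD.
  rewrite (linonZ sY1.1 (linD i 1 sY1 Y1X0)) //; apply: (subspZ sY'.1).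
  by have := eigp i 1%N; rewrite eqc subrr scale0r subr0.
have [i0 ni0] : exists i0, c i0 - g i0 != 0.
  apply: contrapT => no; apply: nc; apply/funext => i.
  by apply/eqP; rewrite -subr_eq0; apply/negPn/negP => ni; apply: no; exists i.
have [a Ya] := sp _ (hp i0).
pose del := (c i0 - g i0) ^+ p; have del0 : del != 0 by rewrite expf_neq0.
(* Modulo [Y'], the p-th power of Phi i0 - g i0 sends e to a e1 and multiplies e1 by [del]; this
   coefficient makes the two images cancel. *)
pose e' := e - (a / del) *: e1.
have Xe1 : X (a / del *: e1) by apply: (subspZ sX.1); apply: YX.
have Xe' : X e' by apply: (subspB sX.1).
have h0 : Y' (iter p (Dg i0) e').
  rewrite (linonB sX.1 (linD i0 p sX XX)) // (linonZ sX.1 (linD i0 p sX XX)); last exact: YX.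
  have -> : iter p (Dg i0) e - (a / del) *: iter p (Dg i0) e1 =
  (iter p (Dg i0) e - a *: e1) - (a / del) *: (iter p (Dg i0) e1 - del *: e1).
  by rewrite scalerBr scalerA divfK // opprB addrA subrK.
  by apply: (subspB sY'.1) => //; apply: (subspZ sY'.1); apply: eigp.
exists e'; first by rewrite subKr; apply: (subspZ sY1.1).
exists p => i.
have Y1i : Y1 (iter p (Dg i) e').
  rewrite (linonB sX.1 (linD i p sX XX)) // (linonZ sX.1 (linD i p sX XX)); last exact: YX.
  by apply: (subspB sY1.1) => //; apply: (subspZ sY1.1); apply: stabD.
have [b Yb] := sp _ Y1i.
have : Y' (iter p (Dg i0) (iter p (Dg i) e')).
  by rewrite comD; [apply: stabD|apply: XX].
set z := iter p (Dg i) e' in Yb Y1i *.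
have Y1b : Y1 (b *: e1) by apply: (subspZ sY1.1).
have Y1zb : Y1 (z - b *: e1) by apply: Y'Y1.
rewrite -[z](subrK (b *: e1)) (linonD (linD i0 p sY1 Y1X0)) // => h1.
have {}h1 : Y' (iter p (Dg i0) (b *: e1)).
  set w := iter p _ (z - _) in h1; have Yw : Y' w by apply: stabD.
  by rewrite -[X in Y' X](addKr w); apply: (subspD sY'.1) => //; apply: (subspN sY'.1).
rewrite (linonZ sY1.1 (linD i0 p sY1 Y1X0)) // in h1.
have h2 : Y' (b *: (del *: e1)).
  rewrite -[del *: e1](subKr (iter p (Dg i0) e1)) scalerBr.
  apply: (subspB sY'.1) => //; apply: (subspZ sY'.1); exact: eigp.
have [b0|b0] := eqVneq b 0; first by rewrite subrK; move: Yb; rewrite b0 scale0r subr0.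
case: nY'e; rewrite -[e1](scalerK (_ : b * del != 0)) ?mulf_neq0 //.
by apply: (subspZ sY'.1); rewrite -scalerA.
Qed.
(** Only steps of character g enlarge the generalized eigenspace: there the top vector lifts by
    [geneig_lift], elsewhere some Phi i - g i is invertible on the step. Multiplicities of l-weights
    can thus be read off from any flag. *)
Lemma geneig_rdim Z X cs : stab Z -> flag Z X cs -> X `<=` X0 ->
  rdim Z (geneig g X Z) (chcount g cs).
Proof.
move=> sZ; elim=> [|Y X1 c cs' e fl IH sX Xe nYe YX sp hc] XX.
  rewrite (_ : geneig g Z Z = Z); first exact: rdim0.
  apply/seteqP; split=> [x []//|x Zx]; split=> //; exists 0%N => i //.
have sY := flag_stab sZ fl.
have YX0 : Y `<=` X0 by exact: subset_trans XX.
have {}IH := IH YX0.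
have GS : geneig g Y Z `<=` geneig g X1 Z by move=> x [Yx ?]; split=> //; apply: YX.
have ZY := flag_sub fl.
rewrite /=; case: asboolP => [eqc|nc].
  have [x Gx Yx] : exists2 x, geneig g X1 Z x & Y (e - x).
  apply: (geneig_lift sZ fl sX XX YX Xe); exists 1%N => i.
  by rewrite /Dg -?eqc; apply: hc.
  have nYx : ~ Y x.
  by move=> Yx'; apply: nYe; rewrite -[e](subrK x); apply: (subspD sY.1).
  have hG := geneig_subsp sX sZ XX.
  rewrite add1n; apply: (rdimS hG IH Gx _ GS) => [[//]|y Gy].
  have [a Ya] := sp y Gy.1; exists a; split; last by have [] := hG.2 (- a) x y Gx Gy; rewrite scaleNr addrC.
  have -> : y - a *: x = (y - a *: e) + a *: (e - x) by rewrite scalerBr addrA subrK.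
  by apply: (subspD sY.1) => //; apply: (subspZ sY.1).
rewrite (_ : geneig g X1 Z = geneig g Y Z) //.
apply/seteqP; split=> // x [Xx [p hp]]; split; last by exists p.
have [a Ya] := sp x Xx.
have [a0|a0] := eqVneq a 0; first by move: Ya; rewrite a0 scale0r subr0.
case: nc; apply/funext => i; apply/eqP; rewrite -subr_eq0; apply/negPn/negP => ni.
have Xe' : X1 (a *: e) by apply: (subspZ sX.1).
have Xxe : X1 (x - a *: e) by apply: YX.
have := ZY _ (hp i).
rewrite -[x in iter p _ x](subrK (a *: e)) (linonD (linD i p sX XX)) // => h1.
have h2 : Y (iter p (Dg i) (a *: e)).
  rewrite -[X in Y X](addKr (iter p (Dg i) (x - a *: e))).
  by apply: (subspD sY.1) => //; apply: (subspN sY.1); apply: stabD.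
rewrite (linonZ sX.1 (linD i p sX XX)) // in h2.
have h3 : Y (a *: ((c i - g i) ^+ p *: e)).
  rewrite -[_ ^+ _ *: e](subKr (iter p (Dg i) e)) scalerBr.
  apply: (subspB sY.1) => //; apply: (subspZ sY.1); apply: iterD_eig => //; exact: XX.
apply: nYe; rewrite -[e](scalerK (_ : a * (c i - g i) ^+ p != 0)) ?mulf_neq0 ?expf_neq0 //.
by apply: (subspZ sY.1); rewrite -scalerA.
Qed.

End GenEig.
End Flags.

(** Each pulled-back step maps isomorphically onto the original one, so characters do not change;
    surjectivity onto [X'] supplies the top vectors. *)
Lemma flag_pull (F : closedFieldType) (E E' : lmodType F) (I : Type)
  (Phi : I -> E -> E) (Phi' : I -> E' -> E') (p : E -> E') (X : set E)
  (Z' X' : set E') cs :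
  stab Phi X -> linon X p -> (forall i x, X x -> p (Phi i x) = Phi' i (p x)) ->
  stab Phi' Z' -> flag Phi' Z' X' cs ->
  (forall y, X' y -> exists2 x, X x & p x = y) ->
  flag Phi (X `&` p @^-1` Z') (X `&` p @^-1` X') cs.
Proof.
move=> sX lp cp sZ; elim=> [|Y' X1 c cs' e fl IH sX1 X1e nY'e Y'X1 sp hc] sur.
  exact: flag0.
have [e0 Xe0 pe0] := sur _ X1e.
have {}IH := IH (fun y Yy => sur y (Y'X1 y Yy)).
apply: (flagS (e := e0) IH) => //=.
- split; first split=> /=.
  + by split; [apply: subsp0 sX.1|rewrite (linon0 sX.1 lp); apply: subsp0 sX1.1].
  + move=> d u v [Xu Yu] [Xv Yv]; split; first exact: sX.1.2.
  by rewrite lp //; apply: sX1.1.2.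
  by move=> i v [Xv Yv]; split; [exact: sX.2|rewrite /= cp //; exact: sX1.2].
- by split=> //; rewrite pe0.
- by move=> [_]; rewrite pe0.
- by move=> x [Xx Yx]; split=> //; apply: Y'X1.
- move=> x [Xx X1x]; have [a Ya] := sp _ X1x; exists a; split=> /=.
  by apply: (subspB sX.1) => //; apply: (subspZ sX.1).
  rewrite (linonB sX.1 lp) ?(linonZ sX.1 lp) ?pe0 //; exact: (subspZ sX.1).
- move=> i; split=> /=.
  by apply: (subspB sX.1); [exact: sX.2|exact: (subspZ sX.1)].
  rewrite (linonB sX.1 lp) ?(linonZ sX.1 lp) ?cp ?pe0 //; last exact: (subspZ sX.1).
  exact: sX.2.
Qed.

(** * Evaluation of presented algebras and exponentials of operator series *)

Definition linfun1 (K : fieldType) (V V' : lmodType K) (f : V -> V') : Prop :=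
  forall (c : K) u v, f (c *: u + v) = c *: f u + f v.

Section Evaluation.
Variables (K : fieldType) (G : Type) (V : lmodType K) (g : G -> V -> V).
Hypothesis lg : forall x, linfun1 (g x).

Fixpoint tev (t : term K G) : V -> V :=
  match t with
  | TGen x => g x
  | TCst c => fun v => c *: v
  | TAdd a b => fun v => tev a v + tev b v
  | TMul a b => fun v => tev a (tev b v)
  end.

Lemma tev_lin t : linfun1 (tev t).
Proof.
elim: t => [x|c|a IHa b IHb|a IHa b IHb] k u v /=.
- exact: lg.
- lmod_in K.
- rewrite IHa IHb; lmod_in K.
- by rewrite IHb.
Qed.
Lemma tevD t u v : tev t (u + v) = tev t u + tev t v.
Proof. by have := tev_lin t 1 u v; rewrite !scale1r. Qed.
Lemma tev0 t : tev t 0 = 0.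
Proof. by apply: (addrI (tev t 0)); rewrite -tevD !addr0. Qed.
Lemma tevZ t c v : tev t (c *: v) = c *: tev t v.
Proof. by have := tev_lin t c v 0; rewrite tev0 !addr0. Qed.

Section Rel.
Variable rel : term K G -> term K G -> Prop.
Hypothesis hrel : forall a b, rel a b -> tev a =1 tev b.

Lemma tev_teq a b : teq rel a b -> tev a =1 tev b.
Proof.
elim=> //=.
- by move=> a1 b1 _ h v; rewrite h.
- by move=> b1 a1 c1 _ h1 _ h2 v; rewrite h1.
- by move=> a1 a2 b1 b2 _ h1 _ h2 v; rewrite h1 h2.
- by move=> a1 a2 b1 b2 _ h1 _ h2 v; rewrite h2.
- by move=> a1 b1 c1 v; rewrite addrA.
- by move=> a1 b1 v; rewrite addrC.
- by move=> a1 v; rewrite scale0r add0r.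
- by move=> a1 v; rewrite scaleN1r addNr scale0r.
- by move=> a1 v; rewrite scale1r.
- by move=> a1 v; rewrite scale1r.
- by move=> a1 b1 c1 v; rewrite tevD.
- by move=> x y v; rewrite scalerDl.
- by move=> x y v; rewrite scalerA.
- by move=> x a1 v; rewrite tevZ.
Qed.
Definition pev (u : presented rel) : V -> V := tev (repr u).

Lemma pevE t : pev (tclass rel t) =1 tev t.
Proof. exact/tev_teq/teq_repr. Qed.
Lemma pevD u w v : pev (u + w) v = pev u v + pev w v.
Proof. exact: pevE. Qed.
Lemma pevM u w v : pev (u * w) v = pev u (pev w v).
Proof. exact: pevE. Qed.
Lemma pev_cst c v : pev (p_cst rel c) v = c *: v.
Proof. exact: pevE. Qed.
Lemma pevZ c u v : pev (c *: u) v = c *: pev u v.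
Proof. by rewrite pevM pev_cst. Qed.
Lemma pev1 v : pev 1 v = v.
Proof. by rewrite pev_cst scale1r. Qed.
Lemma pev0 v : pev 0 v = 0.
Proof. by rewrite pev_cst scale0r. Qed.
Lemma pevN u v : pev (- u) v = - pev u v.
Proof. by rewrite -scaleN1r pevZ. Qed.
Lemma pevB u w v : pev (u - w) v = pev u v - pev w v.
Proof. by rewrite pevD pevN. Qed.
Lemma pev_gen x v : pev (pgen rel x) v = g x v.
Proof. exact: pevE. Qed.
Lemma pev_lin u : linfun1 (pev u). Proof. exact: tev_lin. Qed.
Lemma pev_sum (J : Type) (r : seq J) (P : pred J) (f : J -> presented rel) v :
  pev (\sum_(j <- r | P j) f j) v = \sum_(j <- r | P j) pev (f j) v.
Proof.
by apply: (big_morph (pev^~ v)) => [a b|]; [exact: pevD|exact: pev0].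
Qed.
Lemma pev_prod (J : Type) (r : seq J) (P : pred J) (f : J -> presented rel) v :
  pev (\prod_(j <- r | P j) f j) v =
  foldr (fun j => pev (f j)) v [seq j <- r | P j].
Proof.
elim: r => [|j r IH]; first by rewrite big_nil pev1.
by rewrite big_cons /=; case: (P j) => //; rewrite pevM IH.
Qed.
(** The image of [ser_pow] under evaluation, kept at the level of operators so that no algebra of
    endomorphisms has to be built. *)
Definition opow (f : nat -> V -> V) (k m : nat) : V -> V :=
  iter k (fun p m v => \sum_(j < m.+1) f j (p (m - j)%N v))
  (fun m v => (m == 0%N)%:R *: v) m.
Definition oexp (f : nat -> V -> V) (m : nat) (v : V) : V :=
  \sum_(k < m.+1) (k`!%:R)^-1 *: opow f k m v.

Lemma pev_pow (f : nat -> presented rel) k m v :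
  pev (ser_pow f k m) v = opow (fun j => pev (f j)) k m v.
Proof.
elim: k m v => [|k IH] m v /=.
  by rewrite -[RHS]/(_ *: v); case: (m == 0%N); rewrite ?pev1 ?pev0 ?scale1r ?scale0r.
rewrite pev_sum.
by apply: eq_bigr => j _; rewrite pevM IH.
Qed.
Lemma pev_exp (f : nat -> presented rel) m v :
  pev (exp_coef f m) v = oexp (fun j => pev (f j)) m v.
Proof.
by rewrite pev_sum; apply: eq_bigr => k _; rewrite pevZ pev_pow.
Qed.
End Rel.
End Evaluation.

Lemma opowS (K : fieldType) (V : lmodType K) (f : nat -> V -> V) k m v :
  opow f k.+1 m v = \sum_(j < m.+1) f j (opow f k (m - j)%N v).
Proof. by []. Qed.
Lemma eq_opow (K : fieldType) (V : lmodType K) (f f' : nat -> V -> V) k m v :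
  (forall j v, f j v = f' j v) -> opow f k m v = opow f' k m v.
Proof.
move=> e; elim: k m v => //= k IH m v; apply: eq_bigr => j _.
by rewrite IH.
Qed.
Lemma tri_exch (V : nmodType) (m : nat) (f : nat -> nat -> V) :
  \sum_(j < m.+1) \sum_(l < (m - j).+1) f j l =
  \sum_(l < m.+1) \sum_(j < (m - l).+1) f j l.
Proof.
have wid (a : nat) (h : nat -> V) : (a <= m)%N ->
  \sum_(l < (m - a).+1) h l = \sum_(l < m.+1 | (a + l <= m)%N) h l.
  move=> am; have le : ((m - a).+1 <= m.+1)%N by rewrite ltnS leq_subr.
  rewrite (big_ord_widen m.+1 h le); apply: eq_bigl => l.
  by rewrite ltnS leq_subRL.
under eq_bigr => j _ do rewrite (wid _ (f j) (leq_ord j)).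
under [RHS]eq_bigr => l _ do rewrite (wid _ (fun j => f j l) (leq_ord l)).
rewrite (exchange_big_dep xpredT) //; apply: eq_bigr => l _.
by apply: eq_bigl => j; rewrite addnC.
Qed.

Section OExp.
Variables (K : fieldType) (V : lmodType K) (f : nat -> V -> V).
Hypothesis charK : forall m : nat, m.+1%:R != 0 :> K.
Hypothesis lf : forall j, linfun1 (f j).
Hypothesis f0 : forall v, f 0%N v = 0.
Hypothesis cf : forall j l v, f j (f l v) = f l (f j v).

Let fX j : linon setT (f j). Proof. by move=> c u v _ _; apply: lf. Qed.
Let fZ j c v : f j (c *: v) = c *: f j v.
Proof. exact: (linonZ (lsubT V) (fX j)). Qed.
Let fS j (J : Type) (r : seq J) (h : J -> V) :
  f j (\sum_(l <- r) h l) = \sum_(l <- r) f j (h l).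
Proof. exact: (linon_sum (lsubT V) (fX j)). Qed.
Lemma opow_gt k m v : (m < k)%N -> opow f k m v = 0.
Proof.
elim: k m v => // k IH m v mk; rewrite -[LHS]/(\sum_(j < m.+1) f j (opow f k (m - j) v)).
rewrite big1 // => j _; case: j => [[|j] /= jm]; first by rewrite f0.
rewrite IH; first by rewrite (linon0 (lsubT V) (fX _)).
by clear -jm mk; lia.
Qed.
(** Leibniz rule: the coefficients of z d/dz f^(k+1) = (k+1) (z d/dz f) f^k, valid since the
    coefficients of f commute. *)
Lemma opow_deriv k m v :
  m%:R *: opow f k.+1 m v =
  k.+1%:R *: \sum_(j < m.+1) (j%:R : K) *: f j (opow f k (m - j) v).
Proof.
elim: k m v => [|k IH] m v.
  rewrite scale1r -[LHS]/(m%:R *: \sum_(j < m.+1) f j (opow f 0 (m - j) v)).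
  rewrite scaler_sumr; apply: eq_bigr => j _.
  have [e|ne] := eqVneq (m - j)%N 0%N; last first.
  rewrite [opow _ _ _ _](_ : _ = 0) ?(linon0 (lsubT V) (fX _)) ?scaler0 //.
  by rewrite /= (negbTE ne) scale0r.
  congr (_%:R *: _); have := leq_ord j; clear -e; lia.
rewrite -[opow f k.+2 m v]/(\sum_(j < m.+1) f j (opow f k.+1 (m - j) v)).
have -> : m%:R *: (\sum_(j < m.+1) f j (opow f k.+1 (m - j) v)) =
  \sum_(j < m.+1) (j%:R : K) *: f j (opow f k.+1 (m - j) v) +
  \sum_(j < m.+1) f j ((m - j)%:R *: opow f k.+1 (m - j) v).
  rewrite scaler_sumr -big_split; apply: eq_bigr => j _ /=.
  by rewrite fZ -scalerDl -natrD subnKC // -ltnS.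
rewrite scalerDl scale1r; congr (_ + _).
under eq_bigr => j _ do rewrite IH fZ fS.
rewrite -scaler_sumr; congr (_ *: _).
under eq_bigr => j _ do under eq_bigr => l _ do rewrite fZ cf.
rewrite (tri_exch m (fun j l => (l%:R : K) *: f l (f j (opow f k (m - j - l) v)))).
apply: eq_bigr => l _.
rewrite -[opow f k.+1 _ v]/(\sum_(j < (m - l).+1) f j (opow f k (m - l - j) v)).
rewrite fS scaler_sumr; apply: eq_bigr => j _.
by rewrite -!subnDA addnC.
Qed.
Lemma oexp0 v : oexp f 0 v = v.
Proof. by rewrite /oexp big_ord1 invr1 scale1r /= scale1r. Qed.
(** The differential equation z d/dz exp(f) = (z d/dz f) exp(f). In characteristic zero it
    determines the exponential from its constant term, and phi is axiomatized by it in [isrep]. *)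
Lemma oexp_rec m v :
  m%:R *: oexp f m v = \sum_(j < m) (j.+1%:R : K) *: f j.+1 (oexp f (m - j.+1) v).
Proof.
case: m => [|m]; first by rewrite scale0r big_ord0.
rewrite /oexp big_ord_recl [X in X + _](_ : _ = 0) ?add0r; last first.
  by rewrite /= scale0r !scaler0.
rewrite scaler_sumr.
under eq_bigr => k _.
  rewrite scalerA mulrC -scalerA opow_deriv scalerA natrM invfM.
  rewrite mulrAC mulVf // mul1r big_ord_recl scale0r add0r.
  rewrite scaler_sumr; over.
rewrite exchange_big; apply: eq_bigr => j _.
rewrite fS scaler_sumr (bigID (fun k : 'I_m.+1 => (k < (m.+1 - j.+1).+1)%N)) /=.
rewrite [X in _ + X]big1 ?addr0 => [|k]; last first.
  rewrite -leqNgt => h; rewrite opow_gt ?(linon0 (lsubT V) (fX _)) ?scaler0 //.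
rewrite subSS.
have le : ((m - j).+1 <= m.+1)%N by rewrite ltnS leq_subr.
rewrite (big_ord_widen m.+1 (fun k => j.+1%:R *: f j.+1 ((k`!%:R)^-1 *: opow f k (m - j) v)) le).
by apply: eq_bigr => k _; rewrite fZ !scalerA mulrC.
Qed.
Lemma oexp_uniq (P : nat -> V -> V) v :
  P 0%N v = v ->
  (forall m, m%:R *: P m v = \sum_(j < m) (j.+1%:R : K) *: f j.+1 (P (m - j.+1)%N v)) ->
  forall m, P m v = oexp f m v.
Proof.
move=> P0 Pr; elim/ltn_ind => -[|m] IH; first by rewrite oexp0.
apply: (scalerI (charK m)); rewrite Pr oexp_rec; apply: eq_bigr => j _.
by rewrite IH // subSS ltnS leq_subr.
Qed.
End OExp.

Lemma tri_diag (V : nmodType) (m : nat) (f : nat -> nat -> V) :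
  \sum_(j < m.+1) \sum_(l < (m - j).+1) f j l =
  \sum_(k < m.+1) \sum_(j < k.+1) f j (k - j)%N.
Proof.
have st (j : 'I_m.+1) : \sum_(l < (m - j).+1) f j l =
  \sum_(k < m.+1 | (j <= k)%N) f j (k - j)%N.
  rewrite -subSn ?leq_ord // -(big_mkord xpredT (f j)).
  under eq_bigr => l _ do rewrite -{1}(addnK j l).
  rewrite -(big_addn 0 m.+1 j xpredT (fun k => f j (k - j)%N)).
  rewrite -(big_mkord (fun k => (j <= k)%N) (fun k => f j (k - j)%N)).
  rewrite [RHS](@big_cat_nat _ _ _ j) //; last exact/ltnW.
  rewrite [X in _ = X + _]big1_seq ?add0r; last first.
  by move=> k; rewrite mem_index_iota => /andP[jk]; rewrite ltnNge jk.
  rewrite big_seq_cond [RHS]big_seq_cond; apply: eq_bigl => k.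
  by rewrite mem_index_iota; case: (leqP j k).
under eq_bigr => j _ do rewrite st.
rewrite (exchange_big_dep xpredT) //; apply: eq_bigr => k _.
rewrite (big_ord_widen m.+1 (fun j => f j (k - j)%N) (ltn_ord k)).
exact: eq_bigl => j; rewrite ltnS.
Qed.

(** The interface through which q and the chosen rational powers q^a enter; it is instantiated by
    [qpow] in [qpow_data]. *)
Record qdata (F : numClosedFieldType) (q : F) (qp : rat -> F) : Prop := QData {
  qd_neq0 : q != 0;
  qd_root : forall m : nat, (0 < m)%N -> q ^+ m != 1;
  qd_0 : qp 0 = 1;
  qd_D : forall a b, qp (a + b) = qp a * qp b;
  qd_1 : qp 1 = q
}.

Section GSeries.
Variable F : numClosedFieldType.

(* Coefficients of (b - y) / (1 - b y). *)
Definition gser (b : F) (t : nat) : F :=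
  if t is t'.+1 then b ^+ t' * (b ^+ 2 - 1) else b.

(** Logarithmic derivative: the coefficient of y^m in y d/dy log((b - y) / (1 - b y)) is b^m -
    b^(-m). *)
Lemma gser_rec (b : F) s : b != 0 ->
  \sum_(m < s) (b ^+ m.+1 - b ^- m.+1) * gser b (s - m.+1) = s%:R * gser b s.
Proof.
move=> b0; elim: s => [|s IH]; first by rewrite big_ord0 mul0r.
case: s IH => [|s] IH.
  by rewrite big_ord1 /= mul1r mul1r mulrBl mulVf.
rewrite big_ord_recr subnn.
have -> : \sum_(i < s.+1) (b ^+ i.+1 - b ^- i.+1) * gser b (s.+2 - i.+1) =
  b * (\sum_(m < s.+1) (b ^+ m.+1 - b ^- m.+1) * gser b (s.+1 - m.+1))
  - (b ^+ s.+1 - b ^- s.+1).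
  rewrite big_ord_recr [in RHS]big_ord_recr subnn subSnn mulrDr mulr_sumr.
  rewrite -addrA; congr (_ + _).
  apply: eq_bigr => m _; have ms := ltn_ord m; rewrite !subSS subSn ?(ltnW ms) //.
  have [k ->] : exists k, (s - m)%N = k.+1 by exists (s - m.+1)%N; lia.
  by set u := _ - _; rewrite /= [b ^+ k.+1]exprS; ring.
  by rewrite /=; ring.
have bn k : b ^+ k != 0 by rewrite expf_neq0.
rewrite IH /= ![b ^+ s.+2]exprS ![b ^+ s.+1]exprS.
by field; rewrite bn.
Qed.
End GSeries.

(** * Quantum sl2 acting on a weight string *)

Section SL2.
Variables (F : numClosedFieldType) (z : rat -> F) (ka : F).
Hypotheses (z0 : z 0 = 1) (zD : forall a b, z (a + b) = z a * z b)
  (z_inj : forall a, z a = 1 -> a = 0) (ka0 : ka != 0).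

Definition br (a : rat) : F := (z a - z (- a)) / ka.

Lemma z_neq0 a : z a != 0.
Proof.
apply/eqP => e; have := zD a (- a).
by rewrite subrr z0 e mul0r => /eqP; rewrite oner_eq0.
Qed.
Lemma zN a : z (- a) = (z a)^-1.
Proof.
by apply: (mulfI (z_neq0 a)); rewrite -zD subrr divff // z_neq0.
Qed.
Lemma br_eq0 a : br a = 0 -> a = 0.
Proof.
move=> /eqP; rewrite mulf_eq0 invr_eq0 (negbTE ka0) orbF subr_eq0 zN => /eqP e.
have : z (a + a) = 1 by rewrite zD {1}e mulVf // z_neq0.
move=> /z_inj /eqP; rewrite -mulr2n mulrn_eq0 => /eqP //.
Qed.
Lemma br_neq0 a : a != 0 -> br a != 0.
Proof. by move=> a0; apply/eqP => /br_eq0 e; rewrite e in a0. Qed.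
Lemma brN a : br (- a) = - br a.
Proof. by rewrite /br opprK -mulNr opprB. Qed.
(** The scalar in E F^m v = F^m E v + brs m a F^(m-1) v for v of weight a; by [brsE], [1] brs m a =
    [m] [a - m + 1]. *)
Definition brs (m : nat) (a : rat) : F := \sum_(j < m) br (a - 2 * j%:R).

Lemma brsE m a : br 1 * brs m a = br m%:R * br (a - m%:R + 1).
Proof.
elim: m => [|m IH]; first by rewrite /brs big_ord0 mulr0 /br subrr mul0r mul0r.
rewrite /brs big_ord_recr mulrDr IH /br.
have e2 : z (2 * m%:R) = z m%:R * z m%:R by rewrite -zD mulr_natl.
have e3 : z m.+1%:R = z m%:R * z 1 by rewrite -natr1.
have e4 : z (a - m%:R + 1) = z a / z m%:R * z 1 by rewrite !zD zN.
have e5 : z (a - m.+1%:R + 1) = z a / z m%:R.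
  have -> : a - m.+1%:R + 1 = a - m%:R by rewrite -natr1; ring.
  by rewrite zD zN.
have e6 : z (a - 2 * m%:R) = z a / (z m%:R * z m%:R) by rewrite zD zN e2.
rewrite !zN e3 e4 e5 e6.
have := z_neq0 a; have := z_neq0 m%:R; have := z_neq0 1.
move: (z a) (z m%:R) (z 1) => A M O O0 M0 A0.
by field; rewrite M0 A0 ka0.
Qed.
Lemma brs_neq0 m a : (0 < m)%N -> a - m%:R + 1 != 0 -> brs m a != 0.
Proof.
move=> m0 am; have : br 1 * brs m a != 0.
  by rewrite brsE mulf_neq0 ?br_neq0 // pnatr_eq0 -lt0n.
by rewrite mulf_eq0 negb_or => /andP[].
Qed.

Section Triple.
Variables (V : lmodType F) (W : int -> set V) (w : rat) (E1 F1 : V -> V).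
Definition sval2 (k : int) : rat := w + 2 * k%:~R.

(** Weights may be rational and the spaces infinite-dimensional; nilpotency comes from [s2_nil], and
    integrality of the weights is a consequence ([s2_integral]). *)
Record sl2 : Prop := Sl2 {
  s2_sub : forall k, lsub (W k);
  s2_linE : forall k, linon (W k) E1;
  s2_linF : forall k, linon (W k) F1;
  s2_E : forall k v, W k v -> W (k + 1) (E1 v);
  s2_F : forall k v, W k v -> W (k - 1) (F1 v);
  s2_EF : forall k v, W k v -> E1 (F1 v) - F1 (E1 v) = br (sval2 k) *: v;
  s2_nil : exists N : nat, forall k, (N < `|k|)%N -> W k `<=` [set 0]
}.
Hypothesis h : sl2.

Lemma s2_iterE k v m : W k v -> W (k + m%:Z) (iter m E1 v).
Proof.
move=> Wv; elim: m => [|m IH]; first by rewrite addr0.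
have e : k + m.+1%:Z = k + m%:Z + 1 by lia.
by rewrite e; apply: (s2_E h).
Qed.
Lemma s2_iterF k v m : W k v -> W (k - m%:Z) (iter m F1 v).
Proof.
move=> Wv; elim: m => [|m IH]; first by rewrite subr0.
have e : k - m.+1%:Z = k - m%:Z - 1 by lia.
by rewrite e; apply: (s2_F h).
Qed.
Lemma s2_nilE k v : W k v -> exists m, iter m E1 v = 0.
Proof.
move=> Wv; have [N hN] := s2_nil h; exists (`|k| + N).+1%N.
apply: (hN (k + (`|k| + N).+1%:Z)); last exact: s2_iterE.
by lia.
Qed.
Lemma s2_nilF k v : W k v -> exists m, iter m F1 v = 0.
Proof.
move=> Wv; have [N hN] := s2_nil h; exists (`|k| + N).+1%N.
apply: (hN (k - (`|k| + N).+1%:Z)); last exact: s2_iterF.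
by lia.
Qed.
Lemma s2_EFm k v m : W k v ->
  E1 (iter m.+1 F1 v) = iter m.+1 F1 (E1 v) + brs m.+1 (sval2 k) *: iter m F1 v.
Proof.
move=> Wv; elim: m => [|m IH].
  have /eqP := s2_EF h Wv; rewrite subr_eq /brs big_ord1 subr0 => /eqP ->.
  by rewrite addrC.
have Wm := s2_iterF m.+1 Wv.
have /eqP := s2_EF h Wm; rewrite subr_eq => /eqP ->.
rewrite IH (linonD (s2_linF h (k := k - m%:Z))); last 2 first.
- have := s2_iterF m.+1 (s2_E h Wv).
  by have -> : k + 1 - m.+1%:Z = k - m%:Z by lia.
- by apply: (subspZ (s2_sub h _)); apply: s2_iterF.
rewrite (linonZ (s2_sub h _) (s2_linF h (k := k - m%:Z))); last exact: s2_iterF.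
rewrite -[F1 (iter m.+1 F1 _)]/(iter m.+2 F1 _).
rewrite [brs m.+2 _]big_ord_recr /= -[\sum_(i < m.+1) _]/(brs m.+1 (sval2 k)).
have -> : sval2 (k - m.+1%:Z) = sval2 k - 2 * m.+1%:R.
  by rewrite /sval2; ring.
lmod_in F.
Qed.
Lemma s2_E0 : E1 0 = 0. Proof. exact: (linon0 (s2_sub h 0) (s2_linE h (k:=_))). Qed.
Lemma s2_F0 m : iter m F1 0 = 0.
Proof. by elim: m => //= m ->; exact: (linon0 (s2_sub h 0) (s2_linF h (k:=_))). Qed.
(** Induction on the nilpotency order of E on v. From F^m v = 0 one gets F^(m+1) E v = 0, so E v = 0
    by induction, its weight being larger by 2. For a singular vector the scalars [brs] are nonzero
    in this range, and F^m v = 0 descends to v = 0. *)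
Lemma s2_inj k v m : W k v -> (m%:R <= sval2 k)%R -> iter m F1 v = 0 -> v = 0.
Proof.
move=> Wv; have [j] := s2_nilE Wv.
elim: j k v m Wv => [|j IH] k v m Wv Ej mk Fm; first by [].
have Ev0 : E1 v = 0.
  case: m mk Fm => [|m] mk Fm.
  by move: Fm => /= ->; rewrite s2_E0.
  apply: (IH (k + 1) _ m.+2); [exact: s2_E|by rewrite -iterSr| |].
  rewrite /sval2 rmorphD mulrDr addrA -natr1.
  apply: lerD; first exact: le_trans mk _.
  by [].
  have := s2_EFm m Wv; rewrite Fm.
  rewrite s2_E0.
  move/esym/eqP; rewrite addr_eq0 => /eqP e.
  rewrite iterS e (linonN (s2_sub h (k - m%:Z)) (s2_linF h (k:=_))).
  rewrite (linonZ (s2_sub h (k - m%:Z)) (s2_linF h (k:=_))); last exact: s2_iterF.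
  by rewrite -[F1 (iter m F1 v)]/(iter m.+1 F1 v) Fm scaler0 oppr0.
  by apply: (subspZ (s2_sub h _)); apply: s2_iterF.
elim: m mk Fm => [//|m IHm] mk Fm; apply: IHm.
  by apply: le_trans mk; rewrite ler_nat.
have := s2_EFm m Wv; rewrite Fm Ev0.
rewrite s2_F0 add0r s2_E0 => /esym/eqP.
rewrite scaler_eq0 => /orP[|/eqP//]; rewrite (negbTE (brs_neq0 _ _)) //.
by rewrite -natr1 opprD addrA subrK subr_eq0; apply/eqP => e; move: mk; rewrite e -natr1 gerDl.
Qed.
Lemma s2_sing k v : W k v -> v != 0 -> E1 v = 0 ->
  exists2 N : nat, sval2 k = N%:R & iter N.+1 F1 v = 0.
Proof.
move=> Wv v0 Ev; have [m Fm] := s2_nilF Wv.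
elim: m Fm => [Fm|m IH Fm]; first by move: v0; rewrite -[v]/(iter 0 F1 v) Fm eqxx.
have [e|ne] := eqVneq (sval2 k - m.+1%:R + 1) 0.
  exists m => //; move/eqP: e; rewrite -natr1 opprD addrA subrK subr_eq0.
  by move/eqP.
apply: IH; have := s2_EFm m Wv; rewrite Fm Ev s2_F0 add0r.
rewrite s2_E0 => /esym/eqP.
by rewrite scaler_eq0 (negbTE (brs_neq0 _ ne)) // => /eqP.
Qed.
Lemma s2_top k v : W k v -> v != 0 ->
  exists j, [/\ iter j E1 v != 0 & E1 (iter j E1 v) = 0].
Proof.
move=> Wv v0; have [m Em] := s2_nilE Wv.
elim: m Em => [|m IH] Em; first by move: v0; rewrite -[v]/(iter 0 E1 v) Em eqxx.
by have [/eqP//|e] := eqVneq (iter m E1 v) 0; [move/eqP/IH|exists m].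
Qed.
Lemma s2_integral k v : W k v -> v != 0 -> exists m : int, sval2 k = m%:~R.
Proof.
move=> Wv v0; have [j [nz Ej]] := s2_top Wv v0.
have [N e _] := s2_sing (s2_iterE j Wv) nz Ej.
exists (N%:Z - 2 * j%:Z); move: e; rewrite /sval2 => e.
rewrite rmorphB /= -!pmulrn -e; ring.
Qed.
Lemma s2_lin_iterE k m : linon (W k) (iter m E1).
Proof.
move=> c u v Wu Wv; elim: m => //= m ->.
by rewrite (s2_linE h (k := k + m%:Z)) //; apply: s2_iterE.
Qed.
Lemma s2_EmFm k u N m : W k u -> E1 u = 0 -> sval2 k = N%:R -> (m <= N)%N ->
  exists2 c : F, c != 0 & iter m E1 (iter m F1 u) = c *: u.
Proof.
move=> Wu Eu kN; elim: m => [|m IH] mN.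
  by exists 1; rewrite // scale1r.
have [c c0 e] := IH (ltnW mN).
exists (brs m.+1 (sval2 k) * c).
  rewrite mulf_neq0 // brs_neq0 // kN -natr1 opprD addrA subrK subr_eq0 eqr_nat.
  by rewrite neq_ltn mN orbT.
rewrite iterSr (s2_EFm m Wu) Eu s2_F0 add0r -scalerA -e.
by rewrite (linonZ (s2_sub h (k - m%:Z)) (@s2_lin_iterE _ m)) //; apply: s2_iterF.
Qed.
End Triple.

(** Exchanging E and F negates the weights; each statement on F then gives one on E. *)
Lemma s2_swap (V : lmodType F) (W : int -> set V) w E1 F1 :
  sl2 W w E1 F1 -> sl2 (fun k => W (- k)) (- w) F1 E1.
Proof.
move=> h; split=> [k|k|k|k v Wv|k v Wv|k v Wv|].
- exact: (s2_sub h).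
- exact: (s2_linF h (k:=_)).
- exact: (s2_linE h (k:=_)).
- by rewrite opprD; apply: (s2_F h).
- by rewrite opprB addrC; apply: (s2_E h).
- have -> : sval2 (- w) k = - sval2 w (- k) by rewrite /sval2; ring.
  by rewrite brN scaleNr -(s2_EF h Wv) opprB.
- by have [N hN] := s2_nil h; exists N => k kN; apply: hN; rewrite abszN.
Qed.
(** For weight m nonnegative F^m is injective by [s2_inj]; for negative weight the same holds for a
    power of E through [s2_swap]. This is the simple reflection on weights. *)
Lemma s2_reflect (V : lmodType F) (W : int -> set V) w E1 F1 k v :
  sl2 W w E1 F1 -> W k v -> v != 0 ->
  exists m : int, sval2 w k = m%:~R /\ exists2 u, W (k - m) u & u != 0.
Proof.
move=> h Wv v0; have [m em] := s2_integral h Wv v0; exists m; split=> //.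
case: m em => m em.
  exists (iter m F1 v); first exact: (s2_iterF h).
  by apply/eqP => e; move/eqP: v0; apply; apply: (s2_inj h Wv _ e); rewrite em.
have h' := s2_swap h; have Wv' : W (- - k) v by rewrite opprK.
exists (iter m.+1 E1 v); first by rewrite NegzE; apply: (s2_iterE h).
apply/eqP => e; move/eqP: v0; apply; apply: (s2_inj h' Wv' _ e).
have -> : sval2 (- w) (- k) = - sval2 w k by rewrite /sval2; ring.
by rewrite em opprK.
Qed.
(** A singular vector u of weight N is killed by F^(N+1), hence so is S u; but the weight of S u is
    at least N + 2, where F^(N+1) is injective. A general v is reduced to this case by subtracting a
    multiple of F^j E^j v. *)
Lemma s2_vanish (V : lmodType F) (W W' : int -> set V) w w' E1 E1' F1 (S : V -> V) :
  sl2 W w E1 F1 -> sl2 W' w' E1' F1 -> w + 2 <= w' ->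
  (forall k v, W k v -> W' k (S v)) -> (forall k, linon (W k) S) ->
  (forall k v, W k v -> S (F1 v) = F1 (S v)) ->
  forall k v, W k v -> S v = 0.
Proof.
move=> h h' ww WS lS SF k v Wv; have [j Ej] := s2_nilE h Wv.
have SFm m : forall k v, W k v -> S (iter m F1 v) = iter m F1 (S v).
  elim: m => // m IH k' v' Wv'; rewrite (SF (k' - m%:Z)); first by rewrite (IH k').
  exact: (s2_iterF h).
elim: j k v Wv Ej => [|j IH] k v Wv Ej.
  by move: Ej => /= ->; rewrite (linon0 (s2_sub h k) (lS _)).
have [u0|u0] := eqVneq (iter j E1 v) 0; first exact: IH Wv u0.
set u := iter j E1 v in u0; have Wu : W (k + j%:Z) u := s2_iterE h j Wv.
have Eu : E1 u = 0 by [].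
have [N eN FN] := s2_sing h Wu u0 Eu.
have Su : S u = 0.
  apply: (s2_inj h' (WS _ _ Wu) (m := N.+1)).
  rewrite /sval2 in eN *; rewrite -natr1 -eN addrAC lerD2r.
  by apply: le_trans ww; rewrite lerD2l.
  by rewrite -(SFm _ _ _ Wu) FN (linon0 (s2_sub h 0) (lS 0)).
have F0 := s2_F0 h.
have [jN|Nj] := leqP j N.
  have [c c0 ec] := s2_EmFm h Wu Eu eN jN.
  have WF : W k (iter j F1 u) by have := s2_iterF h j Wu; rewrite addrK.
  have WF' : W k (c^-1 *: iter j F1 u) by apply: (subspZ (s2_sub h k)).
  rewrite -[v](subrK (c^-1 *: iter j F1 u)) (linonD (lS k)) //; last first.
  exact: (subspB (s2_sub h k)).
  rewrite (linonZ (s2_sub h k) (lS k)) // (SFm _ _ _ Wu) Su F0 scaler0 addr0.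
  apply: (IH k); first exact: (subspB (s2_sub h k)).
  rewrite (linonB (s2_sub h k) (@s2_lin_iterE _ _ _ _ _ h k j)) //.
  by rewrite (linonZ (s2_sub h k) (@s2_lin_iterE _ _ _ _ _ h k j)) // ec scalerA mulVf // scale1r subrr.
(* For j > N the weight N - 2j of v is at most -(j + 1), so E^(j+1), which kills v, is injective
   there. *)
have v0 : v = 0.
  have Wv' : W (- - k) v by rewrite opprK.
  apply: (s2_inj (s2_swap h) Wv' (m := j.+1)) => //.
  have -> : sval2 (- w) (- k) = 2 * j%:R - N%:R.
  by rewrite -eN /sval2; ring.
  by rewrite lerBrDr -natrM -natrD ler_nat; lia.
by rewrite v0 (linon0 (s2_sub h k) (lS k)).
Qed.
End SL2.

(** * Subquotients and finite-dimensional linear algebra *)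

Section Subquotient.
Variables (F : fieldType) (E : lmodType F).

Record sqdata := SqData {
  sqX : set E; sqY : set E;
  sqX_sub : lsub sqX; sqY_sub : lsub sqY; sqYX : sqY `<=` sqX
}.

Variable d : sqdata.
Local Notation X := (sqX d).
Local Notation Y := (sqY d).
Let hX := sqX_sub d.
Let hY := sqY_sub d.

(** The set given to [xget] depends on the coset of x only, so this is a canonical representative;
    the quotient is then the type of canonical representatives. *)
Definition sqrep (x : E) : E := xget 0 [set y | X y /\ Y (x - y)].

Lemma sqrepP x : X x -> X (sqrep x) /\ Y (x - sqrep x).
Proof.
move=> Xx; apply: (@xgetPex _ 0 [set y | X y /\ Y (x - y)]).
by exists x; split=> //; rewrite subrr; apply: subsp0.
Qed.
Lemma sqrep_eq x y : Y (x - y) -> sqrep x = sqrep y.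
Proof.
move=> Yxy; rewrite /sqrep; congr xget; apply/seteqP; split=> z [Xz Yz]; split=> //.
  by rewrite (_ : y - z = (x - z) - (x - y)); [apply: subspB|lmod_in F].
by rewrite (_ : x - z = (x - y) + (y - z)); [apply: subspD|lmod_in F].
Qed.
Lemma sqrepK x : X x -> X (sqrep x) /\ sqrep (sqrep x) = sqrep x.
Proof.
move=> Xx; have [Xr Yr] := sqrepP Xx; split=> //.
by apply/esym/sqrep_eq.
Qed.

Record sqt := Sqt { sq_val : E; sq_valP : X sq_val /\ sqrep sq_val = sq_val }.

Lemma sq_val_inj : injective sq_val.
Proof.
case=> x hx [y hy] /= e; move: hx; rewrite e => hx; congr Sqt.
exact: Prop_irrelevance.
Qed.
Definition sqpi (x : E) : sqt :=
  if pselect (X x) is left h then Sqt (sqrepK h) else Sqt (sqrepK (subsp0 hX)).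

Lemma sqpiE x : X x -> sq_val (sqpi x) = sqrep x.
Proof. by rewrite /sqpi; case: pselect. Qed.
Lemma sq_valX s : X (sq_val s). Proof. by case: s => x [hx]. Qed.
Hint Resolve sq_valX : core.

Lemma sqpiK s : sqpi (sq_val s) = s.
Proof. by apply: sq_val_inj; rewrite sqpiE; case: s => x []. Qed.
Lemma sqpi_eq x y : X x -> X y -> Y (x - y) -> sqpi x = sqpi y.
Proof. by move=> Xx Xy h; apply: sq_val_inj; rewrite !sqpiE //; apply: sqrep_eq. Qed.
Lemma sqpi_val x : X x -> Y (x - sq_val (sqpi x)).
Proof. by move=> Xx; rewrite sqpiE; have [] := sqrepP Xx. Qed.

HB.instance Definition _ := gen_eqMixin sqt.
HB.instance Definition _ := gen_choiceMixin sqt.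

Definition sq_add s t := sqpi (sq_val s + sq_val t).
Definition sq_opp s := sqpi (- sq_val s).
Definition sq_scale c s := sqpi (c *: sq_val s).

Lemma sq_addE x y : X x -> X y -> sq_add (sqpi x) (sqpi y) = sqpi (x + y).
Proof.
move=> Xx Xy; apply: sqpi_eq; try exact: subspD.
rewrite (_ : _ - _ = - ((x - sq_val (sqpi x)) + (y - sq_val (sqpi y)))); last by lmod_in F.
by apply/(subspN hY)/(subspD hY); apply: sqpi_val.
Qed.
Lemma sq_oppE x : X x -> sq_opp (sqpi x) = sqpi (- x).
Proof.
move=> Xx; apply: sqpi_eq; try exact: subspN.
rewrite (_ : _ - _ = x - sq_val (sqpi x)); last by lmod_in F.
exact: sqpi_val.
Qed.
Lemma sq_scaleE c x : X x -> sq_scale c (sqpi x) = sqpi (c *: x).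
Proof.
move=> Xx; apply: sqpi_eq; try exact: subspZ.
rewrite (_ : _ - _ = (- c) *: (x - sq_val (sqpi x))); last by lmod_in F.
by apply/(subspZ hY)/sqpi_val.
Qed.

Local Ltac ground := repeat match goal with
  | s : sqt |- _ => rewrite -(sqpiK s); move: (sq_val s) (sq_valX s); clear s;
  let x := fresh "x" in move=> x ?
  end.
Local Ltac ssolve := repeat first [done | apply: (subspD hX) | apply: (subspN hX) | apply: (subspZ hX) | apply: (subsp0 hX)].

Lemma sq_addA : associative sq_add.
Proof. by move=> a b c; ground; rewrite !sq_addE ?addrA; ssolve. Qed.
Lemma sq_addC : commutative sq_add.
Proof. by move=> a b; ground; rewrite !sq_addE 1?addrC; ssolve. Qed.
Lemma sq_add0 : left_id (sqpi 0) sq_add.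
Proof. by move=> a; ground; rewrite !sq_addE ?add0r; ssolve. Qed.
Lemma sq_addN : left_inverse (sqpi 0) sq_opp sq_add.
Proof. by move=> a; ground; rewrite sq_oppE // sq_addE ?addNr; ssolve. Qed.

HB.instance Definition _ := GRing.isZmodule.Build sqt sq_addA sq_addC sq_add0 sq_addN.

Lemma sq_scaleA x y u : sq_scale x (sq_scale y u) = sq_scale (x * y) u.
Proof. by ground; rewrite !sq_scaleE ?scalerA; ssolve. Qed.
Lemma sq_scale1 : left_id 1 sq_scale.
Proof. by move=> u; ground; rewrite !sq_scaleE ?scale1r. Qed.
Lemma sq_scaleDr : right_distributive sq_scale +%R.
Proof.
move=> c u v; rewrite -![_ + _]/(sq_add _ _); ground.
by rewrite !(sq_scaleE, sq_addE) ?scalerDr; ssolve.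
Qed.
Lemma sq_scaleDl u : {morph sq_scale^~ u : x y / x + y}.
Proof.
move=> a b; rewrite -![X in _ = X]/(sq_add _ _); ground.
by rewrite !(sq_scaleE, sq_addE) ?scalerDl; ssolve.
Qed.
HB.instance Definition _ := GRing.Zmodule_isLmodule.Build F sqt
  sq_scaleA sq_scale1 sq_scaleDr sq_scaleDl.

Lemma sqpi_lin : linon X sqpi.
Proof.
move=> c x y Xx Xy; rewrite -sq_addE //; last exact: subspZ.
by rewrite -sq_scaleE.
Qed.
Lemma sqpi0 x : X x -> sqpi x = 0 <-> Y x.
Proof.
move=> Xx; split=> [e|Yx].
  have := sqpi_val Xx; rewrite e => h0.
  have := sqpi_val (subsp0 hX); rewrite sub0r => h1.
  rewrite (_ : x = (x - sq_val 0) - (- sq_val (sqpi 0))); first exact: subspB.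
  by rewrite -[0 in X in _ = X - _]/(sqpi 0); lmod_in F.
by apply: sqpi_eq => //; rewrite ?subr0 //; apply: subsp0.
Qed.
Lemma sqpi_sur s : exists2 x, X x & sqpi x = s.
Proof. by exists (sq_val s) => //; exact: sqpiK. Qed.
Definition sqf (f : E -> E) (s : sqt) : sqt := sqpi (f (sq_val s)).

Section Op.
Variable f : E -> E.
Hypotheses (fX : forall x, X x -> X (f x)) (fY : forall x, Y x -> Y (f x))
  (lf : linon X f).
Lemma sqfE x : X x -> sqf f (sqpi x) = sqpi (f x).
Proof.
move=> Xx; apply: sqpi_eq; try exact: fX.
rewrite -(linonB hX lf) //; apply: fY.
by rewrite -opprB; apply/(subspN hY)/sqpi_val.
Qed.
Lemma sqf_lin : linon setT (sqf f).
Proof.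
move=> c u v _ _; have [x Xx <-] := sqpi_sur u; have [y Xy <-] := sqpi_sur v.
rewrite -sqpi_lin // !sqfE //; last by apply: (subspD hX) => //; apply: (subspZ hX).
by rewrite lf // sqpi_lin //; apply: fX.
Qed.
End Op.
End Subquotient.

Section Wspan.
Variables (F : fieldType) (n : nat) (D : cartan_datum n) (H : realization D).
Local Notation hdual := 'Hom(hh H, rat^o).
Variables (E : lmodType F) (X : hdual -> set E).

Lemma wsum_seq (s t : seq hdual) (f : hdual -> E) :
  uniq t -> {subset s <= t} ->
  \sum_(om <- s) f om = \sum_(om <- t) (count_mem om s)%:R *: f om.
Proof.
move=> Ut; elim: s => [|a s IH] st.
  by rewrite big_nil big1 // => om _; rewrite scale0r.
rewrite big_cons IH; last by move=> om so; apply: st; rewrite inE so orbT.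
under [RHS]eq_bigr => om _ do rewrite natrD scalerDl.
rewrite big_split; congr (_ + _).
rewrite (bigD1_seq a) //=; last by apply: st; rewrite mem_head.
rewrite eqxx scale1r big1 ?addr0 // => om /negbTE.
by rewrite eq_sym => ->; rewrite scale0r.
Qed.

Hypothesis sX : forall om, lsub (X om).

Definition wspan : set E := [set v | exists (s : seq hdual) (f : hdual -> E),
  (forall om, X om (f om)) /\ v = \sum_(om <- s) f om].

Lemma wspan_sub : lsub wspan.
Proof.
split; first by exists [::], (fun=> 0); rewrite big_nil; split=> // om; apply: subsp0 (sX om).
move=> c u v [s [f [hf ->]]] [t [g [hg ->]]].
pose r := undup (s ++ t).
have sr : {subset s <= r} by move=> x xs; rewrite mem_undup mem_cat xs.
have tr : {subset t <= r} by move=> x xs; rewrite mem_undup mem_cat xs orbT.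
exists r, (fun om => c *: ((count_mem om s)%:R *: f om) + (count_mem om t)%:R *: g om).
split=> [om|].
  by apply: (sX om).2; apply: (subspZ (sX om)).
rewrite big_split -scaler_sumr -(wsum_seq f (undup_uniq _) sr).
by rewrite -(wsum_seq g (undup_uniq _) tr).
Qed.
Lemma wspan1 om v : X om v -> wspan v.
Proof.
move=> Xv; exists [:: om], (fun o => if o == om then v else 0); split.
  by move=> o; case: eqP => [->//|_]; apply: subsp0 (sX o).
by rewrite big_seq1 eqxx.
Qed.
End Wspan.

Section FdRdim.
Variables (F : closedFieldType) (E : lmodType F).
Lemma rdim_lsub (Z W : set E) d : lsub Z -> rdim Z W d -> lsub W.
Proof. by move=> hZ []. Qed.
(** A flag for the empty family of operators is a chain of subspaces of codimension one, and all of
    [W] is then a generalized eigenspace. *)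
Lemma fd_rdim (W : set E) n : lsub W -> fd [set 0] W n -> exists d, rdim [set 0] W d.
Proof.
move=> sW hf; pose Phi := fun (i : void) (v : E) => v.
have cW : comfam Phi W by split=> // [[]|[]].
have sZ : stab Phi [set 0] by split; [exact: lsub0|case].
have [cs fl] := flag_ex cW sZ (fun x (e : x = 0) => eq_ind_r W (subsp0 sW) e) hf.
pose g : void -> F := fun i => match i with end.
have := geneig_rdim g cW sZ fl (@subset_refl _ W).
rewrite (_ : geneig Phi g W [set 0] = W); first by exists (chcount g cs).
by apply/seteqP; split=> [x []//|x Wx]; split=> //; exists 0%N; case.
Qed.
Lemma fd_basis (X : set E) n : lsub X -> fd [set 0] X n ->
  exists d (s : 'I_d -> E), (forall j, X (s j)) /\
  forall x, X x -> exists c : 'I_d -> F, x = \sum_j c j *: s j.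
Proof.
move=> sX /(fd_rdim sX) [d r]; exists d; elim: r => [|Y X' d' e _ _ [s [Ys hs]] Xe _ YX sp].
  exists (fun=> 0); split=> [[]//|x ->]; exists (fun=> 0).
  by rewrite big1 // => j _; rewrite scaler0.
exists (fcons e s); split.
  by move=> j; case: unliftP => // k _; apply: YX.
move=> x Xx; have [a Ya] := sp x Xx; have [c ec] := hs _ Ya.
exists (fcons a c).
rewrite big_ord_recl unlift_none; under eq_bigr do rewrite liftK.
by rewrite -ec addrC subrK.
Qed.
End FdRdim.

Section Dimension.
Variables (R : realType).
Local Notation C := R[i].
Variables (E : lmodType C).

Lemma has_dim_fd (W : set E) d : has_dim W d -> fd [set 0] W d.
Proof.
move=> [b [Wb hb]]; apply: (fd_span (s := b) (lsub0 E)) => x /hb [c [ec _]].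
by exists (fun i => c 0 i); rewrite [X in X - _]ec subrr.
Qed.
Lemma rdim_has_dim (W : set E) d : rdim [set 0] W d -> has_dim W d.
Proof.
elim=> [|Y X d' e sX rY [b [Yb hb]] Xe nYe YX sp].
  exists (fun=> 0); split=> [[]//|v ->]; exists 0; split=> [|c' _]; first by rewrite big_ord0.
  by apply/rowP => -[].
have sY := rdim_lsub (lsub0 E) rY.
exists (fcons e b); split.
  by move=> i; case: unliftP => // j _; apply: YX.
move=> v Xv; have [a Ya] := sp v Xv; have [c [ec uc]] := hb _ Ya.
have S (c' : 'rV[R[i]]_d'.+1) : \sum_i c' 0 i *: (if unlift ord0 i is Some j then b j else e) =
  (c' 0 ord0 : R[i]) *: e + \sum_j (c' 0 (fintype.lift ord0 j) : R[i]) *: b j.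
  by rewrite big_ord_recl unlift_none; under eq_bigr do rewrite liftK.
exists (\row_i if unlift ord0 i is Some j then c 0 j else a); split.
  rewrite S !mxE unlift_none; under eq_bigr do rewrite mxE liftK.
  by rewrite -ec addrC subrK.
move=> c' ec'; rewrite S in ec'.
set y := \sum_j _ in ec'.
have Yy : Y y by apply: (subsp_sum sY) => j _; apply: (subspZ sY).
have c0 : c' 0 ord0 = a.
  apply/eqP; rewrite -subr_eq0; apply/negPn/negP => n0; apply: nYe.
  rewrite -[e](scalerK n0); apply: (subspZ sY).
  rewrite (_ : _ *: e = (v - a *: e) - y); first exact: (subspB sY).
  by rewrite ec' scalerBl addrAC addrK.
have ey : v - a *: e = \sum_j (\row_k c' 0 (fintype.lift ord0 k)) 0 j *: b j.
  under eq_bigr do rewrite mxE.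
  by rewrite ec' c0 addrAC subrr add0r.
have := uc _ ey => ecc; apply/rowP => i; rewrite !mxE.
by case: (unliftP ord0 i) => [j ->|-> //]; rewrite ecc mxE.
Qed.
Lemma has_dim_le (W : set E) d n : W 0 -> has_dim W d -> fd [set 0] W n -> (d <= n)%N.
Proof.
move=> W0 [b [Wb hb]] hf; rewrite leqNgt; apply/negP => nd.
have [c [i ci] e0] := hf d b nd Wb.
have [c0 [_ uc]] := hb 0 W0.
have := uc (\row_i c i); under eq_bigr do rewrite mxE; rewrite e0 => /(_ erefl) e1.
have := uc 0; under eq_bigr do rewrite mxE scale0r.
rewrite big1 // => /(_ erefl) e2; case/eqP: ci.
by move: e1; rewrite e2 => /rowP/(_ i); rewrite !mxE.
Qed.
Lemma has_dim_uniq (W : set E) d d' : W 0 -> has_dim W d -> has_dim W d' -> d = d'.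
Proof.
move=> W0 h h'; apply/eqP; rewrite eqn_leq.
by rewrite (has_dim_le W0 h (has_dim_fd h')) (has_dim_le W0 h' (has_dim_fd h)).
Qed.
Lemma sdim_rdim (W : set E) d : rdim [set 0] W d -> sdim W = d.
Proof.
move=> r; have W0 := subsp0 (rdim_lsub (lsub0 E) r).
have h := rdim_has_dim r.
apply: (has_dim_uniq W0 _ h); rewrite /sdim.
by case: xgetP => [d' ->|/(_ d)].
Qed.

End Dimension.

Section FdMore.
Variables (F : fieldType) (E E' : lmodType F).
Lemma fd_img (X : set E) (X' : set E') (p : E -> E') n : lsub X -> linon X p ->
  fd [set 0] X n -> (forall y, X' y -> exists2 x, X x & p x = y) -> fd [set 0] X' n.
Proof.
move=> sX lp hf sur m b nm Xb.
have /choice [a ha] : forall i, exists x, X x /\ p x = b i.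
  by move=> i; have [x Xx px] := sur _ (Xb i); exists x.
have [c nc /= e] := hf m a nm (fun i => (ha i).1); exists c => //.
have := congr1 p e; rewrite (linon0 sX lp) (linon_sum sX lp); last first.
  by move=> i _; apply: (subspZ sX); have [] := ha i.
by move=> e'; rewrite -[RHS]e'; apply: eq_bigr => i _; have [Xa ea] := ha i; rewrite (linonZ sX lp) // ea.
Qed.
End FdMore.

Section FdStrict.
Variables (F : fieldType) (E : lmodType F).
Lemma fd_strict (X Y : set E) n x : lsub Y -> fd [set 0] X n.+1 -> Y `<=` X -> X x -> ~ Y x ->
  fd [set 0] Y n.
Proof.
move=> sY hf YX Xx nYx.
have x0 a : a != 0 -> ~ [set 0] (a *: x).
  move=> a0 /eqP; rewrite scaler_eq0 (negbTE a0) => /eqP e.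
  by apply: nYx; rewrite e; apply: subsp0.
apply: (fd_drop (lsub0 E) hf Xx YX) => // a y a0 Yy; left => e; apply: nYx.
rewrite -[x](scalerK a0); apply: (subspZ sY).
by rewrite -[a *: x](addrK y) e sub0r; apply: (subspN sY).
Qed.
Lemma fd_chain0 n (X : nat -> set E) : (forall k, lsub (X k)) ->
  (forall k, X k.+1 `<=` X k) -> \bigcap_k X k `<=` [set 0] -> fd [set 0] (X 0%N) n ->
  exists K, forall k, (K <= k)%N -> X k `<=` [set 0].
Proof.
elim: n X => [|n IH] X sX dX capX hf.
  exists 0%N => k _; have h := fd0 (lsub0 E) hf.
  by apply: subset_trans h; elim: k => // k IH; apply: subset_trans IH.
have dec k j : X (k + j)%N `<=` X k.
  by elim: j => [|j IHj]; [rewrite addn0|rewrite addnS; apply: subset_trans IHj].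
have [sub|] := pselect (X 0%N `<=` [set 0]).
  by exists 0%N => k _; apply: subset_trans sub; apply: (dec 0%N).
move/existsNP => [x /not_implyP [X0x nx]].
have [j nj] : exists j, ~ X j x.
  by apply: contrapT => no; apply: nx; apply: capX => j _; apply: contrapT => h; apply: no; exists j.
have hj : fd [set 0] (X (j + 0)%N) n.
  by rewrite addn0; apply: fd_strict (sX j) hf _ X0x nj; apply: (dec 0%N).
have [||K hK] := IH (fun k => X (j + k)%N) (fun k => sX _) _ _ hj.
- by move=> k; rewrite addnS.
- move=> y hy; apply: capX => k _; case: (leqP j k) => jk.
  by rewrite -(subnKC jk); apply: hy.
  by apply: (dec k (j - k)%N); rewrite subnKC ?(ltnW jk); have := hy 0%N I; rewrite addn0.
by exists (j + K)%N => k Kk; rewrite -(subnKC (leq_trans (leq_addr K j) Kk)); apply: hK; lia.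
Qed.
End FdStrict.

(** The combinatorial core of the fact that characters are well defined on the Grothendieck group.
    The [items] are composition factors with integer coefficients and Q relates a factor to the
    simple modules isomorphic to it; one isomorphism class is cancelled at a time. *)
Lemma wd_list (T S : Type) (N : T -> nat) (Q : T -> S -> Prop) (dS : S -> nat)
  (items : seq (int * T)) :
  (forall t s, Q t s -> N t = dS s) -> (forall t, N t != 0%N -> exists s, Q t s) ->
  (forall t t' s s', Q t s -> Q t s' -> Q t' s -> Q t' s') ->
  (forall s, dS s != 0%N -> \sum_(x <- items | `[< Q x.2 s >]) x.1 = 0) ->
  \sum_(x <- items) x.1 * (N x.2)%:Z = 0.
Proof.
move=> h1 h2 h3; have [m] := ubnP (size items); elim: m items => // m IH items.
rewrite ltnS => sm h4.
case: items sm h4 => [|d items0]; first by rewrite big_nil.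
set items := d :: items0 => sm h4.
have [/(has_nthP d)[i0 i0s nx]|no] := boolP (has (fun x => N x.2 != 0%N) items); last first.
  rewrite (bigID (fun x => N x.2 != 0%N)) -big_filter.
  move: no; rewrite has_count -leqNgt leqn0 -size_filter => /nilP ->.
  by rewrite big_nil big1 // => x /negPn/eqP ->; rewrite mulr0.
have [s Qs] := h2 _ nx; have ds : dS s != 0%N by rewrite -(h1 _ _ Qs).
rewrite (bigID (fun x => `[< Q x.2 s >])) /=.
have -> : \sum_(x <- items | `[< Q x.2 s >]) x.1 * (N x.2)%:Z = 0.
  transitivity (\sum_(x <- items | `[< Q x.2 s >]) x.1 * (dS s)%:Z).
  by apply: eq_bigr => x /asboolP Qx; rewrite (h1 _ _ Qx).
  by rewrite -mulr_suml h4.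
rewrite add0r -big_filter; apply: IH => [|s' ds'].
  rewrite size_filter; apply: leq_trans sm.
  have := count_predC (fun x => `[< Q x.2 s >]) items => <-.
  rewrite -[X in (X < _)%N]add0n ltn_add2r -has_count; apply/(has_nthP d); exists i0 => //.
  exact/asboolP.
rewrite big_filter_cond.
have [[x [Qx Qx']]|nx'] := pselect (exists x, Q x s /\ Q x s').
  rewrite big1 // => y /andP[/negP nQ /asboolP Qy]; case: nQ; apply/asboolP.
  exact: (h3 x y.2 s' s).
rewrite -[RHS](h4 s' ds'); apply: eq_bigl => y.
apply/andP/idP => [[]//|Qy]; split=> //; apply/negP => /asboolP Qs'.
by apply: nx'; exists y.2; split=> //; apply/asboolP.
Qed.

(** * Laurent series, recurrences and expansions of rational functions *)

Section Shift.
Variable F : fieldType.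
Local Notation E := (int -> F^o).

(** Multiplication by z on two-sided series, so that [pap shf p] is multiplication by p(z). *)
Definition shf (h : E) : E := fun k => h (k - 1).

Lemma iter_shf j h k : iter j shf h k = h (k - j%:Z).
Proof.
elim: j h k => [|j IH] h k; first by rewrite subr0.
by rewrite iterSr IH; congr h; lia.
Qed.
Lemma pap_shf (p : {poly F}) (h : E) k :
  pap shf p h k = \sum_(j < size p) p`_j * h (k - j%:Z).
Proof.
by rewrite /pap fct_sumE; apply: eq_bigr => j _; rewrite -[LHS]/(_ * _) iter_shf.
Qed.
Definition kron0 : E := fun k => (k == 0)%:R.

Lemma pap_kron (p : {poly F}) : pap shf p kron0 = zext true (nth 0 p).
Proof.
apply/funext => k; rewrite pap_shf /zext mul1r /kron0.
case: ifP => [k0|/negbT]; last first.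
  rewrite -ltNge => k0; rewrite big1 // => j _.
  by rewrite (_ : (k - j%:Z == 0) = false) ?mulr0 //; lia.
have [ks|ks] := ltnP `|k|%N (size p).
  rewrite (bigD1 (Ordinal ks)) //= (_ : (k - `|k|%N%:Z == 0) = true); last by lia.
  rewrite mulr1 big1 ?addr0 // => j jk; rewrite (_ : (k - j%:Z == 0) = false) ?mulr0 //.
  by apply/negP => /eqP e; move/eqP: jk; apply; apply: val_inj => /=; lia.
rewrite nth_default // big1 // => j _.
by rewrite (_ : (k - j%:Z == 0) = false) ?mulr0 //; have := ltn_ord j; lia.
Qed.
Lemma expandsP e f (N D : {poly F}) :
  expands_as e f N D <-> pap shf D (zext e f : E) = pap shf N kron0.
Proof.
rewrite pap_kron; split=> [h|h k]; first by apply/funext => k; rewrite pap_shf.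
by rewrite -h pap_shf.
Qed.
Lemma papMs (p r : {poly F}) (x : E) : pap shf (p * r) x = pap shf p (pap shf r x).
Proof. exact: (papM (lsubT E)). Qed.
Lemma pap_lins (p : {poly F}) : linon setT (pap shf p).
Proof. exact: pap_lin2. Qed.
(** A series bounded on one side has an extreme coefficient there, which p multiplies by its own
    extreme coefficient. The bound matters: the two-sided series with all coefficients 1 is killed
    by 1 - z. *)
Lemma recur_inj (M : lmodType F) (p : {poly F}) (h : int -> M) e B : p != 0 ->
  (forall k, pm e * k < B -> h k = 0) ->
  (forall k, \sum_(j < size p) p`_j *: h (k - j%:Z) = 0) -> forall k, h k = 0.
Proof.
move=> p0 hB hp; have exj : exists j, p`_j != 0.
  by exists (size p).-1; rewrite lead_coef_eq0.
(* The lowest exponent of p when h is bounded below, the degree of p when h is bounded above. *)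
pose j0 := if e then ex_minn exj else (size p).-1.
have [pj hj] : p`_j0 != 0 /\ forall j, p`_j != 0 -> j = j0 \/ (pm e * (j0%:Z - j%:Z) < 0).
  rewrite /j0; case: (e) => /=.
  case: ex_minnP => j pj mj; split=> // j' /mj; rewrite leq_eqVlt => /orP[/eqP ->|]; first by left.
  by move=> ?; right; lia.
  rewrite lead_coef_eq0; split=> // j pj.
  have : (j < size p)%N by rewrite ltnNge; apply: contra pj => /leq_sizeP ->.
  by case: (size p) => // s; rewrite ltnS leq_eqVlt => /orP[/eqP ->|?]; [left|right => /=; lia].
have js : (j0 < size p)%N by rewrite ltnNge; apply: contra pj => /leq_sizeP ->.
suff st m : forall k, pm e * k < B + m%:Z -> h k = 0.
  move=> k; have kB : pm e * k < B + (absz (pm e * k - B)%R).+1%:Z by lia.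
  exact: st kB.
elim: m => [|m IH] k km; first by apply: hB; lia.
have := hp (k + j0%:Z); rewrite (bigD1 (Ordinal js)) //= addrK big1 => [|j /eqP jj].
  by rewrite addr0 => /eqP; rewrite scaler_eq0 (negbTE pj) => /eqP.
have [->|pj'] := eqVneq p`_j 0; first by rewrite scale0r.
case: (hj _ pj') => [e1|lt]; first by case: jj; apply: val_inj.
by rewrite IH ?scaler0 //; move: lt km; case: (e) => /=; lia.
Qed.
Lemma pap_shf_inj (p : {poly F}) (h : E) e B : p != 0 -> (forall k, pm e * k < B -> h k = 0) ->
  pap shf p h = 0 -> h = 0.
Proof.
move=> p0 hB hp; apply/funext; apply: (recur_inj p0 hB) => k.
by rewrite -[RHS](congr1 (fun g : E => g k) hp) pap_shf.
Qed.
Lemma pap_zext_inj e (f : nat -> F) (p : {poly F}) : p != 0 ->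
  pap shf p (zext e f : E) = 0 -> forall m, f m = 0.
Proof.
move=> p0 h m; have z0 : zext e f = 0 :> E.
  by apply: (pap_shf_inj (e := e) (B := 0) p0 _ h) => k; rewrite /zext ltNge; case: ifP.
have := congr1 (fun g : E => g (pm e * m%:Z)) z0; rewrite /zext.
have [-> ->] // : 0 <= pm e * (pm e * m%:Z) /\ absz (pm e * m%:Z)%R = m by case: (e) => /=; lia.
Qed.
Lemma zextB e (f f' : nat -> F) : (zext e f : E) - zext e f' = zext e (fun m => f m - f' m).
Proof. by apply/funext => k; rewrite /zext -[LHS]/(_ - _); case: ifP; rewrite ?subrr. Qed.
Lemma expands_uniq e f f' (N D N' D' : {poly F}) : D != 0 -> D' != 0 ->
  N * D' = N' * D -> expands_as e f N D -> expands_as e f' N' D' -> f = f'.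
Proof.
move=> D0 D0' ND /expandsP h /expandsP h'; apply/funext => m.
apply/eqP; rewrite -subr_eq0; apply/eqP.
apply: (@pap_zext_inj e (fun m => f m - f' m) (D * D')); first by rewrite mulf_neq0.
rewrite -zextB (linBT (pap_lins _)) // {1}[D * D']mulrC !papMs h h' -!papMs.
by rewrite [D' * N]mulrC ND mulrC subrr.
Qed.
Lemma expands_cross e f (N D N' D' : {poly F}) :
  expands_as e f N D -> expands_as e f N' D' -> N * D' = N' * D.
Proof.
move=> /expandsP h /expandsP h'; apply/eqP; rewrite -subr_eq0; apply/eqP/polyP => m.
rewrite coef0; apply: (@pap_zext_inj true (nth 0 (N * D' - N' * D)) 1 (oner_neq0 _)).
rewrite (pap1 _ _) -pap_kron papD papN.
by rewrite [N * D']mulrC [N' * D]mulrC !papMs -h -h' -!papMs [D' * D]mulrC subrr.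
Qed.
End Shift.

Section Mup0.
Variable F : fieldType.
Lemma c1_neq0 (p : {poly F}) : p`_0 = 1 -> p != 0.
Proof. by move=> s0; apply/eqP => e; move/eqP: s0; rewrite e coef0 eq_sym oner_eq0. Qed.
Lemma c1_mul (p r : {poly F}) : p`_0 = 1 -> r`_0 = 1 -> (p * r)`_0 = 1.
Proof. by rewrite -!horner_coef0 hornerM => -> ->; rewrite mulr1. Qed.
End Mup0.

Section Mup.
Variable F : closedFieldType.

(** Over a closed field the roots with multiplicity fix a polynomial up to a scalar, and the
    constant term 1 fixes the scalar and excludes the root 0. *)
Lemma mup_eq_poly (p r : {poly F}) : p`_0 = 1 -> r`_0 = 1 ->
  (forall x, x != 0 -> mup x p = mup x r) -> p = r.
Proof.
move=> p0 r0 h.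
have nz := @c1_neq0 F.
have m0 (s : {poly F}) : s`_0 = 1 -> mup 0 s = 0%N.
  by move=> s0; apply: mupNroot; rewrite /root horner_coef0 s0 oner_eq0.
have [sp ep] := closed_field_poly_normal p; have [sr er] := closed_field_poly_normal r.
have lp : lead_coef p != 0 by rewrite lead_coef_eq0 nz.
have lr : lead_coef r != 0 by rewrite lead_coef_eq0 nz.
have mS (c : F) (s : {poly F}) x : c != 0 -> s != 0 -> mup x (c *: s) = mup x s.
  move=> c0 s0; rewrite -mul_polyC mupMr //.
  by rewrite /root hornerC.
have nzp (s : seq F) : \prod_(z <- s) ('X - z%:P) != 0.
  by rewrite monic_neq0 // monic_prod_XsubC.
have psr : perm_eq sp sr.
  apply/allP => x _ /=; rewrite -!mu_prod_XsubC -(mS _ _ x lp (nzp sp)) -(mS _ _ x lr (nzp sr)).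
  rewrite -ep -er; have [->|x0] := eqVneq x 0; first by rewrite !m0.
  by rewrite h.
have epr : \prod_(z <- sp) ('X - z%:P) = \prod_(z <- sr) ('X - z%:P) :> {poly F}.
  exact: perm_big.
rewrite ep er epr; congr (_ *: _).
have := p0; have := r0; rewrite {1}ep {1}er epr !coefZ => e1 e2.
have c0 : (\prod_(z <- sr) ('X - z%:P))`_0 != 0.
  by apply/eqP => c0; move: e1; rewrite c0 mulr0 => /eqP; rewrite eq_sym oner_eq0.
by apply: (mulIf c0); rewrite e1.
Qed.
End Mup.

Section PScale.
Variable R : realType.
Local Notation C := R[i].

Lemma pscaleM (a : C) p r : pscale a (p * r) = pscale a p * pscale a r.
Proof. exact: comp_polyM. Qed.
Lemma pscaleK (a : C) p : a != 0 -> pscale a^-1 (pscale a p) = p.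
Proof.
move=> a0; rewrite /pscale -comp_polyA comp_polyZ comp_polyX scalerA mulfV //.
by rewrite scale1r comp_polyXr.
Qed.
Lemma size_pscale (a : C) p : a != 0 -> size (pscale a p) = size p.
Proof.
by move=> a0; rewrite size_comp_poly2 // size_scale // size_polyX.
Qed.
Lemma pscale_eq0 (a : C) p : a != 0 -> (pscale a p == 0) = (p == 0).
Proof. by move=> a0; rewrite -!size_poly_eq0 size_pscale. Qed.
Lemma pscale0 (a : C) p : (pscale a p)`_0 = p`_0.
Proof. by rewrite -!horner_coef0 horner_comp hornerZ hornerX mulr0. Qed.
Lemma mup_pscale (a x : C) p : a != 0 -> p != 0 -> mup x (pscale a p) = mup (a * x) p.
Proof.
have dir (b y : C) s m : b != 0 -> ('X - (b * y)%:P) ^+ m %| s -> ('X - y%:P) ^+ m %| pscale b s.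
  move=> b0 /(dvdp_comp_poly (b *: 'X)); rewrite rmorphXn /= comp_polyB comp_polyX comp_polyC.
  rewrite polyCM mul_polyC -scalerBr exprZn => /(dvdp_trans _); apply.
  by rewrite dvdpZr ?expf_neq0.
move=> a0 p0; have pp0 : pscale a p != 0 by rewrite pscale_eq0.
apply/eqP; rewrite eqn_leq; apply/andP; split.
  rewrite mup_geq // -[X in _ %| X](pscaleK p a0); apply: dir; first by rewrite invr_eq0.
  by rewrite mulKf // -mup_geq.
by rewrite mup_geq //; apply: dir => //; rewrite -mup_geq.
Qed.
End PScale.

Section SdimMore.
Variables (R : realType) (E : lmodType R[i]).

Lemma sdim_fd (Y : set E) n : lsub Y -> fd [set 0] Y n -> has_dim Y (sdim Y).
Proof.
move=> sY hf; have [d r] := fd_rdim sY hf.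
by rewrite (sdim_rdim r); apply: rdim_has_dim.
Qed.
Lemma sdim_le (Y : set E) n : lsub Y -> fd [set 0] Y n -> (sdim Y <= n)%N.
Proof. by move=> sY hf; apply: has_dim_le (subsp0 sY) (sdim_fd sY hf) hf. Qed.
Lemma sdim_lt (Y Y' : set E) n x : lsub Y -> lsub Y' -> fd [set 0] Y' n -> Y `<=` Y' ->
  Y' x -> ~ Y x -> (sdim Y < sdim Y')%N.
Proof.
move=> sY sY' hf YY Yx nYx; have h := has_dim_fd (sdim_fd sY' hf).
case: (sdim Y') h => [|k] h.
  by case: nYx; rewrite (fd0 (lsub0 E) h Yx); apply: subsp0.
by rewrite ltnS; apply: sdim_le => //; apply: fd_strict h YY Yx nYx.
Qed.
End SdimMore.

Lemma fd_fun (R : realType) (V : lmodType R[i]) (X : set V) d K : lsub X -> fd [set 0] X d ->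
  exists k, fd [set 0] [set g : nat -> V | (forall j, X (g j)) /\ forall j, (K <= j)%N -> g j = 0] k.
Proof.
move=> sX hd; have [d' r] := fd_rdim sX hd; have [b [Xb hb]] := rdim_has_dim r.
pose T : finType := ('I_K * 'I_d')%type.
pose S (p : T) : nat -> V := fun j => if j == p.1 then b p.2 else 0.
exists #|T|; apply: (fd_span (s := fun i => S (enum_val i)) (lsub0 _)) => g [Xg Kg].
have /choice [c hc] : forall j, exists c : 'rV[R[i]]_d', g j = \sum_i c 0 i *: b i.
  by move=> j; have [c [ec _]] := hb _ (Xg j); exists c.
pose cf (p : 'I_K * 'I_d') := c p.1 0 p.2.
exists (fun i => cf (enum_val i)).
apply/eqP; rewrite subr_eq0; apply/eqP.
rewrite -(big_enum_val (fun p : T => cf p *: S p)).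
apply/funext => j; rewrite fct_sumE.
rewrite -(pair_bigA _ (fun (k : 'I_K) (i : 'I_d') => (c k 0 i *: S (k, i)) j)).
have [jK|Kj] := ltnP j K.
  rewrite (bigD1 (Ordinal jK)) //= [X in _ + X]big1 ?addr0 => [|k kj]; last first.
  rewrite big1 // => i _; rewrite -[LHS]/(_ *: (if j == k then b i else 0)).
  case: eqP => [e|_]; last by rewrite scaler0.
  by case/eqP: kj; apply: val_inj.
  rewrite hc; apply: eq_bigr => i _.
  by rewrite -[RHS]/(_ *: (if j == j then b i else 0)) eqxx.
rewrite Kg // big1 // => k _; rewrite big1 // => i _.
rewrite -[LHS]/(_ *: (if j == k then b i else 0)).
by case: eqP => [e|_]; [move: (ltn_ord k); rewrite -e ltnNge Kj|rewrite scaler0].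
Qed.

Section ForwardShift.
Variables (F : fieldType) (V : lmodType F).
Definition sht (f : int -> V) : int -> V := fun r => f (r + 1).

Lemma iter_sht j f r : iter j sht f r = f (r + j%:Z).
Proof.
elim: j f r => [|j IH] f r; first by rewrite addr0.
by rewrite iterSr IH; congr f; lia.
Qed.
Lemma pap_sht (p : {poly F}) (f : int -> V) r :
  pap sht p f r = \sum_(j < size p) p`_j *: f (r + j%:Z).
Proof.
by rewrite /pap fct_sumE; apply: eq_bigr => j _; rewrite -[LHS]/(_ *: _) iter_sht.
Qed.
Lemma papMt (p r : {poly F}) f : pap sht (p * r) f = pap sht p (pap sht r f).
Proof. exact: (papM (lsubT _)). Qed.
Lemma pap_lint (p : {poly F}) : linon setT (pap sht p).
Proof. exact: pap_lin2. Qed.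
Lemma papBt (p : {poly F}) f g : pap sht p (f - g) = pap sht p f - pap sht p g.
Proof. exact: (linBT (pap_lint p)). Qed.
Lemma papZt (p : {poly F}) c f : pap sht p (c *: f) = c *: pap sht p f.
Proof. exact: (linZT (pap_lint p)). Qed.
Lemma pap0t (p : {poly F}) : pap sht p 0 = 0.
Proof. exact: lin0T (pap_lint p). Qed.
Lemma papXt (f : int -> V) : pap sht 'X f = sht f.
Proof. by rewrite -[X in pap sht X]mulr1 (pap_mulX (lsubT _)) // pap1. Qed.
Lemma papXC a (f : int -> V) : pap sht ('X - a%:P) f = sht f - a *: f.
Proof. by rewrite papD papXt papN papC. Qed.
Lemma sht_geom a (f : int -> V) : a != 0 -> sht f = a *: f -> forall r t, f (r + t) = a ^ t *: f r.
Proof.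
move=> a0 h; have S r : f (r + 1) = a *: f r by rewrite -[LHS]/(sht f r) h.
have P t : forall r, f (r + t%:Z) = a ^+ t *: f r.
  elim: t => [|t IH] r; first by rewrite addr0 scale1r.
  by rewrite exprS -scalerA -IH -S; congr f; lia.
move=> r [t|t]; first exact: P.
rewrite NegzE; have := P t.+1 (r - t.+1%:Z); rewrite subrK => ->.
by rewrite scalerA mulVf ?scale1r // expf_neq0.
Qed.
Lemma pap_linear_map (V' : lmodType F) (g : V -> V') (p : {poly F}) f : linon setT g ->
  forall r, \sum_(j < size p) p`_j *: g (f (r + j%:Z)) = g (pap sht p f r).
Proof.
move=> lg r; rewrite pap_sht (linsT lg) //; apply: eq_bigr => j _.
by rewrite (linZT lg).
Qed.
(** Linear factors are dropped until the result is nonzero but killed by one more factor. That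
    vector is an eigenvector of the shift, hence a geometric progression by [sht_geom] when the
    ratio is nonzero. *)
Lemma pap_geom (s : seq F) (f : int -> V) : f <> 0 -> pap sht (\prod_(z <- s) ('X - z%:P)) f = 0 ->
  exists S a, [/\ a \in s, pap sht S f <> 0 & sht (pap sht S f) = a *: pap sht S f].
Proof.
elim: s f => [|a s IH] f f0; first by rewrite big_nil pap1 => /f0.
rewrite big_cons papMt => h.
have [e|ne] := pselect (pap sht (\prod_(z <- s) ('X - z%:P)) f = 0).
  by have [S [a' [as' h1 h2]]] := IH f f0 e; exists S, a'; rewrite inE as' orbT.
exists (\prod_(z <- s) ('X - z%:P)), a; split=> //; first exact: mem_head.
by apply/eqP; rewrite -subr_eq0 -papXC h.
Qed.
End ForwardShift.

Section ScalarShift.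
Variable F : fieldType.
Local Notation E := (int -> F^o).
Local Notation T := (@sht F F^o).

Lemma papT_kron (p : {poly F}) k : pap T p (@kron0 F) k = zext false (nth 0 p) k.
Proof.
have -> : zext false (nth 0 p) k = zext true (nth 0 p) (- k).
  by rewrite /zext /pm mulN1r mul1r abszN.
rewrite -pap_kron pap_shf pap_sht; apply: eq_bigr => j _.
by rewrite /kron0 -opprD oppr_eq0.
Qed.
Lemma papT_kron_inj (p r : {poly F}) : pap T p (@kron0 F) = pap T r (@kron0 F) -> p = r.
Proof.
move=> h; apply/polyP => m; have := congr1 (fun f : E => f (- m%:Z)) h.
by rewrite !papT_kron /zext mulN1r opprK abszN.
Qed.
(** The commutator of x^+ and x^- acts on an eigenvector through this difference of the two halves
    of phi. A polynomial annihilating it exhibits both halves as expansions of one rational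
    function. *)
Definition delta (g : bool -> nat -> F) : E := (zext true (g true) : E) - zext false (g false).

(* The common value of U(T) on both halves of delta is supported on [-deg U, 0]. *)
Lemma delta_poly (g : bool -> nat -> F) (U : {poly F}) : pap T U (delta g) = 0 ->
  exists W : {poly F}, [/\ (size W <= size U)%N, forall e, pap T U (zext e (g e) : E) = pap T W (@kron0 F),
  W`_(size U).-1 = U`_(size U).-1 * g true 0%N & W`_0 = U`_0 * g false 0%N].
Proof.
move=> h; have [U0|U0] := eqVneq U 0.
  exists 0; rewrite U0 !coef0 !mul0r; split=> // e.
  by rewrite /pap !size_poly0 !big_ord0.
have eqh : pap T U (zext true (g true) : E) = pap T U (zext false (g false) : E).
  by apply/eqP; rewrite -subr_eq0 -papBt h.
have nk := lt0n; have sU : (0 < size U)%N by rewrite size_poly_gt0.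
pose W := \poly_(j < size U) pap T U (zext true (g true) : E) (- j%:Z).
have vt k : k < - (size U).-1%:Z -> pap T U (zext true (g true) : E) k = 0.
  move=> hk; rewrite pap_sht big1 // => j _; rewrite /zext mul1r.
  by rewrite ifF ?scaler0 //; have := ltn_ord j; lia.
have vf k : 0 < k -> pap T U (zext true (g true) : E) k = 0.
  move=> hk; rewrite eqh pap_sht big1 // => j _; rewrite /zext mulN1r.
  by rewrite ifF ?scaler0 //; lia.
have WE : pap T U (zext true (g true) : E) = pap T W (@kron0 F).
  apply/funext => k; rewrite papT_kron /zext mulN1r; case: ifP => k0; last first.
  by apply: vf; lia.
  rewrite coef_poly; case: ifP => ks; first by congr (pap _ _ _ _); lia.
  by apply: vt; lia.
exists W; split.
- exact: size_poly.
- by case; rewrite -?eqh.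
- rewrite coef_poly prednK // leqnn pap_sht.
  have lt : ((size U).-1 < size U)%N by rewrite prednK.
  rewrite (bigD1 (Ordinal lt)) // addNr /zext /= big1 ?addr0 // => j /eqP ne.
  rewrite ifF ?scaler0 //; apply/negbTE; rewrite -ltNge.
  have := ltn_ord j; have : (j : nat) != (size U).-1 by apply/eqP => e; apply: ne; apply: val_inj.
  by move: (seq.size _) (nat_of_ord _) => s t; lia.
rewrite coef_poly sU eqh pap_sht (bigD1 (Ordinal sU)) // /zext /= big1 ?addr0 // => j /eqP ne.
rewrite ifF ?scaler0 //.
have : (j : nat) <> 0%N by move=> e; apply: ne; apply: val_inj.
lia.
Qed.
End ScalarShift.

(** * Zeros and poles of eigenvalue series *)

Section Fits.
Variable F : closedFieldType.
Local Notation E := (int -> F^o).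
Local Notation T := (@sht F F^o).
Definition pA (A : seq F) : {poly F} := \prod_(z <- A) ('X - z%:P).

(* The rational function c (T - A) / (T - B), T = 1/z, has expansion g. *)
Definition fits (g : bool -> nat -> F) (c : F) (A B : seq F) : Prop :=
  [/\ c != 0, 0 \notin A ++ B, size A = size B &
  forall e, pap T (pA B) (zext e (g e) : E) = c *: pap T (pA A) (@kron0 F)].

Lemma pA_neq0 A : pA A != 0. Proof. by rewrite monic_neq0 // monic_prod_XsubC. Qed.
(** From U(T) delta = 0 comes a polynomial W with pA B W = c pA A U; comparing multiplicities at a
    bounds the pole order. *)
Lemma fits_ord g c A B (U : {poly F}) a : fits g c A B -> U != 0 -> pap T U (delta g) = 0 ->
  (count_mem a B <= count_mem a A + mup a U)%N.
Proof.
move=> [c0 _ _ h] U0 /delta_poly [W [_ hW _ _]].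
have e : pA B * W = c *: (pA A * U).
  apply: papT_kron_inj; rewrite papMt -(hW true) -papMt mulrC papMt h papZt papZ.
  by rewrite [pA A * U]mulrC papMt.
have W0 : W != 0.
  apply/eqP => W0; move/eqP: e; rewrite W0 mulr0 eq_sym scaler_eq0 (negbTE c0).
  by rewrite mulf_eq0 (negbTE (pA_neq0 A)) (negbTE U0).
have cP : c%:P != 0 :> {poly F} by rewrite polyC_eq0.
have := congr1 (mup a) e; rewrite -mul_polyC (mupM a (pA_neq0 B) W0).
rewrite (mupM a cP (mulf_neq0 (pA_neq0 A) U0)) (mupM a (pA_neq0 A) U0).
rewrite (@mupNroot _ a c%:P); last by rewrite /root hornerC.
by rewrite !mu_prod_XsubC add0n => <-; exact: leq_addr.
Qed.
(** Both constant terms of g are nonzero, so numerator and denominator have equal degree and neither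
    vanishes at 0. *)
Lemma fits_ex (g : bool -> nat -> F) (P : {poly F}) : P`_0 != 0 -> g true 0%N != 0 -> g false 0%N != 0 ->
  pap T P (delta g) = 0 -> exists c A B, fits g c A B.
Proof.
move=> P0 gt gf /delta_poly [W [sW hW eW eW0]].
have Pn : P != 0 by apply: contraNneq P0 => ->; rewrite coef0.
have lP : P`_(size P).-1 != 0 by rewrite -lead_coefE lead_coef_eq0.
have W0 : W`_0 != 0 by rewrite eW0 mulf_neq0.
have Wn : W != 0 by apply: contraNneq W0 => ->; rewrite coef0.
have sWP : size W = size P.
  apply/eqP; rewrite eqn_leq sW /= leqNgt; apply/negP => lt.
  have : W`_(size P).-1 = 0 by apply: nth_default; move: lt; case: (size P).
  by rewrite eW => /eqP; rewrite mulf_eq0 (negbTE lP) (negbTE gt).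
have [A eA] := closed_field_poly_normal W; have [B eB] := closed_field_poly_normal P.
have lW0 : lead_coef W != 0 by rewrite lead_coef_eq0.
exists (lead_coef W / lead_coef P), A, B; split.
- by rewrite mulf_neq0 // invr_eq0.
- rewrite mem_cat negb_or; apply/andP; split; apply/negP => h0.
  case/negP: W0; rewrite -horner_coef0 -/(root W 0) eA rootZ //.
  by rewrite root_prod_XsubC.
  case/negP: P0; rewrite -horner_coef0 -/(root P 0) eB rootZ //.
  by rewrite root_prod_XsubC.
- have := sWP; rewrite eA eB !size_scale // !size_prod_XsubC => -[].
  by [].
move=> e; have := hW e; rewrite {1}eA {1}eB !papZ => h.
by rewrite mulrC -scalerA -h scalerA mulVf // scale1r.
Qed.
(** The hypothesis is the coefficient form of g' = g (b T - a) / (T - b a) for both expansions; the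
    factor b of the numerator goes into the constant. *)
Lemma fits_step (g g' : bool -> nat -> F) c A B (b a : F) : fits g c A B -> a != 0 -> b != 0 ->
  (forall e (k : int), zext e (g' e) (k + 1) - b * a * zext e (g' e) k =
  b * zext e (g e) (k + 1) - a * zext e (g e) k) ->
  fits g' (c * b) (b^-1 * a :: A) (b * a :: B).
Proof.
move=> [c0 n0 sAB h] a0 b0 hg; split.
- by rewrite mulf_neq0.
- move: n0; rewrite !mem_cat !negb_or => /andP[-> ->].
  by rewrite ![0 == _]eq_sym !mulf_neq0 // invr_eq0.
- by rewrite /= sAB.
move=> e; rewrite /pA !big_cons mulrC papMt papXC.
have -> : T (zext e (g' e) : E) - (b * a) *: (zext e (g' e) : E) =
  b *: (T (zext e (g e) : E) - (b^-1 * a) *: (zext e (g e) : E)).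
  apply/funext => k; have hk := hg e k.
  rewrite -[RHS]/(b * (zext e (g e) (k + 1) - b^-1 * a * zext e (g e) k)).
  by rewrite mulrBr !mulrA mulfV // mul1r.
rewrite papZt -papXC -papMt mulrC papMt h papZt scalerA mulrC.
by rewrite papMt.
Qed.
End Fits.

Lemma lin_dep (F : fieldType) (T : finType) m (A : 'I_m -> T -> F) : (#|T| < m)%N ->
  exists2 c : 'I_m -> F, (exists r, c r != 0) & forall p, \sum_r c r * A r p = 0.
Proof.
move=> Tm; pose M := \matrix_(r < m, k < #|T|) A r (enum_val k).
have : kermx M != 0.
  rewrite -mxrank_eq0 mxrank_ker -lt0n subn_gt0.
  exact: leq_ltn_trans (rank_leq_col M) Tm.
case/rowV0Pn => v /sub_kermxP vM v0; exists (fun r => v 0 r).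
  apply: contrapT => nc; case/eqP: v0; apply/rowP => r; rewrite mxE.
  by apply/eqP/negPn/negP => h; apply: nc; exists r.
move=> p; have := congr1 (fun B : 'rV_ _ => B 0 (enum_rank p)) vM; rewrite !mxE => e.
by rewrite -[RHS]e; apply: eq_bigr => r _; rewrite !mxE enum_rankK.
Qed.

Section Pairing.
Variable F : closedFieldType.
Definition psc (a : F) (p : {poly F}) : {poly F} := p \Po (a *: 'X).
Definition deg1 (p : {poly F}) : int := (size p).-1%:Z.
Definition lin1 (r : F) : {poly F} := 1 - r *: 'X.
Definition prz (A : seq F) : {poly F} := \prod_(z <- A) lin1 z.

Lemma psc_lin1 a r : psc a (lin1 r) = lin1 (r * a).
Proof. by rewrite /psc comp_polyB comp_polyC comp_polyZ comp_polyX scalerA. Qed.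
Lemma psc1 a : psc a 1 = 1. Proof. exact: comp_polyC. Qed.
Lemma lin1_0 r : (lin1 r)`_0 = 1.
Proof. by rewrite coefB coefZ coefX mulr0 subr0 coef1. Qed.
Lemma size_lin1 r : r != 0 -> size (lin1 r) = 2%N.
Proof.
move=> r0; rewrite /lin1 addrC size_polyDl; rewrite size_polyN size_scale // size_polyX //.
by rewrite size_poly1.
Qed.
Lemma deg1M (p r : {poly F}) : p != 0 -> r != 0 -> deg1 (p * r) = deg1 p + deg1 r.
Proof.
move=> p0 r0; rewrite /deg1 size_mul //.
have key a b : (0 < a)%N -> (0 < b)%N -> ((a + b).-1.-1)%:Z = a.-1%:Z + b.-1%:Z by lia.
by apply: key; rewrite size_poly_gt0.
Qed.
Lemma deg1_1 : deg1 1 = 0. Proof. by rewrite /deg1 size_poly1. Qed.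
Lemma deg1_lin1 r : r != 0 -> deg1 (lin1 r) = 1. Proof. by move=> r0; rewrite /deg1 size_lin1. Qed.

Variable qi : F.
Hypothesis qi0 : qi != 0.
Local Notation b := (qi ^+ 2).

(** When the two constant terms of a series are inverse to each other, its constant c satisfies c^2
    prod A = prod B. With the last clause this brings c prz A / prz B to the shape required in
    QP_l^+, with Q and P in the parts of Q_i and R_i. *)
Definition qrpair (A B : seq F) (Q P : {poly F}) : Prop :=
  [/\ Q`_0 = 1, P`_0 = 1,
  prz A * (psc qi Q * psc qi^-1 P) = prz B * (psc qi^-1 Q * psc qi P)
  & \prod_(z <- B) z = (\prod_(z <- A) z) * qi ^ (2 * (deg1 Q - deg1 P))].

Lemma qrpair_cat A B A' B' Q P Q' P' : qrpair A B Q P -> qrpair A' B' Q' P' ->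
  qrpair (A ++ A') (B ++ B') (Q * Q') (P * P').
Proof.
move=> [q1 p1 e d] [q1' p1' e' d']; split; [exact: c1_mul|exact: c1_mul| |].
  rewrite /prz !big_cat -!/(prz _) /=.
  transitivity ((prz A * (psc qi Q * psc qi^-1 P)) * (prz A' * (psc qi Q' * psc qi^-1 P'))).
  by rewrite /prz; ring.
  by rewrite e e'; ring.
rewrite !big_cat /= d d' !deg1M ?c1_neq0 //.
rewrite (_ : 2 * (deg1 Q + deg1 Q' - (deg1 P + deg1 P')) =
  2 * (deg1 Q - deg1 P) + 2 * (deg1 Q' - deg1 P')); last by ring.
by rewrite expfzDr //; ring.
Qed.
(** One linear factor of P moves a zero by one step along its orbit under b = qi^2; [qrpair_down]
    does the same with Q in the other direction, and arbitrary powers of b are reached by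
    telescoping. *)
Lemma qrpair_up be : be != 0 -> qrpair [:: be * b] [:: be] 1 (lin1 (be * qi)).
Proof.
move=> be0; split; rewrite ?coef1 ?lin1_0 //.
  by rewrite /prz !big_seq1 !psc1 !psc_lin1 !mul1r -!mulrA mulfV // mulr1 mulrC.
by rewrite !big_seq1 deg1_1 deg1_lin1 ?mulf_neq0 // mulfK // expf_neq0.
Qed.
Lemma qrpair_down be : be != 0 -> qrpair [:: be * b^-1] [:: be] (lin1 (be / qi)) 1.
Proof.
move=> be0; split; rewrite ?coef1 ?lin1_0 //.
  by rewrite /prz !big_seq1 !psc1 !psc_lin1 !mulr1 -!mulrA mulVf // mulr1 invfM mulrC.
rewrite !big_seq1 deg1_1 deg1_lin1; last by rewrite mulf_neq0 // invr_eq0.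
by rewrite mulfVK // expf_neq0.
Qed.
Lemma qrpair_trans be A al Q P Q' P' : qrpair A [:: be] Q P -> qrpair [:: be] [:: al] Q' P' ->
  qrpair A [:: al] (Q * Q') (P * P').
Proof.
move=> h1 h2; have [q1 p1 e d] := qrpair_cat h1 h2; split=> //.
  move: e; rewrite /prz !big_cat /= !big_seq1 => e.
  have l0 : lin1 be != 0 by apply/c1_neq0/lin1_0.
  by apply: (mulIf l0); rewrite mulrAC e; ring.
have [_ _ _ d1] := h1; have [_ _ _ d2] := h2.
move: d1 d2; rewrite !big_seq1 => d1 d2.
have [Q1 P1 _ _] := h1; have [Q1' P1' _ _] := h2.
rewrite d2 d1 !deg1M ?c1_neq0 //.
rewrite (_ : 2 * (deg1 Q + deg1 Q' - (deg1 P + deg1 P')) =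
  2 * (deg1 Q - deg1 P) + 2 * (deg1 Q' - deg1 P')); last by ring.
by rewrite expfzDr // mulrA.
Qed.
Lemma qrpair_orb be (k : int) : be != 0 -> exists Q P, qrpair [:: be * b ^ k] [:: be] Q P.
Proof.
have b0 : b != 0 by rewrite expf_neq0.
have base : qrpair [:: be] [:: be] 1 1.
  split; rewrite ?coef1 ?psc1 ?deg1_1 ?mulr1 //.
move=> be0; case: k => k.
  elim: k => [|k [Q [P h]]]; first by exists 1, 1; rewrite mulr1.
  have := qrpair_up (mulf_neq0 be0 (expf_neq0 k b0)).
  rewrite -mulrA -exprSr => h2; exists (1 * Q), (lin1 (be * b ^+ k * qi) * P).
  exact: qrpair_trans h2 h.
rewrite NegzE; elim: k => [|k [Q [P h]]].
  by exists (lin1 (be / qi)), 1; rewrite exprN1; apply: qrpair_down.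
have bk : b ^ (- k.+1%:Z) != 0 by rewrite expfz_neq0.
have := qrpair_down (mulf_neq0 be0 bk).
rewrite -mulrA -[b^-1]exprN1 -expfzDr // (_ : - k.+1%:Z + -1 = - k.+2%:Z); last by lia.
by move=> h2; exists (lin1 (be * b ^ (- k.+1%:Z) / qi) * Q), (1 * P); exact: qrpair_trans h2 h.
Qed.
Lemma prz_perm A B : perm_eq A B -> prz A = prz B. Proof. exact: perm_big. Qed.
Lemma qrpair_perm A A' B Q P : perm_eq A A' -> qrpair A B Q P -> qrpair A' B Q P.
Proof. by move=> pA [h1 h2 h3 h4]; split; rewrite -?(prz_perm pA) // -(perm_big _ pA). Qed.
(** Each pole is matched with a zero of its own orbit; removing the matched pair preserves the
    counting hypothesis. *)
Lemma qrpair_ex (orb : F -> F -> bool) (A B : seq F) : size A = size B -> 0 \notin A ++ B ->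
  (forall a y, orb a y -> exists k : int, y = a * b ^ k) -> (forall a, orb a a) ->
  (forall a x y, orb x y -> orb a x = orb a y) ->
  (forall a, a != 0 -> (count (orb a) B <= count (orb a) A)%N) -> exists Q P, qrpair A B Q P.
Proof.
move=> sz n0 o1 o2 o3; elim: B A sz n0 => [|be B IH] A.
  move=> /size0nil -> _ _; exists 1, 1; split; rewrite ?coef1 ?psc1 ?deg1_1 ?mulr1 //.
move=> sz n0 cnt; have be0 : be != 0.
  by move: n0; rewrite mem_cat !negb_or => /and3P[_ + _]; rewrite eq_sym.
have /hasP[al alA oal] : has (orb be) A.
  by rewrite has_count; apply: leq_trans (cnt be be0); rewrite /= o2.
have pA : perm_eq (al :: rem al A) A by rewrite perm_sym; apply: perm_to_rem.
have [||a a0|Q [P h]] := IH (rem al A).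
- by rewrite size_rem // sz.
- apply: contra n0; rewrite !mem_cat !inE => /orP[/mem_rem ->//|->]; by rewrite !orbT.
- have := cnt a a0; rewrite -(seq.permP pA (orb a)) /= (o3 a be al oal).
  by rewrite leq_add2l.
have [k ek] := o1 _ _ oal; have [Q' [P' h']] := qrpair_orb k be0.
rewrite -ek in h'; exists (Q' * Q), (P' * P).
by apply: qrpair_perm pA _; apply: qrpair_cat h' h.
Qed.
End Pairing.

Section FitsExpand.
Variable F : closedFieldType.
Local Notation E := (int -> F^o).

Lemma shf_sht (f : E) : shf (sht f) = f.
Proof. by apply/funext => k; rewrite /sht /shf subrK. Qed.
Lemma papBs (p : {poly F}) (f g : E) : pap (@shf F) p (f - g) = pap (@shf F) p f - pap (@shf F) p g.
Proof. exact: (linBT (pap_lins p)). Qed.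
Lemma pap_shf_lin1 r (f : E) : pap (@shf F) (lin1 r) f = f - r *: shf f.
Proof.
rewrite papD papN papZ pap1; congr (_ - _ *: _).
by rewrite -['X]mulr1 (pap_mulX (lsubT _)) // pap1.
Qed.
Lemma pap_sht_shf (p : {poly F}) (g : E) : pap (@sht F F^o) p (shf g) = shf (pap (@sht F F^o) p g).
Proof.
apply/funext => k; rewrite /shf !pap_sht; apply: eq_bigr => j _.
by have -> : k + j%:Z - 1 = k - 1 + j%:Z by rewrite addrAC.
Qed.
(** As T is the inverse of z, each factor 1 - a z is z (T - a). *)
Lemma prz_pA (A : seq F) (f : E) : pap (@shf F) (prz A) f = iter (size A) (@shf F) (pap (@sht F F^o) (pA A) f).
Proof.
elim: A f => [|a A IH] f; first by rewrite /prz /pA !big_nil !pap1.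
rewrite /prz /pA !big_cons mulrC papMs IH pap_shf_lin1 [_ * pA A]mulrC papMt papXC /=.
rewrite -iterS iterSr; congr iter.
have e : f - a *: shf f = shf (sht f - a *: f) by rewrite -{1}[f]shf_sht.
by rewrite e pap_sht_shf.
Qed.
Lemma iter_shf_lin j : linon setT (iter j (@shf F)).
Proof. by move=> c u v _ _; elim: j => //= j ->. Qed.
Lemma fits_expands g (c : F) (A B : seq F) e : fits g c A B -> expands_as e (g e) (c *: prz A) (prz B).
Proof.
move=> [c0 _ sz h]; apply/expandsP; rewrite papZ !prz_pA h sz.
exact: (linZT (@iter_shf_lin (size B))).
Qed.
(** The difference of the two sides is bounded on the side given by e, so multiplication by D can be
    cancelled. *)
Lemma expands_trans (e : bool) (f : nat -> F) (N D N' D' : {poly F}) : D != 0 -> N * D' = N' * D ->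
  expands_as e f N D -> expands_as e f N' D'.
Proof.
move=> D0 ND /expandsP h; apply/expandsP.
apply/eqP; rewrite -subr_eq0; apply/eqP.
set g := _ - _.
have key0 (x y j1 : nat) (k : int) : pm e * k < - x%:Z - y%:Z -> (j1 < x)%N -> (k - j1%:Z == 0) = false.
  by case: (e) => /= h1 h2; lia.
have key1 (x y j2 : nat) (k : int) : pm e * k < - x%:Z - y%:Z -> (j2 < y)%N -> (0 <= pm e * (k - j2%:Z)) = false.
  by case: (e) => /= h1 h2; lia.
apply: (@pap_shf_inj F D g e (- (size N')%:Z - (size D')%:Z)) => // [k kM|].
  rewrite -[LHS]/(_ - _) !pap_shf !big1 ?subrr // => j _.
  by rewrite /kron0 (key0 _ _ _ _ kM (ltn_ord j)) mulr0.
  by rewrite /zext (key1 _ _ _ _ kM (ltn_ord j)) mulr0.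
have e1 : pap (@shf F) D (pap (@shf F) D' (zext e f)) = pap (@shf F) D' (pap (@shf F) D (zext e f)).
  by rewrite -!papMs mulrC.
have e2 : pap (@shf F) D (pap (@shf F) N' (@kron0 F)) = pap (@shf F) D' (pap (@shf F) N (@kron0 F)).
  by rewrite -!papMs [D' * N]mulrC ND mulrC.
by rewrite papBs e1 e2 (congr1 (pap (@shf F) D') h) subrr.
Qed.
(** Comparison of extreme coefficients: the leading ones for the expansion at T = infinity, the
    constant ones for the expansion at T = 0. *)
Lemma fits_const g (c : F) (A B : seq F) : fits g c A B ->
  g true 0%N = c /\ (\prod_(z <- B) z) * g false 0%N = c * \prod_(z <- A) z.
Proof.
move=> [c0 n0 sz h].
have sA L : size (pA L : {poly F}) = (size L).+1 by rewrite /pA size_prod_XsubC.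
have lA L : (pA L : {poly F})`_(size L) = 1.
  by have /monicP := monic_prod_XsubC L xpredT id; rewrite /lead_coef -/(pA L) sA.
have cA L : (pA L : {poly F})`_0 = (-1) ^+ size L * \prod_(z <- L) z.
  rewrite -horner_coef0 /pA; elim: L => [|z L IH]; first by rewrite !big_nil hornerC mulr1.
  by rewrite !big_cons hornerM IH !hornerE /= exprS; ring.
have keyA (N j : nat) : (j < N.+1)%N -> (- N%:Z + j%:Z == 0) = (j == N) by lia.
have keyB (N j : nat) : (j < N.+1)%N -> (0 <= pm true * (- N%:Z + j%:Z)) = (j == N).
  by rewrite /=; lia.
split.
  have := congr1 (fun f : E => f (- (size B)%:Z)) (h true); rewrite -[X in _ = X]/(_ * _) !pap_sht !sA sz.
  rewrite (bigD1 ord_max) //= big1 ?addr0 => [|j jN].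
  rewrite (bigD1 (ord_max : 'I_(size B).+1)) //= big1 ?addr0 => [|j jN].
  by rewrite /zext /kron0 keyB // eqxx addNr absz0 lA -{1}sz lA !scale1r eqxx mulr1.
  by rewrite /kron0 keyA // -val_eqE /= in jN *; rewrite (negbTE jN) scaler0.
  by rewrite /zext keyB // -val_eqE /= in jN *; rewrite (negbTE jN) scaler0.
have := congr1 (fun f : E => f 0) (h false); rewrite -[X in _ = X]/(_ * _) !pap_sht !sA sz.
rewrite big_ord_recl big1 ?addr0 => [|j _]; last first.
  have -> : zext false (g false) (0 + (fintype.lift ord0 j)%:Z) = 0; last by rewrite scaler0.
  by rewrite /zext.
rewrite big_ord_recl big1 ?addr0 => [|j _]; last first.
  by rewrite scaler0.
have cA' (L : seq F) (o : 'I_(size B).+1) : (o : nat) = 0%N -> (pA L : {poly F})`_o = (-1) ^+ size L * \prod_(z <- L) z.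
  by move=> ->; exact: cA.
rewrite !cA' // sz => e.
have s0 : (-1) ^+ size B != 0 :> F by rewrite expf_neq0 // oppr_eq0 oner_eq0.
by apply: (mulfI s0); rewrite mulrA [RHS]mulrCA -[X in _ = _ * X]mulr1.
Qed.
End FitsExpand.

Lemma sum_sub (W : nmodType) N l (b : nat -> W) : \sum_(m < N | (l <= m)%N) b (m - l)%N = \sum_(t < N - l) b t.
Proof.
elim: l N => [|l IH] [|N]; rewrite ?big_ord0 //; first by rewrite subn0; apply: eq_bigr => j; rewrite subn0.
rewrite big_mkcond big_ord_recl /= add0r -IH [RHS]big_mkcond.
exact: eq_bigr => j _; rewrite /bump.
Qed.
(** In (R5) for coproducts each product has four terms; they form four groups, each satisfying its
    own relation, and these relations are added here. *)
Lemma r5_comb (F : comNzRingType) (M : lmodType F) (b : F)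
  (a1 a2 a3 a4 m1 m2 m3 m4 n1 n2 n3 n4 d1 d2 d3 d4 : M) :
  a1 - b *: a2 = b *: a3 - a4 -> m1 - b *: m2 = b *: m3 - m4 ->
  n1 - b *: n2 = b *: n3 - n4 -> d1 - b *: d2 = b *: d3 - d4 ->
  a1 + m1 + (n4 + d1) - b *: (a2 + n3 + (m2 + d2)) =
  b *: (a3 + m3 + (n2 + d3)) - (a4 + n1 + (m4 + d4)).
Proof.
move=> /eqP + /eqP + /eqP + /eqP.
by rewrite !subr_eq => /eqP -> /eqP -> /eqP -> /eqP ->; lmod_in F.
Qed.

(** * Linearly recurrent sequences *)

Section Sequences.
Variables (F : fieldType) (M : lmodType F).

Definition shn (f : nat -> M) : nat -> M := fun s => f s.+1.
Definition nrec (p : {poly F}) (f : nat -> M) : Prop := pap shn p f = 0.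

Lemma iter_shn j f s : iter j shn f s = f (s + j)%N.
Proof. by elim: j f s => [|j IH] f s; rewrite ?addn0 // iterSr addnS. Qed.
Lemma pap_shn p f s : pap shn p f s = \sum_(j < size p) p`_j *: f (s + j)%N.
Proof.
by rewrite /pap fct_sumE; apply: eq_bigr => j _; rewrite -[LHS]/(_ *: _) iter_shn.
Qed.
Lemma papMn (p r : {poly F}) f : pap shn (p * r) f = pap shn p (pap shn r f).
Proof. exact: (papM (lsubT _)). Qed.
Lemma pap_linn (p : {poly F}) : linon setT (pap shn p).
Proof. exact: pap_lin2. Qed.
Lemma nrecMl p r f : nrec r f -> nrec (p * r) f.
Proof. by rewrite /nrec papMn => ->; rewrite (lin0T (pap_linn p)). Qed.
Lemma nrecMr p r f : nrec p f -> nrec (p * r) f.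
Proof. by rewrite mulrC; apply: nrecMl. Qed.
Lemma nrec_mod p f n s : p != 0 -> nrec p f -> f (s + n)%N = \sum_(i < size p) ('X^n %% p)`_i *: f (s + i)%N.
Proof.
move=> p0 h; transitivity (pap shn 'X^n f s).
  rewrite pap_shn size_polyXn big_ord_recr /= big1 ?add0r => [|j _].
  by rewrite coefXn eqxx scale1r.
  by rewrite coefXn ltn_eqF ?scale0r.
rewrite {1}[X in pap shn X](divp_eq 'X^n p) papD papMn [pap shn p f]h.
rewrite (lin0T (pap_linn _)) add0r.
have sz : (size (('X^n : {poly F}) %% p)%R <= size p)%N by rewrite ltnW // ltn_modp.
rewrite (papE _ _ sz) fct_sumE; apply: eq_bigr => i _.
by rewrite -[LHS]/(_ *: _) iter_shn.
Qed.
End Sequences.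

Section SeqMap.
Variables (F : fieldType) (M M' : lmodType F).
Lemma nrec_map (p : {poly F}) (g : M -> M') (f : nat -> M) : linon setT g -> nrec p f -> nrec p (fun s => g (f s)).
Proof.
move=> lg h; apply/funext => s; rewrite pap_shn.
transitivity (g (pap (@shn F M) p f s)); last by rewrite [pap _ _ _]h (lin0T lg).
rewrite pap_shn (linsT lg) //; apply: eq_bigr => j _.
by rewrite (linZT lg).
Qed.
End SeqMap.

Section Rev.
Variable F : fieldType.
Definition rpol (p : {poly F}) : {poly F} := \poly_(j < size p) p`_((size p).-1 - j).
Lemma rpol_neq0 p : p != 0 -> rpol p != 0.
Proof.
move=> p0; apply/eqP => /(congr1 (fun r : {poly F} => r`_0)); rewrite coef_poly coef0 subn0 size_poly_gt0 p0.
by move/eqP; rewrite lead_coef_eq0 (negbTE p0).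
Qed.
Lemma nrec_rev (M : lmodType F) (p : {poly F}) (f : int -> M) r e :
  pap (@sht F M) p f = 0 -> nrec (p * rpol p) (fun s => f (r + pm e * s%:Z)).
Proof.
move=> h; have hk k : \sum_(j < size p) p`_j *: f (k + j%:Z) = 0 by rewrite -pap_sht h.
case: e.
  apply: nrecMr; apply/funext => s; rewrite pap_shn -[RHS](hk (r + s%:Z)).
  by apply: eq_bigr => j _; congr (_ *: f _); rewrite /=; lia.
apply: nrecMl; apply/funext => s.
have sz : (size (rpol p) <= size p)%N := size_poly _ _.
rewrite (papE _ _ sz) fct_sumE -[RHS](hk (r - s%:Z - (size p).-1%:Z)).
rewrite [RHS](reindex_inj rev_ord_inj); apply: eq_bigr => j _.
have key (m a : nat) : (a < m)%N -> (m.-1 - a = m - a.+1)%N by lia.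
have key2 (m a b : nat) (c : int) : (a < m)%N -> c + -1 * (b + a)%N%:Z = c - b%:Z - m.-1%:Z + (m - a.+1)%N%:Z by lia.
have sj := ltn_ord j.
by rewrite -[LHS]/(_ *: _) iter_shn coef_poly ltn_ord (key _ _ sj) (key2 (size p) _ _ _ sj).
Qed.
End Rev.

(* All shifts of the product lie in the span of the products of the first
  shifts of the factors. *)
Lemma nrec_prod (F : fieldType) (V W : lmodType F) (p r : {poly F}) :
  p != 0 -> r != 0 -> exists2 c : {poly F}, c != 0 &
  forall (a : nat -> V) (b : nat -> W -> W) (g : V -> W), linon setT g ->
  (forall s, linon setT (b s)) -> nrec p a -> (forall t, nrec r (fun s => b s (g (a t)))) ->
  nrec c (fun s => b s (g (a s))).
Proof.
move=> p0 r0.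
pose A (m : 'I_(size p * size r).+1) (t : 'I_(size p) * 'I_(size r)) : F :=
  ('X^m %% p)`_t.1 * ('X^m %% r)`_t.2.
have [|c [m0 cm0] hc] := @lin_dep F _ _ A; first by rewrite card_prod !card_ord.
exists (\poly_(m < (size p * size r).+1) c (inord m)).
  apply: contraNneq cm0 => /(congr1 (fun P : {poly F} => P`_m0)).
  by rewrite coef_poly ltn_ord coef0 inord_val => ->.
move=> a b g lg lb ha hb; apply/funext => s.
rewrite (papE _ _ (size_poly _ _)) fct_sumE.
transitivity (\sum_(m < (size p * size r).+1) \sum_t (c m * A m t) *: b (s + t.2)%N (g (a (s + t.1)%N))).
  apply: eq_bigr => m _; rewrite -[LHS]/(_ *: _) iter_shn coef_poly ltn_ord inord_val.
  under [RHS]eq_bigr do rewrite -scalerA; rewrite -scaler_sumr; congr (_ *: _).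
  rewrite (nrec_mod m s p0 ha) (linsT lg) // (linsT (lb _)) //.
  rewrite -(pair_bigA _ (fun (i : 'I_(size p)) (j : 'I_(size r)) =>
  (('X^m %% p)`_i * ('X^m %% r)`_j) *: b (s + j)%N (g (a (s + i)%N)))).
  apply: eq_bigr => i _; rewrite (linZT lg) // (linZT (lb _)) //.
  rewrite (nrec_mod m s r0 (hb (s + i)%N)) scaler_sumr; apply: eq_bigr => j _.
  by rewrite scalerA.
rewrite exchange_big big1 // => t _; rewrite -scaler_suml hc scale0r //.
Qed.

Section PapComm.
Variables (F : fieldType) (E E' : lmodType F) (T : E -> E) (T' : E' -> E') (A : E -> E') (X : set E).
Hypotheses (hX : lsub X) (sT : forall v, X v -> X (T v)) (lA : linon X A)
  (cT : forall v, X v -> A (T v) = T' (A v)).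
Lemma pap_comm p x : X x -> A (pap T p x) = pap T' p (A x).
Proof.
move=> Xx; have hi j : X (iter j T x) /\ A (iter j T x) = iter j T' (A x).
  by elim: j => [//|j [h1 h2]]; rewrite cT // h2; split=> //; exact: sT.
rewrite (linon_sum hX lA) => [|j _]; last by apply: (subspZ hX); case: (hi j).
by apply: eq_bigr => j _; have [h1 h2] := hi j; rewrite (linonZ hX lA) // h2.
Qed.
End PapComm.

Section Span.
Variables (F : fieldType) (E : lmodType F).
Definition spanned (A : set E) : set E := [set f | forall Z, lsub Z -> A `<=` Z -> Z f].
Lemma spanned_sub A : lsub (spanned A).
Proof.
split=> [Z hZ _|c u v hu hv Z hZ AZ]; first exact: subsp0 hZ.
by apply: hZ.2; [apply: hu|apply: hv].
Qed.
Lemma sub_spanned A : A `<=` spanned A.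
Proof. by move=> f Af Z _ AZ; apply: AZ. Qed.
Lemma spanned_min A Z : lsub Z -> A `<=` Z -> spanned A `<=` Z.
Proof. by move=> hZ AZ f; apply. Qed.
Lemma spanned_map (X : set E) (T : E -> E) A Z : lsub X -> linon X T -> lsub Z -> A `<=` X ->
  (forall f, A f -> Z (T f)) -> forall f, spanned A f -> Z (T f).
Proof.
move=> hX lT hZ AX h f sf.
have [] // : (X `&` T @^-1` Z) f.
apply: sf; last by move=> g Ag; split; [apply: AX|apply: h].
split=> [|c u v [Xu Zu] [Xv Zv]]; first by split; [apply: subsp0 hX|rewrite /= (linon0 hX lT); apply: subsp0 hZ].
by split; [apply: hX.2|rewrite /= lT //; apply: hZ.2].
Qed.
End Span.

(** There are finitely many lists of bounded length over a finite alphabet. *)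
Lemma list_bound (A : finType) (bd : seq A -> nat) L : exists b, forall l, (size l <= L)%N -> (bd l <= b)%N.
Proof.
elim: L bd => [|L IH] bd; first by exists (bd [::]) => -[].
have [f hf] := choice (fun a => IH (fun l => bd (a :: l))).
exists (maxn (bd [::]) (\max_a f a)) => -[_|a l sl]; first exact: leq_maxl.
by rewrite leq_max; apply/orP; right; apply: leq_trans (hf a l sl) _; apply: leq_bigmax.
Qed.

(** * Uniqueness of flag multiplicities, images of flags, linear functionals *)

Section RdimUniq.
Variables (F : closedFieldType) (E : lmodType F).
Lemma rdim_le (Z X : set E) d m : lsub Z -> rdim Z X d -> fd Z X m -> (d <= m)%N.
Proof.
move=> sZ r; elim: r m => // Y X' d' e sX rY IH Xe nYe YX sp [|m] hm.
  by case: nYe; have ZY : Z `<=` Y; [elim: rY => // ? ? ? ? _ _ ZY _ _ YX' _; exact: (subset_trans ZY)|apply: ZY; apply: (fd0 sZ hm)].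
have ZY : Z `<=` Y by elim: rY => // ? ? ? ? _ _ ZY _ _ YX' _; exact: (subset_trans ZY).
have sY := rdim_lsub sZ rY.
rewrite ltnS; apply: IH; apply: (fd_drop sZ hm Xe YX) => //.
- move=> a y a0 Yy; left => /ZY h; apply: nYe.
  rewrite -[e](scalerK a0); apply: (subspZ sY); rewrite -(addrK y (a *: e)).
  exact: (subspB sY).
- by move=> a a0 /ZY h; apply: nYe; rewrite -[e](scalerK a0); apply: (subspZ sY).
Qed.
Lemma rdim_fd (Z X : set E) d : lsub Z -> rdim Z X d -> fd Z X d.
Proof.
move=> sZ r; suff [s hs] : exists s : 'I_d -> E, forall x, X x -> exists c : 'I_d -> F, Z (x - \sum_i c i *: s i).
  exact: fd_span sZ hs.
elim: r => [|Y X' d' e sX rY [s hs] Xe nYe YX sp].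
  by exists (fun=> 0) => x Zx; exists (fun=> 0); rewrite big_ord0 subr0.
exists (fcons e s) => x /sp[a /hs[c hc]].
exists (fcons a c).
rewrite sum_ord_unlift unlift_none; under eq_bigr do rewrite liftK.
by rewrite opprD addrA.
Qed.
Lemma rdim_uniq (Z X : set E) d d' : lsub Z -> rdim Z X d -> rdim Z X d' -> d = d'.
Proof.
by move=> sZ h h'; apply/eqP; rewrite eqn_leq; apply/andP; split;
  [apply: rdim_le sZ h (rdim_fd sZ h')|apply: rdim_le sZ h' (rdim_fd sZ h)].
Qed.

Variables (I : Type) (Phi : I -> E -> E).
(** Both counts are the dimension of the same generalized eigenspace modulo [Z], so the multiset of
    characters does not depend on the flag. *)
Lemma flag_uniq g (Z X : set E) cs cs' : comfam Phi X -> stab Phi Z ->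
  flag Phi Z X cs -> flag Phi Z X cs' -> chcount g cs = chcount g cs'.
Proof.
move=> cX sZ f f'.
exact: rdim_uniq sZ.1 (geneig_rdim g cX sZ f (@subset_refl _ _)) (geneig_rdim g cX sZ f' (@subset_refl _ _)).
Qed.
Lemma flag_fd_ex (Z X : set E) cs : lsub Z -> flag Phi Z X cs -> exists m, fd Z X m.
Proof. by move=> sZ /(flag_fd sZ)[m [s hs]]; exists m; exact: fd_span sZ hs. Qed.
End RdimUniq.

Lemma flag_push (F : closedFieldType) (E E' : lmodType F) (I : Type)
  (Phi : I -> E -> E) (Phi' : I -> E' -> E') (p : E -> E') (X Z : set E) cs :
  stab Phi Z -> linon X p -> (forall i x, X x -> p (Phi i x) = Phi' i (p x)) ->
  (forall x, X x -> p x = 0 -> Z x) ->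
  flag Phi Z X cs -> flag Phi' (p @` Z) (p @` X) cs.
Proof.
move=> sZ lp cp kp fl; elim: fl lp cp kp => [|Y X1 c cs' e fl IH sX X1e nYe YX sp hc] lp cp kp.
  exact: flag0.
have sY := flag_stab sZ fl; have ZY := flag_sub fl; have ZX := subset_trans ZY YX.
have {}IH := IH (linon_sub YX lp) (fun i x Yx => cp i x (YX x Yx)) (fun x Yx => kp x (YX x Yx)).
apply: (flagS IH).
- split; first split.
  + by exists 0; [exact: subsp0 sX.1|rewrite (linon0 sX.1 lp)].
  + move=> a _ _ [u Xu <-] [v Xv <-]; exists (a *: u + v); first exact: sX.1.2.
  by rewrite lp.
  + by move=> i _ [v Xv <-]; exists (Phi i v); [exact: sX.2|rewrite cp].
- by exists e.
- move=> [y Yy ey]; apply: nYe.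
  rewrite -[e](subrK y); apply: (subspD sY.1) => //; apply: ZY; apply: kp.
  exact: (subspB sX.1 X1e (YX _ Yy)).
  by rewrite (linonB sX.1 lp) ?ey ?subrr //; apply: YX.
- by move=> _ [y Yy <-]; exists y => //; apply: YX.
- move=> _ [x Xx <-]; have [a Ya] := sp x Xx; exists a; exists (x - a *: e) => //.
  have Xae : X1 (a *: e) by exact: (subspZ sX.1).
  by rewrite (linonB sX.1 lp) // (linonZ sX.1 lp).
- move=> i; exists (Phi i e - c i *: e); first exact: hc.
  have Xce : X1 (c i *: e) by exact: (subspZ sX.1).
  have XPe : X1 (Phi i e) by exact: sX.2.
  by rewrite (linonB sX.1 lp) // (linonZ sX.1 lp) // cp.
Qed.
(** A maximal subspace containing [S] but not [v0], obtained from Zorn's lemma, has codimension one;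
    the functional is the coordinate along [v0]. *)
Lemma functional_ex (F : fieldType) (V : lmodType F) (S : set V) (v0 : V) :
  lsub S -> ~ S v0 -> exists la : V -> F, [/\ forall c u v, la (c *: u + v) = c * la u + la v,
  forall x, S x -> la x = 0 & la v0 = 1].
Proof.
move=> sS nS.
pose Q (U : set V) := [/\ lsub U, S `<=` U & ~ U v0].
pose P (U : set V) := U = set0 \/ Q U.
have [|U [PU mU]] := @Zorn_bigcup V P.
  move=> C CP tot; have [[U0 CU0 nU0]|no] := pselect (exists2 U, C U & U !=set0); last first.
  left; rewrite -subset0 => x [U CU Ux]; apply: no; exists U => //; by exists x.
  have CQ U x : C U -> U x -> Q U by move=> CU Ux; case: (CP U CU) => // e; rewrite e in Ux.
  have [x0 Ux0] := nU0; have [sU0 SU0 _] := CQ _ _ CU0 Ux0.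
  right; split.
  - split; first by exists U0 => //; exact: subsp0 sU0.
  move=> c u v [U1 C1 U1u] [U2 C2 U2v].
  have [s1 _ _] := CQ _ _ C1 U1u; have [s2 _ _] := CQ _ _ C2 U2v.
  case: (tot _ _ C1 C2) => sub; [exists U2|exists U1] => //.
  by apply: s2.2 => //; apply: sub.
  by apply: s1.2 => //; apply: sub.
  - by move=> x Sx; exists U0 => //; apply: SU0.
  - by move=> [U1 C1 U1v]; have [_ _] := CQ _ _ C1 U1v; apply.
have [sU SU nU] : Q U.
  case: PU => // e; exfalso; apply: (mU S); last by right; split.
  by rewrite e; split=> // /(_ 0 (subsp0 sS)).
have dec x : exists c, U (x - c *: v0).
  apply: contrapT => no; pose U' := [set y | exists a : F, U (y - a *: x)].
  apply: (mU U').
  split=> [y Uy|h]; first by exists 0; rewrite scale0r subr0.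
  apply: no; exists 0; rewrite scale0r subr0; apply: h.
  by exists 1; rewrite scale1r subrr; exact: subsp0 sU.
  right; split.
  - split; first by exists 0; rewrite scale0r subr0; exact: subsp0 sU.
  move=> c u v [a Ua] [b Ub]; exists (c * a + b).
  rewrite (_ : _ - _ = c *: (u - a *: x) + (v - b *: x)); first exact: sU.2.
  lmod_in F.
  - by move=> y Sy; exists 0; rewrite scale0r subr0; apply: SU.
  - move=> [a Ua]; have [a0|a0] := eqVneq a 0.
  by apply: nU; move: Ua; rewrite a0 scale0r subr0.
  apply: no; exists a^-1; rewrite (_ : _ - _ = (- a^-1) *: (v0 - a *: x)); first exact: (subspZ sU).
  by rewrite scalerBr !scaleNr scalerA mulVf // scale1r opprK addrC.
have uniq_c c c' x : U (x - c *: v0) -> U (x - c' *: v0) -> c = c'.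
  move=> h1 h2; apply/eqP; rewrite -subr_eq0; apply/negPn/negP => n0; apply: nU.
  rewrite -[v0](scalerK n0); apply: (subspZ sU).
  rewrite (_ : _ *: v0 = (x - c' *: v0) - (x - c *: v0)); first exact: (subspB sU).
  lmod_in F.
have [la hla] := choice dec; exists la; split.
- move=> c u v; apply: uniq_c (hla _) _.
  rewrite (_ : _ - _ = c *: (u - la u *: v0) + (v - la v *: v0)); first exact: sU.2.
  lmod_in F.
- by move=> x Sx; apply: uniq_c (hla _) _; rewrite scale0r subr0; apply: SU.
- by apply: uniq_c (hla _) _; rewrite scale1r subrr; exact: subsp0 sU.
Qed.

(** * Products of expansions *)

Section ExpandsMul.
Variable F : fieldType.
Local Notation E := (int -> F^o).

Definition cauchy_prod (f g : nat -> F) (m : nat) : F := \sum_(s < m.+1) f s * g (m - s)%N.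

(** A product of series truncated at M; once M exceeds the exponents that contribute, this finite
    sum is the true coefficient. *)
Definition pconv e (f : nat -> F) (M : nat) (h : E) (k : int) : F :=
  \sum_(s < M) f s * h (k - pm e * s%:Z).

Lemma zext_cauchy_prod e f g M k : pm e * k < M%:Z ->
  zext e (cauchy_prod f g) k = pconv e f M (zext e g) k.
Proof.
have pp : pm e * pm e = 1 by case: e.
move=> kM; rewrite /pconv /zext; case: ifP => k0; last first.
  rewrite big1 // => s _; rewrite ifF ?mulr0 //.
  by apply/negbTE; move: k0 => /negbT; lia.
have km : k = pm e * `|k|%N.
  have : pm e * k = `|k|%N by move: k0; case: (e); rewrite /pm; lia.
  by move=> <-; rewrite mulrA pp mul1r.
have lM : (`|k|%N < M)%N by move: kM; rewrite {1}km mulrA pp; lia.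
have sub (s : nat) : k - pm e * s%:Z = pm e * (`|k|%N%:Z - s%:Z).
  by rewrite mulrBr -km.
rewrite /cauchy_prod (big_ord_widen M (fun s => f s * g (`|k| - s)%N)) // big_mkcond.
apply: eq_bigr => s _; rewrite sub mulrA pp.
case: ifP => sk; last by rewrite ifF ?mulr0 //; lia.
by rewrite ifT; [congr (_ * g _); case: (e); rewrite /pm; lia|lia].
Qed.
Lemma zext_pconv e f M k : pm e * k < M%:Z -> zext e f k = pconv e f M (@kron0 F) k.
Proof.
move=> kM; have -> : f = cauchy_prod f (fun m => (m == 0%N)%:R).
  apply/funext => m; rewrite /cauchy_prod big_ord_recr /= subnn mulr1 big1 ?add0r // => s _.
  by rewrite subn_eq0 leqNgt ltn_ord mulr0.
rewrite (zext_cauchy_prod _ _ kM); apply: eq_bigr => s _; congr (_ * _); last first.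
  rewrite /zext /kron0; case: ifP => h.
  by rewrite absz_eq0.
  by rewrite (_ : _ == 0 = false) //; apply/negbTE/eqP => e0; move: h; rewrite e0 mulr0.
rewrite /cauchy_prod big_ord_recr /= subnn mulr1 big1 ?add0r // => t _.
by rewrite subn_eq0 leqNgt ltn_ord mulr0.
Qed.
Lemma pconv_pap e f M (p : {poly F}) (h : E) k :
  pconv e f M (pap (@shf F) p h) k = \sum_(j < size p) p`_j * pconv e f M h (k - j%:Z).
Proof.
rewrite /pconv; under eq_bigr => s _ do rewrite pap_shf mulr_sumr.
rewrite exchange_big; apply: eq_bigr => j _; rewrite mulr_sumr; apply: eq_bigr => s _.
by rewrite mulrCA; congr (_ * (_ * h _)); ring.
Qed.
Lemma expands_mul e f g (N D N' D' : {poly F}) :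
  expands_as e f N D -> expands_as e g N' D' ->
  expands_as e (cauchy_prod f g) (N * N') (D * D').
Proof.
move=> /expandsP h /expandsP h'; apply/expandsP.
rewrite papMs [N * N']mulrC papMs -h -[RHS]papMs [N' * D]mulrC papMs; congr (pap _ _ _).
apply/funext => k; rewrite !pap_shf.
pose M := (`|k| + size D' + size N').+1.
have bd (j B : nat) : (j < B)%N -> (B <= size D' + size N')%N -> pm e * (k - j%:Z) < M%:Z.
  by rewrite /M; case: (e); rewrite /pm; lia.
transitivity (\sum_(j < size D') D'`_j * pconv e f M (zext e g) (k - j%:Z)).
  by apply: eq_bigr => j _; rewrite (@zext_cauchy_prod e f g M) // (bd _ _ (ltn_ord j)) ?leq_addr.
rewrite -pconv_pap h' pconv_pap; apply: eq_bigr => j _.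
by rewrite -zext_pconv // (bd _ _ (ltn_ord j)) ?leq_addl.
Qed.
End ExpandsMul.

Lemma sum_count_mem (T : eqType) (f : T -> int) (s t : seq T) : uniq t -> {subset s <= t} ->
  \sum_(a <- t) (count_mem a s)%:Z * f a = \sum_(a <- s) f a.
Proof.
move=> ut; elim: s => [|b s IH] st.
  by rewrite big_nil big1 // => a _; rewrite mul0r.
rewrite big_cons -IH; last by move=> a hs; apply: st; rewrite inE hs orbT.
under eq_bigr => a _ do rewrite PoszD mulrDl.
rewrite big_split; congr (_ + _).
rewrite (bigD1_seq b) ?st ?mem_head //= eqxx mul1r big1 ?addr0 // => a /negbTE e.
by rewrite eq_sym e mul0r.
Qed.

(** * Operators satisfying the defining relations *)

Section Representations.
Variables (F : numClosedFieldType) (q : F) (qp : rat -> F) (hq : qdata q qp).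
Variables (n : nat) (D : cartan_datum n) (H : realization D).
Local Notation hdual := 'Hom(hh H, rat^o).
Local Notation kx := (bool * 'I_n * nat)%type.

Section Reps.

Definition qd (i : 'I_n) : F := q ^+ symz D i.

(** phi gets labels of its own and [LH i 0] is allowed, acting by 0; the relations can then be
    written on these labels without the exponential. *)
Inductive lab :=
| LX of bool & 'I_n & int
| LK of hh H
| LH of 'I_n & int
| LP of bool & 'I_n & nat.

Definition zp (V : lmodType F) (op : lab -> V -> V) e i (k : int) (v : V) : V :=
  if 0 <= pm e * k then op (LP e i `|k|%N) v else 0.

(* The relations (R1)-(R5) hold on X; the operators [LP e i m], which stand for
  phi, are characterized by the logarithmic derivative of their series. *)
Record isrep (V : lmodType F) (op : lab -> V -> V) (X : set V) : Prop := IsRep {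
  rp_sub : lsub X;
  rp_st : forall g v, X v -> X (op g v);
  rp_lin : forall g, linon X (op g);
  rp_H0 : forall i v, X v -> op (LH i 0) v = 0;
  rp_KK : forall a b v, X v -> op (LK a) (op (LK b) v) = op (LK (a + b)) v;
  rp_K0 : forall v, X v -> op (LK 0) v = v;
  rp_KH : forall a j m v, X v -> m != 0 ->
  op (LK a) (op (LH j m) v) = op (LH j m) (op (LK a) v);
  rp_HH : forall i m j m' v, X v -> m != 0 -> m' != 0 ->
  op (LH i m) (op (LH j m') v) = op (LH j m') (op (LH i m) v);
  rp_KX : forall a e j r v, X v -> op (LK a) (op (LX e j r) v) =
  qp ((pm e)%:~R * sroot H j a) *: op (LX e j r) (op (LK a) v);
  rp_HX : forall i m e j r v, X v -> m != 0 ->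
  op (LH i m) (op (LX e j r) v) - op (LX e j r) (op (LH i m) v) =
  ((pm e)%:~R / m%:~R * qnum q (m * bmat D i j)) *: op (LX e j (m + r)) v;
  rp_XX : forall i j r r' v, X v ->
  op (LX true i r) (op (LX false j r') v) -
  op (LX false j r') (op (LX true i r) v) =
  if i == j then (qd i - (qd i)^-1)^-1 *:
  (zp op true i (r + r') v - zp op false i (r + r') v) else 0;
  rp_R5 : forall e i j r r' v, X v ->
  op (LX e i (r + 1)) (op (LX e j r') v)
  - q ^ (pm e * bmat D i j) *: op (LX e j r') (op (LX e i (r + 1)) v) =
  q ^ (pm e * bmat D i j) *: op (LX e i r) (op (LX e j (r' + 1)) v)
  - op (LX e j (r' + 1)) (op (LX e i r) v);
  rp_P0 : forall e i v, X v -> op (LP e i 0) v =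
  op (LK ((pm e * (symz D i)%:Z)%:~R *: scoroot H i)) v;
  rp_PS : forall e i m v, X v -> m%:R *: op (LP e i m) v =
  \sum_(j < m) (j.+1%:R * ((pm e)%:~R * (q - q^-1))) *:
  op (LH i (pm e * j.+1%:Z)) (op (LP e i (m - j.+1)%N) v)
}.

Definition xfold (V : lmodType F) (op : lab -> V -> V) e i s (r : 'I_s -> int)
  (p : 'S_s) (P : pred 'I_s) (v : V) : V :=
  foldr (fun u => op (LX e i (r (p u)))) v [seq u <- index_enum 'I_s | P u].

Definition serre (V : lmodType F) (op : lab -> V -> V) (e : bool) i j s
  (r : 'I_s -> int) (r' : int) (v : V) : V :=
  \sum_(p : 'S_s) \sum_(t < s.+1)
  ((-1) ^+ t * qbinom (qd i) s t) *:
  xfold op e i r p (fun u => u < t)%N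
  (op (LX e j r') (xfold op e i r p (fun u => t <= u)%N v)).

(** Kept apart from [isrep], since it is deduced from integrability in [oint_serre]. *)
Definition serre_rel (V : lmodType F) (op : lab -> V -> V) : Prop :=
  forall e i j s (r : 'I_s -> int) r' v, i != j -> s%:Z = 1 - D i j ->
  serre op e i j r r' v = 0.

Section Gen.
Variables (V : lmodType F) (g : qgen H -> V -> V).

Definition hop (i : 'I_n) (m : int) (v : V) : V :=
  oapp (fun m' => g (GenH H i m') v) 0 (insub m).

Definition hser e i (m' : nat) (v : V) : V :=
  ((pm e)%:~R * (q - q^-1)) *: hop i (pm e * m'%:Z) v.

Definition gop (l : lab) : V -> V :=
  match l with
  | LX e i r => g (GenX H e i r)
  | LK a => g (GenK a)
  | LH i m => hop i m
  | LP e i m => fun v =>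
  g (GenK ((pm e * (symz D i)%:Z)%:~R *: scoroot H i)) (oexp (hser e i) m v)
  end.

Hypothesis lg : forall x, linfun1 (g x).

Lemma charC m : m.+1%:R != 0 :> F.
Proof. by rewrite pnatr_eq0. Qed.
Lemma hop0 i v : hop i 0 v = 0.
Proof. by rewrite /hop insubF. Qed.
Lemma hop_lin i m : linfun1 (hop i m).
Proof.
by move=> c u v; rewrite /hop; case: insubP => [m' _ _|_]; [exact: lg|rewrite scaler0 addr0].
Qed.
Lemma hser_lin e i m : linfun1 (hser e i m).
Proof. by move=> c u v; rewrite /hser hop_lin; lmod_in F. Qed.
Lemma hser0 e i v : hser e i 0 v = 0.
Proof. by rewrite /hser mulr0 hop0 scaler0. Qed.
Lemma opow_lin (f : nat -> V -> V) k m : (forall j, linfun1 (f j)) -> linfun1 (opow f k m).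
Proof.
move=> lf c; elim: k m => [|k IH] m u v; first by rewrite /=; lmod_in F.
rewrite !opowS scaler_sumr -big_split; apply: eq_bigr => j _.
by rewrite IH lf.
Qed.
Lemma gop_lin l : linon setT (gop l).
Proof.
move=> c u v _ _; case: l => [e i r|a|i m|e i m]; [exact: lg|exact: lg|exact: hop_lin|].
rewrite -lg; congr (g _ _); rewrite scaler_sumr -big_split /=.
apply: eq_bigr => k _; rewrite opow_lin; first by lmod_in F.
by move=> j; apply: hser_lin.
Qed.

Hypothesis HH : forall i j m m' v, m != 0 -> m' != 0 -> hop i m (hop j m' v) = hop j m' (hop i m v).

Lemma hser_comm e i j l v : hser e i j (hser e i l v) = hser e i l (hser e i j v).
Proof.
have hZ m c w : hop i m (c *: w) = c *: hop i m w.
  exact: (linonZ (lsubT V) (gop_lin (LH i m))).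
have h0 m : hop i m 0 = 0 by exact: (linon0 (lsubT V) (gop_lin (LH i m))).
rewrite /hser !hZ.
have [->|j0] := eqVneq (pm e * j%:Z) 0; first by rewrite !hop0 h0.
have [->|l0] := eqVneq (pm e * l%:Z) 0; first by rewrite !hop0 h0.
by rewrite HH.
Qed.

Hypothesis KH : forall a j m v, m != 0 -> g (GenK a) (hop j m v) = hop j m (g (GenK a) v).

Lemma gop_PS e i m v : m%:R *: gop (LP e i m) v =
  \sum_(j < m) (j.+1%:R * ((pm e)%:~R * (q - q^-1))) *:
  gop (LH i (pm e * j.+1%:Z)) (gop (LP e i (m - j.+1)%N) v).
Proof.
have gZ a c w : g (GenK a) (c *: w) = c *: g (GenK a) w.
  exact: (linonZ (lsubT V) (gop_lin (LK a))).
rewrite -gZ (oexp_rec charC (hser_lin e i) (hser0 e i) (hser_comm e i)).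
rewrite (linon_sum (f := g (GenK _)) (lsubT V) (gop_lin (LK _))) //.
apply: eq_bigr => j _; rewrite gZ gZ scalerA; congr (_ *: _).
by apply: KH; case: (e).
Qed.
Lemma gop_P0 e i v :
  gop (LP e i 0) v = gop (LK ((pm e * (symz D i)%:Z)%:~R *: scoroot H i)) v.
Proof. by rewrite /= oexp0. Qed.
End Gen.

Section GenOp.
Variables (V : lmodType F) (op : lab -> V -> V).
Definition genop (x : qgen H) : V -> V :=
  match x with
  | GenX e i r => op (LX e i r)
  | GenK a => op (LK a)
  | GenH i m => op (LH i (val m))
  end.
Hypothesis hr : isrep op setT.

Lemma hop_genop i m v : hop genop i m v = op (LH i m) v.
Proof.
have [->|m0] := eqVneq m 0; first by rewrite (rp_H0 hr) // hop0.
by rewrite /hop insubT.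
Qed.
Lemma genop_lin x : linfun1 (genop x).
Proof. by move=> c u v; case: x => [e i r|a|i m]; apply: (rp_lin hr). Qed.
(** Once the factor k is stripped, the given operators for phi solve the recursion of the
    exponential, which has a unique solution by [oexp_uniq]. *)
Lemma gop_genop : gop genop = op.
Proof.
have lT g : linon setT (op g) := rp_lin hr g.
apply/funext => l; apply/funext => v; case: l => [e i r|a|i m|e i m] //=.
  exact: hop_genop.
rewrite -[RHS](rp_K0 hr) //.
set a := _ *: scoroot H i; rewrite -(subrr a) -(rp_KK hr) //; congr (op _ _).
pose P m v := op (LK (- a)) (op (LP e i m) v).
apply/esym; apply: (@oexp_uniq _ _ (hser genop e i) (@charC) _ _ _ P).
- exact: (hser_lin genop_lin).
- exact: hser0.
- move=> j l w; apply: (hser_comm genop_lin) => i1 j1 m1 m2 w1 m10 m20.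
  by rewrite !hop_genop (rp_HH hr).
- by rewrite /P (rp_P0 hr) // (rp_KK hr) // addNr (rp_K0 hr).
- move=> k; rewrite /P -(linonZ (lsubT V) (lT _)) // (rp_PS hr) //.
  rewrite (linon_sum (lsubT V) (lT _)) //; apply: eq_bigr => j _.
  rewrite (linonZ (lsubT V) (lT _)) // scalerA hop_genop.
  by rewrite (rp_KH hr); case: (e).
Qed.
End GenOp.
End Reps.

Section QData.

Lemma qp_neq0 a : qp a != 0.
Proof.
apply/eqP => e; have := qd_D hq a (- a).
by rewrite subrr (qd_0 hq) e mul0r => /eqP; rewrite oner_eq0.
Qed.
Lemma qpN a : qp (- a) = (qp a)^-1.
Proof.
apply: (mulfI (qp_neq0 a)); rewrite -(qd_D hq) subrr (qd_0 hq) divff //.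
exact: qp_neq0.
Qed.
Lemma qp_natM (m : nat) a : qp (m%:R * a) = qp a ^+ m.
Proof.
elim: m => [|m IH]; first by rewrite mul0r (qd_0 hq).
by rewrite mulrS mulrDl mul1r (qd_D hq) IH exprS.
Qed.
Lemma qp_intM (m : int) a : qp (m%:~R * a) = qp a ^ m.
Proof.
case: m => m; first exact: qp_natM.
by rewrite mulNr qpN qp_natM.
Qed.
Lemma qp_int (m : int) : qp m%:~R = q ^ m.
Proof. by rewrite -[m%:~R]mulr1 qp_intM (qd_1 hq). Qed.
Lemma qp_nat (m : nat) : qp m%:R = q ^+ m.
Proof. by rewrite -[m%:R]mulr1 qp_natM (qd_1 hq). Qed.
Lemma qexpz_eq1 (m : int) : q ^ m = 1 -> m = 0.
Proof.
case: m => [[//|m]|m] /eqP.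
  by rewrite -exprnP => h; have := qd_root hq (ltn0Sn m); rewrite (eqP h) eqxx.
rewrite invr_eq1 => h.
by have := qd_root hq (ltn0Sn m); rewrite (eqP h) eqxx.
Qed.
(** Raising to the denominator of a reduces to an integral power of q, and q is not a root of
    unity. *)
Lemma qp_eq1 a : qp a = 1 -> a = 0.
Proof.
move=> h; have e : (denq a)%:~R * a = (numq a)%:~R by rewrite mulrC -numqE.
have := qp_intM (denq a) a; rewrite e qp_int h exp1rz => /qexpz_eq1 na.
by apply/eqP; rewrite -numq_eq0 na.
Qed.
Lemma qp_inj : injective qp.
Proof.
move=> a b e; apply/eqP; rewrite -subr_eq0; apply/eqP/qp_eq1.
by rewrite (qd_D hq) qpN e divff // qp_neq0.
Qed.
Lemma qexpz_neq (m : int) : m != 0 -> q ^ m - q ^ (- m) != 0.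
Proof.
move=> m0; rewrite subr_eq0 -!qp_int; apply/eqP => /qp_inj /intr_inj; lia.
Qed.
Lemma qnum_neq0 (m : int) : m != 0 -> qnum q m != 0.
Proof.
move=> m0; rewrite mulf_neq0 ?qexpz_neq // invr_neq0 //.
by have := @qexpz_neq 1 isT; rewrite expr1z.
Qed.
End QData.

Section PhiX.
Variables (V : lmodType F) (op : lab -> V -> V) (X : set V)
  (hr : isrep op X).
Local Notation x e i r := (op (LX e i r)).
Local Notation ph e i m := (op (LP e i m)).

Definition gb (e' e : bool) i j : F := q ^ (pm e' * pm e * bmat D i j).

Lemma gb_neq0 e' e i j : gb e' e i j != 0.
Proof. by rewrite expfz_neq0 // (qd_neq0 hq). Qed.
Let XX g v : X v -> X (op g v) := @rp_st _ _ _ hr g v.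
Let lZ g c v : X v -> op g (c *: v) = c *: op g v.
Proof. by move=> Xv; apply: (linonZ (rp_sub hr) (rp_lin hr g)). Qed.
Let lS g (J : Type) (r : seq J) (h : J -> V) : (forall j, X (h j)) ->
  op g (\sum_(l <- r) h l) = \sum_(l <- r) op g (h l).
Proof. by move=> Xh; apply: (linon_sum (rp_sub hr) (rp_lin hr g)). Qed.
Let XZ c v : X v -> X (c *: v) := @subspZ _ _ _ (rp_sub hr) c v.

Let l0 g : op g 0 = 0. Proof. exact: (linon0 (rp_sub hr) (rp_lin hr g)). Qed.
Lemma pm_neq0 e : pm e != 0. Proof. by case: e. Qed.
Lemma ph0_x e' e i j r v : X v ->
  ph e' i 0 (x e j r v) = gb e' e i j *: x e j r (ph e' i 0 v).
Proof.
move=> Xv; rewrite (rp_P0 hr e' i (XX _ Xv)) (rp_P0 hr e' i Xv) (rp_KX hr) //.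
congr (_ *: _).
rewrite /gb -qp_int; congr qp.
have -> : sroot H j ((pm e' * symz D i)%:~R *: scoroot H i) = (pm e' * symz D i)%:~R * (D i j)%:~R.
  by rewrite linearZ /= sroot_scoroot.
rewrite -!intrM /bmat; congr _%:~R; ring.
Qed.
(** Coefficients of the exchange relation between the series phi and x, whose factor is (b - y) / (1
    - b y) with b = [gb] and y the ratio of the variables. Both sides satisfy the recursion coming
    from the logarithmic derivative of phi. *)
Lemma ph_x e' e i j s r v : X v ->
  ph e' i s (x e j r v) =
  \sum_(t < s.+1) gser (gb e' e i j) t *: x e j (r + pm e' * t%:Z) (ph e' i (s - t)%N v).
Proof.
move=> Xv; set b := gb e' e i j.
pose kp := (pm e')%:~R * (q - q^-1).
elim/ltn_ind: s => -[|s] IH.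
  by rewrite big_ord1 mulr0 addr0 ph0_x.
apply: (scalerI (charC s)); rewrite (rp_PS hr e' i s.+1 (XX (LX e j r) Xv)).
pose B (j' t : nat) := x e j (r + pm e' * t%:Z) (op (LH i (pm e' * j'.+1%:Z)) (ph e' i (s - j' - t)%N v)).
pose B' (k : nat) := x e j (r + pm e' * k.+1%:Z) (ph e' i (s - k)%N v).
(* One side of the recursion: by (R3), moving h past x leaves a shifted x with scalar proportional
   to b^(l+1) - b^(-l-1). *)
have L : \sum_(l < s.+1) (l.+1%:R * kp) *: op (LH i (pm e' * l.+1%:Z)) (ph e' i (s.+1 - l.+1)%N (x e j r v))
  = \sum_(l < s.+1) \sum_(t < (s - l).+1) ((l.+1%:R * kp * gser b t) *: B l t +
  ((b ^+ l.+1 - b ^- l.+1) * gser b t) *: B' (l + t)%N).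
  apply: eq_bigr => l _; rewrite subSS IH; last by rewrite ltnS leq_subr.
  rewrite lS ?scaler_sumr => [|t]; last by apply/XZ/XX/XX.
  apply: eq_bigr => t _.
  have m0 : pm e' * l.+1%:Z != 0 by rewrite mulf_neq0 // pm_neq0.
  rewrite lZ; last by apply/XX/XX.
  set w := ph _ _ _ v; have Xw : X w by apply: XX.
  have := rp_HX hr i e j (r + pm e' * t%:Z) Xw m0.
  move/eqP; rewrite subr_eq => /eqP ->; rewrite scalerDr scalerDr addrC.
  congr (_ + _); first by rewrite !scalerA.
  rewrite !scalerA /B'.
  have -> : pm e' * l.+1%:Z + (r + pm e' * t%:Z) = r + pm e' * (l + t).+1%:Z by lia.
  rewrite subnDA; congr (_ *: _).
  rewrite /qnum /kp.
  have nz : q - q^-1 != 0.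
  by have := @qexpz_neq 1 isT; rewrite expr1z.
  have pe : (pm e')%:~R != 0 :> F by rewrite intr_eq0 pm_neq0.
  have bE : (pm e)%:~R / (pm e' * l.+1%:Z)%:~R *
  (q ^ (pm e' * l.+1%:Z * bmat D i j) - q ^ (- (pm e' * l.+1%:Z * bmat D i j))) =
  (b ^+ l.+1 - b ^- l.+1) / ((pm e')%:~R * l.+1%:R).
  have bl : b ^+ l.+1 = q ^ (pm e * (pm e' * bmat D i j * l.+1%:Z)).
  by rewrite exprnP exprz_exp; congr (_ ^ _); ring.
  rewrite bl invr_expz intrM.
  have -> : pm e' * l.+1%:Z * bmat D i j = pm e' * bmat D i j * l.+1%:Z by ring.
  case: (e) => /=.
  by rewrite !mul1r mulrC.
  by rewrite !mulN1r opprK mulNr -mulrN opprB mulrC.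
  transitivity (l.+1%:R * (pm e')%:~R * gser b t *
  ((pm e)%:~R / (pm e' * l.+1%:Z)%:~R *
  (q ^ (pm e' * l.+1%:Z * bmat D i j) - q ^ (- (pm e' * l.+1%:Z * bmat D i j))))).
  have dm0 : (pm e' * l.+1%:Z)%:~R != 0 :> F by rewrite intr_eq0.
  move: nz dm0; set d := q - q^-1; set dm := (_ * _)%:~R; set A := q ^ _ - _ => d0 dm0.
  have dE : d * (A / d) = A by rewrite mulrCA divff // mulr1.
  by rewrite -[in RHS]dE; move: (A / d) => A'; ring.
  rewrite bE; have d0 : (pm e')%:~R * l.+1%:R != 0 :> F by rewrite mulf_neq0.
  move: (b ^+ l.+1 - b ^- l.+1) => A.
  have dE : (pm e')%:~R * l.+1%:R * (A / ((pm e')%:~R * l.+1%:R)) = A.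
  by rewrite mulrCA divff // mulr1.
  by rewrite -[in RHS]dE; move: (A / _) => A'; ring.
rewrite L.
under eq_bigr => l _ do rewrite big_split.
rewrite big_split.
(* The other side: s + 1 is split as (s + 1 - t) + t; the first part is absorbed by the recursion
   for phi, the second is the weight that appears in [gser_rec]. *)
have R1 : s.+1%:R *: \sum_(t < s.+2) gser b t *: x e j (r + pm e' * t%:Z) (ph e' i (s.+1 - t)%N v) =
  \sum_(t < s.+1) \sum_(l < (s - t).+1) (l.+1%:R * kp * gser b t) *: B l t +
  \sum_(t < s.+1) (t.+1%:R * gser b t.+1) *: B' t.
  have -> : s.+1%:R *: \sum_(t < s.+2) gser b t *: x e j (r + pm e' * t%:Z) (ph e' i (s.+1 - t)%N v) =
  \sum_(t < s.+2) (gser b t *: x e j (r + pm e' * t%:Z) ((s.+1 - t)%:R *: ph e' i (s.+1 - t)%N v) +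
  (t%:R * gser b t) *: x e j (r + pm e' * t%:Z) (ph e' i (s.+1 - t)%N v)).
  rewrite scaler_sumr; apply: eq_bigr => t _; rewrite lZ; last exact: XX.
  have -> : s.+1%:R = (s.+1 - t)%:R + t%:R :> F by rewrite -natrD subnK // leq_ord.
  lmod_in F.
  rewrite big_split /=; congr (_ + _); last first.
  by rewrite big_ord_recl mul0r scale0r add0r; apply: eq_bigr => t _; rewrite /=.
  rewrite big_ord_recr /= subnn scale0r l0 scaler0 addr0.
  apply: eq_bigr => t _; rewrite (rp_PS hr) // subSn ?leq_ord // lS => [|l]; last by apply/XZ/XX/XX.
  rewrite scaler_sumr; apply: eq_bigr => l _.
  rewrite lZ ?scalerA; last by apply/XX/XX.
  by rewrite mulrC /B subSS -!subnDA addnC.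
rewrite R1; congr (_ + _).
  exact: (tri_exch s (fun l t => (l.+1%:R * kp * gser b t) *: B l t)).
rewrite (tri_diag s (fun l t => ((b ^+ l.+1 - b ^- l.+1) * gser b t) *: B' (l + t)%N)).
apply: eq_bigr => k _; rewrite -gser_rec ?gb_neq0 // scaler_suml.
by apply: eq_bigr => l _; rewrite subnKC // -ltnS.
Qed.
(** The denominator 1 - b y of [ph_x] is cleared, which leaves four terms and the shape of (R5). *)
Lemma ph_x1 e' e i j s r v : X v ->
  ph e' i s.+1 (x e j r v) - gb e' e i j *: ph e' i s (x e j (r + pm e') v) =
  gb e' e i j *: x e j r (ph e' i s.+1 v) - x e j (r + pm e') (ph e' i s v).
Proof.
move=> Xv; rewrite !ph_x // big_ord_recl subn0 big_ord_recl.
rewrite [in X in _ - X]big_ord_recl /= !mulr0 !addr0 /bump subSS subn0 mulr1.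
set b := gb _ _ _ _; set S1 := \sum_(i0 < s) _; set S2 := \sum_(i0 < s) _.
have -> : S1 = b *: S2.
  rewrite scaler_sumr; apply: eq_bigr => t _; rewrite !add1n.
  have -> : r + pm e' * t.+2%:Z = r + pm e' + pm e' * t.+1%:Z by lia.
  by rewrite scalerA !add0n exprS mulrA.
rewrite expr0; lmod_in F.
Qed.
(** The recursion builds phi from k and h, so it suffices that A commute with those. *)
Lemma ph_comm (A : V -> V) e i s v : (forall w, X w -> X (A w)) -> linon X A ->
  (forall a w, X w -> A (op (LK a) w) = op (LK a) (A w)) ->
  (forall m w, X w -> A (op (LH i m) w) = op (LH i m) (A w)) ->
  X v -> A (ph e i s v) = ph e i s (A v).
Proof.
move=> sA lA AK AH Xv; elim/ltn_ind: s => -[|s] IH.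
  by rewrite (rp_P0 hr e i Xv) (rp_P0 hr e i (sA _ Xv)) AK.
apply: (scalerI (charC s)).
have Xp' : X (ph e i s.+1 v) by apply: XX.
rewrite (rp_PS hr e i s.+1 (sA _ Xv)) -(linonZ (rp_sub hr) lA) //.
rewrite (rp_PS hr e i s.+1 Xv).
rewrite (linon_sum (rp_sub hr) lA) => [|l _]; last by apply/XZ/XX/XX.
apply: eq_bigr => l _; rewrite (linonZ (rp_sub hr) lA); last by apply/XX/XX.
have Xp : X (ph e i (s.+1 - l.+1) v) by apply: XX.
by rewrite (AH _ _ Xp) IH // subSS ltnS leq_subr.
Qed.
Lemma HH_comm i m j m' v : X v ->
  op (LH i m) (op (LH j m') v) = op (LH j m') (op (LH i m) v).
Proof.
move=> Xv; have [->|m0] := eqVneq m 0.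
  by rewrite (rp_H0 hr _ (XX _ Xv)) (rp_H0 hr _ Xv).
have [->|m1] := eqVneq m' 0; last exact: (rp_HH hr).
by rewrite (rp_H0 hr _ (XX _ Xv)) (rp_H0 hr _ Xv).
Qed.
Lemma KH_comm a j m v : X v ->
  op (LK a) (op (LH j m) v) = op (LH j m) (op (LK a) v).
Proof.
move=> Xv; have [->|m0] := eqVneq m 0; last exact: (rp_KH hr).
by rewrite (rp_H0 hr _ (XX _ Xv)) (rp_H0 hr _ Xv).
Qed.
Lemma KK_comm a b v : X v -> op (LK a) (op (LK b) v) = op (LK b) (op (LK a) v).
Proof. by move=> Xv; rewrite !(rp_KK hr) // addrC. Qed.
Lemma phH_comm e i s j m v : X v ->
  op (LH j m) (ph e i s v) = ph e i s (op (LH j m) v).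
Proof.
move=> Xv; apply: ph_comm => //.
- by move=> w; apply: XX.
- exact: (rp_lin hr).
- by move=> a w Xw; rewrite KH_comm.
- by move=> a w Xw; rewrite HH_comm.
Qed.
Lemma phK_comm e i s a v : X v ->
  op (LK a) (ph e i s v) = ph e i s (op (LK a) v).
Proof.
move=> Xv; apply: ph_comm => //.
- by move=> w; apply: XX.
- exact: (rp_lin hr).
- by move=> b w Xw; rewrite KK_comm.
- by move=> b w Xw; rewrite KH_comm.
Qed.
Lemma phph_comm e i s e' j t v : X v ->
  ph e' j t (ph e i s v) = ph e i s (ph e' j t v).
Proof.
move=> Xv; apply: ph_comm => //.
- by move=> w; apply: XX.
- exact: (rp_lin hr).
- by move=> a w Xw; rewrite phK_comm.
- by move=> a w Xw; rewrite phH_comm.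
Qed.
End PhiX.

(** * Weight spaces and root strings *)

Section Weights.

Definition wsp (V : lmodType F) (op : lab -> V -> V) (om : hdual) : set V :=
  [set v | forall a, op (LK a) v = qp (om a) *: v].

Definition wsh (e : bool) (j : 'I_n) : hdual := (pm e)%:~R *: sroot H j.

Lemma hdualZ (u : hdual) c y : u (c *: y) = c * (u y : rat).
Proof. by rewrite linearZ. Qed.
Lemma hdualE (u v : hdual) c y : (u + c *: v) y = u y + c * (v y : rat) :> rat.
Proof. by rewrite add_lfunE scale_lfunE. Qed.

Section One.
Variables (V : lmodType F) (op : lab -> V -> V) (X : set V)
  (hr : isrep op X).

Lemma wsp_sub om : X = setT -> lsub (wsp op om).
Proof.
move=> eX; split=> [a|c u v Wu Wv a].
  by rewrite (linon0 (rp_sub hr) (rp_lin hr _)) scaler0.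
by rewrite (rp_lin hr) ?eX // Wu Wv; lmod_in F.
Qed.
Lemma wsp_x om e j r v : X v -> wsp op om v -> wsp op (om + wsh e j) (op (LX e j r) v).
Proof.
move=> Xv Wv a; rewrite (rp_KX hr) // Wv (linonZ (rp_sub hr) (rp_lin hr _)) //.
rewrite scalerA -(qd_D hq) add_lfunE scale_lfunE addrC; congr (_ *: _).
Qed.
Lemma wsp_h om i m v : X v -> wsp op om v -> wsp op om (op (LH i m) v).
Proof.
move=> Xv Wv a; rewrite (KH_comm hr) // Wv.
by rewrite (linonZ (rp_sub hr) (rp_lin hr _)).
Qed.
Lemma wsp_k om b v : X v -> wsp op om v -> wsp op om (op (LK b) v).
Proof.
move=> Xv Wv a; rewrite (KK_comm hr) // Wv.
by rewrite (linonZ (rp_sub hr) (rp_lin hr _)).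
Qed.
Lemma wsp_ph om e i m v : X v -> wsp op om v -> wsp op om (op (LP e i m) v).
Proof.
move=> Xv Wv a; rewrite (phK_comm hr) // Wv.
by rewrite (linonZ (rp_sub hr) (rp_lin hr _)).
Qed.
End One.

(** Integrability in terms of operators. Directness of the weight decomposition follows from the
    separation of the characters of k, by [wsp_graded]. *)
Record oint (V : lmodType F) (op : lab -> V -> V) : Prop := Oint {
  oi_rep : isrep op setT;
  oi_span : forall v, exists (s : seq hdual) (f : hdual -> V),
  (forall om, wsp op om (f om)) /\ v = \sum_(om <- s) f om;
  oi_fd : forall om, exists d, fd [set 0] (wsp op om) d;
  oi_cone : exists s : seq hdual, forall om,
  (exists2 v, wsp op om v & v != 0) -> exists2 la, la \in s & leQ om la;
  oi_str : forall (mu : hdual) i, exists N : nat, forall r : nat, (N <= r)%N ->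
  wsp op (mu + sroot H i *+ r) `<=` [set 0] /\
  wsp op (mu - sroot H i *+ r) `<=` [set 0]
}.

Section Strings.
Variables (V : lmodType F) (op : lab -> V -> V).
Hypothesis hr : isrep op setT.
Hypothesis hstr : forall (mu : hdual) i, exists N : nat, forall r : nat, (N <= r)%N ->
  wsp op (mu + sroot H i *+ r) `<=` [set 0] /\
  wsp op (mu - sroot H i *+ r) `<=` [set 0].

Definition zi (i : 'I_n) (a : rat) : F := qp ((symz D i)%:R * a).
Definition kai (i : 'I_n) : F := qd i - (qd i)^-1.

Lemma zi0 i : zi i 0 = 1. Proof. by rewrite /zi mulr0 (qd_0 hq). Qed.
Lemma ziD i a b : zi i (a + b) = zi i a * zi i b.
Proof. by rewrite /zi mulrDr (qd_D hq). Qed.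
Lemma symz_neq0 i : (symz D i)%:R != 0 :> rat.
Proof. by rewrite pnatr_eq0 -lt0n symz_gt0. Qed.
Lemma zi_inj i a : zi i a = 1 -> a = 0.
Proof.
by move=> /qp_eq1 /eqP; rewrite mulf_eq0 (negbTE (symz_neq0 i)) => /eqP.
Qed.
Lemma kai_neq0 i : kai i != 0.
Proof.
have := @qexpz_neq (symz D i)%:Z.
by rewrite -exprnN => -> //; rewrite -lt0n symz_gt0.
Qed.
Definition strw (om : hdual) e i (k : int) : set V :=
  wsp op (om + (pm e * k)%:~R *: sroot H i).

(** For every mode a, (R4) with r + r' = 0 involves phi_0 alone, which acts by a power of q_i
    determined by the weight; so opposite modes a and -a of opposite signs form a quantum sl2 triple
    on the root string. *)
Lemma op_sl2 om e i a :
  sl2 (zi i) (kai i) (strw om e i) ((pm e)%:~R * om (scoroot H i))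
  (op (LX e i a)) (op (LX (~~ e) i (- a))).
Proof.
split=> [k|k|k|k v Wv|k v Wv|k v Wv|].
- exact: (wsp_sub hr).
- by move=> c u v _ _; apply: (rp_lin hr).
- by move=> c u v _ _; apply: (rp_lin hr).
- rewrite /strw mulrDr mulr1 rmorphD scalerDl addrA.
  exact: (wsp_x hr).
- have -> : strw om e i (k - 1) = wsp op (om + (pm e * k)%:~R *: sroot H i + wsh (~~ e) i).
  have pe : (pm e * (k - 1))%:~R = (pm e * k)%:~R + (pm (~~ e))%:~R :> rat.
  by rewrite -rmorphD; congr _%:~R; case: (e) => /=; ring.
  by rewrite /strw pe scalerDl addrA.
  exact: (wsp_x hr).
- have P0 e' : zp op e' i 0 v = zi i ((pm e')%:~R * sval2 ((pm e)%:~R * om (scoroot H i)) k * (pm e)%:~R) *: v.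
  rewrite /zp mulr0 (rp_P0 hr) // Wv; congr (_ *: _); rewrite /zi; congr qp.
  rewrite hdualE !hdualZ sroot_scoroot cmat_diag.
  rewrite /sval2.
  have pe : (pm e)%:~R * (pm e)%:~R = 1 :> rat by case: (e).
  transitivity ((symz D i)%:R * ((pm e')%:~R * (((pm e)%:~R * (pm e)%:~R) * om (scoroot H i) + 2 * (pm e)%:~R * k%:~R))).
  by rewrite pe; ring.
  by ring.
  have := rp_XX hr i i a (- a) (v := v) I; have := rp_XX hr i i (- a) a (v := v) I.
  rewrite eqxx subrr addNr !P0.
  set sv := sval2 _ _; case: (e) => /=.
  move=> _ ->; rewrite mul1r mulr1 mulN1r mulr1.
  by rewrite -scalerBl scalerA mulrC.
  move=> h1 _; rewrite -[LHS]opprB h1.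
  rewrite mul1r mulrN1 mulN1r mulrN1 opprK.
  by rewrite -scalerBl scalerA -scaleNr -mulrN opprB mulrC.
- have [N hN] := hstr om i; exists N => k kN.
  have [h1 h2] := hN `|k|%N (ltnW kN).
  have [e1|e1] : pm e * k = `|k|%:Z \/ pm e * k = - `|k|%:Z.
  by case: (e) => /=; lia.
  by rewrite /strw e1 scaler_nat.
  by rewrite /strw e1 rmorphN scaleNr scaler_nat.
Qed.
Lemma wsp_reflect om i v : wsp op om v -> v != 0 ->
  exists2 m : int, om (scoroot H i) = m%:~R &
  exists2 u, wsp op (om - m%:~R *: sroot H i) u & u != 0.
Proof.
move=> Wv v0; have h := op_sl2 om true i 0.
have W0 : strw om true i 0 v by rewrite /strw scale0r addr0.
have [m [em [u Wu u0]]] := s2_reflect (zi0 i) (@ziD i) (@zi_inj i) (kai_neq0 i) h W0 v0.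
exists m; first by move: em; rewrite /sval2 addr0 mul1r.
by exists u => //; move: Wu; rewrite /strw mul1r sub0r rmorphN scaleNr.
Qed.
Lemma wsp_sing om i v : wsp op om v -> v != 0 -> op (LX true i 0) v = 0 ->
  om (scoroot H i) \is a Num.nat.
Proof.
move=> Wv v0 Ev; have h := op_sl2 om true i 0.
have W0 : strw om true i 0 v by rewrite /strw scale0r addr0.
have [N] := s2_sing (zi0 i) (@ziD i) (@zi_inj i) (kai_neq0 i) h W0 v0 Ev.
by rewrite /sval2 addr0 mul1r => -> _; apply: natr_nat.
Qed.
End Strings.
End Weights.

(** * The Serre relations as a consequence of integrability *)

Section Serre.
Variables (V : lmodType F) (op : lab -> V -> V).
Hypothesis ho : oint op.
Let hr := oi_rep ho.
Let lZ g c v : op g (c *: v) = c *: op g v.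
Proof. exact: (linonZ (lsubT V) (rp_lin hr g)). Qed.
Let lD g u v : op g (u + v) = op g u + op g v.
Proof. exact: (linonD (rp_lin hr g)). Qed.
Let l0 g : op g 0 = 0.
Proof. exact: (linon0 (lsubT V) (rp_lin hr g)). Qed.
Let lS g (J : Type) (r : seq J) (P : pred J) (h : J -> V) :
  op g (\sum_(l <- r | P l) h l) = \sum_(l <- r | P l) op g (h l).
Proof. exact: (linon_sum (lsubT V) (rp_lin hr g)). Qed.
Lemma iter_lin g m : linon setT (iter m (op g)).
Proof. by move=> c u v _ _; elim: m => //= m ->; rewrite (rp_lin hr). Qed.

Section Diagonal.
Variables (e : bool) (i j : 'I_n) (a b : int) (s : nat).
Hypotheses (ij : i != j) (hs : s%:Z = 1 - D i j).
Local Notation E := (op (LX e i a)).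
Local Notation F1 := (op (LX (~~ e) i (- a))).
Local Notation xj := (op (LX e j b)).
Local Notation br' := (br (zi i) (kai i)).
Local Notation brs' := (brs (zi i) (kai i)).

Let Z0 : zi i 0 = 1 := zi0 i.
Let ZD : forall x y, zi i (x + y) = zi i x * zi i y := ziD i.
Let ZI x : zi i x = 1 -> x = 0 := @zi_inj i x.
Let KA : kai i != 0 := kai_neq0 i.

(** The left side of (R6) with all modes of node i equal to a, for a single permutation. *)
Definition sdiag (v : V) : V :=
  \sum_(t < s.+1) ((-1) ^+ t * qbinom (qd i) s t) *:
  iter t E (xj (iter (s - t) E v)).

Lemma sdiag_lin : linon setT sdiag.
Proof.
move=> c u v _ _; rewrite scaler_sumr -big_split; apply: eq_bigr => t _ /=.
rewrite (@iter_lin _ (s - t)) // (rp_lin hr) // (@iter_lin _ t) //; lmod_in F.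
Qed.
Lemma qnum_br (m : nat) : qnum (qd i) m%:Z = br' m%:R.
Proof.
rewrite /qnum /br /zi mulrN qpN mulrC qp_natM qp_nat.
rewrite -invr_expz -exprnP -!exprM mulrC.
by rewrite [(m * _)%N]mulnC.
Qed.
Lemma qfactS z m : qfact z m.+1 = qfact z m * qnum z m.+1%:Z :> F.
Proof. by rewrite /qfact big_nat_recr. Qed.
Lemma br_nat_neq0 m : br' m.+1%:R != 0.
Proof.
apply: (br_neq0 Z0 ZD ZI KA).
by rewrite pnatr_eq0.
Qed.
Lemma qfact_neq0 m : qfact (qd i) m != 0.
Proof.
elim: m => [|m IH]; first by rewrite /qfact big_nil.
by rewrite qfactS mulf_neq0 // qnum_br br_nat_neq0.
Qed.
Lemma qbinom_rec k : (k < s)%N ->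
  qbinom (qd i) s k.+1 * br' k.+1%:R = qbinom (qd i) s k * br' (s - k)%:R.
Proof.
move=> ks; rewrite /qbinom.
have [m em] : exists m, (s - k)%N = m.+1 by exists (s - k).-1; lia.
have -> : (s - k.+1)%N = m by lia.
rewrite em !qfactS !qnum_br.
have := qfact_neq0 k; have := qfact_neq0 m; have := br_nat_neq0 k; have := br_nat_neq0 m.
move: (qfact _ s) (qfact _ k) (qfact _ m) (br' _) (br' _) => A B C M N M0 N0 C0 B0.
by field; rewrite M0 C0 B0.
Qed.
Lemma E_F om k m v : strw op om e i k v ->
  iter m E (F1 v) = F1 (iter m E v) -
  brs' m (- sval2 ((pm e)%:~R * om (scoroot H i)) k) *: iter m.-1 E v.
Proof.
move=> Wv; case: m => [|m]; first by rewrite /brs big_ord0 scale0r subr0.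
have h := op_sl2 hr (oi_str ho) om e i a.
have Wv' : strw op om e i (- - k) v by rewrite opprK.
have := s2_EFm KA (s2_swap h) m Wv'.
move=> ->.
have -> : sval2 (- ((pm e)%:~R * om (scoroot H i))) (- k) =
  - sval2 ((pm e)%:~R * om (scoroot H i)) k.
  by rewrite /sval2; ring.
by rewrite addrK.
Qed.
Lemma xj_F v : xj (F1 v) = F1 (xj v).
Proof.
have ji : (j == i) = false by rewrite eq_sym (negbTE ij).
case: (e) => /=; apply/eqP; rewrite -subr_eq0.
  by rewrite (rp_XX hr) // ji.
by rewrite -oppr_eq0 opprB (rp_XX hr) // (negbTE ij).
Qed.
Lemma wsp_xj om k v : strw op om e i k v -> strw op (om + wsh e j) e i k (xj v).
Proof. by move=> Wv; rewrite /strw addrAC; apply: (wsp_x hr). Qed.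
(** Moving F past the powers of E leaves two families of terms, one from each side of x_j; they
    cancel in pairs by [qbinom_rec], because C i j = 1 - s. *)
Lemma sdiag_F om k v : strw op om e i k v -> sdiag (F1 v) = F1 (sdiag v).
Proof.
move=> Wv; set w := (pm e)%:~R * om (scoroot H i); set sv := sval2 w k.
pose be t := (-1) ^+ t * qbinom (qd i) s t.
have h := op_sl2 hr (oi_str ho) om e i a.
have Wit m : strw op om e i (k + m%:Z) (iter m E v) by apply: (s2_iterE KA h).
have T (t : 'I_s.+1) : iter t E (xj (iter (s - t) E (F1 v))) =
  F1 (iter t E (xj (iter (s - t) E v)))
  - brs' t (- (sv + 2 * (s - t)%:R + (D i j)%:~R)) *: iter t.-1 E (xj (iter (s - t) E v))
  - brs' (s - t) (- sv) *: iter t E (xj (iter (s - t).-1 E v)).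
  rewrite (E_F _ Wv).
  rewrite -[_ - _ *: _]addrC -scaleNr (rp_lin hr) // (@iter_lin _ t) //.
  rewrite xj_F (E_F _ (wsp_xj (Wit (s - t)%N))).
  have -> : sval2 ((pm e)%:~R * (om + wsh e j) (scoroot H i)) (k + (s - t)%N%:Z) =
  sv + 2 * (s - t)%:R + (D i j)%:~R.
  rewrite hdualE sroot_scoroot /sv /w /sval2.
  by case: (e) => /=; rewrite -?[(1)%:~R]/(1 : rat); ring.
  lmod_in F.
rewrite /sdiag; under eq_bigr => t _ do rewrite T !scalerBr.
rewrite !sumrB.
rewrite (_ : \sum_(t < s.+1) be t *: F1 (iter t E (xj (iter (s - t) E v))) =
  \sum_(t < s.+1) F1 (be t *: iter t E (xj (iter (s - t) E v)))); last first.
  exact: eq_bigr => t _; rewrite lZ.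
rewrite -addrA -opprD [X in _ - X](_ : _ = 0) ?subr0 //.
rewrite big_ord_recl [in X in _ + X]big_ord_recr /=.
have brs0 x : brs' 0 x = 0 by rewrite /brs big_ord0.
rewrite subnn !brs0 !scale0r !scaler0 add0r addr0 -big_split.
apply: big1 => t _ /=; rewrite /bump.
have ts := ltn_ord t.
have -> : (s - t).-1 = (s.-1 - t)%N by lia.
have -> : (s - t.+1)%N = (s.-1 - t)%N by lia.
rewrite !scalerA -scalerDl.
rewrite [X in X *: _](_ : _ = 0) ?scale0r //.
have br1 : br' 1 != 0 := br_nat_neq0 0.
apply: (mulfI br1); rewrite mulr0 mulrDr.
have BE := brsE Z0 ZD KA.
rewrite ![br' 1 * (_ * _)]mulrCA !BE.
have DE : (D i j)%:~R = 1 - s%:R :> rat.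
  have -> : D i j = 1 - s%:Z by rewrite hs; ring.
  by rewrite rmorphB.
have sE : s%:R = (s.-1 - t)%:R + t%:R + 1 :> rat.
  have e1 : s = ((s.-1 - t) + t + 1)%N by lia.
  by rewrite {1}e1 !natrD.
have -> : - (sv + 2 * (s.-1 - t)%:R + (D i j)%:~R) - t.+1%:R + 1 = - sv - (s - t)%:R + 1.
  have -> : (s - t)%N = (s.-1 - t).+1 by lia.
  by rewrite DE sE; ring.
have eb := qbinom_rec ts; move: eb.
move: (br' (_ + 1)) (br' t.+1%:R) (br' (s - t)%:R) (qbinom _ _ _) (qbinom _ _ _) => B b1 b2 Q1 Q2 e1.
rewrite exprS (_ : _ + _ = (-1) ^+ t * B * (Q1 * b2 - Q2 * b1)); last by ring.
by rewrite e1 subrr mulr0.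
Qed.
(** The operator commutes with F, and it raises the weight of the triple by 2 s + C i j = s + 1,
    which is at least 2; [s2_vanish] applies. *)
Lemma sdiag0 v : sdiag v = 0.
Proof.
have W0 om u : wsp op om u -> sdiag u = 0.
  move=> Wu.
  have s1 : (1 <= s)%N.
  have := cmat_offdiag D ij; move: hs; lia.
  pose om' := om + ((pm e * s%:Z)%:~R *: sroot H i) + wsh e j.
  have h := op_sl2 hr (oi_str ho) om e i a.
  have h' := op_sl2 hr (oi_str ho) om' e i a.
  have Wu0 : strw op om e i 0 u by rewrite /strw mulr0 scale0r addr0.
  apply: (s2_vanish Z0 ZD ZI KA h h' _ _ _ _ Wu0).
  - rewrite !hdualE !sroot_scoroot cmat_diag.
  have -> : D i j = 1 - s%:Z by rewrite hs; ring.
  have s1' : 1 <= s%:R :> rat by rewrite ler1n.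
  rewrite !rmorphM.
  have pe : (pm e)%:~R * (pm e)%:~R = 1 :> rat by case: (e).
  rewrite !mulrDr !mulrA pe.
  by rewrite !mul1r; move: s1'; set x : rat := s%:R; lra.
  - move=> k v' Wv'; rewrite /sdiag.
  have sub := wsp_sub hr (om' + (pm e * k)%:~R *: sroot H i) (erefl _).
  apply: (subsp_sum sub) => t _; apply: (subspZ sub).
  have h1 := op_sl2 hr (oi_str ho) (om + wsh e j) e i a.
  have := s2_iterE KA h1 t (wsp_xj (s2_iterE KA h (s - t) Wv')).
  rewrite /strw.
  have -> : om + wsh e j + (pm e * (k + (s - t)%N%:Z + t%:Z))%:~R *: sroot H i =
  om + (pm e * s%:Z)%:~R *: sroot H i + wsh e j + (pm e * k)%:~R *: sroot H i.
  have -> : pm e * (k + (s - t)%N%:Z + t%:Z) = pm e * s%:Z + pm e * k.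
  have := leq_ord t; case: (e) => /=; lia.
  by rewrite rmorphD; lmod_in rat.
  by [].
  - by move=> k c x y _ _; apply: sdiag_lin.
  - by move=> k v' Wv'; apply: sdiag_F Wv'.
have [r [f [Wf ->]]] := oi_span ho v.
rewrite (linon_sum (lsubT V) sdiag_lin) //.
by rewrite big1 // => om _; apply: W0 (Wf om).
Qed.
End Diagonal.

Section General.
Variables (e : bool) (i j : 'I_n) (s : nat).
Hypotheses (ij : i != j) (hs : s%:Z = 1 - D i j).
Local Notation xf r p P := (xfold op e i r p P).
Local Notation sx := (@serre V op e i j s).

Lemma count_lt (t : nat) : (t <= s)%N -> count (fun u : 'I_s => u < t)%N (index_enum 'I_s) = t.
Proof.
move=> ts; rewrite -sum1_count -[RHS]card_ord -sum1_card.
by rewrite (big_ord_narrow ts).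
Qed.
Lemma count_ge (t : nat) : (t <= s)%N -> count (fun u : 'I_s => t <= u)%N (index_enum 'I_s) = (s - t)%N.
Proof.
move=> ts; have := count_predC (fun u : 'I_s => u < t)%N (index_enum 'I_s).
rewrite count_lt // => e1.
have e2 : size (index_enum 'I_s) = s by rewrite -[RHS]card_ord cardE size_filter.
transitivity (count (predC (fun u : 'I_s => u < t)%N) (index_enum 'I_s)).
  by apply: eq_count => u; rewrite leqNgt.
by rewrite -[in RHS]e2 -e1 addKn.
Qed.
Lemma xfold_const a p P v : xf (fun=> a) p P v =
  iter (count P (index_enum 'I_s)) (op (LX e i a)) v.
Proof. by rewrite /xfold -size_filter; elim: (seq.filter _ _) => //= u l ->. Qed.
Lemma serre_const a r' v : sx (fun=> a) r' v = 0.
Proof.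
rewrite /serre big1 // => p _.
rewrite -[RHS](@sdiag0 e i j a r' s ij hs v).
apply: eq_bigr => t _; have ts := leq_ord t.
by rewrite !xfold_const count_lt // count_ge.
Qed.
Definition upd (r : 'I_s -> int) y m : 'I_s -> int :=
  fun u => if u == y then r u + m else r u.

Local Notation cc m k := ((pm e)%:~R / m%:~R * qnum q (m * bmat D i k)).

Lemma op_hx m k r v : m != 0 -> op (LH i m) (op (LX e k r) v) =
  op (LX e k r) (op (LH i m) v) + cc m k *: op (LX e k (r + m)) v.
Proof.
move=> m0; have := rp_HX hr i e k r I m0.
by rewrite [m + r]addrC => <-; rewrite addrC subrK.
Qed.
Definition fl r (p : 'S_s) (l : seq 'I_s) v :=
  foldr (fun u => op (LX e i (r (p u)))) v l.

Lemma fl_upd r (p : 'S_s) l y m v : y \notin l -> fl (upd r (p y) m) p l v = fl r p l v.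
Proof.
elim: l => //= u l IH; rewrite negb_or => /andP[yu yl]; rewrite IH // /upd.
by rewrite (inj_eq perm_inj) eq_sym (negbTE yu).
Qed.
Lemma fl_lin r p l : linon setT (fl r p l).
Proof. by move=> c u v _ _; elim: l => //= y l ->; rewrite (rp_lin hr). Qed.
Lemma fl_h m r (p : 'S_s) l v : m != 0 -> uniq l ->
  op (LH i m) (fl r p l v) = fl r p l (op (LH i m) v) +
  cc m i *: \sum_(u <- l) fl (upd r (p u) m) p l v.
Proof.
move=> m0; elim: l => [|u l IH] /=; first by rewrite big_nil scaler0 addr0.
move=> /andP[ul Ul]; rewrite op_hx // IH // lD lZ lS big_cons.
rewrite fl_upd // {2}/upd eqxx scalerDr -addrA; congr (_ + _); rewrite addrC; congr (_ + _).
congr (_ *: _); rewrite big_seq [RHS]big_seq; apply: eq_bigr => y yl.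
rewrite {2}/upd (inj_eq perm_inj); case: eqP => // e1.
by move: ul; rewrite e1 yl.
Qed.
Lemma xfE r p P v : xf r p P v = fl r p [seq u <- index_enum 'I_s | P u] v.
Proof. by []. Qed.
(** Commutation with h_{i,m} is a derivation shifting one mode at a time, which is the means of
    leaving the case of equal modes. *)
Lemma serre_h m r r' v : m != 0 ->
  op (LH i m) (sx r r' v) = sx r r' (op (LH i m) v) +
  cc m i *: \sum_(y : 'I_s) sx (upd r y m) r' v + cc m j *: sx r (r' + m) v.
Proof.
move=> m0; rewrite /serre.
have T (p : 'S_s) (t : 'I_s.+1) :
  op (LH i m) (xf r p (fun u => u < t)%N (op (LX e j r') (xf r p (fun u => t <= u)%N v))) =
  xf r p (fun u => u < t)%N (op (LX e j r') (xf r p (fun u => t <= u)%N (op (LH i m) v))) +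
  cc m i *: (\sum_(u : 'I_s) xf (upd r (p u) m) p (fun u => u < t)%N
  (op (LX e j r') (xf (upd r (p u) m) p (fun u => t <= u)%N v))) +
  cc m j *: xf r p (fun u => u < t)%N (op (LX e j (r' + m)) (xf r p (fun u => t <= u)%N v)).
  pose l1 := [seq u : 'I_s <- index_enum 'I_s | (u < t)%N].
  pose l2 := [seq u : 'I_s <- index_enum 'I_s | (t <= u)%N].
  suff T' : op (LH i m) (fl r p l1 (op (LX e j r') (fl r p l2 v))) =
  fl r p l1 (op (LX e j r') (fl r p l2 (op (LH i m) v))) +
  cc m i *: (\sum_(u : 'I_s) fl (upd r (p u) m) p l1
  (op (LX e j r') (fl (upd r (p u) m) p l2 v))) +
  cc m j *: fl r p l1 (op (LX e j (r' + m)) (fl r p l2 v)) by exact: T'.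
  have U1 : uniq l1 by apply/filter_uniq/index_enum_uniq.
  have U2 : uniq l2 by apply/filter_uniq/index_enum_uniq.
  have L := @fl_lin r p l1.
  rewrite fl_h // op_hx // fl_h // lD lZ lS.
  rewrite (linonD L) // (linonD L) // !(linonZ (lsubT V) L) // (linon_sum (lsubT V) L) //.
  have e1 : \sum_(u <- l1) fl (upd r (p u) m) p l1 (op (LX e j r') (fl r p l2 v)) =
  \sum_(u <- index_enum 'I_s | (u < t)%N) fl (upd r (p u) m) p l1 (op (LX e j r') (fl (upd r (p u) m) p l2 v)).
  rewrite big_filter; apply: eq_bigr => u ut; rewrite (@fl_upd r p l2 u m v) //.
  by rewrite mem_filter leqNgt ut.
  have e2 : \sum_(u <- l2) fl r p l1 (op (LX e j r') (fl (upd r (p u) m) p l2 v)) =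
  \sum_(u <- index_enum 'I_s | ~~ (u < t)%N) fl (upd r (p u) m) p l1 (op (LX e j r') (fl (upd r (p u) m) p l2 v)).
  rewrite big_filter; apply: eq_big => u; first by rewrite leqNgt.
  move=> ut; rewrite (@fl_upd r p l1 u m _) //.
  by rewrite mem_filter ltnNge ut.
  rewrite e1 e2 [\sum_(u : 'I_s) _](bigID (fun u : 'I_s => (u < t)%N)).
  by rewrite scalerDr -!addrA; congr (_ + _); rewrite addrA addrC.
rewrite lS; under eq_bigr => p _ do rewrite lS.
under eq_bigr => p _ do under eq_bigr => t _ do rewrite lZ T !scalerDr.
under eq_bigr => p _ do rewrite !big_split.
rewrite !big_split; congr (_ + _ + _); rewrite scaler_sumr.
  apply/esym; under [LHS]eq_bigr => y _ do rewrite scaler_sumr.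
  rewrite [LHS]exchange_big; apply: eq_bigr => p _.
  under eq_bigr => y _ do rewrite scaler_sumr.
  rewrite exchange_big; apply: eq_bigr => t _.
  rewrite -!scaler_sumr !scalerA mulrC; congr (_ *: _).
  by rewrite (reindex_inj (@perm_inj _ p)).
apply: eq_bigr => p _; rewrite scaler_sumr; apply: eq_bigr => t _.
by rewrite !scalerA mulrC.
Qed.
Lemma serre_ext r1 r2 r' v : r1 =1 r2 -> sx r1 r' v = sx r2 r' v.
Proof. by move=> /funext ->. Qed.
Lemma serre_perm (sg : 'S_s) r r' v : sx (fun u => r (sg u)) r' v = sx r r' v.
Proof.
rewrite [RHS](reindex_inj (mulIg sg)); apply: eq_bigr => p _.
apply: eq_bigr => t _; rewrite !xfE /fl.
have -> // : (fun u : 'I_s => op (LX e i (r ((p * sg)%g u)))) = (fun u => op (LX e i (r (sg (p u))))).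
by apply/funext => u; rewrite permM.
Qed.
Lemma cc_neq0 m : m != 0 -> cc m i != 0.
Proof.
move=> m0; apply: mulf_neq0; first by rewrite mulf_neq0 ?invr_neq0 ?intr_eq0 ?pm_neq0.
apply: qnum_neq0; rewrite mulf_neq0 // /bmat cmat_diag mulf_neq0 //.
by rewrite -lt0n symz_gt0.
Qed.
(** Induction on the number of modes different from [a]. Resetting one such mode, at [u0], gives an
    expression that vanishes; applying h_{i,m} with m = r u0 - a yields a sum where some terms
    vanish by induction and the others are permutations of the wanted expression. The latter are
    present, [u0] itself giving one. *)
Lemma serre0 r r' v : sx r r' v = 0.
Proof.
have [a _] : exists a : int, True by exists 0.
have [k] := ubnP #|[pred u | r u != a]|; elim: k r r' v => // k IH r r' v.
rewrite ltnS leq_eqVlt => /orP[/eqP ek|]; last exact: IH.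
have [k0|k0] := posnP k.
  rewrite (@serre_ext _ (fun=> a)) ?serre_const // => u.
  apply/eqP/negPn/negP => ru; move: ek; rewrite k0 => /card0_eq/(_ u).
  by rewrite inE ru.
have /card_gt0P[u0] : (0 < #|[pred u | r u != a]|)%N by rewrite ek.
rewrite inE => ru0.
pose m := r u0 - a; have m0 : m != 0 by rewrite subr_eq0.
pose r0 := upd r u0 (- m).
have r0u0 : r0 u0 = a by rewrite /r0 /upd eqxx; lia.
have r0u u : u != u0 -> r0 u = r u by rewrite /r0 /upd => /negbTE ->.
have c0 : (#|[pred u | r0 u != a]| < k)%N.
  rewrite -ek; apply: proper_card; apply/fintype.properP; split.
  apply/fintype.subsetP => u; rewrite !inE; have [->|uu] := eqVneq u u0; first by rewrite r0u0.
  by rewrite r0u.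
  by exists u0; rewrite !inE // r0u0 eqxx.
have Z0 r1' v1 : sx r0 r1' v1 = 0 by exact: IH.
have := serre_h r0 r' v m0; rewrite !Z0 l0 scaler0 addr0 add0r => /esym/eqP.
rewrite scaler_eq0 (negbTE (cc_neq0 m0)) => /eqP sum0.
pose A := [pred u | (u != u0) && (r u != a)].
have tA u : u \in A -> sx (upd r0 u m) r' v = 0.
  rewrite inE => /andP[uu ru]; apply: IH; rewrite -ek; apply: proper_card; apply/fintype.properP; split.
  apply/fintype.subsetP => y; rewrite !inE /upd; have [->|_] := eqVneq y u; first by rewrite ru.
  by have [->|yu] := eqVneq y u0; [rewrite r0u0 eqxx|rewrite r0u].
  by exists u0; rewrite !inE // /upd [u0 == u]eq_sym (negbTE uu) r0u0 eqxx.
(* A position outside [A] is [u0] or carries the mode [a]; transposing it with [u0] recovers r. *)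
have tB u : u \notin A -> sx (upd r0 u m) r' v = sx r r' v.
  rewrite negb_and !negbK => hu.
  rewrite -[RHS](serre_perm (tperm u u0)); apply: serre_ext => y.
  have ru : u != u0 -> r u = a by move=> uu; move: hu; rewrite (negbTE uu) => /eqP.
  rewrite /upd; case: tpermP => [->|->|/eqP yu /eqP yu0].
  - rewrite eqxx; have [->|uu] := eqVneq u u0; first by rewrite r0u0; lia.
  by rewrite r0u; lia.
  - have [<-|uu] := eqVneq u0 u; first by rewrite r0u0; lia.
  by rewrite ru // eq_sym.
  - by rewrite (negbTE yu) r0u.
move: sum0; rewrite (bigID (mem A)) /= big1 ?add0r; last by move=> u; apply: tA.
rewrite (eq_bigr (fun=> sx r r' v)); last by move=> u; apply: tB.
rewrite sumr_const => /eqP; rewrite -scaler_nat scaler_eq0 => /orP[|/eqP //].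
rewrite pnatr_eq0 => /eqP /card0_eq/(_ u0); rewrite -topredE /= !inE eqxx.
by [].
Qed.
End General.

Lemma oint_serre : serre_rel op.
Proof. by move=> e i j s r r' v ij hs; apply: serre0. Qed.
End Serre.

(** * Subquotients and weight gradings of representations *)

Section SubquotRep.
Variables (E : lmodType F) (d : sqdata E) (op : lab -> E -> E).
Hypothesis hr : isrep op (sqX d).
Hypothesis sY : forall g x, sqY d x -> sqY d (op g x).
Local Notation pi := (sqpi d).

Definition sqop (g : lab) : sqt d -> sqt d := sqf (op g).

Lemma sqopE g x : sqX d x -> sqop g (pi x) = pi (op g x).
Proof. by apply: sqfE; [apply: (rp_st hr)|apply: sY|apply: (rp_lin hr)]. Qed.
Lemma sqop_rep : isrep sqop setT.
Proof.
have pl := @sqpi_lin _ _ d; have hX := sqX_sub d.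
have st g x : sqX d x -> sqX d (op g x) by exact: (rp_st hr).
have pB x y : sqX d x -> sqX d y -> pi x - pi y = pi (x - y).
  by move=> Xx Xy; rewrite (linonB hX pl).
have pZ c x : sqX d x -> c *: pi x = pi (c *: x).
  by move=> Xx; rewrite (linonZ hX pl).
have sZ c x : sqX d x -> sqX d (c *: x) by exact: subspZ.
have sB x y : sqX d x -> sqX d y -> sqX d (x - y) by exact: subspB.
have zpE e i k x : sqX d x -> zp sqop e i k (pi x) = pi (zp op e i k x) /\ sqX d (zp op e i k x).
  move=> Xx; rewrite /zp; case: ifP => _; last by split=> //; apply: subsp0.
  by rewrite sqopE //; split=> //; apply: st.
split=> //.
- by move=> g; apply: sqf_lin; [apply: st|apply: sY|apply: (rp_lin hr)].
- by move=> i v _; have [x Xx <-] := sqpi_sur v; rewrite sqopE // (rp_H0 hr).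
- by move=> a b v _; have [x Xx <-] := sqpi_sur v; rewrite !sqopE ?(rp_KK hr) //; apply: st.
- by move=> v _; have [x Xx <-] := sqpi_sur v; rewrite !sqopE ?(rp_K0 hr).
- move=> a j m v _ m0; have [x Xx <-] := sqpi_sur v.
  by rewrite !sqopE 1?(rp_KH hr) //; apply: st.
- move=> i m j m' v _ m0 m0'; have [x Xx <-] := sqpi_sur v.
  by rewrite !sqopE 1?(rp_HH hr) //; apply: st.
- move=> a e j r v _; have [x Xx <-] := sqpi_sur v.
  rewrite !sqopE; try by do ?apply: st.
  by rewrite (rp_KX hr) // -pZ //; apply/st/st.
- move=> i m e j r v _ m0; have [x Xx <-] := sqpi_sur v.
  rewrite !sqopE; try by do ?apply: st.
  have XL : sqX d (op (LX e j (m + r)) x) by exact: st.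
  have X1 : sqX d (op (LH i m) (op (LX e j r) x)) by apply/st/st.
  have X2 : sqX d (op (LX e j r) (op (LH i m) x)) by apply/st/st.
  by rewrite (pB _ _ X1 X2) (pZ _ _ XL) (rp_HX hr).
- move=> i j r r' v _; have [x Xx <-] := sqpi_sur v.
  rewrite !sqopE; try by do ?apply: st.
  have X1 : sqX d (op (LX true i r) (op (LX false j r') x)) by apply/st/st.
  have X2 : sqX d (op (LX false j r') (op (LX true i r) x)) by apply/st/st.
  rewrite (pB _ _ X1 X2) (rp_XX hr) // => {X1 X2}.
  have [e1 X1] := zpE true i (r + r') x Xx; have [e2 X2] := zpE false i (r + r') x Xx.
  by rewrite e1 e2; case: ifP => // _; rewrite (pB _ _ X1 X2) (pZ _ _ (sB _ _ X1 X2)).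
- move=> e i j r r' v _; have [x Xx <-] := sqpi_sur v.
  rewrite !sqopE; try by do ?apply: st.
  have S2 g g' : sqX d (op g (op g' x)) by apply/st/st.
  by rewrite !(pZ _ _ (S2 _ _)) !(pB _ _ (S2 _ _) (sZ _ _ (S2 _ _))) !(pB _ _ (sZ _ _ (S2 _ _)) (S2 _ _)) (rp_R5 hr).
- by move=> e i v _; have [x Xx <-] := sqpi_sur v; rewrite !sqopE // (rp_P0 hr).
- move=> e i m v _; have [x Xx <-] := sqpi_sur v.
  rewrite sqopE // pZ ?(rp_PS hr) //; last exact: st.
  rewrite (linon_sum hX pl) => [|j _]; last by apply/sZ/st/st.
  apply: eq_bigr => j _; rewrite !sqopE; try by do ?apply: st.
  by rewrite pZ //; apply/st/st.
Qed.
End SubquotRep.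

Section Graded.
Variables (E : lmodType F) (op : lab -> E -> E) (X W : set E).
Hypotheses (sW : lsub W) (WX : W `<=` X).
Hypothesis lK : forall a, linon X (op (LK a)).
Hypothesis sX : lsub X.
Hypothesis stW : forall a v, W v -> W (op (LK a) v).

Lemma hdual_sep (u v : hdual) : u != v -> exists a, u a != v a.
Proof.
move=> uv; apply: contrapT => no; move/eqP: uv; apply; apply/lfunP => a.
by apply/eqP/negPn/negP => h; apply: no; exists a.
Qed.
(** The operator k_a - qp (om1 a) removes the component of weight [om1] and, when a separates [om0]
    from [om1], scales that of [om0] by a nonzero number; this shortens the sum. *)
Lemma wsp_graded (s : seq hdual) (f : hdual -> E) : uniq s ->
  (forall om, om \in s -> X (f om) /\ wsp op om (f om)) -> W (\sum_(om <- s) f om) ->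
  forall om, om \in s -> W (f om).
Proof.
elim: s f => // om1 s IH f /andP[n1 Us] hf; rewrite big_cons => Wv.
have h1 : forall om, om \in s -> W (f om).
  move=> om0 s0; have [|a qa] := @hdual_sep om0 om1; first by apply: contraNneq n1 => <-.
  have ca : qp (om0 a) - qp (om1 a) != 0.
  by rewrite subr_eq0; apply: contra qa => /eqP/qp_inj ->.
  have Xs om : om \in s -> X (f om) /\ wsp op om (f om) by move=> so; apply: hf; rewrite inE so orbT.
  have [X1 W1] := hf om1 (mem_head _ _).
  have Xsum : X (\sum_(om <- s) f om).
  by rewrite big_seq; apply: (subsp_sum sX) => om /Xs [].
  have := IH (fun om => (qp (om a) - qp (om1 a)) *: f om) Us _ _ om0 s0.
  move=> W0; suff : W ((qp (om0 a) - qp (om1 a)) *: f om0).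
  by move=> /(subspZ sW (qp (om0 a) - qp (om1 a))^-1); rewrite scalerA mulVf // scale1r.
  apply: W0 => [om so|].
  have [Xo Wo] := Xs om so; split; first exact: subspZ.
  by move=> b; rewrite (linonZ sX (lK b)) // Wo; lmod_in F.
  rewrite (_ : \sum_(om <- s) _ = op (LK a) (f om1 + \sum_(om <- s) f om) -
  qp (om1 a) *: (f om1 + \sum_(om <- s) f om)).
  by apply: (subspB sW); [apply: stW|apply: subspZ].
  rewrite (linonD (lK a)) // W1 scalerDr opprD addrACA subrr add0r.
  rewrite [in RHS]big_seq (linon_sum sX (lK a)) => [|om /Xs []//].
  rewrite scaler_sumr big_seq -sumrB; apply: eq_bigr => om so.
  by rewrite (Xs om so).2 scalerBl.
move=> om; rewrite inE => /orP[/eqP ->|]; last exact: h1.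
rewrite -(addrK (\sum_(om <- s) f om) (f om1)); apply: (subspB sW) => //.
by rewrite big_seq; apply: (subsp_sum sW) => om' /h1.
Qed.
End Graded.

(** * Rationality and matching of zeros and poles at one node *)

Section OneNode.
Variables (V : lmodType F) (op : lab -> V -> V) (ho : oint op) (i : 'I_n).
Let hr := oi_rep ho.
Local Notation T := (@sht F V).
Local Notation Tc := (@sht F F^o).
Local Notation W := (wsp op).
Let oL g : linon setT (op g) := rp_lin hr g.
Let oZ g c v : op g (c *: v) = c *: op g v. Proof. exact: (linonZ (lsubT V) (oL g)). Qed.
Let oS g (J : Type) (r : seq J) (P : pred J) (h : J -> V) :
  op g (\sum_(l <- r | P l) h l) = \sum_(l <- r | P l) op g (h l).
Proof. exact: (linon_sum (lsubT V) (oL g)). Qed.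
Definition xs e (u : V) : int -> V := fun r => op (LX e i r) u.
Local Notation b := (q ^ bmat D i i).

Lemma b_neq0 : b != 0. Proof. by rewrite expfz_neq0 ?(qd_neq0 hq). Qed.
Lemma bmat_neq0 : bmat D i i != 0.
Proof. by rewrite /bmat cmat_diag mulf_neq0 // -lt0n symz_gt0. Qed.
Lemma b_root (m : int) : b ^ m = 1 -> m = 0.
Proof.
rewrite exprz_exp => h; have := qexpz_eq1 h => /eqP; rewrite mulf_eq0 (negbTE bmat_neq0).
by move/eqP.
Qed.
(** Finite-dimensionality gives a relation between finitely many modes at r = 0, valid on the whole
    weight space. As h_{i,m'} preserves that space, (R3) transports the relation to every r. Holding
    on all of Z, it may then be divided by powers of X. *)
Lemma xs_rec e om : exists2 p : {poly F}, p`_0 != 0 &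
  forall v, W om v -> pap T p (xs e v) = 0.
Proof.
have sW om' := wsp_sub hr om' (erefl _).
have [d0 hd0] := oi_fd ho om; have [d [s [Ws hs]]] := fd_basis (sW om) hd0.
have [d0' hd0'] := oi_fd ho (om + wsh e i); have [d' [t [Wt ht]]] := fd_basis (sW _) hd0'.
have /choice [A hA] (rj : nat * 'I_d) : exists c : 'I_d' -> F, xs e (s rj.2) rj.1%:Z = \sum_k c k *: t k.
  by apply: ht; apply: (wsp_x hr).
(* One more mode than there are matrix entries for a map between the two weight spaces. *)
pose m := #|{: 'I_d * 'I_d'}|.+1.
have [c [r0 cr0] hc] := @lin_dep F _ m (fun r p => A (nat_of_ord r, p.1) p.2) (ltnSn _).
pose p := \poly_(r < m) (if insub r is Some r' then c r' else 0).
have pE (r : 'I_m) : p`_r = c r by rewrite coef_poly ltn_ord valK.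
have p0 : p != 0.
  by apply/eqP => e0; case/eqP: cr0; rewrite -pE e0 coef0.
have base v : W om v -> pap T p (xs e v) 0 = 0.
  move=> /hs [cv ->]; rewrite (papE _ _ (size_poly _ _)) fct_sumE.
  transitivity (\sum_(r < m) \sum_j (c r * cv j) *: xs e (s j) (val r)%:Z).
  apply: eq_bigr => r _; rewrite -[LHS]/(_ *: _) iter_sht pE /xs oS scaler_sumr.
  by apply: eq_bigr => j _; rewrite oZ scalerA.
  rewrite exchange_big big1 // => j _.
  transitivity (cv j *: \sum_k (\sum_r c r * A (nat_of_ord r, j) k) *: t k).
  rewrite scaler_sumr; under [RHS]eq_bigr do rewrite scaler_suml scaler_sumr.
  rewrite exchange_big; apply: eq_bigr => r _; rewrite (hA (nat_of_ord r, j)) scaler_sumr.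
  by apply: eq_bigr => k _; rewrite !scalerA; congr (_ *: _); ring.
  rewrite big1 ?scaler0 // => k _; have := hc (j, k); rewrite /= => ->.
  by rewrite scale0r.
have step (m' : int) r : m' != 0 -> (forall v, W om v -> pap T p (xs e v) r = 0) ->
  forall v, W om v -> pap T p (xs e v) (r + m') = 0.
  move=> m0 h v Wv; have Wh := wsp_h hr i m' I Wv.
  have := congr1 (op (LH i m')) (h v Wv).
  rewrite (linon0 (lsubT V) (oL _)) pap_sht oS.
  under eq_bigr => j _.
  rewrite oZ -[op (LH _ _) _](subrK (op (LX e i (r + j%:Z)) (op (LH i m') v))).
  rewrite (rp_HX hr) // scalerDr scalerA [_ * (_ * _)]mulrC -scalerA.
  rewrite (_ : m' + (r + j%:Z) = r + m' + j%:Z); last by lia.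
  over.
  rewrite big_split /= -scaler_sumr.
  have := h _ Wh; rewrite pap_sht => ->; rewrite addr0 => /eqP.
  rewrite scaler_eq0 => /orP[|/eqP]; last by rewrite pap_sht.
  rewrite mulf_eq0 => /orP[|]; last first.
  by rewrite (negbTE (qnum_neq0 _)) // mulf_neq0 // bmat_neq0.
  by rewrite mulf_eq0 invr_eq0 !intr_eq0 (negbTE m0) (negbTE (pm_neq0 e)).
have all0 r v : W om v -> pap T p (xs e v) r = 0.
  have up (k : nat) : forall v, W om v -> pap T p (xs e v) k%:Z = 0.
  by elim: k => [|k IH] //; rewrite -addn1 PoszD; apply: step.
  have dn (k : nat) : forall v, W om v -> pap T p (xs e v) (- k%:Z) = 0.
  elim: k => [|k IH]; first by rewrite oppr0.
  by rewrite -addn1 PoszD opprD; apply: step.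
  by case: r => k; [apply: up|rewrite NegzE; apply: dn].
have {base step}allp v : W om v -> pap T p (xs e v) = 0.
  by move=> Wv; apply/funext => r; apply: all0.
clear pE hc; move: p0 allp; clearbody p.
have [N] := ubnP (size p); elim: N p {all0} => // N IH p sN p0 allp.
have [pz|] := eqVneq p`_0 0; last by exists p.
have rp : root p 0 by rewrite /root horner_coef0 pz.
have /dvdpP [p' ep] : 'X - 0%:P %| p by rewrite dvdp_XsubCl.
have p'0 : p' != 0 by apply: contraNneq p0 => e0; rewrite ep e0 mul0r.
apply: (IH p') => //.
  by move: sN; rewrite ep size_mul ?polyXsubC_eq0 // size_XsubC addn2.
move=> v Wv; have := allp v Wv; rewrite ep subr0 mulrC papMt papXt => h.
apply/funext => r; have := congr1 (fun f : int -> V => f (r - 1)) h.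
by rewrite /sht subrK.
Qed.
Definition eig (om : hdual) (u : V) (g : bool -> nat -> F) : Prop :=
  [/\ W om u, u != 0 & forall e m, op (LP e i m) u = g e m *: u].

(** When S(T) applied to the modes of x u is a geometric progression of ratio a, shifting a mode in
    [ph_x] amounts to a scalar, so phi acts on the new vector by g times (be T - a) / (T - be a). *)
Lemma eig_move e om u g S a : eig om u g -> a != 0 -> pap T S (xs e u) 0 != 0 ->
  T (pap T S (xs e u)) = a *: pap T S (xs e u) ->
  exists g', eig (om + wsh e i) (pap T S (xs e u) 0) g' /\
  forall c A B, fits g c A B -> let be := q ^ (pm e * bmat D i i) in
  fits g' (c * be) (be^-1 * a :: A) (be * a :: B).
Proof.
move=> [Wu u0 hu] a0 f0 hf; set f := pap T S (xs e u) in f0 hf *.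
have fr r t : f (r + t) = a ^ t *: f r by apply: sht_geom.
have fE r : f r = \sum_(j < size S) S`_j *: op (LX e i (r + j%:Z)) u by rewrite /f pap_sht.
pose g' e' s := \sum_(t < s.+1) gser (gb e' e i i) t * a ^ (pm e' * t%:Z) * g e' (s - t)%N.
have phf e' s r : op (LP e' i s) (f r) = g' e' s *: f r.
  rewrite {1}fE oS /g' scaler_suml.
  transitivity (\sum_(t < s.+1) \sum_(j < size S) (S`_j * gser (gb e' e i i) t * g e' (s - t)%N) *:
  op (LX e i (r + pm e' * t%:Z + j%:Z)) u).
  rewrite exchange_big; apply: eq_bigr => j _ /=; rewrite oZ (ph_x hr) // scaler_sumr.
  apply: eq_bigr => t _; rewrite hu oZ !scalerA; congr (_ *: op (LX e i _) u); lia.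
  apply: eq_bigr => t _; rewrite -mulrA [_ * g _ _]mulrC mulrA -scalerA -fr fE scaler_sumr.
  by apply: eq_bigr => j _; rewrite scalerA; congr (_ *: _); ring.
have Wf : W (om + wsh e i) (f 0).
  rewrite fE; have sub := wsp_sub hr (om + wsh e i) (erefl _).
  by apply: (subsp_sum sub) => j _; apply: (subspZ sub); apply: (wsp_x hr).
exists g'; split; first by split=> // e' m; apply: phf.
move=> c A B ft; cbv zeta; set be := q ^ _.
have be0 : be != 0 by rewrite expfz_neq0 ?(qd_neq0 hq).
apply: (fits_step ft a0 be0).
have gbt : gb true e i i = be by rewrite /gb mul1r.
have gbf : gb false e i i = be^-1 by rewrite /gb mulN1r mulNr invr_expz.
have r0 e' : g' e' 0%N = gb e' e i i * g e' 0%N.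
  by rewrite /g' big_ord1 /= mulr0 expr0z mulr1.
have r1 e' s : g' e' s.+1 - gb e' e i i * a ^ (pm e') * g' e' s =
  gb e' e i i * g e' s.+1 - a ^ (pm e') * g e' s.
  set b' := gb _ _ _ _.
  rewrite /g' big_ord_recl /= mulr0 expr0z mulr1 subn0 -addrA; congr (_ + _).
  have aP (t : nat) : a ^ (pm e' * t.+1%:Z) = a ^ pm e' * a ^ (pm e' * t%:Z).
  rewrite (_ : pm e' * t.+1%:Z = pm e' + pm e' * t%:Z); last by lia.
  by rewrite expfzDr.
  rewrite mulr_sumr -sumrB big_ord_recl [X in _ + X]big1 => [|t _].
  rewrite addr0; change (b' ^+ 0 * (b' ^+ 2 - 1) * a ^ (pm e' * 1%:Z) * g e' (s.+1 - 1)%N -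
  b' * a ^ pm e' * (b' * a ^ (pm e' * 0%:Z) * g e' (s - 0)%N) = - (a ^ pm e' * g e' s)).
  rewrite subSS !subn0 mulr1 mulr0 expr0z expr0; ring.
  rewrite /bump /= !add1n subSS aP [b' ^+ t.+1]exprS; ring.
case=> k.
  rewrite /zext !mul1r.
  have [k0|k0] := leP 0 k.
  have -> : 0 <= k + 1 by lia.
  have -> : absz (k + 1) = (absz k).+1 by lia.
  by have := r1 true `|k|%N; rewrite gbt expr1z.
  have [e1|ne1] := eqVneq k (-1).
  by rewrite e1 addNr /= r0 gbt !mulr0 !subr0.
  rewrite (_ : (0 <= k + 1) = false) ?mulr0 ?subr0 //; lia.
rewrite /zext !mulN1r.
have [k0|k0] := leP 0 (- k); last first.
  by rewrite (_ : (0 <= - (k + 1)) = false) ?mulr0 ?subr0 //; lia.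
have [->|ne0] := eqVneq k 0.
  rewrite add0r /= r0 gbf mulr0 !add0r; congr (- _).
  by rewrite mulrCA !mulrA mulVf // mul1r.
have [s es] : exists s, k = - s.+1%:Z by exists `|k|%N.-1; lia.
rewrite es (_ : 0 <= - (- s.+1%:Z + 1)) ; last by lia.
have -> : absz (- s.+1%:Z + 1) = s by lia.
have := r1 false s; rewrite gbf exprN1 => h.
have -> : g' false s - be * a * g' false s.+1 =
  - (be * a) * (g' false s.+1 - be^-1 * a^-1 * g' false s).
  by field; rewrite a0.
rewrite h; field; by rewrite a0.
Qed.
Lemma xy_delta om u g s t : eig om u g ->
  op (LX true i s) (op (LX false i t) u) = op (LX false i t) (op (LX true i s) u) +
  ((kai i)^-1 * delta g (s + t)) *: u.
Proof.
move=> [_ _ hu]; have := rp_XX hr i i s t (v := u) I; rewrite eqxx.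
have zE e k : zp op e i k u = zext e (g e) k *: u.
  by rewrite /zp /zext; case: ifP => // _; rewrite scale0r.
by rewrite !zE -scalerBl scalerA => <-; rewrite addrC subrK.
Qed.
(** Among the polynomials killing the modes of x^- u, P has the least multiplicity at a. As U P
    kills [delta g], the pole of g at a is too strong for A and U alone, so a is a root of P;
    dividing it out once gives a geometric progression, to which [eig_move] applies. The modes of
    x^+ on the result, after applying U, are geometric too since the commutator depends on the sum
    of the modes only, whence the factor X - a. *)
Lemma eig_lower om u g c A B a (U : {poly F}) : eig om u g -> fits g c A B -> a != 0 -> U != 0 ->
  pap T U (xs true u) = 0 -> (count_mem a A + mup a U < count_mem a B)%N ->
  exists u' g' c', [/\ eig (om + wsh false i) u' g', fits g' c' (b * a :: A) (b^-1 * a :: B) &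
  pap T (('X - a%:P) * U) (xs true u') = 0].
Proof.
move=> eu ft a0 U0 hU cnt; have [Wu u0 _] := eu.
pose y := xs false u.
have k0 : (kai i)^-1 != 0 by rewrite invr_eq0 kai_neq0.
(* Both orders of x^+_s x^-_t summed against U and P. *)
have comm P r t : pap T U (fun s => op (LX true i s) (pap T P y t)) r =
  ((kai i)^-1 * pap Tc (U * P) (delta g) (r + t)) *: u.
  have e1 s : op (LX true i s) (pap T P y t) =
  pap T P (xs false (op (LX true i s) u)) t + ((kai i)^-1 * pap Tc P (delta g) (s + t)) *: u.
  rewrite !pap_sht oS mulr_sumr scaler_suml -big_split; apply: eq_bigr => j _.
  rewrite oZ (xy_delta _ _ eu) scalerDr scalerA; congr (_ + _ *: _).
  rewrite mulrCA; congr (_ * (_ * delta g _)); lia.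
  rewrite pap_sht; under eq_bigr do rewrite e1 scalerDr.
  rewrite big_split [X in X + _ = _](_ : _ = 0) ?add0r; last first.
  transitivity (pap T P (xs false (pap T U (xs true u) r)) t).
  rewrite !pap_sht; under eq_bigr do rewrite pap_sht scaler_sumr.
  rewrite exchange_big; apply: eq_bigr => j _; rewrite /xs oS scaler_sumr.
  by apply: eq_bigr => l _; rewrite oZ !scalerA mulrC.
  rewrite hU pap_sht big1 // => j _.
  by rewrite /xs (linon0 (lsubT V) (oL _)) scaler0.
  rewrite papMt [in RHS]pap_sht mulr_sumr scaler_suml; apply: eq_bigr => j _.
  rewrite (_ : r + j%:Z + t = r + t + j%:Z); last by lia.
  by rewrite scalerA mulrCA.
have [P1 P10 hP1] := xs_rec false om.
pose Q k := `[< exists P : {poly F}, [/\ P != 0, pap T P y = 0 & mup a P = k] >].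
have exQ : exists k, Q k.
  exists (mup a P1); apply/asboolP; exists P1; split=> //; last exact: hP1.
  by apply: contraNneq P10 => ->; rewrite coef0.
case: (ex_minnP exQ) => k /asboolP [P [P0 hP mP]] mink.
have UPd : pap Tc (U * P) (delta g) = 0.
  apply/funext => r; have := comm P r 0.
  rewrite addr0 hP => /esym; rewrite [pap T U _ r]pap_sht big1 => [|j _]; last first.
  by rewrite (linon0 (lsubT V) (oL _)) scaler0.
  move/eqP; rewrite scaler_eq0 (negbTE u0) orbF mulf_eq0 (negbTE k0).
  by move/eqP.
have := fits_ord a ft (mulf_neq0 U0 P0) UPd.
rewrite (mupM a U0 P0) => cnt2.
have key (x z w t : nat) : (x + w < z)%N -> (z <= x + (w + t))%N -> (0 < t)%N by lia.
have mP0 : (0 < mup a P)%N by exact: key cnt cnt2.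
have /dvdpP [S eP] : 'X - a%:P %| P by rewrite XsubC_dvd.
have S0 : S != 0 by apply: contraNneq P0 => e; rewrite eP e mul0r.
have mS : mup a P = (mup a S).+1.
  rewrite eP (mupM a S0) ?polyXsubC_eq0 // -['X - a%:P]expr1 mup_XsubCX eqxx addn1 //.
have f0 : pap T S y <> 0.
  move=> e; have : (k <= mup a S)%N by apply: mink; apply/asboolP; exists S.
  by rewrite -mP mS ltnn.
have Tf : T (pap T S y) = a *: pap T S y.
  by apply/eqP; rewrite -subr_eq0 -papXC -papMt mulrC -eP hP.
have fr := sht_geom a0 Tf.
have f00 : pap T S y 0 != 0.
  by apply/eqP => e; apply: f0; apply/funext => r; rewrite -[r]add0r fr e scaler0.
have [g' [eg' fg']] := eig_move eu a0 f00 Tf.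
exists (pap T S y 0), g', (c * q ^ (pm false * bmat D i i)); split=> //.
  have := fg' c A B ft; cbv zeta.
  by rewrite mulN1r -invr_expz invrK.
apply/funext => r; rewrite papMt papXC.
have G t r' : pap T U (fun s => op (LX true i s) (pap T S y t)) r' =
  a ^ t *: pap T U (xs true (pap T S y 0)) r'.
  rewrite [LHS]pap_sht [X in _ = _ *: X]pap_sht scaler_sumr; apply: eq_bigr => j _.
  by rewrite -{1}[t]add0r fr oZ scalerA mulrC -scalerA.
rewrite -[LHS]/(pap T U (xs true (pap T S y 0)) (r + 1) - a *: pap T U (xs true (pap T S y 0)) r).
have := G 1 r; rewrite expr1z => <-.
rewrite comm; have := comm S (r + 1) 0; rewrite addr0 => ->.
by rewrite subrr.
Qed.
(** The half-orbit a, a/b, a/b^2 and so on; b has infinite order, so for nonzero a these points are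
    distinct. *)
Definition below (a y : F) : bool := `[< exists k : nat, y = a * b ^- k >].
Definition cbl (a : F) (L : seq F) : nat := count (below a) L.
Definition inorb (a y : F) : bool := `[< exists k : int, y = a * b ^ k >].

Lemma belowE a y : below a y = (y == a) || below (b^-1 * a) y.
Proof.
apply/asboolP/orP => [[[|k] ->]|[/eqP ->|/asboolP[k ->]]].
- by left; rewrite invr1 mulr1.
- right; apply/asboolP; exists k; rewrite exprS invfM; ring.
- by exists 0%N; rewrite invr1 mulr1.
- by exists k.+1; rewrite exprS invfM; ring.
Qed.
Lemma bpow_neq (m : int) a : a != 0 -> m != 0 -> a * b ^ m != a.
Proof.
move=> a0; apply: contra => /eqP e; apply/eqP/b_root; apply: (mulfI a0).
by rewrite mulr1.
Qed.
Lemma below_self a : a != 0 -> below (b^-1 * a) a = false.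
Proof.
move=> a0; apply/asboolP => -[k e].
have := @bpow_neq (- k.+1%:Z) a a0; rewrite oppr_eq0 => /(_ isT)/eqP; apply.
by rewrite -exprnN {2}e exprS invfM; ring.
Qed.
Lemma below_up a : a != 0 -> below (b^-1 * a) (b * a) = false.
Proof.
move=> a0; apply/asboolP => -[k e].
have := @bpow_neq (- k.+2%:Z) (b * a) (mulf_neq0 b_neq0 a0); rewrite oppr_eq0 => /(_ isT)/eqP; apply.
rewrite -exprnN [in RHS]e !exprS.
have b0 := b_neq0; have bk : b ^+ k != 0 by rewrite expf_neq0.
by field; rewrite bk.
Qed.
Lemma cblE a L : a != 0 -> cbl a L = (count_mem a L + cbl (b^-1 * a) L)%N.
Proof.
move=> a0; rewrite -count_predUI [X in (_ + X)%N](_ : _ = 0%N) ?addn0.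
  by apply: eq_count => y; rewrite belowE.
rewrite (@eq_count _ _ pred0) ?count_pred0 // => y /=.
by case: eqP => [->|//]; rewrite below_self.
Qed.
Lemma cbl_far a L : a != 0 -> exists K, forall k, (K <= k)%N -> cbl (a * b ^- k) L = 0%N.
Proof.
move=> a0; elim: L => [|y L [K hK]]; first by exists 0%N.
have [[m em]|no] := pselect (exists m : nat, y = a * b ^- m); last first.
  exists K => k Kk; rewrite /= hK // /below.
  case: asboolP => // -[m em]; case: no; exists (k + m)%N.
  by rewrite exprD invfM mulrA.
exists (maxn K m.+1) => k; rewrite geq_max => /andP[Kk mk].
rewrite /= hK // /below; case: asboolP => // -[m' em'].
have e : a * b ^- m = a * b ^- (k + m')%N by rewrite -em exprD invfM mulrA.
have := @bpow_neq (m%:Z - (k + m')%N%:Z) (a) a0.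
rewrite expfzDr ?b_neq0 // -exprnN mulrCA -mulrCA.
rewrite (_ : a * (b ^+ m * b ^- (k + m')) = b ^+ m * (a * b ^- (k + m'))); last by ring.
rewrite -e mulrCA mulfV ?expf_neq0 ?b_neq0 // mulr1 eqxx => h.
suff : false by [].
apply: h; lia.
Qed.
(** An impossible configuration: poles outnumber zeros in the half-orbit of a, while the modes of
    x^+ on u are killed by a polynomial without roots there. [state_step] reproduces it lower in the
    same root string, against the finiteness of strings. *)
Definition state (om : hdual) : Prop := exists u g c A B a (U : {poly F}),
  [/\ eig om u g, fits g c A B, a != 0 /\ U != 0, (cbl a A < cbl a B)%N &
  pap T U (xs true u) = 0 /\ forall k : nat, U.[a * b ^- k] != 0].

(** The point a is first moved down to the last place where poles outnumber zeros. Lowering [kk]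
    times at a adds [kk] zeros at b a and [kk] poles at a/b; [kk] is one more than the excess of
    zeros from a/b downwards, so poles prevail there. *)
Lemma state_step om : state om -> exists2 k : nat, (0 < k)%N & state (om + k%:R *: wsh false i).
Proof.
move=> [u [g [c [A [B [a1 [U [eu ft [a10 U0] lt1 [hU rU]]]]]]]]].
have [a [a0 lt2 ge2 rU2]] : exists a, [/\ a != 0, (cbl a A < cbl a B)%N,
  (cbl (b^-1 * a) B <= cbl (b^-1 * a) A)%N & forall k : nat, U.[a * b ^- k] != 0].
  have [K hK] := cbl_far (A ++ B) a10.
  pose Q k := (cbl (a1 * b ^- k) A < cbl (a1 * b ^- k) B)%N.
  have exQ : exists k, Q k by exists 0%N; rewrite /Q invr1 mulr1.
  have bQ k : Q k -> (k <= K)%N.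
  rewrite leqNgt; apply: contraL => Kk; have := hK k (ltnW Kk).
  by rewrite /Q /cbl count_cat => /eqP; rewrite addn_eq0 => /andP[/eqP -> /eqP ->].
  case: (ex_maxnP exQ bQ) => k Qk maxk; exists (a1 * b ^- k); split=> //.
  - by rewrite mulf_neq0 // invr_eq0 expf_neq0 // b_neq0.
  - rewrite leqNgt; apply/negP => h; have : (k.+1 <= k)%N; last by rewrite ltnn.
  by apply: maxk; rewrite /Q exprS invfM mulrCA.
  - by move=> j; rewrite -mulrA -invfM -exprD.
have Va0 : b^-1 * a != 0 by rewrite mulf_neq0 // invr_eq0 b_neq0.
have Ua : ~~ root U a by have := rU2 0%N; rewrite invr1 mulr1.
have nba : (b * a == a) = false.
  by apply/negbTE; rewrite mulrC; apply: (@bpow_neq 1).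
have nVba : (b^-1 * a == a) = false.
  by apply/negbTE; rewrite mulrC; apply: (@bpow_neq (-1)).
pose kk := (cbl (b^-1 * a) A - cbl (b^-1 * a) B).+1.
have Xn0 j : ('X - a%:P) ^+ j != 0 :> {poly F} by rewrite expf_neq0 // polyXsubC_eq0.
have loop j : (j <= kk)%N -> exists u' g' c', [/\ eig (om + j%:R *: wsh false i) u' g',
  fits g' c' (nseq j (b * a) ++ A) (nseq j (b^-1 * a) ++ B) &
  pap T (('X - a%:P) ^+ j * U) (xs true u') = 0].
  elim: j => [|j IH] jk.
  by exists u, g, c; rewrite scale0r addr0 mul1r.
  have [u' [g' [c' [eu' ft' hU']]]] := IH (ltnW jk).
  have [|u2 [g2 [c2 [e2 f2 h2]]]] := eig_lower eu' ft' a0 (mulf_neq0 (Xn0 j) U0) hU'.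
  rewrite !count_cat !count_nseq /= nba nVba.
  rewrite (mupM a (Xn0 j) U0) mup_XsubCX eqxx (mupNroot Ua) addn0.
  move: lt2; rewrite (cblE A a0) (cblE B a0) => lt3.
  have key (x z w t : nat) : (x + w < z + t)%N -> (t <= w)%N -> (j < (w - t).+1)%N -> (x + j < z)%N by lia.
  exact: key lt3 ge2 jk.
  exists u2, g2, c2; split=> //.
  by rewrite -natr1 scalerDl scale1r addrA.
  by rewrite exprS -mulrA.
have [u' [g' [c' [eu' ft' hU']]]] := loop kk (leqnn _).
exists kk => //; exists u', g', c', (nseq kk (b * a) ++ A), (nseq kk (b^-1 * a) ++ B), (b^-1 * a),
  (('X - a%:P) ^+ kk * U); split=> //.
- by split=> //; rewrite mulf_neq0.
- rewrite /cbl !count_cat !count_nseq below_up // belowE eqxx -!/(cbl _ _).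
  move: ge2; rewrite /kk; lia.
split=> // k; rewrite hornerM mulf_neq0 //.
  rewrite horner_exp expf_neq0 // hornerXsubC subr_eq0.
  rewrite (_ : b^-1 * a * b ^- k = a * b ^ (- k.+1%:Z)).
  exact: bpow_neq => //; lia.
  by rewrite -exprnN exprS invfM; ring.
by have := rU2 k.+1; rewrite exprS invfM mulrCA mulrA.
Qed.
Lemma wshE (e : bool) r mu : mu + r%:R *: wsh e i = if e then mu + sroot H i *+ r else mu - sroot H i *+ r.
Proof.
rewrite scalerA; case: e => /=; first by rewrite mulr1 scaler_nat.
by rewrite mulrN1 scaleNr scaler_nat.
Qed.
Lemma wstring_bound e mu : exists N : nat, forall (r : nat) v, (N <= r)%N ->
  W (mu + r%:R *: wsh e i) v -> v = 0.
Proof.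
have [N hN] := oi_str ho mu i; exists N => r v Nr; rewrite wshE.
by have [h1 h2] := hN r Nr; case: e; [apply: h1|apply: h2].
Qed.
Lemma no_state om : ~ state om.
Proof.
move=> st; have [N hN] := wstring_bound false om.
have P m : exists2 k : nat, (m <= k)%N & state (om + k%:R *: wsh false i).
  elim: m => [|m [k mk sk]]; first by exists 0%N => //; rewrite scale0r addr0.
  have [k' k'0 sk'] := state_step sk; exists (k + k')%N; first by lia.
  by rewrite natrD scalerDl addrA.
have [k Nk [u [g [c [A [B [a [U [[Wu u0 _] _ _ _ _]]]]]]]]] := P N.
by case/eqP: u0; apply: hN Wu.
Qed.
Definition corb (a : F) (L : seq F) : nat := count (inorb a) L.

Lemma inorb_b a y (m : int) : inorb a (b ^ m * y) = inorb a y.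
Proof.
have b0 := b_neq0.
apply/asboolP/asboolP => -[k e].
  exists (k - m); rewrite expfzDr // mulrA -e mulrC mulrA -expfzDr // addNr mul1r //.
by exists (k + m); rewrite e expfzDr //; ring.
Qed.
Lemma orb_top a (L : seq F) : a != 0 -> exists K : nat, forall k, (K <= k)%N ->
  forall y, y \in L -> inorb a y = below (a * b ^+ k) y.
Proof.
move=> a0; have b0 := b_neq0; elim: L => [|y L [K hK]]; first by exists 0%N.
have sub k : below (a * b ^+ k) y -> inorb a y.
  move=> /asboolP[m ->]; apply/asboolP; exists (k%:Z - m%:Z).
  by rewrite expfzDr // -exprnN mulrA.
have [[m em]|no] := pselect (exists m : int, y = a * b ^ m); last first.
  exists K => k Kk z; rewrite inE => /orP[/eqP ->|]; last exact: hK.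
  have -> : inorb a y = false by apply/asboolP.
  by apply/esym/negbTE/negP => /sub /asboolP.
exists (maxn K `|m|%N) => k; rewrite geq_max => /andP[Kk mk] z; rewrite inE => /orP[/eqP ->|]; last exact: hK.
have -> : inorb a y by apply/asboolP; exists m.
apply/esym/asboolP; exists (absz (k%:Z - m)).
rewrite em -mulrA; congr (_ * _).
have e1 : m = k%:Z - (absz (k%:Z - m))%:Z by lia.
by rewrite {1}e1 expfzDr // -exprnN.
Qed.
(** Raising by x^+ adds one zero and one pole in the same orbit, so an excess of poles in a full
    orbit persists up the string. If x^+ kills the vector, U = 1 and a point far enough up the orbit
    form a [state], which is excluded; so the string would never end. *)
Lemma count_orb om u g c A B a : eig om u g -> fits g c A B -> a != 0 -> (corb a B <= corb a A)%N.
Proof.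
move=> eu ft a0; rewrite leqNgt; apply/negP => lt.
pose bad mu := exists u g c A B, [/\ eig mu u g, fits g c A B & (corb a A < corb a B)%N].
have up mu : bad mu -> bad (mu + 1%:R *: wsh true i).
  move=> [u1 [g1 [c1 [A1 [B1 [eu1 ft1 lt1]]]]]].
  have [x0|x0] := pselect (xs true u1 = 0).
  exfalso; apply: (@no_state mu).
  have [K hK] := orb_top (A1 ++ B1) a0.
  exists u1, g1, c1, A1, B1, (a * b ^+ K), 1; split=> //.
  - by rewrite oner_eq0 mulf_neq0 // expf_neq0 // b_neq0.
  - have E L : {subset L <= A1 ++ B1} -> cbl (a * b ^+ K) L = corb a L.
  by move=> sL; apply: eq_in_count => y /sL yL; rewrite (hK K (leqnn K) y yL).
  by rewrite !E // => y yL; rewrite mem_cat yL ?orbT.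
  - by split=> [|k]; rewrite ?pap1 // hornerC.
  have [Wu1 u10 _] := eu1; have [P P0 hP] := xs_rec true mu.
  have Pn : P != 0 by apply: contraNneq P0 => ->; rewrite coef0.
  have [s es] := closed_field_poly_normal P.
  have sP : pap T (\prod_(z <- s) ('X - z%:P)) (xs true u1) = 0.
  have := hP u1 Wu1; rewrite es papZ => /eqP; rewrite scaler_eq0 lead_coef_eq0 (negbTE Pn).
  by move/eqP.
  have [S [a1 [a1s f0 Tf]]] := pap_geom x0 sP.
  have a10 : a1 != 0.
  apply: contraNneq P0 => e; rewrite -horner_coef0 -/(root P 0) es rootZ ?lead_coef_eq0 //.
  by rewrite root_prod_XsubC -e.
  have f00 : pap T S (xs true u1) 0 != 0.
  by apply/eqP => e; apply: f0; apply/funext => r; rewrite -[r]add0r (sht_geom a10 Tf) e scaler0.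
  have [g2 [eg2 fg2]] := eig_move eu1 a10 f00 Tf.
  have := fg2 _ _ _ ft1; cbv zeta; set c2 := c1 * _; rewrite mul1r => ft2.
  exists (pap T S (xs true u1) 0), g2, c2, (b^-1 * a1 :: A1), (b * a1 :: B1).
  split=> //; first by rewrite scale1r.
  rewrite /= -exprN1 -{2}[b]expr1z !inorb_b ltn_add2l; exact: lt1.
have [N hN] := wstring_bound true om.
have [u' [g' [c' [A' [B' [[Wu u0 _] _ _]]]]]] : bad (om + N%:R *: wsh true i).
  elim: N {hN} => [|N IH]; first by rewrite scale0r addr0; exists u, g, c, A, B.
  by have := up _ IH; rewrite -addrA -scalerDl natr1.
by case/eqP: u0; apply: hN Wu.
Qed.
(** The recurrences for x^+ on u and on x^- u together annihilate [delta g], through the commutator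
    of x^+ and x^-. *)
Lemma eig_fits om u g : eig om u g -> exists c A B, fits g c A B.
Proof.
move=> eu; have [Wu u0 hu] := eu.
have [P1 P10 hP1] := xs_rec true om; have [P2 P20 hP2] := xs_rec true (om + wsh false i).
have g0 e : g e 0%N != 0.
  apply/eqP => e0; have := hu e 0%N; rewrite e0 scale0r (rp_P0 hr) // Wu => /eqP.
  by rewrite scaler_eq0 (negbTE u0) (negbTE (qp_neq0 _)).
have k0 : (kai i)^-1 != 0 by rewrite invr_eq0 kai_neq0.
apply: (@fits_ex _ g (P1 * P2)) => //.
  by rewrite -horner_coef0 hornerM !horner_coef0 mulf_neq0.
apply/funext => r.
have h1 : pap T (P1 * P2) (xs true (op (LX false i 0) u)) = 0.
  by rewrite papMt hP2 ?pap0t //; apply: (wsp_x hr).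
have h2 : pap T (P1 * P2) (xs true u) = 0 by rewrite mulrC papMt hP1 ?pap0t.
have := congr1 (fun f : int -> V => f r) h1; rewrite pap_sht.
under eq_bigr => j _ do rewrite /xs (xy_delta _ _ eu) scalerDr addr0 scalerA.
rewrite big_split /= (pap_linear_map (P1 * P2) (xs true u) (oL (LX false i 0))) h2.
rewrite (linon0 (lsubT V) (oL _)) add0r -scaler_suml => /eqP.
rewrite scaler_eq0 (negbTE u0) orbF => /eqP h3.
apply: (mulfI k0); rewrite pap_sht mulr0 mulr_sumr -[RHS]h3; apply: eq_bigr => j _.
by rewrite mulrCA.
Qed.
End OneNode.

Section OintRec.
Variables (V : lmodType F) (op : lab -> V -> V) (ho : oint op).
Let hr := oi_rep ho.

Lemma x_rec e i ka : exists2 p : {poly F}, p != 0 &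
  forall d r v, wsp op ka v -> nrec p (fun s => op (LX e i (r + pm d * s%:Z)) v).
Proof.
have [p p0 hp] := xs_rec ho i e ka.
have pn0 : p != 0 by apply: contraNneq p0 => ->; rewrite coef0.
exists (p * rpol p); first by rewrite mulf_neq0 ?rpol_neq0.
by move=> d r v Wv; apply: (@nrec_rev _ _ p (fun r => op (LX e i r) v)); exact: hp.
Qed.
(** Up to a scalar phi_{s+1} is a commutator of x^+ and x^- with the mode of x^- fixed at 0, so it
    inherits their recurrences; the factor X skips s = 0, where both halves of phi would
    contribute. *)
Lemma ph_rec e i ka : exists2 p : {poly F}, p != 0 &
  forall v, wsp op ka v -> nrec p (fun s => op (LP e i s) v).
Proof.
have [p1 p10 h1] := x_rec true i ka.
have [p2 p20 h2] := x_rec true i (ka + wsh false i).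
exists ((p1 * p2) * 'X); first by rewrite !mulf_neq0 // polyX_eq0.
move=> v Wv; rewrite /nrec papMn.
have -> : pap (@shn F V) 'X (fun s => op (LP e i s) v) = fun s => op (LP e i s.+1) v.
  by rewrite -['X]mulr1 (pap_mulX (lsubT _)) // pap1.
pose c := (pm e)%:~R * (qd i - (qd i)^-1).
pose A s := op (LX true i (pm e + pm e * s%:Z)) (op (LX false i 0) v).
pose B s := op (LX false i 0) (op (LX true i (pm e + pm e * s%:Z)) v).
have -> : (fun s => op (LP e i s.+1) v) = c *: (A - B).
  apply/funext => s; have := rp_XX hr i i (pm e + pm e * s%:Z) 0 (I : setT v).
  rewrite eqxx -[(_ *: (A - B)) s]/(c *: (A s - B s)) /A /B => ->.
  rewrite /c scalerA -mulrA mulfV ?mulr1; last exact: (kai_neq0 i).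
  rewrite addr0 /zp; case: (e).
  have -> : (0 <= pm true * (pm true + pm true * s%:Z)) = true by rewrite /=; lia.
  have -> : (0 <= pm false * (pm true + pm true * s%:Z)) = false by rewrite /=; lia.
  have -> : absz (pm true + pm true * s%:Z) = s.+1 by rewrite /=; lia.
  by rewrite scale1r subr0.
  have -> : (0 <= pm true * (pm false + pm false * s%:Z)) = false by rewrite /=; lia.
  have -> : (0 <= pm false * (pm false + pm false * s%:Z)) = true by rewrite /=; lia.
  have -> : absz (pm false + pm false * s%:Z) = s.+1 by rewrite /=; lia.
  by rewrite scaleN1r sub0r opprK.
have nA : pap (@shn F V) (p1 * p2) A = 0.
  by apply: nrecMl; apply: h2; exact: (wsp_x hr).
have nB : pap (@shn F V) (p1 * p2) B = 0.
  apply: nrecMr; apply: (nrec_map (g := op (LX false i 0))); last exact: h1.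
  exact: (rp_lin hr).
have lin := pap_linn (M := V) (p1 * p2).
by rewrite (linZT lin) // (linBT lin) // nA nB subr0 scaler0.
Qed.
End OintRec.

Section Restrict.
Variables (E : lmodType F) (op : lab -> E -> E) (X Y : set E).
Lemma isrep_sub : isrep op X -> lsub Y -> (forall g v, Y v -> Y (op g v)) -> Y `<=` X -> isrep op Y.
Proof.
move=> hr sY stY YX; split=> //.
- by move=> g; apply: linon_sub YX (rp_lin hr g).
- by move=> *; apply: (rp_H0 hr); apply: YX.
- by move=> *; apply: (rp_KK hr); apply: YX.
- by move=> *; apply: (rp_K0 hr); apply: YX.
- by move=> *; apply: (rp_KH hr) => //; apply: YX.
- by move=> *; apply: (rp_HH hr) => //; apply: YX.
- by move=> *; apply: (rp_KX hr); apply: YX.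
- by move=> *; apply: (rp_HX hr) => //; apply: YX.
- by move=> *; apply: (rp_XX hr); apply: YX.
- by move=> *; apply: (rp_R5 hr); apply: YX.
- by move=> *; apply: (rp_P0 hr); apply: YX.
- by move=> *; apply: (rp_PS hr); apply: YX.
Qed.
Lemma wsp_comp om v s (f : 'Hom(hh H, rat^o) -> E) : isrep op X -> X v -> wsp op om v ->
  (forall om', X (f om') /\ wsp op om' (f om')) -> v = \sum_(om' <- s) f om' ->
  v = (count_mem om s)%:R *: f om.
Proof.
move=> hr Xv Wv hf ev; have sX := rp_sub hr; have lK a := rp_lin hr (LK a).
pose t := undup (om :: s).
have st : {subset s <= t} by move=> x xs; rewrite mem_undup inE xs orbT.
have ot : om \in t by rewrite mem_undup mem_head.
pose g om' := (count_mem om' s)%:R *: f om' - (if om' == om then v else 0).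
have sg : \sum_(om' <- t) g om' = 0.
  rewrite sumrB -(wsum_seq f (undup_uniq _) st) -ev (bigD1_seq om) ?undup_uniq //= eqxx big1 ?addr0 ?subrr //.
  by move=> o /negbTE ->.
have hg om' : om' \in t -> X (g om') /\ wsp op om' (g om').
  move=> _; have [Xf Wf] := hf om'.
  have X2 : X (if om' == om then v else 0) by case: eqP => // _; exact: subsp0 sX.
  have W2 : wsp op om' (if om' == om then v else 0).
  by case: eqP => [->//|_] a; rewrite (linon0 sX (lK a)) scaler0.
  have X1 := subspZ sX (count_mem om' s)%:R Xf.
  split; first exact: (subspB sX).
  move=> a; rewrite /g (linonB sX (lK a)) // (linonZ sX (lK a)) // Wf W2; lmod_in F.
have h := @wsp_graded E op X [set 0] (lsub0 _) lK sX _ t g (undup_uniq _) hg sg om ot.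
move: h; rewrite /g eqxx => h; apply/esym/eqP; rewrite -subr_eq0; apply/eqP; apply: h.
by move=> a x ->; rewrite (linon0 sX (lK a)).
Qed.
End Restrict.

Definition lw (g : lab) : hdual := if g is LX e i _ then wsh e i else 0.

(** * Triangular form of words in the operators *)

Section Closure.
Variables (E : lmodType F) (op : lab -> E -> E) (X : set E).
Hypothesis hr : isrep op X.
Local Notation wsp := (wsp op).
Let sX := rp_sub hr.
Let stX := rp_st hr.
Let lX := rp_lin hr.

Definition diag (g : lab) : Prop := forall e i r, g <> LX e i r.

(** All x with the signs and nodes listed in [l] and arbitrary modes; the modes are forgotten
    because the bounds on poles will not depend on them. *)
Definition pth (S : set E) (l : seq (bool * 'I_n)) : set E :=
  foldr (fun a Z => spanned [set f | exists r y, Z y /\ f = op (LX a.1 a.2 r) y]) S l.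

Definition lwt (l : seq (bool * 'I_n)) : hdual := \sum_(a <- l) wsh a.1 a.2.

Lemma pth_sub S l : lsub S -> lsub (pth S l).
Proof. by case: l => // a l _; apply: spanned_sub. Qed.
Lemma pth_X S l : S `<=` X -> pth S l `<=` X.
Proof.
move=> SX; elim: l => // a l IH; apply: spanned_min => // f [r [y [/IH Xy ->]]].
exact: stX.
Qed.
Lemma pth_step S l e i r y : pth S l y -> pth S ((e, i) :: l) (op (LX e i r) y).
Proof. by move=> hy; apply: sub_spanned; exists r, y. Qed.
Lemma pth_diag S l g : lsub S -> S `<=` X -> (forall g f, diag g -> S f -> S (op g f)) ->
  diag g -> forall f, pth S l f -> pth S l (op g f).
Proof.
move=> sS SX hS; elim: l g => [|a l IH] g dg0; first by move=> f; apply: hS.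
have sP := pth_sub (a :: l) sS.
apply: (spanned_map sX (lX g) sP) => [f [r [y [hy ->]]]|f [r [y [hy ->]]]].
  by apply: stX; apply: pth_X SX _ hy.
have Xy := pth_X SX hy.
case: g dg0 => [e i r'|b|i m|e i m] dg0; first by case: (dg0 e i r').
- rewrite (rp_KX hr) //; apply: (subspZ sP); apply: pth_step; exact: IH.
- have [->|m0] := eqVneq m 0; first by rewrite (rp_H0 hr i (stX (LX a.1 a.2 r) Xy)); apply: subsp0 sP.
  have /eqP := rp_HX hr i a.1 a.2 r Xy m0; rewrite subr_eq => /eqP ->.
  apply: (subspD sP); first by apply: (subspZ sP); apply: pth_step.
  by apply: pth_step; apply: IH.
- rewrite (ph_x hr) //; apply: (subsp_sum sP) => t _; apply: (subspZ sP).
  by apply: pth_step; apply: IH.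
Qed.

Variables (om0 : hdual) (S : set E).
Hypotheses (sS : lsub S) (SX : S `<=` X) (dS : forall g f, diag g -> S f -> S (op g f)).

Definition tri (lo up : seq 'I_n) : seq (bool * 'I_n) := [seq (false, i) | i <- lo] ++ [seq (true, i) | i <- up].

(** Lowering operators applied after raising ones, as in a triangular decomposition; the diagonal
    operators are absorbed by S, which they preserve. *)
Definition Gcl (om : hdual) : set E :=
  spanned [set f | exists lo up, pth S (tri lo up) f /\ om0 + lwt (tri lo up) = om].

Lemma lwt_cons a l : lwt (a :: l) = wsh a.1 a.2 + lwt l.
Proof. by rewrite /lwt big_cons. Qed.
Lemma Gcl_diag om g f : diag g -> Gcl om f -> Gcl om (op g f).
Proof.
move=> dg0; apply: (spanned_map sX (lX g) (spanned_sub _)) => [f' [lo [up [hf _]]]|f' [lo [up [hf e]]]].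
  exact: pth_X hf.
by apply: sub_spanned; exists lo, up; split=> //; apply: pth_diag.
Qed.
Lemma Gcl_xm om i r f : Gcl om f -> Gcl (om + wsh false i) (op (LX false i r) f).
Proof.
apply: (spanned_map sX (lX _) (spanned_sub _)) => [f' [lo [up [hf _]]]|f' [lo [up [hf e]]]].
  exact: pth_X hf.
apply: sub_spanned; exists (i :: lo), up; split; first exact: pth_step.
by rewrite -e lwt_cons addrA addrAC.
Qed.
(** x^+ travels to the right past the lowering operators; each commutator is a combination of phi,
    absorbed by [Gcl_diag]. *)
Lemma Gcl_xp0 lo up i r f : pth S (tri lo up) f ->
  Gcl (om0 + lwt (tri lo up) + wsh true i) (op (LX true i r) f).
Proof.
elim: lo r f => [|j lo IH] r f.
  move=> hf; apply: sub_spanned; exists [::], (i :: up); split; first exact: pth_step.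
  by rewrite lwt_cons addrA addrAC.
apply: (spanned_map sX (lX _) (spanned_sub _)) => [f' [r' [y [hy ->]]]|f' [r' [y [hy ->]]]].
  by apply: stX; apply: pth_X hy.
have Xy := pth_X SX hy.
have /eqP := rp_XX hr i j r r' Xy; rewrite subr_eq => /eqP ->.
have sG := spanned_sub [set f | exists lo0 up0, pth S (tri lo0 up0) f /\
  om0 + lwt (tri lo0 up0) = om0 + lwt (tri (j :: lo) up) + wsh true i].
have wc : wsh true i + wsh false i = 0 by rewrite /wsh scaleN1r scale1r subrr.
apply: (subspD sG).
  case: eqP => [e|_]; last exact: subsp0 sG.
  have Gy : Gcl (om0 + lwt (tri (j :: lo) up) + wsh true i) y.
  apply: sub_spanned; exists lo, up; split=> //; rewrite -e lwt_cons.
  by rewrite [wsh false i + _]addrC !addrA -[RHS]addrA [wsh false i + _]addrC wc addr0.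
  apply: (subspZ sG); apply: (subspB sG); rewrite /zp; case: ifP => _; try exact: subsp0 sG;
  exact: Gcl_diag.
have e : om0 + lwt (tri lo up) + wsh true i + wsh false j = om0 + lwt (tri (j :: lo) up) + wsh true i.
  have h (a b c d : hdual) : a + b + c + d = a + (d + b) + c by lmod_in rat.
  by rewrite lwt_cons; exact: h.
by have := @Gcl_xm _ j r' _ (IH r y hy); rewrite e.
Qed.
Lemma Gcl_op om g f : Gcl om f -> Gcl (om + lw g) (op g f).
Proof.
case: g => [e i r|a|i m|e i m]; rewrite ?addr0; try exact: Gcl_diag.
case: e; last exact: Gcl_xm.
apply: (spanned_map sX (lX _) (spanned_sub _)) => [f' [lo [up [hf _]]]|f' [lo [up [hf e]]]].
  exact: pth_X hf.
by rewrite -e; apply: Gcl_xp0.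
Qed.
Definition wapp (w : seq (lab)) (f : E) : E := foldr op f w.
Definition lws (w : seq (lab)) : hdual := \sum_(g <- w) lw g.

(** Reordering replaces words of any length by triangular ones of the same weight, for which a bound
    on the raising part is enough. *)
Lemma Gcl_words w f : S f -> Gcl (om0 + lws w) (wapp w f).
Proof.
move=> Sf; elim: w => [|g w IH].
  apply: sub_spanned; exists [::], [::]; split=> //.
  by rewrite /lwt /lws !big_nil.
by rewrite /lws big_cons [lw g + _]addrC addrA; apply: Gcl_op.
Qed.
Lemma lwt_tri lo up : lwt (tri lo up) = \sum_i sroot H i *+ (count_mem i up) - \sum_i sroot H i *+ (count_mem i lo).
Proof.
have aux e (s : seq 'I_n) : lwt [seq (e, i) | i <- s] = (pm e)%:~R *: \sum_i sroot H i *+ (count_mem i s).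
  elim: s => [|j s IH]; first by rewrite /lwt big_nil big1 ?scaler0 // => i _; rewrite mulr0n.
  rewrite lwt_cons IH -scalerDr; congr (_ *: _).
  under [RHS]eq_bigr do rewrite mulrnDr.
  rewrite big_split; congr (_ + _).
  by rewrite (bigD1 j) //= eqxx big1 ?addr0 // => i /negbTE; rewrite eq_sym => ->; rewrite mulr0n.
by rewrite /lwt big_cat -!/(lwt _) !aux scale1r scaleN1r addrC.
Qed.
Lemma sum_count (s : seq 'I_n) : (\sum_i count_mem i s)%N = size s.
Proof.
elim: s => [|j s IH]; first by rewrite big1.
rewrite big_split IH (bigD1 j) //= eqxx big1 // => i /negbTE.
by rewrite eq_sym => ->.
Qed.
(** Simple roots are independent, so the weight fixes the difference of the two lengths. *)
Lemma tri_size lo up lo' up' : lwt (tri lo up) = lwt (tri lo' up') ->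
  (size up + size lo' = size up' + size lo)%N.
Proof.
rewrite !lwt_tri => e.
have e2 : \sum_i sroot H i *+ (count_mem i up + count_mem i lo') = \sum_i sroot H i *+ (count_mem i up' + count_mem i lo).
  under eq_bigr do rewrite mulrnDr; under [RHS]eq_bigr do rewrite mulrnDr.
  rewrite !big_split; move/eqP: e; rewrite subr_eq addrAC eq_sym subr_eq => /eqP e.
  exact: esym.
have := sroot_comb_inj e2 => h.
by rewrite -!sum_count -!big_split; apply: eq_bigr => i _; exact: h.
Qed.
End Closure.

(** * The trivial module, giving the unit *)

Section Trivial.

Definition triv (g : lab) (v : F^o) : F^o :=
  match g with
  | LX _ _ _ | LH _ _ => 0
  | LK _ => v
  | LP _ _ m => if m == 0%N then v else 0
  end.

Lemma triv_rep : isrep triv setT.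
Proof.
have lin0 : linon setT (fun _ : F^o => 0 : F^o) by move=> c u v _ _; rewrite scaler0 addr0.
split=> //.
- by case=> [e i r|a|i m|e i [|m]]; try exact: lin0; move=> c u v _ _.
- by move=> *; rewrite scaler0.
- by move=> *; rewrite subrr scaler0.
- move=> i j r r' v _; rewrite subrr; case: ifP => // _.
  rewrite /zp /= absz_eq0.
  by case: (r + r' =P 0) => [->|_]; rewrite ?subrr ?scaler0 // !if_same subrr scaler0.
- by move=> *; rewrite scaler0.
- move=> e i [|m] v _; first by rewrite big_ord0 scale0r.
  by rewrite scaler0 big1 // => j _; rewrite scaler0.
Qed.
Lemma triv_wsp om (v : F^o) : wsp triv om v -> v != 0 -> om = 0 :> hdual.
Proof.
move=> Wv v0; apply/eqP/negPn/negP => /hdual_sep[a].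
have := Wv a; rewrite /= => /eqP; rewrite eq_sym -subr_eq0 -[X in _ - X]scale1r -scalerBl scaler_eq0 (negbTE v0) orbF subr_eq0.
move=> /eqP /qp_eq1 ->; by rewrite zero_lfunE.
Qed.
Lemma triv_wsp0 : wsp triv (0 : hdual) = setT.
Proof.
by apply/seteqP; split=> // v _ a; rewrite zero_lfunE (qd_0 hq) scale1r.
Qed.
Lemma triv_oint : oint triv.
Proof.
split; first exact: triv_rep.
- move=> v; exists [:: 0], (fun om => if om == 0 then v else 0); split.
  move=> om; case: eqP => [->|_]; first by rewrite triv_wsp0.
  by move=> a; rewrite scaler0.
  by rewrite big_seq1 eqxx.
- move=> om; exists 1%N => m b m1 _.
  have [j0 [j1 jn]] : exists j0 j1 : 'I_m, j1 != j0.
  by exists (Ordinal (ltnW m1)), (Ordinal m1).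
  have [b0|b0] := eqVneq (b j0) 0.
  exists (fun i => (i == j0)%:R); first by exists j0; rewrite eqxx oner_neq0.
  rewrite (bigD1 j0) //= eqxx scale1r b0 add0r big1 // => i /negbTE ->; exact: scale0r.
  exists (fun i => if i == j0 then - b j1 else if i == j1 then b j0 else 0).
  by exists j1; rewrite (negbTE jn) eqxx.
  rewrite (bigD1 j0) // eqxx (bigD1 j1) //= (negbTE jn) eqxx big1 ?addr0; last first.
  by move=> i /andP[/negbTE -> /negbTE ->]; exact: scale0r.
  by rewrite scaleNr /GRing.scale /= mulrC addNr.
- exists [:: 0] => om [v Wv v0]; exists 0; rewrite ?inE // (triv_wsp Wv v0).
  by exists (fun _ => 0%N); rewrite subrr big1.
- move=> mu i.
  have a0 : sroot H i != 0.
  apply/eqP => e; have := sroot_scoroot H i i.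
  by rewrite e zero_lfunE cmat_diag => /eqP; rewrite eq_sym.
  have inj (r s : nat) : sroot H i *+ r = sroot H i *+ s -> r = s.
  move=> /eqP; rewrite -!scaler_nat -subr_eq0 -scalerBl scaler_eq0 (negbTE a0) orbF subr_eq0 eqr_nat.
  by move/eqP.
  pose X1 := [set r : nat | mu + sroot H i *+ r = 0]; pose X2 := [set r : nat | mu - sroot H i *+ r = 0].
  exists (xget 0%N X1 + xget 0%N X2).+1 => r hr.
  have h1 : ~ X1 r.
  move=> hX; have e1 : X1 (xget 0%N X1) := @xgetPex _ 0%N X1 (ex_intro _ r hX).
  have /addrI/inj e := etrans (hX : _ = 0) (esym (e1 : _ = 0)).
  by move: hr; rewrite -e ltnNge leq_addr.
  have h2 : ~ X2 r.
  move=> hX; have e1 : X2 (xget 0%N X2) := @xgetPex _ 0%N X2 (ex_intro _ r hX).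
  have /addrI/oppr_inj/inj e := etrans (hX : _ = 0) (esym (e1 : _ = 0)).
  by move: hr; rewrite -e ltnNge leq_addl.
  by split=> v Wv; apply: contrapT => /eqP v0; [apply: h1|apply: h2]; exact: triv_wsp Wv v0.
Qed.
End Trivial.

(** * The deformed Drinfeld coproduct *)

Section Tensor.
Variables (V W : lmodType F) (oV : lab -> V -> V) (oW : lab -> W -> W).
Hypotheses (hV : oint oV) (hW : oint oW).
Let rV := oi_rep hV.
Let rW := oi_rep hW.
Local Notation E := (V -> int -> W).

Lemma eD (f g : E) v k : (f + g) v k = f v k + g v k. Proof. by []. Qed.
Lemma eN (f : E) v k : (- f) v k = - f v k. Proof. by []. Qed.
Lemma eZ c (f : E) v k : (c *: f) v k = c *: f v k. Proof. by []. Qed.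
Lemma e0 v k : (0 : E) v k = 0. Proof. by []. Qed.
Lemma eS (J : Type) (r : seq J) (P : pred J) (f : J -> E) v k :
  (\sum_(j <- r | P j) f j) v k = \sum_(j <- r | P j) f j v k.
Proof. by rewrite !fct_sumE. Qed.
Lemma eext (f g : E) : (forall v k, f v k = g v k) -> f = g.
Proof. by move=> h; apply/funext => v; apply/funext => k. Qed.
Definition bb (B : int) (f : E) := forall v k, k < B -> f v k = 0.
Definition elin (f : E) := forall k, linon setT (fun v => f v k).
(** The integer argument is the exponent of u: an element is a linear map from V to Laurent series
    over W, with a lower bound on exponents uniform in v. *)
Definition MX : set E := [set f | elin f /\ exists B, bb B f].

(** Precomposition reverses products, so V has to act through an anti-involution; this one fixes k,
    h and phi, which keeps weights and l-weights. *)
Definition antil (g : lab) : lab := if g is LX e i r then LX (~~ e) i r else g.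
(** W is twisted by u to this degree; the coproduct sums then converge coefficientwise. *)
Definition dg (g : lab) : int :=
  match g with LX _ _ r => r | LK _ => 0 | LH _ m => m | LP e _ m => pm e * m%:Z end.

Definition Aop (g : lab) (f : E) : E := fun v k => f (oV (antil g) v) k.
Definition Bop (g : lab) (f : E) : E := fun v k => oW g (f v (k - dg g)).

Let LW g : linon setT (oW g) := rp_lin rW g.
Let LV g : linon setT (oV g) := rp_lin rV g.
Let oW0 g : oW g 0 = 0. Proof. exact: lin0T (LW g). Qed.
Lemma MX_sub : lsub MX.
Proof.
split=> [|c f g [lf [B bf]] [lg [B' bg]]].
  by split=> [k c u v _ _|]; rewrite ?scaler0 ?addr0 //; exists 0.
split=> [k d u v _ _|].
  by rewrite !(eD, eZ) (lf k) // (lg k) //; lmod_in F.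
exists (Order.min B B') => v k; rewrite lt_min => /andP[h1 h2].
by rewrite eD eZ bf // bg // scaler0 addr0.
Qed.
Lemma Aop_bb g B f : bb B f -> bb B (Aop g f).
Proof. by move=> bf v k /bf; apply. Qed.
Lemma Bop_bb g B f : bb B f -> bb (B + dg g) (Bop g f).
Proof. by move=> bf v k kB; rewrite /Bop bf // ltrBlDr. Qed.
Lemma Aop_st g f : MX f -> MX (Aop g f).
Proof.
move=> [lf [B bf]]; split; last by exists B; apply: Aop_bb.
by move=> k c u v _ _; rewrite /Aop LV // (lf k).
Qed.
Lemma Bop_st g f : MX f -> MX (Bop g f).
Proof.
move=> [lf [B bf]]; split; last by exists (B + dg g); apply: Bop_bb.
by move=> k c u v _ _; rewrite /Bop (lf (k - dg g)) // LW.
Qed.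
Lemma Aop_lin g : linon setT (Aop g). Proof. by []. Qed.
Lemma Bop_lin g : linon setT (Bop g).
Proof. by move=> c f f' _ _; apply: eext => v k; rewrite /Bop LW. Qed.
Lemma zp_A e i m (f : E) v k : elin f -> zp Aop e i m f v k = f (zp oV e i m v) k.
Proof. by move=> lf; rewrite /zp; case: ifP => // _; rewrite (lin0T (lf k)). Qed.
Lemma zp_B e i m (f : E) v k : zp Bop e i m f v k = zp oW e i m (f v (k - m)).
Proof.
rewrite /zp; case: ifP => // h; rewrite /Bop; congr (oW _ (f v _)).
by move: h; case: (e) => /= h; lia.
Qed.
Lemma pmN e : pm (~~ e) = - pm e. Proof. by case: e. Qed.
Lemma Aop_rep : isrep Aop MX.
Proof.
have fB (f : E) (lf : elin f) u v k : f (u - v) k = f u k - f v k.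
  by rewrite (linBT (lf k)).
have fZ (f : E) (lf : elin f) c v k : f (c *: v) k = c *: f v k.
  by rewrite (linZT (lf k)).
split.
- exact: MX_sub.
- exact: Aop_st.
- by move=> g; apply: linon_sub (Aop_lin g).
- move=> i f [lf _]; apply: eext => v k.
  by rewrite /Aop (rp_H0 rV) // (lin0T (lf k)).
- by move=> a b f [lf _]; apply: eext => v k; rewrite /Aop (rp_KK rV) // addrC.
- by move=> f [lf _]; apply: eext => v k; rewrite /Aop (rp_K0 rV).
- by move=> a j m f [lf _] m0; apply: eext => v k; rewrite /Aop (rp_KH rV).
- by move=> i m j m' f [lf _] m0 m0'; apply: eext => v k; rewrite /Aop (rp_HH rV).
- move=> a e j r f [lf _]; apply: eext => v k; rewrite /Aop eZ.
  rewrite (rp_KX rV) // fZ // scalerA -(qd_D hq) -mulrDl pmN -intrD subrr mul0r (qd_0 hq) scale1r //.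
- move=> i m e j r f [lf _] m0; apply: eext => v k; rewrite eD /Aop.
  rewrite -fB // -opprB (rp_HX rV) // -scaleNr fZ // pmN; congr (_ *: _); rewrite intrN; ring.
- move=> i j r r' f [lf _]; apply: eext => v k; rewrite eD /Aop -fB // (rp_XX rV) // eq_sym.
  case: eqP => [->|_]; last by rewrite (lin0T (lf k)).
  by rewrite fZ // fB // [r' + r]addrC -!zp_A.
- move=> e i j r r' f [lf _]; apply: eext => v k; rewrite !(eD, eN, eZ) /Aop /=.
  have := congr1 (fun w => f (- (q ^ (pm e * bmat D i j)) *: w) k) (rp_R5 rV (~~ e) i j r r' (I : setT v)).
  have bb' : q ^ (pm e * bmat D i j) * q ^ (pm (~~ e) * bmat D i j) = 1.
  by rewrite -expfzDr ?(qd_neq0 hq) // pmN mulNr subrr.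
  rewrite !fZ // !fB // !fZ // !scalerBr !scalerA !mulNr bb' !scaleN1r !opprK => e1.
  move: e1; move: (q ^ (pm e * _)) => b e1.
  by rewrite addrC -scaleNr e1; lmod_in F.
- by move=> e i f [lf _]; apply: eext => v k; rewrite /Aop (rp_P0 rV).
- move=> e i m f [lf _]; apply: eext => v k; rewrite eZ eS /Aop -fZ // (rp_PS rV) //.
  rewrite (linsT (lf k)); apply: eq_bigr => j _.
  by rewrite fZ // (phH_comm rV).
Qed.
Lemma Bop_rep : isrep Bop MX.
Proof.
have sh (f : E) v k a b c : a + b = c -> f v (k - a - b) = f v (k - c).
  by move=> <-; rewrite -addrA -opprD.
split.
- exact: MX_sub.
- exact: Bop_st.
- by move=> g; apply: linon_sub (Bop_lin g).
- by move=> i f _; apply: eext => v k; rewrite /Bop (rp_H0 rW).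
- by move=> a b f _; apply: eext => v k; rewrite /Bop (rp_KK rW) !subr0.
- by move=> f _; apply: eext => v k; rewrite /Bop (rp_K0 rW) subr0.
- by move=> a j m f _ m0; apply: eext => v k; rewrite /Bop (rp_KH rW) // !subr0.
- by move=> i m j m' f _ m0 m0'; apply: eext => v k; rewrite /Bop (rp_HH rW) // -addrA [- m - _]addrC addrA.
- by move=> a e j r f _; apply: eext => v k; rewrite eZ /Bop (rp_KX rW) !subr0.
- move=> i m e j r f _ m0; apply: eext => v k; rewrite eD eN /Bop.
  rewrite (sh f v k m r (m + r)) // (sh f v k r m (m + r)) ?(addrC r) //; exact: (rp_HX rW).
- move=> i j r r' f _; apply: eext => v k; rewrite eD eN /Bop.
  rewrite (sh f v k r r' (r + r')) // (sh f v k r' r (r + r')) ?(addrC r') // (rp_XX rW) //.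
  by case: eqP => // ->; rewrite eZ eD eN !zp_B.
- move=> e i j r r' f _; apply: eext => v k; rewrite !(eD, eN, eZ) /Bop.
  rewrite (sh f v k (r + 1) r' (r + r' + 1)); last by ring.
  rewrite (sh f v k r' (r + 1) (r + r' + 1)); last by ring.
  rewrite (sh f v k r (r' + 1) (r + r' + 1)) ?addrA // (sh f v k (r' + 1) r (r + r' + 1)); last by ring.
  exact: (rp_R5 rW).
- move=> e i f _; apply: eext => v k; rewrite /Bop /= mulr0; exact: (rp_P0 rW).
- move=> e i m f _; apply: eext => v k; rewrite eZ eS (rp_PS rW) //.
  apply: eq_bigr => j _; rewrite eZ; congr (_ *: oW _ (oW _ _)).
  have jm := ltn_ord j; rewrite (sh f v k _ _ (pm e * m%:Z)) // -mulrDr; congr (_ * _).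
  by rewrite -PoszD; congr Posz; lia.
Qed.
Definition PP (e : bool) (g : lab) : E -> E := if e then Aop g else Bop g.
Lemma PP_rep e : isrep (PP e) MX.
Proof. by case: e; [exact: Aop_rep|exact: Bop_rep]. Qed.
Lemma PP_lin e g : linon setT (PP e g).
Proof. by case: e; [exact: Aop_lin|exact: Bop_lin]. Qed.
Lemma PP_st e g f : MX f -> MX (PP e g f). Proof. exact: (rp_st (PP_rep e)). Qed.
Lemma PP_comm e g g' f : PP e g (PP (~~ e) g' f) = PP (~~ e) g' (PP e g f).
Proof. by case: e. Qed.
Definition pdg (e : bool) g : int := if e then 0 else dg g.
Lemma PP_bb e g B f : bb B f -> bb (B + pdg e g) (PP e g f).
Proof. by case: e => bf; [rewrite addr0; apply: Aop_bb|apply: Bop_bb]. Qed.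
(** An infinite sum taken coefficient by coefficient; the default 0 stands where infinitely many
    terms contribute, which does not happen for families satisfying [sm]. *)
Definition nsum (f : nat -> E) : E := fun v k =>
  if pselect (exists N, forall s, (N <= s)%N -> f s v k = 0) is left h
  then \sum_(s < projT1 (cid h)) f s v k else 0.

Definition bg (B : int) (f : nat -> E) := forall s : nat, bb (B + s%:Z) (f s).
(** The s-th term starts s degrees later, so each coefficient receives finitely many
    contributions. *)
Definition sm (f : nat -> E) := (forall s, elin (f s)) /\ exists B, bg B f.

Lemma nsumN (f : nat -> E) v k N : (forall s, (N <= s)%N -> f s v k = 0) ->
  nsum f v k = \sum_(s < N) f s v k.
Proof.
have ge M M' : (M <= M')%N -> (forall s, (M <= s)%N -> f s v k = 0) ->
  \sum_(s < M) f s v k = \sum_(s < M') f s v k.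
  move=> le hM; rewrite -(subnKC le) big_split_ord [X in _ = _ + X]big1 ?addr0 // => j _.
  by apply: hM; rewrite leq_addr.
move=> hN; rewrite /nsum; case: pselect => [h|[]]; last by exists N.
case: cid => M hM; case: (leqP M N) => [le|/ltnW le]; first exact: ge.
by rewrite (ge N M).
Qed.
Lemma nsumE B f v k N : bg B f -> k < B + N%:Z -> nsum f v k = \sum_(s < N) f s v k.
Proof. by move=> bf kN; apply: nsumN => s Ns; apply: bf; lia. Qed.
Lemma big_nat_bnd (B k : int) : exists N : nat, k < B + N%:Z.
Proof. by exists (absz (k - B)).+1; lia. Qed.
Lemma bg_le B B' f : B' <= B -> bg B f -> bg B' f.
Proof. by move=> le bf s v k h; apply: bf; lia. Qed.
Lemma nsum_bb B f : bg B f -> bb B (nsum f).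
Proof. by move=> bf v k kB; rewrite (nsumE (N := 0) _ bf) ?addr0 // big_ord0. Qed.
Lemma nsum_MX f : sm f -> MX (nsum f).
Proof.
move=> [lf [B bf]]; split; last by exists B; apply: nsum_bb.
move=> k c u v _ _; have [N hN] := big_nat_bnd B k.
rewrite !(nsumE _ bf hN) scaler_sumr -big_split; apply: eq_bigr => s _.
by rewrite (lf s k).
Qed.
Lemma sm_lin c f g : sm f -> sm g -> sm (fun s => c *: f s + g s).
Proof.
move=> [lf [B bf]] [lg [B' bg']]; split.
  move=> s k d u v _ _; rewrite !(eD, eZ) (lf s k) // (lg s k) //; lmod_in F.
exists (Order.min B B') => s v k h; rewrite eD eZ bf ?bg' ?scaler0 ?addr0 //.
  by apply: lt_le_trans h _; rewrite lerD2r ge_min lexx orbT.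
by apply: lt_le_trans h _; rewrite lerD2r ge_min lexx.
Qed.
Lemma nsum_lin c f g : sm f -> sm g -> nsum (fun s => c *: f s + g s) = c *: nsum f + nsum g.
Proof.
move=> [lf [B bf]] [lg [B' bg']]; apply: eext => v k.
have bf' : bg (Order.min B B') f by apply: bg_le bf; rewrite ge_min lexx.
have bg'' : bg (Order.min B B') g by apply: bg_le bg'; rewrite ge_min lexx orbT.
have [N hN] := big_nat_bnd (Order.min B B') k.
rewrite eD eZ (nsumE _ bf' hN) (nsumE _ bg'' hN) (nsumN (N := N)).
  by rewrite scaler_sumr -big_split.
by move=> s Ns; rewrite eD eZ bf' ?bg'' ?scaler0 ?addr0 //; apply: lt_le_trans hN _; lia.
Qed.
Lemma sm0 : sm (fun=> 0).
Proof. by split=> [s k c u v _ _|]; rewrite ?scaler0 ?addr0 //; exists 0. Qed.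
Lemma nsum0 : nsum (fun=> 0) = 0.
Proof. by apply: eext => v k; rewrite (nsumN (N := 0)) // big_ord0. Qed.
Lemma nsum_ext f g : (forall s, f s = g s) -> nsum f = nsum g.
Proof. by move=> h; congr nsum; apply/funext. Qed.
Lemma nsumZ c f : sm f -> nsum (fun s => c *: f s) = c *: nsum f.
Proof.
move=> hf; have := nsum_lin c hf sm0; rewrite nsum0 addr0 => <-.
by apply: nsum_ext => s; rewrite addr0.
Qed.
Lemma nsumD f g : sm f -> sm g -> nsum (fun s => f s + g s) = nsum f + nsum g.
Proof.
by move=> hf hg; rewrite -[X in X + _]scale1r -nsum_lin //; apply: nsum_ext => s; rewrite scale1r.
Qed.
Lemma smZ c f : sm f -> sm (fun s => c *: f s).
Proof.
move=> hf; rewrite (_ : (fun s => c *: f s) = fun s => c *: f s + 0); first exact: (sm_lin c hf sm0).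
by apply/funext => s; rewrite addr0.
Qed.
Lemma nsumB f g : sm f -> sm g -> nsum (fun s => f s - g s) = nsum f - nsum g.
Proof.
move=> hf hg; rewrite -scaleN1r -nsumZ // -nsumD //; last exact: smZ.
by apply: nsum_ext => s; rewrite scaleN1r.
Qed.
Lemma sm_PP e g f : sm f -> sm (fun s => PP e g (f s)).
Proof.
move=> [lf [B bf]]; split=> [s|].
  by have [] // := @PP_st e g (f s); split=> //; exists (B + s%:Z).
exists (B + pdg e g) => s; rewrite addrAC; exact: PP_bb.
Qed.
Lemma nsum_PP e g f : sm f -> PP e g (nsum f) = nsum (fun s => PP e g (f s)).
Proof.
move=> hf; have [_ [B' b']] := sm_PP e g hf; have [lf [B bf]] := hf; apply: eext => v k.
case: e b' => b'; first by [].
have [N1 hN1] := big_nat_bnd B (k - dg g); have [N2 hN2] := big_nat_bnd B' k.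
have h1 : k - dg g < B + (N1 + N2)%N%:Z by apply: lt_le_trans hN1 _; lia.
have h2 : k < B' + (N1 + N2)%N%:Z by apply: lt_le_trans hN2 _; lia.
by rewrite (nsumE _ b' h2) /PP /Bop (nsumE _ bf h1) (linsT (LW g)).
Qed.
Lemma nsumS f : sm f -> nsum f = f 0%N + nsum (fun s => f s.+1).
Proof.
move=> [lf [B bf]]; apply: eext => v k; have [N hN] := big_nat_bnd B k.
have b1 : bg B (fun s => f s.+1) by move=> s v' k' h; apply: bf; lia.
rewrite eD (nsumE (N := N.+1) _ bf) ?(nsumE _ b1 hN) ?big_ord_recl //.
by apply: lt_le_trans hN _; lia.
Qed.
Lemma sm_S f : sm f -> sm (fun s => f s.+1).
Proof.
move=> [lf [B bf]]; split=> //; exists B => s v' k' h; apply: bf; lia.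
Qed.
Lemma nsum_shift f m : sm f -> (forall s, (s < m)%N -> f s = 0) -> nsum f = nsum (fun s => f (m + s)%N).
Proof.
elim: m f => [|m IH] f sf f0; first exact: nsum_ext.
rewrite nsumS // f0 // add0r IH //; last by move=> s sm'; apply: f0.
exact: sm_S.
Qed.
Definition sm2 (g : nat -> nat -> E) :=
  (forall s t, elin (g s t)) /\ exists B, forall s t, bb (B + s%:Z + t%:Z) (g s t).
Lemma sm2r g s : sm2 g -> sm (g s).
Proof. by move=> [lg [B bg']]; split=> //; exists (B + s%:Z) => t; apply: bg'. Qed.
Lemma sm2l g t : sm2 g -> sm (g^~ t).
Proof.
by move=> [lg [B bg']]; split=> [s|]; [apply: lg|exists (B + t%:Z) => s; rewrite addrAC; apply: bg'].
Qed.
Lemma sm2_nsum g : sm2 g -> sm (fun s => nsum (g s)).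
Proof.
move=> hg; have [lg [B bg']] := hg; split=> [s|]; first by have [] := nsum_MX (sm2r s hg).
by exists B => s; apply: nsum_bb => t; apply: bg'.
Qed.
Lemma nsum2E g B v k N : (forall s t, bb (B + s%:Z + t%:Z) (g s t)) -> k < B + N%:Z ->
  nsum (fun s => nsum (g s)) v k = \sum_(s < N) \sum_(t < N) g s t v k.
Proof.
move=> b hN; have b1 s : bg (B + s%:Z) (g s) by move=> t; apply: b.
rewrite (@nsumE B _ v k N) //; last by move=> s; apply: nsum_bb; apply: b1.
by apply: eq_bigr => s _; rewrite (nsumE (N := N) _ (b1 s)) //; lia.
Qed.
Lemma nsum_exch g : sm2 g -> nsum (fun s => nsum (g s)) = nsum (fun t => nsum (g^~ t)).
Proof.
move=> [lg [B b]]; apply: eext => v k; have [N hN] := big_nat_bnd B k.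
rewrite (nsum2E _ b hN) (nsum2E _ _ hN) 1?exchange_big // => s t.
by rewrite addrAC; apply: b.
Qed.
Lemma nsum_cauchy g : sm2 g ->
  nsum (fun m => \sum_(l < m.+1) g l (m - l)%N) = nsum (fun l => nsum (g l)).
Proof.
move=> [lg [B b]]; apply: eext => v k; have [N hN] := big_nat_bnd B k.
rewrite (nsum2E _ b hN) (@nsumE B _ v k N) //; last first.
  move=> m v' k' h; rewrite eS big1 // => l _; apply: b; have := ltn_ord l; lia.
transitivity (\sum_(m < N) \sum_(l < N | (l < m.+1)%N) g l (m - l)%N v k).
  apply: eq_bigr => m _; rewrite eS.
  exact: big_ord_widen N (fun l => g l (m - l)%N v k) (ltn_ord m).
rewrite (exchange_big_dep xpredT) //; apply: eq_bigr => l _.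
rewrite (sum_sub N l (fun t => g l t v k)).
rewrite (big_ord_widen N (fun t => g l t v k) (leq_subr l N)) [in LHS]big_mkcond.
apply: eq_bigr => t _; case: ifP => // /negbT; rewrite -leqNgt => h.
by rewrite b //; have := ltn_ord l; lia.
Qed.
Lemma nsum_R5 b f1 f2 f3 f4 : sm f1 -> sm f2 -> sm f3 -> sm f4 ->
  (forall s, f1 s - b *: f2 s = b *: f3 s - f4 s) ->
  nsum f1 - b *: nsum f2 = b *: nsum f3 - nsum f4.
Proof.
move=> h1 h2 h3 h4 h; rewrite -nsumZ // -nsumZ // -!nsumB //; try exact: smZ.
exact: nsum_ext.
Qed.
Lemma nsum2_R5 b g1 g2 g3 g4 : sm2 g1 -> sm2 g2 -> sm2 g3 -> sm2 g4 ->
  (forall s t, g1 s t - b *: g2 s t = b *: g3 s t - g4 s t) ->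
  nsum (fun s => nsum (g1 s)) - b *: nsum (fun s => nsum (g2 s)) =
  b *: nsum (fun s => nsum (g3 s)) - nsum (fun s => nsum (g4 s)).
Proof.
move=> h1 h2 h3 h4 h; apply: nsum_R5; try exact: sm2_nsum.
by move=> s; apply: nsum_R5 => //; exact: sm2r.
Qed.
(** The terms of the infinite part. x^+_r goes to x^+_r on V plus the sum of phi^-_{-s} on V times
    x^+_{r+s} on W; x^-_r goes to x^-_r on W plus the sum of x^-_{r-s} on V times phi^+_s on W. With
    [PP] both signs share one formula. *)
Definition Fx e i (r : int) (f : E) (s : nat) : E :=
  PP (~~ e) (LX e i (r + pm e * s%:Z)) (PP e (LP (~~ e) i s) f).
Definition DX e i (r : int) f : E := PP e (LX e i r) f + nsum (Fx e i r f).
Definition Dop (g : lab) (f : E) : E :=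
  match g with
  | LX e i r => DX e i r f
  | LK a => Aop (LK a) (Bop (LK a) f)
  | LH i m => Aop (LH i m) f + Bop (LH i m) f
  | LP e i m => \sum_(s < m.+1) Aop (LP e i s) (Bop (LP e i (m - s)) f)
  end.

Lemma sm_Fx e i r f : MX f -> sm (Fx e i r f).
Proof.
move=> hf; split=> [s|]; first by have [] := PP_st (~~ e) (LX e i (r + pm e * s%:Z)) (PP_st e (LP (~~ e) i s) hf).
have [_ [B bf]] := hf; exists (B + (if e then r else 0)) => s.
have := @PP_bb (~~ e) (LX e i (r + pm e * s%:Z)) _ _ (@PP_bb e (LP (~~ e) i s) _ _ bf).
by rewrite /Fx; case: (e) => /= h v k kB; apply: h; move: kB; lia.
Qed.
Lemma Fx_lin e i r c f g s : Fx e i r (c *: f + g) s = c *: Fx e i r f s + Fx e i r g s.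
Proof. by rewrite /Fx !PP_lin. Qed.
Lemma nsum_Fx_lin e i r c f g : MX f -> MX g ->
  nsum (Fx e i r (c *: f + g)) = c *: nsum (Fx e i r f) + nsum (Fx e i r g).
Proof.
move=> hf hg; rewrite -nsum_lin; [|exact: sm_Fx|exact: sm_Fx].
by apply: nsum_ext => s; exact: Fx_lin.
Qed.
Lemma DX_lin e i r : linon MX (DX e i r).
Proof. by move=> c f g hf hg; rewrite /DX PP_lin // nsum_Fx_lin //; lmod_in F. Qed.
Lemma DX_st e i r f : MX f -> MX (DX e i r f).
Proof.
by move=> hf; apply: (subspD MX_sub); [exact: PP_st|apply/nsum_MX/sm_Fx].
Qed.
Let bmatC i j : bmat D i j = bmat D j i. Proof. exact: symz_sym. Qed.
(** The exchange relation [ph_x1] arranged like (R5). The side carrying the higher index of phi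
    depends on the sign, whence the companion [phx_F]. *)
Lemma phx_T e i j s (r : int) f : MX f -> e = true ->
  PP e (LX e i (r + 1)) (PP e (LP (~~ e) j s.+1) f)
  - q ^ (pm e * bmat D i j) *: PP e (LP (~~ e) j s.+1) (PP e (LX e i (r + 1)) f) =
  q ^ (pm e * bmat D i j) *: PP e (LX e i r) (PP e (LP (~~ e) j s) f)
  - PP e (LP (~~ e) j s) (PP e (LX e i r) f).
Proof.
move=> hf ->; set b := q ^ _; set op := PP true.
have := ph_x1 (PP_rep true) false true j i s (r + 1) hf; rewrite -/op /gb /= addrK.
have -> : q ^ (-1 * 1 * bmat D j i) = b^-1 by rewrite mulr1 -bmatC /b mul1r mulN1r -invr_expz.
have b0 : b != 0 by rewrite expfz_neq0 // (qd_neq0 hq).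
move=> /(congr1 (fun w => (- b) *: w)); rewrite !scalerBr !scalerA !mulNr mulfV // !scaleN1r !opprK.
by move=> h; rewrite addrC -scaleNr; apply: (addIr (op (LP false j s) (op (LX true i r) f)));
  rewrite addrAC h; lmod_in F.
Qed.
Lemma phx_F e i j s (r : int) f : MX f -> e = false ->
  PP e (LX e i (r + 1)) (PP e (LP (~~ e) j s) f)
  - q ^ (pm e * bmat D i j) *: PP e (LP (~~ e) j s) (PP e (LX e i (r + 1)) f) =
  q ^ (pm e * bmat D i j) *: PP e (LX e i r) (PP e (LP (~~ e) j s.+1) f)
  - PP e (LP (~~ e) j s.+1) (PP e (LX e i r) f).
Proof.
move=> hf ->; set b := q ^ _; set op := PP false.
have := ph_x1 (PP_rep false) true false j i s r hf; rewrite -/op /gb.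
have -> : q ^ (pm true * pm false * bmat D j i) = b by rewrite -bmatC.
rewrite -[r + 1]/(r + pm true) -[~~ false]/true => h; apply/eqP; rewrite -subr_eq0; apply/eqP.
move/eqP: h; rewrite -subr_eq0 => /eqP <-; lmod_in F.
Qed.
Lemma ph0x e i j r f : MX f -> PP e (LP (~~ e) j 0) (PP e (LX e i r) f) =
  q ^ (- bmat D i j) *: PP e (LX e i r) (PP e (LP (~~ e) j 0) f).
Proof.
move=> hf; rewrite (ph0_x (PP_rep e)) // bmatC; congr (q ^ _ *: _).
by case: (e) => /=; ring.
Qed.
(** Terms of (R5) with one finite and one infinite factor. The relation holds term by term after the
    summation index of one side is shifted by one, and the isolated terms s = 0 cancel by [ph0x]. *)
Lemma DX_mix e i j (r r' : int) f : MX f ->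
  PP e (LX e i (r + 1)) (nsum (Fx e j r' f))
  - q ^ (pm e * bmat D i j) *: nsum (Fx e j r' (PP e (LX e i (r + 1)) f)) =
  q ^ (pm e * bmat D i j) *: PP e (LX e i r) (nsum (Fx e j (r' + 1) f))
  - nsum (Fx e j (r' + 1) (PP e (LX e i r) f)).
Proof.
move=> hf; set b := q ^ _.
have hx r0 := PP_st e (LX e i r0) hf.
have s1 a c : sm (fun s => PP e (LX e i a) (Fx e j c f s)) by apply/sm_PP/sm_Fx.
rewrite (nsum_PP e _ (sm_Fx _ _ _ hf)) (nsum_PP e _ (sm_Fx _ _ _ hf)).
have b0 : b != 0 by rewrite /b expfz_neq0 // (qd_neq0 hq).
have E1 a c s : PP e (LX e i a) (Fx e j c f s) =
  PP (~~ e) (LX e j (c + pm e * s%:Z)) (PP e (LX e i a) (PP e (LP (~~ e) j s) f)).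
  by rewrite /Fx PP_comm.
have lin0 x y c g : PP (~~ e) g x - c *: PP (~~ e) g y = PP (~~ e) g (x - c *: y).
  by rewrite (linBT (@PP_lin _ _)) ?(linZT (@PP_lin _ _)).
have lin1 x y c g : c *: PP (~~ e) g x - PP (~~ e) g y = PP (~~ e) g (c *: x - y).
  by rewrite (linBT (@PP_lin _ _)) ?(linZT (@PP_lin _ _)).
case ee : (e == true).
  have Z a c : PP e (LX e i a) (Fx e j c f 0) - b *: Fx e j c (PP e (LX e i a) f) 0%N = 0.
  rewrite E1 /Fx ph0x // (linZT (@PP_lin _ _)) scalerA -expfzDr ?(qd_neq0 hq) //.
  have pe : pm e = 1 by rewrite (eqP ee).
  by rewrite pe !mul1r subrr scale1r subrr.
  rewrite (nsumS (s1 (r + 1) r')) (nsumS (sm_Fx e j r' (hx (r + 1)))).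
  rewrite scalerDr opprD addrACA Z add0r.
  apply: nsum_R5 => [||||s].
  - exact: sm_S (s1 _ _).
  - exact: sm_S (sm_Fx _ _ _ (hx _)).
  - exact: s1.
  - exact: sm_Fx.
  rewrite !E1 /Fx lin0 (phx_T _ _ _ _ hf (eqP ee)).
  have -> : r' + pm e * s.+1%:Z = r' + 1 + pm e * s%:Z by rewrite (eqP ee) /=; lia.
  by [].
have e2 : e = false by case: (e) ee.
have Z a c : b *: PP e (LX e i a) (Fx e j c f 0) - Fx e j c (PP e (LX e i a) f) 0%N = 0.
  rewrite /Fx ph0x // /b.
  by rewrite e2 !mulN1r subrr.
rewrite (nsumS (s1 r (r' + 1))) (nsumS (sm_Fx e j (r' + 1) (hx r))).
rewrite scalerDr opprD [RHS]addrACA Z add0r.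
apply: nsum_R5 => [||||s].
- exact: s1.
- exact: sm_Fx.
- exact: sm_S (s1 _ _).
- exact: sm_S (sm_Fx _ _ _ (hx _)).
rewrite !E1 /Fx lin0 (phx_F _ _ _ _ hf e2).
have -> : r' + 1 + pm e * s.+1%:Z = r' + pm e * s%:Z by rewrite e2 /=; lia.
by [].
Qed.
Lemma DX_dd e i j (r r' : int) f : MX f ->
  let G s t := PP (~~ e) (LX e i (r + pm e * s%:Z)) (PP (~~ e) (LX e j (r' + pm e * t%:Z))
  (PP e (LP (~~ e) i s) (PP e (LP (~~ e) j t) f))) in
  sm2 G /\ nsum (Fx e i r (nsum (Fx e j r' f))) = nsum (fun s => nsum (G s)).
Proof.
move=> hf G; split.
  split=> [s t|]; first by have [] : MX (G s t) by do 4! apply: PP_st.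
  have [_ [B bf]] := hf; exists (B + (if e then r + r' else 0)) => s t.
  have := @PP_bb (~~ e) (LX e i (r + pm e * s%:Z)) _ _ (@PP_bb (~~ e) (LX e j (r' + pm e * t%:Z)) _ _
  (@PP_bb e (LP (~~ e) i s) _ _ (@PP_bb e (LP (~~ e) j t) _ _ bf))).
  by rewrite /G; case: (e) => /= h v k kB; apply: h; move: kB; lia.
apply: nsum_ext => s; rewrite {1}/Fx.
have h1 := sm_Fx e j r' hf.
rewrite (nsum_PP e _ h1) (nsum_PP (~~ e) _ (sm_PP e _ h1)).
by apply: nsum_ext => t; rewrite PP_comm.
Qed.
Lemma DX_R5 e i j (r r' : int) f : MX f ->
  DX e i (r + 1) (DX e j r' f) - q ^ (pm e * bmat D i j) *: DX e j r' (DX e i (r + 1) f) =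
  q ^ (pm e * bmat D i j) *: DX e i r (DX e j (r' + 1) f) - DX e j (r' + 1) (DX e i r f).
Proof.
move=> hf; have M1 := DX_mix e i j r r' hf; have M2 := DX_mix e j i r' r hf.
have AA := rp_R5 (PP_rep e) e i j r r' hf.
have DD : nsum (Fx e i (r + 1) (nsum (Fx e j r' f)))
  - q ^ (pm e * bmat D i j) *: nsum (Fx e j r' (nsum (Fx e i (r + 1) f))) =
  q ^ (pm e * bmat D i j) *: nsum (Fx e i r (nsum (Fx e j (r' + 1) f)))
  - nsum (Fx e j (r' + 1) (nsum (Fx e i r f))).
  have [s1 ->] := DX_dd e i j (r + 1) r' hf; have [s2 ->] := DX_dd e j i r' (r + 1) hf.
  have [s3 ->] := DX_dd e i j r (r' + 1) hf; have [s4 ->] := DX_dd e j i (r' + 1) r hf.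
  rewrite (nsum_exch s2) (nsum_exch s4).
  have sw g : sm2 g -> sm2 (fun s t => g t s).
  by move=> [lg [B b]]; split=> // ; exists B => s t; rewrite addrAC.
  apply: nsum2_R5 => //; try exact: sw.
  move=> s t; set w := PP e _ (PP e _ f); have hw : MX w by do 2! apply: PP_st.
  have := rp_R5 (PP_rep (~~ e)) e i j (r + pm e * s%:Z) (r' + pm e * t%:Z) hw.
  rewrite -(phph_comm (PP_rep e) _ _ _ _ _ _ hf).
  by rewrite [r + 1 + _]addrAC [r' + 1 + _]addrAC.
rewrite bmatC in M2.
have hX k r0 : MX (PP e (LX e k r0) f) by exact: PP_st.
have hN k r0 : MX (nsum (Fx e k r0 f)) by apply/nsum_MX/sm_Fx.
have ex k r0 l r1 : DX e k r0 (DX e l r1 f) =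
  PP e (LX e k r0) (PP e (LX e l r1) f) + PP e (LX e k r0) (nsum (Fx e l r1 f))
  + (nsum (Fx e k r0 (PP e (LX e l r1) f)) + nsum (Fx e k r0 (nsum (Fx e l r1 f)))).
  rewrite {1}/DX (linonD (@PP_lin _ _)) //.
  have := @nsum_Fx_lin e k r0 1 _ _ (hX l r1) (hN l r1).
  by rewrite !scale1r => ->.
rewrite !ex; move: AA M1 M2 DD; move: (q ^ _) => b.
exact: r5_comb.
Qed.
Lemma DX_HX i m e j (r : int) f : MX f -> m != 0 ->
  Dop (LH i m) (DX e j r f) - DX e j r (Dop (LH i m) f) =
  ((pm e)%:~R / m%:~R * qnum q (m * bmat D i j)) *: DX e j (m + r) f.
Proof.
move=> hf m0; set c := _ * _.
have DH g : Dop (LH i m) g = PP e (LH i m) g + PP (~~ e) (LH i m) g.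
  by case: (e) => //=; rewrite addrC.
have h1 : MX (PP e (LH i m) f) by exact: PP_st.
have h2 : MX (PP (~~ e) (LH i m) f) by exact: PP_st.
have hX : MX (PP e (LX e j r) f) by exact: PP_st.
have sF r0 := sm_Fx e j r0 hf.
have e1 : PP e (LH i m) (nsum (Fx e j r f)) = nsum (Fx e j r (PP e (LH i m) f)).
  rewrite (nsum_PP e _ (sF r)); apply: nsum_ext => s.
  by rewrite PP_comm (phH_comm (PP_rep e)).
have e2 : PP (~~ e) (LH i m) (nsum (Fx e j r f)) =
  nsum (Fx e j r (PP (~~ e) (LH i m) f)) + c *: nsum (Fx e j (m + r) f).
  rewrite (nsum_PP (~~ e) _ (sF r)) -nsumZ // -nsumD; [|exact: sm_Fx|exact: smZ].
  apply: nsum_ext => s; rewrite /Fx PP_comm -[m + r + _]addrA.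
  apply/eqP; rewrite [X in _ == X]addrC -subr_eq; apply/eqP; apply: (rp_HX (PP_rep (~~ e))) => //.
  exact: PP_st.
have e3 : PP e (LH i m) (PP e (LX e j r) f) =
  PP e (LX e j r) (PP e (LH i m) f) + c *: PP e (LX e j (m + r)) f.
  by apply/eqP; rewrite addrC -subr_eq; apply/eqP; apply: (rp_HX (PP_rep e)).
rewrite !DH (linonD (DX_lin e j r)) // !(linonD (@PP_lin _ _)) // e1 e2 e3.
rewrite -PP_comm /DX; lmod_in F.
Qed.
Lemma DX_KX a e j (r : int) f : MX f ->
  Dop (LK a) (DX e j r f) = qp ((pm e)%:~R * sroot H j a) *: DX e j r (Dop (LK a) f).
Proof.
move=> hf; set c := qp _.
have DK g : Dop (LK a) g = PP e (LK a) (PP (~~ e) (LK a) g) by case: (e).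
have sF := sm_Fx e j r hf.
have h1 : MX (PP (~~ e) (LK a) f) by exact: PP_st.
have h2 : MX (PP e (LK a) f) by exact: PP_st.
rewrite !DK scalerDr !(linonD (@PP_lin _ _)) //; congr (_ + _).
  rewrite -PP_comm -(rp_KX (PP_rep e)) //.
rewrite (nsum_PP (~~ e) _ sF) (nsum_PP e); last exact: sm_PP.
rewrite -nsumZ; last by apply: sm_Fx; apply: PP_st.
apply: nsum_ext => s; rewrite (rp_KX (PP_rep (~~ e))); last exact: PP_st.
rewrite (linZT (@PP_lin _ _)) PP_comm; congr (_ *: _).
by rewrite -(PP_comm e (LP (~~ e) j s) (LK a)) (phK_comm (PP_rep e)) //; exact: PP_st.
Qed.
Lemma Dop_PS e i m f : MX f -> m%:R *: Dop (LP e i m) f =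
  \sum_(j < m) (j.+1%:R * ((pm e)%:~R * (q - q^-1))) *:
  Dop (LH i (pm e * j.+1%:Z)) (Dop (LP e i (m - j.+1)%N) f).
Proof.
move=> hf; rewrite /Dop.
pose c (j : nat) : F := j.+1%:R * ((pm e)%:~R * (q - q^-1)).
pose h (j : nat) : lab := LH i (pm e * j.+1%:Z).
pose T a b := Aop (LP e i a) (Bop (LP e i b) f).
transitivity (\sum_(s < m.+1) (s%:R *: T s (m - s)%N + (m - s)%:R *: T s (m - s)%N)).
  rewrite scaler_sumr; apply: eq_bigr => s _; rewrite -scalerDl -natrD subnKC //.
  by rewrite -ltnS.
rewrite big_split /=.
transitivity (\sum_(j < m) c j *: Aop (h j) (\sum_(t < (m - j.+1).+1) T t (m - j.+1 - t)%N) +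
  \sum_(j < m) c j *: Bop (h j) (\sum_(t < (m - j.+1).+1) T t (m - j.+1 - t)%N)); last first.
  by rewrite -big_split; apply: eq_bigr => j _; rewrite scalerDr.
congr (_ + _).
  transitivity (\sum_(s < m.+1) \sum_(j < m | (j < s)%N) c j *: Aop (h j) (T (s - j.+1)%N (m - s)%N)).
  apply: eq_bigr => s _; rewrite (rp_PS Aop_rep); last exact: Bop_st.
  exact: big_ord_widen m (fun j => c j *: Aop (h j) (T (s - j.+1)%N (m - s)%N)) (leq_ord s).
  rewrite (exchange_big_dep xpredT) //; apply: eq_bigr => j _.
  rewrite (linsT (@Aop_lin _)) scaler_sumr.
  have jm := ltn_ord j.
  rewrite -(_ : m.+1 - j.+1 = (m - j.+1).+1)%N; last by lia.
  rewrite -(sum_sub m.+1 j.+1 (fun t => c j *: Aop (h j) (T t (m - j.+1 - t)%N))).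
  by apply: eq_bigr => s js; congr (_ *: Aop _ (T _ _)); lia.
transitivity (\sum_(s < m.+1) \sum_(j < m | (j < m - s)%N) c j *: Bop (h j) (T s (m - s - j.+1)%N)).
  apply: eq_bigr => s _; rewrite -(linZT (@Aop_lin _)) (rp_PS Bop_rep) //.
  rewrite (linsT (@Aop_lin _)).
  rewrite (big_ord_widen m (fun j => Aop (LP e i s) (c j *: Bop (h j) (Bop (LP e i (m - s - j.+1)) f))) (leq_subr s m)).
  exact: eq_bigr => j _; rewrite (linZT (@Aop_lin _)).
rewrite (exchange_big_dep xpredT) //; apply: eq_bigr => j _.
rewrite (linsT (@Bop_lin _)) scaler_sumr.
have jm := ltn_ord j.
have le : ((m - j.+1).+1 <= m.+1)%N by lia.
rewrite (big_ord_widen m.+1 (fun t => c j *: Bop (h j) (T t (m - j.+1 - t)%N)) le).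
by apply: eq_big => s; [lia|move=> _; congr (_ *: Bop _ (T _ _)); lia].
Qed.
Lemma zp_pos op e i (k : nat) (g : E) : zp op e i (pm e * k%:Z) g = op (LP e i k) g.
Proof.
rewrite /zp; have -> : (0 <= pm e * (pm e * k%:Z)) by case: (e) => /=; lia.
by have -> : absz (pm e * k%:Z) = k by case: (e) => /=; lia.
Qed.
Lemma zp_neg op e i k (g : E) : (0 <= pm e * k) = false -> zp op e i k g = 0.
Proof. by rewrite /zp => ->. Qed.
Lemma nsum_fin (g : nat -> E) N : (forall s, (N <= s)%N -> g s = 0) -> nsum g = \sum_(s < N) g s.
Proof.
by move=> h; apply: eext => v k; rewrite (@nsumN _ _ _ N) ?eS // => s /h ->.
Qed.
Lemma sm_zA e i (m : int) f : MX f -> sm (fun t => zp Aop e i (m - t%:Z) (Bop (LP true i t) f)).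
Proof.
move=> hf; split=> [s|].
  by rewrite /zp; case: ifP => _; [have [] : MX (Aop (LP e i (absz (m - s%:Z))) (Bop (LP true i s) f)) by apply: Aop_st; apply: Bop_st|have [h _] := sm0; exact: h 0%N].
have [_ [B bf]] := hf; exists B => s v k kB; rewrite /zp; case: ifP => // _.
by rewrite /Aop; apply: (@Bop_bb (LP true i s) _ _ bf); rewrite /= mul1r.
Qed.
Lemma sm_zB e i (m : int) f : MX f -> sm (fun s => zp Bop e i (m + s%:Z) (Aop (LP false i s) f)).
Proof.
move=> hf; split=> [s|].
  by rewrite /zp; case: ifP => _; [have [] : MX (Bop (LP e i (absz (m + s%:Z))) (Aop (LP false i s) f)) by apply: Bop_st; apply: Aop_st|have [h _] := sm0; exact: h 0%N].
have [_ [B bf]] := hf; exists (B + m) => s v k kB; rewrite zp_B /Aop bf; last by lia.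
by rewrite /zp; case: ifP; rewrite ?oW0.
Qed.
(** Both sums run over the pairs of indices of phi^+ on W and phi^- on V with difference m; these
    are the products that must cancel in (R4). *)
Lemma zcross i (m : int) f : MX f ->
  nsum (fun t => zp Aop false i (m - t%:Z) (Bop (LP true i t) f)) =
  nsum (fun s => zp Bop true i (m + s%:Z) (Aop (LP false i s) f)).
Proof.
move=> hf; have [m0|m0] := leP 0 m.
  rewrite (@nsum_shift _ (absz m)); last 1 first.
  - by move=> s sl; apply: zp_neg; rewrite /=; lia.
  - apply: nsum_ext => s; have -> : m - (absz m + s)%N%:Z = pm false * s%:Z by rewrite /=; lia.
  have -> : m + s%:Z = pm true * (absz m + s)%N%:Z by rewrite /=; lia.
  by rewrite !zp_pos.
  exact: sm_zA.
rewrite [RHS](@nsum_shift _ (absz m)); last 1 first.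
- by move=> s sl; apply: zp_neg; rewrite /=; lia.
- apply: nsum_ext => s; have -> : m + (absz m + s)%N%:Z = pm true * s%:Z by rewrite /=; lia.
  have -> : m - s%:Z = pm false * (absz m + s)%N%:Z by rewrite /=; lia.
  by rewrite !zp_pos.
exact: sm_zB.
Qed.
Lemma zdiagT i (m : int) f : nsum (fun t => zp Aop true i (m - t%:Z) (Bop (LP true i t) f)) = zp Dop true i m f.
Proof.
have [m0|m0] := leP 0 m; last first.
  rewrite [RHS]zp_neg -?[RHS]nsum0; last by rewrite /=; lia.
  by apply: nsum_ext => s; apply: zp_neg; rewrite /=; lia.
have em : m = pm true * (absz m)%:Z by rewrite /=; lia.
rewrite em zp_pos -em (@nsum_fin _ (absz m).+1); last first.
  by move=> s ls; apply: zp_neg; rewrite /=; lia.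
rewrite (reindex_inj rev_ord_inj) /=; apply: eq_bigr => s _; rewrite subSS.
have ls := ltn_ord s.
rewrite /zp ifT /=; last by lia.
by have -> : absz (m - (absz m - s)%N%:Z) = s by lia.
Qed.
Lemma zdiagF i (m : int) f : nsum (fun s => zp Bop false i (m + s%:Z) (Aop (LP false i s) f)) = zp Dop false i m f.
Proof.
have [m0|m0] := leP m 0; last first.
  rewrite [RHS]zp_neg -?[RHS]nsum0; last by rewrite /=; lia.
  by apply: nsum_ext => s; apply: zp_neg; rewrite /=; lia.
have em : m = pm false * (absz m)%:Z by rewrite /=; lia.
rewrite em zp_pos (@nsum_fin _ (absz m).+1); last first.
  by move=> s ls; apply: zp_neg; rewrite /=; lia.
apply: eq_bigr => s _; have ls := ltn_ord s.
rewrite /zp ifT /=; last by lia.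
by rewrite -[LHS]/(Aop _ (Bop _ _)); congr (Aop _ (Bop (LP _ _ _) _)); lia.
Qed.
Lemma sm2_st (g : nat -> nat -> E) B : (forall s t, MX (g s t)) ->
  (forall s t, bb (B + s%:Z + t%:Z) (g s t)) -> sm2 g.
Proof. by move=> h1 h2; split; [move=> s t; case: (h1 s t)|exists B]. Qed.
(** Reordering phi and x on V in one product and on W in the other produces the kernel [gser] with
    the same parameter q^(B i j), so both double sums become the same triple sum of [K]. *)
Lemma DX_cross i j (r r' : int) f : MX f ->
  nsum (Fx true i r (nsum (Fx false j r' f))) = nsum (Fx false j r' (nsum (Fx true i r f))).
Proof.
move=> hf; have [_ [B bf]] := hf.
pose K l s t := Bop (LX true i (r + l%:Z + s%:Z)) (Bop (LP true j t)
  (Aop (LX false j (r' - t%:Z - l%:Z)) (Aop (LP false i s) f))).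
pose g (l : nat) := gser (q ^ bmat D i j) l.
have GM h1 h2 h3 h4 : MX (Bop h1 (Bop h2 (Aop h3 (Aop h4 f)))).
  by do 2 apply: Bop_st; do 2 apply: Aop_st.
have Gb h1 h2 h3 h4 := @Bop_bb h1 _ _ (@Bop_bb h2 _ _ (@Aop_bb h3 _ _ (@Aop_bb h4 _ _ bf))).
have gKM l s t : MX (g l *: K l s t) by apply: (subspZ MX_sub); exact: GM.
have gKb l s t : bb (B + r + l%:Z + s%:Z + t%:Z) (g l *: K l s t).
  by move=> v k kB; rewrite eZ /K Gb ?scaler0 //=; lia.
have kern t : sm2 (fun l s => g l *: K l s t).
  by apply: (@sm2_st _ (B + r + t%:Z)) => l s // v k kB; apply: gKb; move: kB; lia.
have kern' s : sm2 (fun l t => g l *: K l s t).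
  by apply: (@sm2_st _ (B + r + s%:Z)) => l t // v k kB; apply: gKb; move: kB; lia.
have T1 : nsum (Fx true i r (nsum (Fx false j r' f))) =
  nsum (fun t => nsum (fun l => nsum (fun s => g l *: K l s t))).
  pose G s t := Bop (LX true i (r + s%:Z)) (Bop (LP true j t)
  (Aop (LP false i s) (Aop (LX false j (r' - t%:Z)) f))).
  have s2G : sm2 G.
  by apply: (@sm2_st _ (B + r)) => s t; [exact: GM|move=> v k kB; rewrite /G Gb //=; lia].
  transitivity (nsum (fun s => nsum (G s))).
  apply: nsum_ext => s; rewrite {1}/Fx.
  have h1 := sm_Fx false j r' hf.
  rewrite (nsum_PP false _ (sm_PP true _ h1)).
  by apply: nsum_ext => t; rewrite /Fx mul1r mulN1r.
  rewrite (nsum_exch s2G); apply: nsum_ext => t.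
  rewrite -nsum_cauchy; last exact: kern.
  apply: nsum_ext => s; rewrite /G (ph_x Aop_rep) //.
  rewrite !(linsT (@Bop_lin _)); apply: eq_bigr => l _.
  rewrite !(linZT (@Bop_lin _)) /gb !mul1r mulN1r.
  congr (_ *: Bop (LX _ _ _) _); have := ltn_ord l; lia.
have T2 : nsum (Fx false j r' (nsum (Fx true i r f))) =
  nsum (fun s => nsum (fun l => nsum (fun t => g l *: K l s t))).
  pose G t s := Bop (LP true j t) (Bop (LX true i (r + s%:Z))
  (Aop (LX false j (r' - t%:Z)) (Aop (LP false i s) f))).
  have s2G : sm2 G.
  by apply: (@sm2_st _ (B + r)) => t s; [exact: GM|move=> v k kB; rewrite /G Gb //=; lia].
  transitivity (nsum (fun t => nsum (G t))).
  apply: nsum_ext => t; rewrite {1}/Fx.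
  have h1 := sm_Fx true i r hf.
  rewrite (nsum_PP false _ h1).
  by apply: nsum_ext => s; rewrite /Fx mul1r mulN1r.
  rewrite (nsum_exch s2G); apply: nsum_ext => s.
  rewrite -nsum_cauchy; last exact: kern'.
  apply: nsum_ext => t; rewrite /G (ph_x Bop_rep); last by apply: Aop_st; apply: Aop_st.
  apply: eq_bigr => l _; have ll := ltn_ord l.
  rewrite /gb !mul1r bmatC.
  have -> : r + s%:Z + l%:Z = r + l%:Z + s%:Z by lia.
  by have -> : r' - t%:Z = r' - (t - l)%N%:Z - l%:Z by lia.
rewrite T1 T2.
transitivity (nsum (fun t => nsum (fun s => nsum (fun l => g l *: K l s t)))).
  by apply: nsum_ext => t; exact: nsum_exch.
transitivity (nsum (fun s => nsum (fun t => nsum (fun l => g l *: K l s t)))).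
  rewrite nsum_exch //; apply: (@sm2_st _ (B + r)) => t s.
  by apply: nsum_MX; apply: sm2l s (kern t).
  by apply: nsum_bb => l v k kB; apply: gKb; move: kB; lia.
by apply: nsum_ext => s; rewrite -(nsum_exch (kern' s)).
Qed.
(** Finite parts commute and infinite parts commute by [DX_cross]. [c2] and [c3] are the two
    remaining commutators; [zcross] cancels one half of each, and the other halves are the
    coproducts of phi^+ and phi^-. *)
Lemma DX_XX i j (r r' : int) f : MX f ->
  DX true i r (DX false j r' f) - DX false j r' (DX true i r f) =
  if i == j then (qd i - (qd i)^-1)^-1 *:
  (zp Dop true i (r + r') f - zp Dop false i (r + r') f) else 0.
Proof.
move=> hf.
have hA : MX (Aop (LX true i r) f) by exact: Aop_st.
have hB : MX (Bop (LX false j r') f) by exact: Bop_st.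
have sT := sm_Fx true i r hf; have sF := sm_Fx false j r' hf.
have hT := nsum_MX sT; have hF := nsum_MX sF.
pose c2 := nsum (fun t => if i == j then (qd i - (qd i)^-1)^-1 *:
  (zp Aop true i (r + r' - t%:Z) (Bop (LP true i t) f)
  - zp Aop false i (r + r' - t%:Z) (Bop (LP true i t) f)) else 0).
have C2 : Aop (LX true i r) (nsum (Fx false j r' f)) - nsum (Fx false j r' (Aop (LX true i r) f)) = c2.
  rewrite -[Aop _ _]/(PP true _ _) (nsum_PP true _ sF) -nsumB; [|exact: sm_PP|exact: sm_Fx].
  apply: nsum_ext => t; rewrite /Fx.
  have hw : MX (Bop (LP true j t) f) by exact: Bop_st.
  have := rp_XX Aop_rep i j r (r' + -1 * t%:Z) hw.
  by rewrite mulN1r addrA; case: eqP => [->|_].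
pose c3 := nsum (fun s => if i == j then (qd i - (qd i)^-1)^-1 *:
  (zp Bop true i (r + r' + s%:Z) (Aop (LP false i s) f)
  - zp Bop false i (r + r' + s%:Z) (Aop (LP false i s) f)) else 0).
have C3 : nsum (Fx true i r (Bop (LX false j r') f)) - Bop (LX false j r') (nsum (Fx true i r f)) = c3.
  rewrite -[Bop _ (nsum _)]/(PP false _ _) (nsum_PP false _ sT) -nsumB; [|exact: sm_Fx|exact: sm_PP].
  apply: nsum_ext => s; rewrite /Fx.
  have hw : MX (Aop (LP false i s) f) by exact: Aop_st.
  have := rp_XX Bop_rep i j (r + 1 * s%:Z) r' hw.
  by rewrite mul1r [r + _ + r']addrAC.
have ex : DX true i r (DX false j r' f) - DX false j r' (DX true i r f) = c2 + c3.
  rewrite -C2 -C3 /DX /=.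
  have lA := linonD (@Aop_lin (LX true i r)); rewrite lA //.
  have lB := linonD (@Bop_lin (LX false j r')); rewrite lB //.
  have := @nsum_Fx_lin true i r 1 _ _ hB hF; rewrite !scale1r => ->.
  have := @nsum_Fx_lin false j r' 1 _ _ hA hT; rewrite !scale1r => ->.
  rewrite DX_cross // -[Bop _ (Aop _ _)]/(Aop _ (Bop _ _)); lmod_in F.
rewrite ex /c2 /c3; case: eqP => [_|_]; last by rewrite !nsum0 addr0.
have zA e := sm_zA e i (r + r') hf; have zB e := sm_zB e i (r + r') hf.
have smB g h : sm g -> sm h -> sm (fun s => g s - h s).
  move=> sg sh; have := sm_lin (-1) sh sg; rewrite (_ : (fun s => _) = fun s => g s - h s) //.
  by apply/funext => s; rewrite scaleN1r addrC.
rewrite !nsumZ ?nsumB //; [|exact: smB|exact: smB].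
rewrite zcross // zdiagT zdiagF; lmod_in F.
Qed.
Lemma Dop_rep : isrep Dop MX.
Proof.
split.
- exact: MX_sub.
- case=> [e i r|a|i m|e i m] f hf; first exact: DX_st.
  + by apply: Aop_st; apply: Bop_st.
  + by apply: (subspD MX_sub); [apply: Aop_st|apply: Bop_st].
  + by apply: (subsp_sum MX_sub) => s _; apply: Aop_st; apply: Bop_st.
- case=> [e i r|a|i m|e i m] c f g hf hg /=; first exact: DX_lin.
  + by rewrite Bop_lin.
  + by rewrite Bop_lin // Aop_lin //; lmod_in F.
  + rewrite scaler_sumr -big_split; apply: eq_bigr => s _.
  by rewrite Bop_lin.
- by move=> i f hf; rewrite /= (rp_H0 Aop_rep) // (rp_H0 Bop_rep) // addr0.
- move=> a b f hf; rewrite /=.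
  have h2 := Bop_st (LK a) (Bop_st (LK b) hf).
  by rewrite (rp_KK Aop_rep _ _ h2) (rp_KK Bop_rep _ _ hf).
- by move=> f hf; rewrite /= (rp_K0 Aop_rep) ?(rp_K0 Bop_rep) //; apply: Bop_st.
- move=> a j m f hf m0 /=.
  have lA := linonD (@Aop_lin (LK a)); have lB := linonD (@Bop_lin (LK a)); rewrite lB // lA //.
  congr (_ + _).
  rewrite -[Bop _ (Aop _ _)]/(Aop _ (Bop _ _)) (rp_KH Aop_rep) //; exact: Bop_st.
  by rewrite (rp_KH Bop_rep).
- move=> i m j m' f hf m0 m0' /=.
  have lA k p := linonD (@Aop_lin (LH k p)); have lB k p := linonD (@Bop_lin (LH k p)).
  rewrite !lA // !lB // (HH_comm Aop_rep) // (HH_comm Bop_rep) //.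
  rewrite -![Bop _ (Aop _ _)]/(Aop _ (Bop _ _)); lmod_in F.
- by move=> a e j r f hf; rewrite DX_KX.
- by move=> i m e j r f hf m0; rewrite DX_HX.
- by move=> i j r r' f hf; rewrite DX_XX.
- by move=> e i j r r' f hf; rewrite DX_R5.
- move=> e i f hf; rewrite /= big_ord1 (rp_P0 Aop_rep) ?(rp_P0 Bop_rep) //.
  exact: Bop_st.
- by move=> e i m f hf; exact: Dop_PS.
Qed.

Local Notation Dp := Dop.
Let hr : isrep Dp MX := Dop_rep.

(** * Poles at u = 1 and the stable lattice *)

Definition Tu (f : E) : E := fun v k => f v (k - 1).
Local Notation papT := (pap Tu).

Lemma Tu_MX f : MX f -> MX (Tu f).
Proof.
move=> [lf [B bf]]; split=> [k c u v _ _|]; first exact: (lf (k - 1)).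
by exists (B + 1) => v k kB; apply: bf; lia.
Qed.
Lemma iterT j f v k : iter j Tu f v k = f v (k - j%:Z).
Proof. by elim: j k => [|j IH] k; rewrite ?subr0 // iterS /Tu IH; congr (f v _); lia. Qed.
Lemma papTE p f v k : papT p f v k = \sum_(j < size p) p`_j *: f v (k - j%:Z).
Proof. by rewrite /pap eS; apply: eq_bigr => j _; rewrite eZ iterT. Qed.
Lemma papT_lin p : linon setT (papT p).
Proof. exact: pap_lin2. Qed.
Lemma papTM p r f : papT (p * r) f = papT p (papT r f).
Proof. exact: (papM (lsubT _)). Qed.
Lemma papTC p r f : papT p (papT r f) = papT r (papT p f).
Proof. by rewrite -!papTM mulrC. Qed.
Lemma papT_MX p f : MX f -> MX (papT p f).
Proof. exact: (papX MX_sub Tu_MX). Qed.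
Lemma papT_inj p f : p != 0 -> MX f -> papT p f = 0 -> f = 0.
Proof.
move=> p0 [lf [B bf]] h; apply: eext => v; apply: (@recur_inj F W p (f v) true B p0) => k.
  by rewrite mul1r => kB; exact: bf.
by rewrite -papTE h.
Qed.
Lemma Tu_Bop g f : Bop g (Tu f) = Tu (Bop g f).
Proof. by apply: eext => v k; rewrite /Bop /Tu addrAC. Qed.
Lemma Tu_PP e g f : PP e g (Tu f) = Tu (PP e g f).
Proof. by case: e => //=; rewrite Tu_Bop. Qed.
Lemma Tu_nsum f : sm f -> Tu (nsum f) = nsum (fun s => Tu (f s)).
Proof.
move=> [lf [B bf]]; apply: eext => v k; have [N hN] := big_nat_bnd B (k - 1).
rewrite /Tu (nsumE _ bf hN) (nsumN (N := N)) // => s Ns.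
by apply: bf; lia.
Qed.
Lemma Tu_Fx e i r f s : Fx e i r (Tu f) s = Tu (Fx e i r f s).
Proof. by rewrite /Fx !Tu_PP. Qed.
Lemma Tu_Dop g f : MX f -> Dp g (Tu f) = Tu (Dp g f).
Proof.
move=> hf; case: g => [e i r|a|i m|e i m] /=.
- rewrite /DX Tu_PP -[RHS]/(Tu _ + Tu _); congr (_ + _).
  rewrite Tu_nsum; last exact: sm_Fx.
  by apply: nsum_ext => s; rewrite Tu_Fx.
- by rewrite Tu_Bop.
- by rewrite Tu_Bop.
- apply: eext => v k; rewrite /Tu !eS; apply: eq_bigr => s _.
  by rewrite Tu_Bop.
Qed.
Lemma papT_Dop g p f : MX f -> Dp g (papT p f) = papT p (Dp g f).
Proof.
by apply: (@pap_comm _ _ _ _ _ _ MX); [exact: MX_sub|exact: Tu_MX|exact: (rp_lin hr)|exact: Tu_Dop].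
Qed.
Lemma papT_nsumFx e i r p f : MX f -> nsum (Fx e i r (papT p f)) = papT p (nsum (Fx e i r f)).
Proof.
apply: (@pap_comm _ _ _ _ _ (fun f => nsum (Fx e i r f)) MX); [exact: MX_sub|exact: Tu_MX| |].
  by move=> c u v hu hv; apply: nsum_Fx_lin.
move=> v hv; rewrite Tu_nsum; last exact: sm_Fx.
by apply: nsum_ext => s; rewrite Tu_Fx.
Qed.
Definition Mw (om : hdual) : set E := MX `&` wsp Dp om.

Lemma MwP om nu f v k : Mw om f -> wsp oV nu v -> wsp oW (om - nu) (f v k).
Proof.
move=> [[lf bf] Wf] Wv a; have := congr1 (fun g : E => g v k) (Wf a).
rewrite /= /Aop /Bop subr0 Wv (linZT (lf k)) (linZT (rp_lin rW _)) => h.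
have qn := qp_neq0 (nu a).
apply: (scalerI qn); rewrite h scalerA -(qd_D hq); congr (qp _ *: _).
by rewrite add_lfunE opp_lfunE addrC subrK.
Qed.
Lemma span_ext (f g : E) : elin f -> elin g ->
  (forall nu v k, wsp oV nu v -> f v k = g v k) -> f = g.
Proof.
move=> lf lg h; apply: eext => v k; have [s [w [Ww ->]]] := oi_span hV v.
rewrite (linsT (lf k)) (linsT (lg k)).
by apply: eq_bigr => om _; apply: h.
Qed.
Lemma Mw_intro om f : MX f -> (forall nu v k, wsp oV nu v -> wsp oW (om - nu) (f v k)) -> Mw om f.
Proof.
move=> hf h; split=> // a; apply: span_ext.
- by case: (rp_st hr (LK a) hf).
- by case: (subspZ MX_sub (qp (om a)) hf).
move=> nu v k Wv; rewrite /= /Aop /Bop subr0 Wv.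
rewrite (linZT (hf.1 k)) (linZT (rp_lin rW _)) (h _ _ _ Wv).
rewrite scalerA -(qd_D hq); congr (qp _ *: _).
by rewrite add_lfunE opp_lfunE addrC subrK.
Qed.
Lemma Mw_sub om : lsub (Mw om).
Proof.
split=> [|c f g [hf Wf] [hg Wg]].
  split; first exact: subsp0 MX_sub.
  by move=> a; rewrite (linon0 MX_sub (rp_lin hr _)) scaler0.
split; first exact: MX_sub.2.
by move=> a; rewrite (rp_lin hr) // Wf Wg; lmod_in F.
Qed.
Lemma Mw_op g om f : Mw om f -> Mw (om + lw g) (Dp g f).
Proof.
move=> [hf Wf]; split; first exact: (rp_st hr).
case: g => [e i r|a|i m|e i m]; rewrite ?addr0.
- exact: (wsp_x hr).
- exact: (wsp_k hr).
- exact: (wsp_h hr).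
- exact: (wsp_ph hr).
Qed.
Lemma Mw_T om f : Mw om f -> Mw om (Tu f).
Proof.
move=> [hf Wf]; split; first exact: Tu_MX.
by move=> a; rewrite Tu_Dop // Wf.
Qed.
Lemma Mw_pap om p f : Mw om f -> Mw om (papT p f).
Proof. by apply: (papX (Mw_sub om)) => v; apply: Mw_T. Qed.
(** Together with the lower bound in [MX], this makes f a Laurent polynomial in u, uniformly in
    v. *)
Definition Laur (f : E) : Prop := exists N : int, forall v k, N <= k -> f v k = 0.
Lemma Laur_sub : lsub Laur.
Proof.
split; first by exists 0.
move=> c f g [N hN] [N' hN']; exists (Order.max N N') => v k.
by rewrite ge_max => /andP[h1 h2]; rewrite eD eZ hN // hN' // scaler0 addr0.
Qed.
Lemma Laur_T f : Laur f -> Laur (Tu f).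
Proof. by move=> [N hN]; exists (N + 1) => v k h; apply: hN; lia. Qed.
Lemma Laur_pap p f : Laur f -> Laur (papT p f).
Proof. by apply: (papX Laur_sub) => v; apply: Laur_T. Qed.
Lemma Laur_A g f : Laur f -> Laur (Aop g f).
Proof. by move=> [N hN]; exists N => v k; apply: hN. Qed.
Lemma Laur_B g f : Laur f -> Laur (Bop g f).
Proof.
move=> [N hN]; exists (N + dg g) => v k h.
by rewrite /Bop hN // lerBrDr.
Qed.
Lemma Laur_PP e g f : Laur f -> Laur (PP e g f).
Proof. by case: e; [apply: Laur_A|apply: Laur_B]. Qed.
Definition tq : {poly F} := 1 - 'X.
(** On [MX], f is rational in u with a pole of order at most b at u = 1, with one denominator for
    all v. *)
Definition tb (b : nat) : set E :=
  [set f | exists2 p : {poly F}, p.[1] != 0 & Laur (papT (p * tq ^+ b) f)].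

Lemma tb_le b b' f : (b <= b')%N -> tb b f -> tb b' f.
Proof.
move=> le [p p1 Lp]; exists p => //.
by rewrite -(subnK le) exprD mulrCA papTM; apply: Laur_pap.
Qed.
Lemma tb_sub b : lsub (tb b).
Proof.
split.
  exists 1; first by rewrite hornerE.
  rewrite (lin0T (papT_lin _)); exact: subsp0 Laur_sub.
move=> c f g [p p1 Lp] [r r1 Lr]; exists (p * r); first by rewrite hornerM mulf_neq0.
rewrite papT_lin //; apply: Laur_sub.2.
  by rewrite mulrAC mulrC papTM; apply: Laur_pap.
by rewrite -mulrA papTM; apply: Laur_pap.
Qed.
Lemma tb_T b f : tb b f -> tb b (Tu f).
Proof.
move=> [p p1 Lp]; exists p => //.
by rewrite -(@pap_comm _ _ _ Tu Tu Tu setT (lsubT _)) //; apply: Laur_T.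
Qed.
Lemma tb_pap b p f : tb b f -> tb b (papT p f).
Proof. by apply: (papX (tb_sub b)) => v; apply: tb_T. Qed.
Lemma nuB (u v : hdual) : nu H (u - v) = nu H u - nu H v.
Proof. by apply: (addIr (nu H v)); rewrite -nuD !subrK. Qed.
(** The weights of V and of W are bounded above by finitely many cones, so [om] splits in finitely
    many ways. *)
Lemma supp_fin om : exists s : seq hdual, forall ka, (exists2 v, wsp oV ka v & v != 0) ->
  (exists2 w, wsp oW (om - ka) w & w != 0) -> ka \in s.
Proof.
have [s hs] := oi_cone hV; have [t ht] := oi_cone hW.
have fin := cowt_fin s t (nu H om).
have fin2 := finite_preimage (in2W (@nu_inj _ _ H)) fin.
have /finite_seqP[l hl] := fin2.
exists l => ka /hs [la ls lo] /ht [la' lt' lo'].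
suff : [set` l] ka by []. rewrite -hl; split; first by exists la, ka.
by exists la', (om - ka); split=> //; rewrite nuB.
Qed.
Definition gV (e : bool) (i : 'I_n) (r : int) (s : nat) : lab :=
  if e then LP false i s else LX true i (r + pm false * s%:Z).
Definition gW (e : bool) (i : 'I_n) (r : int) (s : nat) : lab :=
  if e then LX true i (r + pm true * s%:Z) else LP true i s.
Definition Zs e i r (f : E) (v : V) (s : nat) (m : int) : W := oW (gW e i r s) (f (oV (gV e i r s) v) m).

Lemma FxE e i r f s v k : Fx e i r f s v k = Zs e i r f v s (k - (if e then r else 0) - s%:Z).
Proof.
rewrite /Fx /Zs; case: e => /=; rewrite /Bop /= mul1r.
  by congr (oW _ (f _ _)); lia.
by rewrite subr0.
Qed.
(** By [supp_fin] finitely many weights of V matter, so products of polynomials serve all of them,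
    and [nrec_prod] combines the two factors. Uniformity in the mode, in f and in v is what bounds
    poles later. *)
Lemma Zs_rec om e i : exists2 c : {poly F}, c != 0 & forall r f v m, Mw om f ->
  nrec c (fun s => Zs e i r f v s m).
Proof.
(* [sg] is the weight by which the operator on V moves: 0 for phi, a simple root for x^+. *)
have [sl hsl] := supp_fin om; pose sg : hdual := if e then 0 else wsh true i.
have recV ka : exists p : {poly F}, p != 0 /\ forall r v, wsp oV (ka - sg) v -> nrec p (fun s => oV (gV e i r s) v).
  rewrite /sg; case: (e).
  by have [p p0 hp] := ph_rec hV false i (ka - 0); exists p; split=> // r v; apply: hp.
  by have [p p0 hp] := x_rec hV true i (ka - wsh true i); exists p; split=> // r v; apply: hp.
have recW ka : exists p : {poly F}, p != 0 /\ forall r v, wsp oW (om - ka) v -> nrec p (fun s => oW (gW e i r s) v).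
  rewrite /gW; case: (e).
  by have [p p0 hp] := x_rec hW true i (om - ka); exists p; split=> // r v; apply: hp.
  by have [p p0 hp] := ph_rec hW true i (om - ka); exists p; split=> // r v; apply: hp.
have [p hp] := choice recV; have [p' hp'] := choice recW.
have n0 (pp : hdual -> {poly F}) : (forall ka, pp ka != 0) -> \prod_(ka <- sl) pp ka != 0.
  by move=> h; rewrite prodf_seq_neq0; apply/allP => ka _; rewrite h.
have [c c0 hc] := @nrec_prod F V W _ _ (n0 p (fun ka => (hp ka).1)) (n0 p' (fun ka => (hp' ka).1)).
have inprod (M : lmodType F) (pp : hdual -> {poly F}) ka (f : nat -> M) : ka \in sl -> nrec (pp ka) f ->
  nrec (\prod_(ka <- sl) pp ka) f.
  elim: (sl) => // ka' l IH; rewrite big_cons => /orP[/eqP <-|/IH h] hn; first exact: nrecMr.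
  by apply: nrecMl; apply: h.
exists c => // r f v m hf; have lf := hf.1.1.
have st ka v' s : wsp oV ka v' -> wsp oV (ka + sg) (oV (gV e i r s) v').
  rewrite /sg; case: (e) => Wv; first by rewrite addr0; apply: (wsp_ph rV).
  exact: (wsp_x rV).
have main ka v' : wsp oV ka v' -> nrec c (fun s => Zs e i r f v' s m).
  move=> Wv; have [ins|nins] := boolP (ka + sg \in sl).
  apply: (hc (fun s => oV (gV e i r s) v') (fun s => oW (gW e i r s)) (fun v => f v m)).
  - exact: lf.
  - by move=> s; apply: (rp_lin rW).
  - by apply: (inprod _ p _ _ ins); apply: (hp _).2; rewrite addrK.
  - move=> t; apply: (inprod _ p' _ _ ins); apply: (hp' _).2.
  by apply: MwP hf _; apply: st.
  rewrite (_ : (fun s => Zs e i r f v' s m) = 0).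
  by rewrite /nrec (lin0T (pap_linn _)).
  apply/funext => s; have lW := linon0 (lsubT _) (rp_lin rW (gW e i r s)).
  rewrite -[RHS]lW; congr (oW _ _); apply/eqP/negPn/negP => nz.
  move/negP: nins; apply; apply: hsl.
  exists (oV (gV e i r s) v'); first exact: st.
  by apply: contraNneq nz => ->; rewrite (lin0T (lf m)).
  by exists (f (oV (gV e i r s) v') m) => //; apply: MwP hf _; apply: st.
have [s [w [Ww ->]]] := oi_span hV v.
rewrite (_ : (fun _ => _) = \sum_(om' <- s) (fun s' => Zs e i r f (w om') s' m)).
  rewrite /nrec (linsT (pap_linn c)) big1 // => om' _; exact: main.
apply/funext => s'; rewrite fct_sumE /Zs (linsT (rp_lin rV _)).
by rewrite (linsT (lf m)) (linsT (rp_lin rW _)).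
Qed.
(** The infinite part is a series in u with linearly recurrent coefficients, so the reversed
    polynomial of the recurrence is a denominator for it. *)
Lemma poles_core om e i : exists2 d : {poly F}, d != 0 & forall r f, Mw om f -> Laur f ->
  Laur (papT d (nsum (Fx e i r f))).
Proof.
have [c c0 hc] := Zs_rec om e i; exists (rpol c); first exact: rpol_neq0.
move=> r f hf [N0 hN0]; have [lf [B bf]] := hf.1.
(* Beyond this exponent each coefficient of the product is made of full instances of the recurrence,
   hence vanishes. *)
pose re := if e then r else 0; exists (N0 + re + (size c)%:Z) => v k hk.
have Z0 s m : m < B \/ N0 <= m -> Zs e i r f v s m = 0.
  by move=> h; rewrite /Zs; have -> : f (oV (gV e i r s) v) m = 0;
  [case: h => h; [exact: bf|exact: hN0]|exact: (lin0T (rp_lin rW _))].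
pose M := k - (size c).-1%:Z - re; have [S hS] : exists S : nat, M - S%:Z < B.
  by exists (absz (M - B)).+1; lia.
have sz : (size (rpol c) <= size c)%N := size_poly _ _.
rewrite (papE _ _ sz) eS (reindex_inj rev_ord_inj) /=.
have key1 (m j : nat) : (j < m)%N -> (m - j.+1 = m.-1 - j)%N by lia.
have key2 (m j : nat) : (j < m)%N -> (m.-1 - (m.-1 - j) = j)%N by lia.
have key3 (m j : nat) (z a : int) (s : nat) : (j < m)%N -> z - (m.-1 - j)%N%:Z - a - s%:Z = (z - m.-1%:Z - a) + j%:Z - s%:Z by lia.
have key4 (m : nat) (z : int) : N0 + re + m%:Z <= z -> N0 <= z - m.-1%:Z - re by lia.
transitivity (\sum_(j < size c) \sum_(t < S) c`_j *: Zs e i r f v (t + j)%N (M - t%:Z)).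
  apply: eq_bigr => j _; rewrite eZ iterT coef_poly (key1 _ _ (ltn_ord j)).
  have lt : ((size c).-1 - j < size c)%N by rewrite -(key1 _ _ (ltn_ord j)) ltn_subrL (leq_ltn_trans _ (ltn_ord j)).
  rewrite lt (key2 _ _ (ltn_ord j)) -scaler_sumr; congr (_ *: _).
  rewrite (nsumN (N := (j + S)%N)); last first.
  move=> s js; rewrite FxE (key3 _ _ _ _ _ (ltn_ord j)) -/M; apply: Z0; left.
  by move: (nat_of_ord j) js => j'; lia.
  rewrite big_split_ord /= big1 ?add0r => [|s _].
  apply: eq_bigr => t _; rewrite FxE (key3 _ _ _ _ _ (ltn_ord j)) -/M addnC; congr Zs.
  by move: (nat_of_ord j) => j'; lia.
  rewrite FxE (key3 _ _ _ _ _ (ltn_ord j)); apply: Z0; right.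
  have key5 (a b : nat) : (a < b)%N -> N0 <= M + b%:Z - a%:Z by lia.
  exact: key5 (ltn_ord s).
rewrite exchange_big big1 // => t _.
by have := congr1 (fun g => g (t : nat)) (hc r f v (M - t%:Z) hf); rewrite pap_shn.
Qed.
Lemma tb_diag g om b f : (forall e i r, g <> LX e i r) -> Mw om f -> tb b f -> tb b (Dp g f).
Proof.
move=> ng hf [p p1 Lp]; exists p => //; rewrite -papT_Dop; last exact: hf.1.
case: g ng => [e i r|a|i m|e i m] ng; first by case: (ng e i r).
- by apply: Laur_A; apply: Laur_B.
- apply: (subspD Laur_sub); first exact: Laur_A.
  exact: Laur_B.
- by apply: (subsp_sum Laur_sub) => s _; apply: Laur_A; apply: Laur_B.
Qed.
Lemma poles om e i : exists c, forall b r f, Mw om f -> tb b f -> tb (b + c) (Dp (LX e i r) f).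
Proof.
have [d d0 hd] := poles_core om e i; have [m [d' rd ed]] := multiplicity_XsubC d 1.
rewrite d0 in rd; exists m => b r f hf fb; apply: (subspD (tb_sub (b + m))).
  apply: tb_le; first exact: leq_addr.
  have [p p1 Lp] := fb; exists p => //.
  rewrite -(@pap_comm _ _ _ Tu Tu (PP e (LX e i r)) setT (lsubT _)) //.
  - exact: Laur_PP.
  - exact: PP_lin.
  - by move=> v _; apply: Tu_PP.
have [p p1 Lp] := fb; exists (d' * p).
  by rewrite hornerM mulf_neq0.
have -> : d' * p * tq ^+ (b + m) = ((-1) ^+ m)%:P * (d * (p * tq ^+ b)).
  rewrite ed exprD rmorphXn /= -[tq ^+ m](_ : (- ('X - 1%:P)) ^+ m = _); last by rewrite opprB.
  by rewrite [(- _) ^+ m]exprNn polyCN; ring.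
rewrite papTM; apply: Laur_pap; rewrite papTM -papT_nsumFx; last exact: hf.1.
by apply: hd => //; apply: Mw_pap.
Qed.
(** The standard lattice of families regular at u = 1. It is stable under k, h and phi, but x may
    create poles, so it is only a reference for comparison. *)
Definition St (om : hdual) : set E := Mw om `&` tb 0.

Lemma St_sub om : lsub (St om).
Proof. by apply: lsubI; [exact: Mw_sub|exact: tb_sub]. Qed.
Lemma St_X om : St om `<=` MX. Proof. by move=> f [[hf _] _]. Qed.
Lemma diag_lw (g : lab) : diag g -> lw g = 0.
Proof. by case: g => // e i r h; case: (h e i r). Qed.
Lemma St_diag om g f : diag g -> St om f -> St om (Dp g f).
Proof.
move=> dg0 [hf fb]; split; last exact: (tb_diag dg0 hf).
by have := Mw_op g hf; rewrite diag_lw // addr0.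
Qed.
Lemma Mw_cone : exists s : seq hdual, forall om f, Mw om f -> f <> 0 -> exists2 la, la \in s & leQ om la.
Proof.
have [s hs] := oi_cone hV; have [t ht] := oi_cone hW.
exists [seq a + b | a <- s, b <- t] => om f hf f0.
have [ka [v [k [Wv nz]]]] : exists ka v k, wsp oV ka v /\ f v k <> 0.
  apply: contrapT => no; apply: f0; apply: (span_ext hf.1.1) => [k c u v _ _|ka v k Wv].
  by rewrite scaler0 addr0.
  by apply: contrapT => nz; apply: no; exists ka, v, k.
have [la ls lo] : exists2 la, la \in s & leQ ka la.
  apply: hs; exists v => //; apply/eqP => e; apply: nz.
  by rewrite e (lin0T (hf.1.1 k)).
have [la' lt' lo'] : exists2 la, la \in t & leQ (om - ka) la.
  by apply: ht; exists (f v k); [exact: MwP k hf Wv|exact/eqP].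
exists (la + la'); first exact: allpairs_f.
by rewrite -[om](subrK ka) addrC; apply: leQD.
Qed.
(** Weights are bounded above by finitely many cones, so sufficiently many raising operators give
    0. *)
Lemma up_bound om : exists N, forall up f, Mw (om + lwt (tri [::] up)) f -> f <> 0 -> (size up <= N)%N.
Proof.
have [s hs] := Mw_cone.
pose A la := [set m | exists a, la - om = \sum_i sroot H i *+ a i /\ (\sum_i a i)%N = m].
(* The height of la - om when this is a sum of simple roots. Independence of the roots makes it
   unique, and the default 0 is never met below. *)
pose bd la := xget 0%N (A la).
exists (\max_(la <- s) bd la) => up f hf f0.
have [la ls [b eb]] := hs _ _ hf f0.
apply: leq_trans (@leq_bigmax_seq _ s xpredT bd la ls isT).
have elo : la - om = \sum_i sroot H i *+ (count_mem i up + b i)%N.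
  under eq_bigr do rewrite mulrnDr; rewrite big_split -eb lwt_tri.
  have -> : \sum_i sroot H i *+ (count_mem i [::]) = 0 by rewrite big1.
  have h (x y z : hdual) : x - y = z + (x - (y + (z - 0))) by lmod_in rat.
  exact: h.
have [c [ec em]] : A la (bd la).
  by apply: (@xgetPex _ 0%N (A la)); exists (\sum_i (count_mem i up + b i))%N; exists (fun i => count_mem i up + b i)%N; split; [exact: elo|].
rewrite -em -sum_count; apply: leq_sum => i _.
have := sroot_comb_inj (etrans (esym ec) elo) => ->; exact: leq_addr.
Qed.
Lemma pth_bound om l : exists b, forall f, pth Dp (St om) l f -> Mw (om + lwt l) f /\ tb b f.
Proof.
elim: l => [|[e i] l [b IH]].
  by exists 0%N => f [hf fb]; rewrite /lwt big_nil addr0.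
have [c hc] := poles (om + lwt l) e i.
exists (b + c)%N => f hf; have hM := Mw_sub (om + lwt ((e, i) :: l)).
apply: (hf _ (lsubI hM (tb_sub (b + c)))) => _ [r [y [/IH [My ty] ->]]]; split; last exact: hc.
have := Mw_op (LX e i r) My.
by rewrite lwt_cons [wsh e i + _]addrC addrA.
Qed.
Lemma pth_cat0 S l1 l2 : (forall f, pth Dp S l2 f -> f = 0) -> forall f, pth Dp S (l1 ++ l2) f -> f = 0.
Proof.
move=> h; elim: l1 => // a l1 IH f hf.
apply: (hf [set 0] (lsub0 _)) => _ [r [y [/IH -> ->]]].
exact: (linon0 (rp_sub hr) (rp_lin hr (LX a.1 a.2 r))).
Qed.
(** In triangular form the raising part has bounded length and the weight then bounds the lowering
    part, so finitely many paths occur and their bounds have a maximum. *)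
Lemma closure_bound om om' : exists b, forall f, Gcl Dp om (St om) om' f -> tb b f.
Proof.
have [bd hbd] := choice (pth_bound om); have [N hN] := up_bound om.
have [[lo0 [up0 e0]]|no] := pselect (exists lo0 up0, om + lwt (tri lo0 up0) = om'); last first.
  exists 0%N => f hf; apply: (hf _ (tb_sub 0)) => f' [lo [up [_ e]]].
  by case: no; exists lo, up.
(* When size up is at most N, [tri_size] bounds size lo by N + size lo0. *)
have [b hb] := list_bound bd (N + size lo0 + N)%N.
exists b => f hf; apply: (hf _ (tb_sub b)) => f' [lo [up [hf' e]]].
have [le|gt] := leqP (size up) N.
  apply: tb_le (hbd _ _ hf').2; apply: hb.
  have e2 : lwt (tri lo up) = lwt (tri lo0 up0) by apply: (addrI om); rewrite e.
  have := tri_size e2.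
  by rewrite size_cat !size_map; move: le; lia.
rewrite (_ : f' = 0); first exact: subsp0 (tb_sub b).
apply: (pth_cat0 _ hf') => g hg; apply: contrapT => g0.
have [Mg _] := hbd _ _ hg; have := hN up g Mg g0.
by rewrite leqNgt gt.
Qed.
Lemma closure_words om om' : exists b, forall f w, St om f -> om + lws w = om' -> tb b (wapp Dp w f).
Proof.
have [b hb] := closure_bound om om'; exists b => f w hf e; apply: hb; rewrite -e.
exact: (Gcl_words hr (St_sub om) (@St_X om) (@St_diag om)).
Qed.
(** A numbering of the weights, available because they form a finite-dimensional space over the
    rationals; it is used to split the bound [bw]. *)
Definition rk (om : hdual) : nat := choice.pickle (VectorInternalTheory.f2mx om).
Lemma rk_inj : injective rk.
Proof. by move=> [A] [B] /(pcan_inj choice.pickleK) /= ->. Qed.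
Definition unrk (m : nat) : hdual := xget 0 [set om | rk om = m].
Lemma unrkK om : unrk (rk om) = om.
Proof. by apply: rk_inj; apply: (@xgetPex _ 0 [set om' | rk om' = rk om]); exists om. Qed.
Definition bw (om om' : hdual) : nat := projT1 (cid (closure_words om om')).
Lemma bwP om f w : St om f -> tb (bw om (om + lws w)) (wapp Dp w f).
Proof. by move=> hf; rewrite /bw; case: cid => b hb; exact: hb. Qed.
(** The bound [bw] depends on an initial and a final weight. Maxima over the weights of smaller
    number split it as [KK] of the initial one plus [BB] of the final one: a power of 1 - u attached
    to the initial weight then leaves a pole bound depending on the final weight only. *)
Definition BB (om' : hdual) : nat := \max_(m < (rk om').+1) bw (unrk m) om'.
Definition KK (om : hdual) : nat := \max_(m < rk om) bw om (unrk m).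
Lemma bw_le om om' : (bw om om' <= KK om + BB om')%N.
Proof.
case: (leqP (rk om) (rk om')) => h.
  have lt : (rk om < (rk om').+1)%N by [].
  apply: leq_trans (leq_addl _ _); rewrite -{1}(unrkK om).
  exact: (leq_bigmax (F := fun m : 'I_(rk om').+1 => bw (unrk m) om') (Ordinal lt)).
apply: leq_trans (leq_addr _ _); rewrite -{1}(unrkK om').
exact: (leq_bigmax (F := fun m : 'I_(rk om) => bw om (unrk m)) (Ordinal h)).
Qed.
Lemma wapp_X w f : MX f -> MX (wapp Dp w f).
Proof. by move=> hf; elim: w => // g w IH; exact: (rp_st hr). Qed.
Lemma wapp_lin w : linon MX (wapp Dp w).
Proof.
move=> c u v hu hv; elim: w => //= g w ->; apply: (rp_lin hr); exact: wapp_X.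
Qed.
Lemma wapp_pap w p f : MX f -> wapp Dp w (papT p f) = papT p (wapp Dp w f).
Proof.
move=> hf; elim: w => //= g w ->; rewrite papT_Dop //; exact: wapp_X.
Qed.
Lemma wapp_rcons w g f : wapp Dp (rcons w g) f = wapp Dp w (Dp g f).
Proof. by rewrite /wapp foldr_rcons. Qed.
Lemma tb_tq b b' c f : (b <= b' + c)%N -> tb b f -> tb b' (papT (tq ^+ c) f).
Proof.
move=> le /(tb_le le) [p p1 Lp]; exists p => //.
by rewrite -(papTM _ (tq ^+ c)) -mulrA -exprD.
Qed.
(** Quantifying over all words makes this stable under every operator. The empty word bounds the
    poles of its elements by [BB om], and [St_Lw] places a multiple of the standard lattice inside
    it. *)
Definition Lw (om : hdual) : set E :=
  [set f | Mw om f /\ forall w, tb (BB (om + lws w)) (wapp Dp w f)].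

Lemma Lw_sub om : lsub (Lw om).
Proof.
have hM := Mw_sub om; split=> [|c u v [hu bu] [hv bv]].
  split=> [|w]; first exact: subsp0 hM.
  rewrite (linon0 MX_sub (wapp_lin w)); exact: subsp0 (tb_sub _).
split=> [|w]; first exact: hM.2.
rewrite wapp_lin; [|exact: hu.1|exact: hv.1]; exact: (tb_sub _).2.
Qed.
Lemma Lw_op om g f : Lw om f -> Lw (om + lw g) (Dp g f).
Proof.
move=> [hf bf]; split=> [|w]; first exact: Mw_op.
rewrite -wapp_rcons (_ : _ + _ + _ = om + lws (rcons w g)); first exact: bf.
by rewrite /lws -cats1 big_cat big_seq1 -addrA; congr (_ + _); rewrite addrC.
Qed.
Lemma Lw_pap om p f : Lw om f -> Lw om (papT p f).
Proof.
move=> [hf bf]; split=> [|w]; first exact: Mw_pap.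
by rewrite wapp_pap; [apply: tb_pap|exact: hf.1].
Qed.
Lemma Lw_tb om f : Lw om f -> tb (BB om) f.
Proof. by move=> [_ /(_ [::])]; rewrite /lws big_nil addr0. Qed.
Lemma St_Lw om f : St om f -> Lw om (papT (tq ^+ KK om) f).
Proof.
move=> hf; split=> [|w]; first by apply: Mw_pap; case: hf.
rewrite wapp_pap; last exact: St_X hf.
by apply: tb_tq _ (bwP w hf); rewrite addnC; exact: bw_le.
Qed.

(* The lattice and its quotient by u = 1. *)
Definition LL : set E := wspan Lw.
Definition tLL : set E := [set f | exists2 g, LL g & f = papT (tq) g].

Lemma LL_sub : lsub LL. Proof. exact: wspan_sub Lw_sub. Qed.
Lemma LL_X : LL `<=` MX.
Proof.
move=> _ [s [f [hf ->]]]; apply: (subsp_sum MX_sub) => om _.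
by have [[]] := hf om.
Qed.
Lemma tLL_sub : lsub tLL.
Proof.
split=> [|c _ _ [u Lu ->] [v Lv ->]].
  by exists 0; [exact: subsp0 LL_sub|rewrite (lin0T (papT_lin _))].
by exists (c *: u + v); [exact: LL_sub.2|rewrite papT_lin].
Qed.
Lemma tLL_LL : tLL `<=` LL.
Proof.
move=> _ [_ [s [f [hf ->]]] ->]; exists s, (fun om => papT (tq) (f om)); split.
  by move=> om; exact: Lw_pap.
by rewrite (linsT (papT_lin _)).
Qed.
Lemma LL_op g f : LL f -> LL (Dp g f).
Proof.
move=> [s [f' [hf ->]]]; rewrite (linon_sum MX_sub (rp_lin hr g)) => [|om _]; last by have [[]] := hf om.
apply: (subsp_sum LL_sub) => om _; apply: (wspan1 Lw_sub); exact: Lw_op.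
Qed.
Lemma tLL_op g f : tLL f -> tLL (Dp g f).
Proof.
move=> [f' hf ->]; exists (Dp g f'); first exact: LL_op.
by rewrite papT_Dop //; exact: LL_X.
Qed.
Definition M1d : sqdata E := SqData LL_sub tLL_sub tLL_LL.
Lemma M1_rep : isrep (sqop (d := M1d) Dp) setT.
Proof.
exact: (sqop_rep (d := M1d) (isrep_sub hr LL_sub LL_op LL_X) tLL_op).
Qed.

(** * Characters of the specialization at u = 1 *)

Definition PhiO (M : lmodType F) (op : lab -> M -> M) (k : kx) : M -> M := op (LP k.1.1 k.1.2 k.2).

Lemma PhiO_comfam (M : lmodType F) (op : lab -> M -> M) X om : isrep op X ->
  comfam (PhiO op) (X `&` wsp op om).
Proof.
move=> h; split.
- split; last by move=> k v [Xv Wv]; split; [exact: (rp_st h)|exact: (wsp_ph h)].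
  split=> [|c u v [Xu Wu] [Xv Wv]].
  split; first exact: subsp0 (rp_sub h).
  by move=> a; rewrite (linon0 (rp_sub h) (rp_lin h _)) scaler0.
  split; first exact: (rp_sub h).2.
  by move=> a; rewrite (rp_lin h) // Wu Wv; lmod_in F.
- by move=> k; apply: linon_sub (rp_lin h _) => v [].
- by move=> k k' v [Xv _]; rewrite /PhiO (phph_comm h).
Qed.
Lemma PhiO_flag (M : lmodType F) (op : lab -> M -> M) om : oint op ->
  exists cs, flag (PhiO op) [set 0] (wsp op om) cs.
Proof.
move=> ho; have [d hd] := oi_fd ho om.
have := PhiO_comfam om (oi_rep ho); rewrite setTI => cX.
apply: flag_ex cX _ _ hd; last by move=> x ->; exact: subsp0 (wsp_sub (oi_rep ho) om (erefl _)).
by split; [exact: lsub0|move=> k v ->; exact: lin0T (rp_lin (oi_rep ho) _)].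
Qed.
(** What the standard lattice becomes at u = 1. On it [PhH] is the coproduct of phi, which is a
    finite sum. *)
Definition Hm (om : hdual) : set (V -> W) :=
  [set g | linon setT g /\ forall nu v, wsp oV nu v -> wsp oW (om - nu) (g v)].
Definition PhH (k : kx) (g : V -> W) : V -> W := fun v =>
  \sum_(s < k.2.+1) oW (LP k.1.1 k.1.2 (k.2 - s)) (g (oV (LP k.1.1 k.1.2 s) v)).
Definition chmul (c c' : kx -> F) (k : kx) : F := \sum_(s < k.2.+1) c (k.1, s : nat) * c' (k.1, (k.2 - s)%N).

Definition HmS om (S : set V) : set (V -> W) := [set g | Hm om g /\ forall x, S x -> g x = 0].

Let sW om : lsub (wsp oW om) := wsp_sub rW om (erefl _).
Lemma HmS_sub om S : lsub (HmS om S).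
Proof.
split=> [|c f g [[lf wf] zf] [[lg wg] zg]].
  split=> //; split=> [c u v _ _|nu v _]; first by rewrite scaler0 addr0.
  exact: subsp0 (sW _).
split; last by move=> x Sx; rewrite -[LHS]/(c *: f x + g x) zf // zg // scaler0 addr0.
split=> [d u v _ _|nu v Wv].
  rewrite -[LHS]/(c *: f _ + g _) lf // lg // -[(c *: f + g) u]/(c *: f u + g u) -[(c *: f + g) v]/(c *: f v + g v).
  lmod_in F.
by apply: (sW _).2; [apply: wf|apply: wg].
Qed.
Lemma HmS_stab om S : (forall k x, S x -> S (PhiO oV k x)) -> stab PhH (HmS om S).
Proof.
move=> hS; split; first exact: HmS_sub.
move=> k g [[lg wg] zg]; split; last first.
  move=> x Sx; rewrite /PhH big1 // => s _.
  by rewrite zg //; apply: (hS (k.1, s : nat)).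
split=> [c u v _ _|nu v Wv].
  rewrite scaler_sumr -big_split; apply: eq_bigr => s _.
  by rewrite (rp_lin rV) // lg // (rp_lin rW).
apply: (subsp_sum (sW _)) => s _; apply: (wsp_ph rW) => //; apply: wg.
exact: (wsp_ph rV).
Qed.
Lemma flag_chmul c (Z X : set W) cs : stab (PhiO oW) Z -> flag (PhiO oW) Z X cs ->
  flag (fun k w => \sum_(s < k.2.+1) c (k.1, s : nat) *: oW (LP k.1.1 k.1.2 (k.2 - s)) w) Z X
  [seq chmul c c' | c' <- cs].
Proof.
move=> sZ; elim=> [|Y X1 c' cs' e fl IH sX1 X1e nYe YX sp hc]; first exact: flag0.
apply: (flagS IH _ X1e nYe YX sp).
  split=> [|k v Xv]; first exact: sX1.1.
  apply: (subsp_sum sX1.1) => s _; apply: (subspZ sX1.1); exact: (sX1.2 (k.1, (k.2 - s)%N)).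
have sY : lsub Y := (flag_stab sZ fl).1.
move=> k; rewrite scaler_suml -sumrB; apply: (subsp_sum sY) => s _.
rewrite -scalerA -scalerBr; apply: (subspZ sY); exact: hc (k.1, (k.2 - s)%N).
Qed.
(** Evaluation at the top vector e maps onto a weight space of W, and its kernel consists of the
    maps vanishing on the larger step. As e has character c, phi acts on the image by c times the
    characters of W. *)
Lemma hom_step om nu (S0 Y X : set V) c e csW :
  (forall k x, S0 x -> S0 (PhiO oV k x)) -> (forall x, S0 x -> exists2 nu', nu' != nu & wsp oV nu' x) ->
  stab (PhiO oV) Y -> X `<=` wsp oV nu -> X e -> ~ Y e -> Y `<=` X ->
  (forall x, X x -> exists a : F, Y (x - a *: e)) -> (forall k, Y (PhiO oV k e - c k *: e)) ->
  flag (PhiO oW) [set 0] (wsp oW (om - nu)) csW ->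
  flag PhH (HmS om (S0 `|` X)) (HmS om (S0 `|` Y)) [seq chmul c c' | c' <- csW].
Proof.
move=> stS0 wS0 sY Xnu Xe nYe YX sp hc flW.
have lp : linon (HmS om (S0 `|` Y)) (fun g : V -> W => g e) by [].
have stY : stab PhH (HmS om (S0 `|` Y)).
  by apply: HmS_stab => k x [/stS0 h|/sY.2 h]; [left|right].
have s0 : stab (fun (k : kx) (w : W) => \sum_(s < k.2.+1) c (k.1, s : nat) *: oW (LP k.1.1 k.1.2 (k.2 - s)) w) [set 0].
  split; first exact: lsub0.
  move=> k w ->; apply: big1 => s _; by rewrite (lin0T (rp_lin rW _)) scaler0.
have cp k g : HmS om (S0 `|` Y) g -> PhH k g e = \sum_(s < k.2.+1) c (k.1, s : nat) *: oW (LP k.1.1 k.1.2 (k.2 - s)) (g e).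
  move=> [[lg wg] zg]; apply: eq_bigr => s _.
  have := zg _ (or_intror (hc (k.1, s : nat))); rewrite (linBT lg) (linZT lg).
  by move/eqP; rewrite subr_eq0 => /eqP ->; rewrite (linZT (rp_lin rW _)).
have s0W : stab (PhiO oW) [set 0].
  by split; [exact: lsub0|move=> k w ->; exact: lin0T (rp_lin rW _)].
have := flag_pull stY lp cp s0 (flag_chmul c s0W flW).
rewrite (_ : HmS om (S0 `|` Y) `&` _ @^-1` [set 0] = HmS om (S0 `|` X)); last first.
  apply/seteqP; split=> [g [[hg zg] ge]|g [hg zg]].
  split=> // x [Sx|Xx]; first by apply: zg; left.
  have [a Ya] := sp x Xx; have := zg _ (or_intror Ya).
  by rewrite (linBT hg.1) (linZT hg.1) ge scaler0 subr0.
  split; last by apply: zg; right.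
  by split=> // x [Sx|/YX Xx]; apply: zg; [left|right].
rewrite (_ : HmS om (S0 `|` Y) `&` _ @^-1` _ = HmS om (S0 `|` Y)); last first.
  apply/seteqP; split=> [g []//|g hg]; split=> //; apply: hg.1.2; exact: Xnu.
apply=> y Wy.
(* A functional with value 1 at e that vanishes on Y and on all other weight spaces turns any y into
   a map of weight [om] with value y at e. *)
pose A nu' := if nu' == nu then Y else wsp oV nu'.
have sA nu' : lsub (A nu') by rewrite /A; case: ifP => _; [exact: sY.1|exact: wsp_sub rV _ erefl].
have nS : ~ wspan A e.
  move=> [s [f [hf ef]]]; apply: nYe.
  have hf' om' : setT (f om') /\ wsp oV om' (f om').
  by split=> //; have := hf om'; rewrite /A; case: eqP => // -> /YX /Xnu.
  rewrite (wsp_comp rV I (Xnu _ Xe) hf' ef); apply: (subspZ sY.1).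
  by have := hf nu; rewrite /A eqxx.
have [la [lla zla la1]] := functional_ex (wspan_sub sA) nS.
have lala x : forall nu', nu' != nu -> wsp oV nu' x -> la x = 0.
  by move=> nu' nn Wx; apply: zla; apply: (wspan1 sA (om := nu')); rewrite /A (negbTE nn).
exists (fun x => la x *: y); last by rewrite la1 scale1r.
split; first split=> [a u v _ _|nu' v Wv].
- by rewrite lla; lmod_in F.
- have [->|nn] := eqVneq nu' nu; first exact: (subspZ (sW _)).
  by rewrite (lala _ _ nn Wv) scale0r; exact: subsp0 (sW _).
move=> x [/wS0[nu' nn Wx]|Yx]; first by rewrite (lala _ _ nn Wx) scale0r.
by rewrite zla ?scale0r //; apply: (wspan1 sA (om := nu)); rewrite /A eqxx.
Qed.
Let s0V : stab (PhiO oV) [set 0].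
Proof. by split; [exact: lsub0|move=> k v ->; exact: lin0T (rp_lin rV _)]. Qed.
Definition cprod (csV csW : seq (kx -> F)) : seq (kx -> F) :=
  flatten [seq [seq chmul c c' | c' <- csW] | c <- csV].

Lemma hom_flag1 om nu (S0 X : set V) csV csW :
  (forall k x, S0 x -> S0 (PhiO oV k x)) -> (forall x, S0 x -> exists2 nu', nu' != nu & wsp oV nu' x) ->
  flag (PhiO oV) [set 0] X csV -> X `<=` wsp oV nu ->
  flag (PhiO oW) [set 0] (wsp oW (om - nu)) csW ->
  exists2 cs, flag PhH (HmS om (S0 `|` X)) (HmS om (S0 `|` [set 0])) cs & forall g, chcount g cs = chcount g (cprod csV csW).
Proof.
move=> stS0 wS0 fl Xnu flW; elim: fl Xnu => [|Y X1 c cs' e fl IH sX1 X1e nYe YX sp hc] Xnu.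
  by exists [::] => //; exact: flag0.
have [cs h1 h2] := IH (subset_trans YX Xnu).
have h3 := hom_step stS0 wS0 (flag_stab s0V fl) Xnu X1e nYe YX sp hc flW.
exists (cs ++ [seq chmul c c' | c' <- csW]); first exact: flag_cat h3 h1.
by move=> g; rewrite !chcount_cat h2 addnC.
Qed.
Definition Wl (l : seq hdual) : set V := [set x | exists2 nu, nu \in l & wsp oV nu x].

Lemma hom_flag om (csV csW : hdual -> seq (kx -> F)) :
  (forall nu, flag (PhiO oV) [set 0] (wsp oV nu) (csV nu)) ->
  (forall nu, flag (PhiO oW) [set 0] (wsp oW nu) (csW nu)) ->
  forall l, uniq l -> exists2 cs, flag PhH (HmS om (Wl l)) (Hm om) cs &
  forall g, chcount g cs = (\sum_(nu <- l) chcount g (cprod (csV nu) (csW (om - nu)%R)))%N.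
Proof.
move=> fV fW; elim=> [_|nu l IH /andP[nl Ul]].
  exists [::] => [|g]; last by rewrite big_nil.
  rewrite (_ : HmS om (Wl [::]) = Hm om); first exact: flag0.
  by apply/seteqP; split=> [g []//|g hg]; split=> // x [].
have [cs h1 h2] := IH Ul.
have st k x : Wl l x -> Wl l (PhiO oV k x).
  by move=> [nu' il Wx]; exists nu' => //; apply: (wsp_ph rV).
have ws x : Wl l x -> exists2 nu', nu' != nu & wsp oV nu' x.
  by move=> [nu' il Wx]; exists nu' => //; apply: contraNneq nl => <-.
have [cs1 f1 e1] := hom_flag1 st ws (fV nu) (@subset_refl _ _) (fW (om - nu)).
exists (cs ++ cs1) => [|g]; last by rewrite chcount_cat h2 e1 big_cons addnC.
apply: flag_cat h1; move: f1.
rewrite (_ : HmS om (Wl l `|` [set 0]) = HmS om (Wl l)); last first.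
  apply/seteqP; split=> g [hg zg]; split=> // x; first by move=> h; apply: zg; left.
  by case=> [|->]; [exact: zg|exact: lin0T hg.1].
rewrite (_ : HmS om (Wl l `|` wsp oV nu) = HmS om (Wl (nu :: l))) //.
apply/seteqP; split=> g [hg zg]; split=> // x.
  move=> [nu']; rewrite inE => /orP[/eqP -> Wx|il Wx]; apply: zg; [by right|left; by exists nu'].
by case=> [[nu' il Wx]|Wx]; apply: zg; [exists nu' => //; rewrite inE il orbT|exists nu => //; exact: mem_head].
Qed.
(** The list l contains all weights of V that can contribute, so a map of weight [om] vanishing on
    those weight spaces is 0. *)
Lemma hom_flag_full om (csV csW : hdual -> seq (kx -> F)) :
  (forall nu, flag (PhiO oV) [set 0] (wsp oV nu) (csV nu)) ->
  (forall nu, flag (PhiO oW) [set 0] (wsp oW nu) (csW nu)) ->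
  exists l cs, [/\ uniq l, forall nu, nu \notin l -> csV nu = [::] \/ csW (om - nu) = [::],
  flag PhH [set 0] (Hm om) cs &
  forall g, chcount g cs = (\sum_(nu <- l) chcount g (cprod (csV nu) (csW (om - nu)%R)))%N].
Proof.
move=> fV fW; have [s hs] := supp_fin om.
pose l := undup s; have Ul : uniq l by exact: undup_uniq.
have zz nu : nu \notin l -> wsp oV nu `<=` [set 0] \/ wsp oW (om - nu) `<=` [set 0].
  rewrite mem_undup => nl; apply: contrapT => no; case/negP: nl; apply: hs.
  apply: contrapT => h; apply: no; left => v Wv; apply: contrapT => v0; apply: h.
  by exists v => //; exact/eqP.
  apply: contrapT => h; apply: no; right => v Wv; apply: contrapT => v0; apply: h.
  by exists v => //; exact/eqP.
have [cs h1 h2] := @hom_flag om _ _ fV fW l Ul.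
have nilf (M : lmodType F) (P : kx -> M -> M) X cs' : flag P [set 0] X cs' -> X `<=` [set 0] -> cs' = [::].
  case=> // Y X' c cs'' e fl _ X'e nYe _ _ _ X0; case: nYe; have := flag_sub fl; apply; exact: X0.
exists l, cs; split=> //.
  by move=> nu /zz [h|h]; [left; exact: nilf (fV nu) h|right; exact: nilf (fW _) h].
rewrite (_ : [set 0] = HmS om (Wl l)) //.
apply/seteqP; split=> [g ->|g [[lg wg] zg]]; first exact: subsp0 (HmS_sub _ _).
apply/funext => v; have [s' [w [Ww ->]]] := oi_span hV v.
rewrite (linsT lg) big1 // => nu _.
have [il|nl] := boolP (nu \in l); first by apply: zg; exists nu.
by case: (zz nu nl) => h; [rewrite (h _ (Ww nu)) (lin0T lg)|exact: h (wg _ _ (Ww nu))].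
Qed.
Definition supp (f : E) (B : int) (M : nat) :=
  (forall v k, k < B -> f v k = 0) /\ (forall v k, B + M%:Z <= k -> f v k = 0).
(** The value at u = 1 of a Laurent polynomial with exponents from B to B + M - 1. *)
Definition tot (B : int) (M : nat) (f : E) (v : V) : W := \sum_(j < M) f v (B + j%:Z).

Lemma Laur_supp f : MX f -> Laur f -> exists B0 N0 : int, forall B M, B <= B0 -> N0 <= B + M%:Z -> supp f B M.
Proof.
move=> [_ [B bf]] [N hN]; exists B, N => B1 M h1 h2; split=> v k hk; first by apply: bf; lia.
by apply: hN; lia.
Qed.
Lemma big_range (B0 N0 B1 N1 : int) : exists (B : int) (M : nat), [/\ B <= B0, N0 <= B + M%:Z, B <= B1 & N1 <= B + M%:Z].
Proof.
exists (Order.min B0 B1), (absz (Order.max N0 N1 - Order.min B0 B1)); split; lia.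
Qed.
Lemma suppB f g B M : supp f B M -> supp g B M -> supp (f - g) B M.
Proof. by move=> [h1 h2] [h3 h4]; split=> v k hk; rewrite eD eN; [rewrite h1 // h3 // subr0|rewrite h2 // h4 // subr0]. Qed.
Lemma supp_le f B M M' : (M <= M')%N -> supp f B M -> supp f B M'.
Proof. by move=> le [h1 h2]; split=> // v k hk; apply: h2; lia. Qed.
Lemma tot_le f B M M' v : (M <= M')%N -> supp f B M -> tot B M' f v = tot B M f v.
Proof.
move=> le [h1 h2]; rewrite /tot -(subnKC le) big_split_ord /= [X in _ + X]big1 ?addr0 // => j _.
by apply: h2; rewrite /=; lia.
Qed.
Lemma totB f g B M v : tot B M (f - g) v = tot B M f v - tot B M g v.
Proof. by rewrite -sumrB. Qed.
Lemma supp_pap (p : {poly F}) f B M : supp f B M -> supp (papT p f) B (M + size p).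
Proof.
move=> [h1 h2]; split=> v k hk; rewrite papTE big1 // => j _.
  by rewrite h1 ?scaler0 //; lia.
have key (a b : nat) : (a < b)%N -> B + (M + b)%N%:Z <= k -> B + M%:Z <= k - a%:Z by lia.
by rewrite h2 ?scaler0 //; exact: key (ltn_ord j) hk.
Qed.
Lemma tot_pap (p : {poly F}) f B M v : supp f B M -> tot B (M + size p) (papT p f) v = p.[1] *: tot B M f v.
Proof.
move=> sf; have [h1 h2] := sf; rewrite horner_coef scaler_suml /tot.
under eq_bigr do rewrite papTE.
rewrite exchange_big; apply: eq_bigr => j _; rewrite expr1n mulr1 -scaler_sumr; congr (_ *: _).
transitivity (\sum_(k < M + size p | (j <= k)%N) f v (B + (k - j)%N%:Z)).
  rewrite [RHS]big_mkcond /=; apply: eq_bigr => k _; case: leqP => jk.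
  by congr (f v _); lia.
  by apply: h1; lia.
rewrite (sum_sub (M + size p) j (fun t => f v (B + t%:Z))).
have key (a b : nat) : (a < b)%N -> (M <= M + b - a)%N by lia.
exact: tot_le v (key _ _ (ltn_ord j)) sf.
Qed.
(** Division by 1 - u, as a geometric series. *)
Definition Sg (f : E) : E := nsum (fun s => iter s Tu f).
Lemma sm_Sg f : MX f -> sm (fun s => iter s Tu f).
Proof.
move=> hf; have [lf [B bf]] := hf; split=> [s k c u v _ _|].
  by rewrite !iterT (lf (k - s%:Z)).
by exists B => s v k hk; rewrite iterT bf //; lia.
Qed.
Lemma papT_tq f : papT tq f = f - Tu f.
Proof.
rewrite papD papN pap1; congr (_ - _).
by rewrite -['X]mulr1 (pap_mulX (lsubT _)) // pap1.
Qed.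
Lemma Sg_t f : MX f -> papT tq (Sg f) = f.
Proof.
move=> hf; have hs := sm_Sg hf; rewrite papT_tq /Sg {1}(nsumS hs).
by rewrite addrK.
Qed.
Lemma Sg_pap p f : MX f -> Sg (papT p f) = papT p (Sg f).
Proof.
apply: (@pap_comm _ _ _ Tu Tu Sg MX); [exact: MX_sub|exact: Tu_MX| |].
  move=> c u v hu hv; rewrite -nsum_lin; [|exact: sm_Sg|exact: sm_Sg].
  apply: nsum_ext => s; apply: eext => w k.
  by rewrite eD eZ !iterT.
move=> v hv; rewrite /Sg; apply: nsum_ext => s.
by rewrite -iterSr.
Qed.
Lemma Sg_Mw om f : Mw om f -> Mw om (Sg f).
Proof.
move=> hf; have hX := hf.1; apply: Mw_intro; first by apply: nsum_MX; exact: sm_Sg.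
move=> nu v k Wv; have [_ [B bf]] := sm_Sg hX; have [N hN] := big_nat_bnd B k.
rewrite /Sg (nsumE _ bf hN); apply: (subsp_sum (wsp_sub rW _ (erefl _))) => s _.
by rewrite iterT; exact: MwP _ hf Wv.
Qed.
Lemma Sg_Laur f B M : MX f -> supp f B M -> (forall v, tot B M f v = 0) -> Laur (Sg f).
Proof.
move=> hf sf t0; have [h1 h2] := sf; exists (B + M%:Z) => v k hk.
pose N := (absz (k - B)).+1.
rewrite /Sg (nsumN (N := N)) => [|s hs]; last by rewrite iterT h1 //; move: hs; rewrite /N; lia.
rewrite -[RHS](t0 v) -(@tot_le f B M N v _ sf); last by rewrite /N; lia.
rewrite (reindex_inj rev_ord_inj) /=; apply: eq_bigr => s _; rewrite iterT; congr (f v _).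
by have := ltn_ord s; rewrite {1}/N => ls; rewrite /N; lia.
Qed.
Definition tSt (om : hdual) : set E := papT tq @` St om.

(** Since p f is a Laurent polynomial vanishing at u = 1, its quotient by 1 - u is one as well, so f
    / (1 - u) is regular at 1. *)
Lemma tot0_tSt om (p : {poly F}) f B M : Mw om f -> p.[1] != 0 -> supp (papT p f) B M ->
  (forall v, tot B M (papT p f) v = 0) -> tSt om f.
Proof.
move=> hf p1 sf t0; exists (Sg f); last exact: Sg_t hf.1.
split; first exact: Sg_Mw.
exists p => //; rewrite mulr1 -Sg_pap; last exact: hf.1.
by apply: Sg_Laur _ sf t0; apply: papT_MX; exact: hf.1.
Qed.
Definition constk (k0 : int) (g : V -> W) : E := fun v k => if k == k0 then g v else 0.

Lemma constk_Mw om k0 g : Hm om g -> Mw om (constk k0 g).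
Proof.
move=> [lg wg]; apply: Mw_intro.
  split=> [k c u v _ _|]; rewrite /constk; first by case: ifP => _; rewrite ?lg // scaler0 addr0.
  by exists k0 => v k hk; rewrite lt_eqF.
move=> nu v k Wv; rewrite /constk; case: ifP => _; first exact: wg.
exact: subsp0 (wsp_sub rW _ (erefl _)).
Qed.
Lemma constk_supp k0 g B M : B <= k0 -> k0 < B + M%:Z -> supp (constk k0 g) B M.
Proof. by move=> h1 h2; split=> v k hk; rewrite /constk; case: eqP => // e; lia. Qed.
Lemma constk_tot k0 g B M v : B <= k0 -> k0 < B + M%:Z -> tot B M (constk k0 g) v = g v.
Proof.
move=> h1 h2; have lt : (absz (k0 - B) < M)%N by lia.
rewrite /tot (bigD1 (Ordinal lt)) //= big1 ?addr0 => [|j].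
  by rewrite /constk; case: eqP => // ne; exfalso; apply: ne; lia.
rewrite -val_eqE /= => ne; rewrite /constk; case: eqP => // e; exfalso; move/negP: ne; apply; apply/eqP; lia.
Qed.
Lemma ev_ex om f : St om f -> exists g, Hm om g /\ tSt om (f - constk 0 g).
Proof.
move=> [hf [p p1]]; rewrite mulr1 => Lp.
have hp : Mw om (papT p f) := Mw_pap p hf.
have [B0 [N0 sp]] := Laur_supp hp.1 Lp.
have [B [M [h1 h2 h3 h4]]] := big_range B0 N0 0 1.
have sB := sp _ _ h1 h2.
(* The value of f at u = 1, computed from the Laurent polynomial p f. *)
pose g v := p.[1]^-1 *: tot B M (papT p f) v.
have hg : Hm om g.
  split=> [c u v _ _|nu v Wv]; rewrite /g.
  rewrite scalerA mulrC -scalerA -scalerDr; congr (_ *: _).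
  rewrite scaler_sumr -big_split; apply: eq_bigr => j _.
  by rewrite (hp.1.1 _).
  apply: (subspZ (wsp_sub rW _ (erefl _))); apply: (subsp_sum (wsp_sub rW _ (erefl _))) => j _.
  exact: MwP _ hp Wv.
exists g; split=> //.
have Mc := constk_Mw 0 hg.
have sc : supp (constk 0 g) B M by apply: constk_supp; lia.
have le : (M <= M + size p)%N by exact: leq_addr.
have eq1 : papT p (f - constk 0 g) = papT p f - papT p (constk 0 g).
  by rewrite (linBT (papT_lin p)).
apply: (@tot0_tSt om p _ B (M + size p)) => //.
- exact: (subspB (Mw_sub om)).
- by rewrite eq1; apply: suppB; [exact: supp_le le sB|exact: supp_pap].
move=> v; rewrite eq1 totB (tot_le v le sB) (tot_pap _ _ sc) constk_tot; [|lia|lia].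
by rewrite scalerA mulfV // scale1r subrr.
Qed.
Lemma ev_uniq om g : Hm om g -> tSt om (constk 0 g) -> g = 0.
Proof.
move=> hg [h [hh [p p1]]]; rewrite mulr1 => Lp eh.
have hp : Mw om (papT p h) := Mw_pap p hh.
have [B0 [N0 sp]] := Laur_supp hp.1 Lp.
have [B [M [h1 h2 h3 h4]]] := big_range B0 N0 0 1.
have sB := sp _ _ h1 h2.
have sc : supp (constk 0 g) B M by apply: constk_supp; lia.
apply/funext => v.
have e1 := tot_pap p v sc; have e2 := tot_pap tq v sB.
rewrite constk_tot in e1; [|lia|lia].
have es : papT p (constk 0 g) = papT tq (papT p h) by rewrite -eh papTC.
have z : tot B (M + size tq) (papT tq (papT p h)) v = 0.
  by rewrite e2 !hornerE subrr scale0r.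
have z' : tot B (M + size p) (papT p (constk 0 g)) v = 0.
  rewrite -(tot_le v (leq_addr (size tq) _) (supp_pap p sc)) es.
  by rewrite -addnA [(size p + _)%N]addnC addnA (tot_le v (leq_addr (size p) _) (supp_pap tq sB)).
by apply: (scalerI p1); rewrite -e1 scaler0.
Qed.
Lemma tSt_sub om : lsub (tSt om).
Proof.
have sS := St_sub om; split; first by exists 0; [exact: subsp0 sS|rewrite (lin0T (papT_lin _))].
by move=> c _ _ [u hu <-] [v hv <-]; exists (c *: u + v); [exact: sS.2|rewrite papT_lin].
Qed.
Lemma tSt_St om : tSt om `<=` St om.
Proof.
by move=> _ [f [hf tf] <-]; split; [exact: Mw_pap|exact: tb_pap].
Qed.
Lemma St_Phi om : stab (PhiO Dp) (St om).
Proof. by split; [exact: St_sub|move=> k f hf; apply: St_diag]. Qed.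
Lemma papT_Phi p k f : MX f -> papT p (PhiO Dp k f) = PhiO Dp k (papT p f).
Proof. by move=> hf; rewrite /PhiO papT_Dop. Qed.
Lemma stab_papT (X : set E) p : X `<=` MX -> stab (PhiO Dp) X -> stab (PhiO Dp) (papT p @` X).
Proof.
move=> XM [sX st]; split.
  split; first by exists 0; [exact: subsp0 sX|rewrite (lin0T (papT_lin _))].
  by move=> c _ _ [u hu <-] [v hv <-]; exists (c *: u + v); [exact: sX.2|rewrite papT_lin].
by move=> k _ [f hf <-]; exists (PhiO Dp k f); [exact: st|rewrite papT_Phi //; exact: XM].
Qed.
Definition ev (om : hdual) (f : E) : V -> W := xget 0 [set g | Hm om g /\ tSt om (f - constk 0 g)].
Lemma evP om f : St om f -> Hm om (ev om f) /\ tSt om (f - constk 0 (ev om f)).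
Proof. by move=> /ev_ex h; exact: (@xgetPex _ 0 [set g | Hm om g /\ tSt om (f - constk 0 g)]). Qed.
Lemma Hm_sub om : lsub (Hm om).
Proof.
have := HmS_sub om set0; rewrite (_ : HmS _ _ = Hm om) //.
by apply/seteqP; split=> [g []//|g hg]; split.
Qed.
Lemma Hm_Phi om k g : Hm om g -> Hm om (PhH k g).
Proof.
move=> hg; have [_ st] := @HmS_stab om set0 (fun k x (h : set0 x) => match h with end).
by have [] := st k g (conj hg (fun x (h : set0 x) => match h with end)).
Qed.
Lemma constkB k0 g h : constk k0 (g - h) = constk k0 g - constk k0 h.
Proof. by apply: eext => v k; rewrite eD eN /constk; case: ifP; rewrite ?subr0. Qed.
Lemma constkZD k0 c g h : constk k0 (c *: g + h) = c *: constk k0 g + constk k0 h.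
Proof. by apply: eext => v k; rewrite eD eZ /constk; case: ifP; rewrite ?scaler0 ?addr0. Qed.
Lemma ev_eq om f g : St om f -> Hm om g -> tSt om (f - constk 0 g) -> ev om f = g.
Proof.
move=> hf hg tg; have [he te] := evP hf; apply/eqP; rewrite -subr_eq0; apply/eqP.
apply: (@ev_uniq om); first exact: (subspB (Hm_sub om)).
rewrite constkB (_ : _ - _ = (f - constk 0 g) - (f - constk 0 (ev om f))); last by lmod_in F.
exact: (subspB (tSt_sub om)).
Qed.
Lemma ev_lin om : linon (St om) (ev om).
Proof.
move=> c u v hu hv; have [h1 t1] := evP hu; have [h2 t2] := evP hv.
apply: ev_eq; [exact: (St_sub om).2|exact: (Hm_sub om).2|].
rewrite constkZD (_ : _ - _ = c *: (u - constk 0 (ev om u)) + (v - constk 0 (ev om v))); last by lmod_in F.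
exact: (tSt_sub om).2.
Qed.
Lemma constk_St om k0 g : Hm om g -> St om (constk k0 g).
Proof.
move=> hg; split; first exact: constk_Mw.
exists 1; first by rewrite hornerE.
by rewrite mul1r pap1; exists (k0 + 1) => v k hk; rewrite /constk; case: eqP => // e; lia.
Qed.
Lemma ev_const om g : Hm om g -> ev om (constk 0 g) = g.
Proof. by move=> hg; apply: ev_eq => //; [exact: constk_St|rewrite subrr; exact: subsp0 (tSt_sub om)]. Qed.
Lemma ev_ker om f : St om f -> ev om f = 0 <-> tSt om f.
Proof.
move=> hf; have c0 : constk 0 0 = 0 by apply: eext => v k; rewrite /constk; case: ifP.
split=> [e|tf]; first by have := (evP hf).2; rewrite e c0 subr0.
by apply: ev_eq => //; [exact: subsp0 (Hm_sub om)|rewrite c0 subr0].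
Qed.
(** The powers of u in the coproduct of phi become 1 at u = 1. *)
Lemma Phi_const om k g : Hm om g -> tSt om (PhiO Dp k (constk 0 g) - constk 0 (PhH k g)).
Proof.
move=> hg; case: k => [[e i] m].
pose gs (s : nat) v := oW (LP e i (m - s)) (g (oV (LP e i s) v)).
have ec : PhiO Dp (e, i, m) (constk 0 g) = \sum_(s < m.+1) constk (pm e * (m - s)%N%:Z) (gs s).
  rewrite /PhiO; apply: eq_bigr => s _; apply: eext => v k.
  rewrite /Aop /Bop /constk subr_eq0; case: ifP => _ //; exact: oW0.
have hP : Hm om (PhH (e, i, m) g).
  exact: Hm_Phi.
have rng (s : 'I_m.+1) : - m%:Z <= pm e * (m - s)%N%:Z /\ pm e * (m - s)%N%:Z < - m%:Z + (m + m).+1%:Z.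
  by case: (e) => /=; lia.
have sS : supp (\sum_(s < m.+1) constk (pm e * (m - s)%N%:Z) (gs s)) (- m%:Z) (m + m).+1.
  split=> v k hk; rewrite eS big1 // => s _; have [r1 r2] := rng s; have [c1 c2] := constk_supp (gs s) r1 r2.
  exact: c1.
  exact: c2.
have s0 : supp (constk 0 (PhH (e, i, m) g)) (- m%:Z) (m + m).+1 by apply: constk_supp; lia.
apply: (@tot0_tSt om 1 _ (- m%:Z) (m + m).+1).
- apply: (subspB (Mw_sub om)); last exact: constk_Mw.
  by have [] := (St_Phi om).2 (e, i, m) _ (constk_St 0 hg).
- by rewrite hornerC.
- by rewrite pap1 ec; exact: suppB.
move=> v; rewrite pap1 totB ec constk_tot; [|lia|lia].
rewrite /tot; under eq_bigr do rewrite eS.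
rewrite exchange_big; apply/eqP; rewrite subr_eq0; apply/eqP; apply: eq_bigr => s _.
have [r1 r2] := rng s; exact: (constk_tot (gs s) v r1 r2).
Qed.

Local Notation M1op := (sqop (d := M1d) Dp).
Local Notation pi := (sqpi M1d).

(** Evaluation at u = 1 identifies the standard lattice modulo 1 - u with [Hm], compatibly with
    phi. *)
Lemma St_flag om HC : flag PhH [set 0] (Hm om) HC -> flag (PhiO Dp) (tSt om) (St om) HC.
Proof.
move=> fH; have sS := St_Phi om.
have cp k f : St om f -> ev om (PhiO Dp k f) = PhH k (ev om f).
  move=> hf; have [he [h hh eh]] := evP hf.
  apply: ev_eq; [exact: sS.2|exact: Hm_Phi _ he|].
  rewrite -[PhiO Dp k f](subrK (PhiO Dp k (constk 0 (ev om f)))) -addrA.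
  apply: (subspD (tSt_sub om)); last exact: Phi_const.
  have lP := rp_lin hr (LP k.1.1 k.1.2 k.2).
  have hc := constk_Mw 0 he.
  rewrite -(linonB MX_sub lP); [|exact: St_X hf|exact: hc.1].
  rewrite -eh -[Dp _ _]/(PhiO Dp k _) -papT_Phi; last exact: St_X hh.
  by exists (PhiO Dp k h) => //; exact: sS.2.
have s0 : stab PhH [set 0].
  split; first exact: lsub0.
  move=> k g ->; apply/funext => v; apply: big1 => s _.
  exact: lin0T (rp_lin rW _).
have := flag_pull sS (@ev_lin om) cp s0 fH.
rewrite (_ : St om `&` _ @^-1` [set 0] = tSt om); last first.
  apply/seteqP; split=> [f [hf e]|f tf]; first by apply/(ev_ker hf).
  have hf := tSt_St tf; split=> //; exact/(ev_ker hf).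
rewrite (_ : St om `&` _ @^-1` _ = St om); last first.
  by apply/seteqP; split=> [f []//|f hf]; split=> //; exact: (evP hf).1.
apply=> g hg; exists (constk 0 g); first exact: constk_St.
exact: ev_const.
Qed.
Lemma tqX m : tq ^+ m != 0.
Proof. by rewrite expf_neq0 // subr_eq0 eq_sym; apply/eqP => /(congr1 (fun p : {poly F} => p`_1%N)); rewrite coefX coef1 => /eqP; rewrite oner_eq0. Qed.
Lemma papT_inj2 p f g : p != 0 -> MX f -> MX g -> papT p f = papT p g -> f = g.
Proof.
move=> p0 hf hg e; apply/eqP; rewrite -subr_eq0; apply/eqP; apply: (papT_inj p0).
  exact: (subspB MX_sub).
by rewrite (linBT (papT_lin p)) e subrr.
Qed.
Lemma papT_img p r (X : set E) : papT p @` (papT r @` X) = papT (p * r) @` X.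
Proof.
apply/seteqP; split=> [_ [_ [f hf <-] <-]|_ [f hf <-]]; first by exists f => //; rewrite papTM.
by exists (papT r f); [exists f|rewrite papTM].
Qed.
Lemma push_papT p (Z X : set E) cs : p != 0 -> X `<=` MX -> stab (PhiO Dp) Z ->
  flag (PhiO Dp) Z X cs -> flag (PhiO Dp) (papT p @` Z) (papT p @` X) cs.
Proof.
move=> p0 XM sZ fl; apply: (flag_push sZ _ _ _ fl).
- exact: linon_sub (@subsetT _ _) (papT_lin p).
- by move=> k x Xx; rewrite papT_Phi //; exact: XM.
- move=> x Xx e; rewrite (papT_inj p0 (XM _ Xx) e); exact: subsp0 sZ.1.
Qed.
Lemma Lw_LL om : Lw om `<=` LL.
Proof. by move=> f hf; exact: (wspan1 Lw_sub hf). Qed.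
Lemma M1opE g f : LL f -> M1op g (pi f) = pi (Dp g f).
Proof.
exact: (sqopE (d := M1d) (isrep_sub hr LL_sub (fun g f => @LL_op g f) (fun f => @LL_X f))
  (fun g f => @tLL_op g f)).
Qed.
Lemma Lw_pi om f : Lw om f -> wsp M1op om (pi f).
Proof.
move=> hf a; have hL := Lw_LL hf; rewrite M1opE // hf.1.2.
by rewrite (linonZ LL_sub (sqpi_lin (d := M1d))).
Qed.
Lemma M1_span y : exists (s : seq hdual) (g : hdual -> E), (forall om, Lw om (g om)) /\
  y = \sum_(om <- s) pi (g om).
Proof.
have [_ [s [g [hg ->]]] <-] := sqpi_sur y; exists s, g; split=> //.
rewrite (linon_sum LL_sub (sqpi_lin (d := M1d))) // => om _; exact: Lw_LL.
Qed.
Lemma M1_wspE om : wsp M1op om = pi @` Lw om.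
Proof.
apply/seteqP; split=> [y Wy|_ [f hf <-]]; last exact: Lw_pi.
have [s [g [hg ey]]] := M1_span y.
have hg' om' : setT (pi (g om')) /\ wsp M1op om' (pi (g om')) by split=> //; exact: Lw_pi.
have ey2 := wsp_comp M1_rep I Wy hg' ey.
rewrite ey2 -(linonZ LL_sub (sqpi_lin (d := M1d))); last exact: Lw_LL.
by exists ((count_mem om s)%:R *: g om) => //; exact: (subspZ (Lw_sub om)).
Qed.

Section OneWeight.
Variables (om : hdual) (HC : seq (kx -> F)).
Hypothesis fH : flag PhH [set 0] (Hm om) HC.
Local Notation S := (St om).
Let SM : S `<=` MX. Proof. exact: St_X. Qed.
Let sS := St_Phi om.
Let Z := papT (tq ^+ BB om) @` Lw om.
Let LM : Lw om `<=` MX. Proof. by move=> f [[]]. Qed.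
Lemma Lw_Phi : stab (PhiO Dp) (Lw om).
Proof.
split=> [|k f hf]; first exact: Lw_sub.
by have := Lw_op (LP k.1.1 k.1.2 k.2) hf; rewrite addr0.
Qed.
Let ZS : Z `<=` S.
Proof.
move=> _ [f hf <-]; split; first by apply: Mw_pap; case: hf.
by apply: (tb_tq (b := BB om)) => //; exact: Lw_tb.
Qed.
Let sZ : stab (PhiO Dp) Z. Proof. exact: stab_papT _ LM Lw_Phi. Qed.
Let ZM : Z `<=` MX. Proof. exact: subset_trans ZS SM. Qed.
Lemma St_pow_flag m : exists cs, flag (PhiO Dp) (papT (tq ^+ m) @` S) S cs.
Proof.
have fS := St_flag fH; elim: m => [|m [cs IH]].
  exists [::]; rewrite (_ : papT _ @` S = S); first exact: flag0.
  by apply/seteqP; split=> [_ [f hf <-]|f hf]; rewrite ?pap1 //; exists f; rewrite ?pap1.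
have st : stab (PhiO Dp) (tSt om) by exact: stab_papT _ SM sS.
have := push_papT (tqX m) SM st fS; rewrite papT_img -exprSr => f1.
by exists (cs ++ HC); exact: flag_cat f1 IH.
Qed.
(** Independence of the lattice. Let Z be a multiple of [Lw om] inside the standard lattice S. The
    quotient of S by (1 - u) Z is filtered through Z and through (1 - u) S; as S / Z and (1 - u) S /
    (1 - u) Z have the same characters, so do Z / (1 - u) Z and S / (1 - u) S. *)
Lemma M1_flag : exists2 cs, flag (PhiO M1op) [set 0] (wsp M1op om) cs &
  forall g, chcount g cs = chcount g HC.
Proof.
(* (1 - u)^N S lies in Z, which makes all the quotients below finite-dimensional. *)
pose N := (BB om + KK om)%N.
have cM : comfam (PhiO Dp) (Mw om) := PhiO_comfam om hr.
have SMw : S `<=` Mw om by move=> f [].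
have cS := comfam_sub cM sS SMw.
have sub1 : papT (tq ^+ N) @` S `<=` Z.
  move=> _ [f hf <-]; exists (papT (tq ^+ KK om) f); first exact: St_Lw.
  by rewrite -papTM -exprD.
have tZZ : papT tq @` Z `<=` Z.
  move=> _ [_ [f hf <-] <-]; exists (papT tq f); first exact: Lw_pap.
  exact: papTC.
have stZ : stab (PhiO Dp) (papT tq @` Z) by exact: (stab_papT _ ZM sZ).
have sub2 : papT (tq ^+ N.+1) @` S `<=` papT tq @` Z.
  by rewrite exprS -papT_img; exact: image_subset.
have [c1 f1] := St_pow_flag N.+1.
have sP : stab (PhiO Dp) (papT (tq ^+ N.+1) @` S) by exact: (stab_papT _ SM sS).
have [m hm] := flag_fd_ex sP.1 f1.
have [c2 f2] := flag_ex cS sZ ZS (fd_sub hm (@subset_refl _ _) (subset_trans sub2 tZZ)).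
have cZ := comfam_sub cS sZ ZS.
have [c3 f3] := flag_ex cZ stZ tZZ (fd_sub hm ZS sub2).
have tq0 : tq != 0 by have := tqX 1; rewrite expr1.
have f4 := push_papT tq0 SM sZ f2.
have cnt g : chcount g c3 = chcount g HC.
  have := flag_uniq g cS stZ (flag_cat f3 f2) (flag_cat f4 (St_flag fH)).
  by rewrite !chcount_cat addnC => /addIn.
have lp : linon (Lw om) (papT (tq ^+ BB om)) by exact: (linon_sub (@subsetT _ _) (papT_lin _)).
have cp k f : Lw om f -> papT (tq ^+ BB om) (PhiO Dp k f) = PhiO Dp k (papT (tq ^+ BB om) f).
  by move=> hf; rewrite papT_Phi //; exact: LM.
have f5 := flag_pull Lw_Phi lp cp stZ f3 (fun y (Zy : Z y) => Zy).
pose tL : set E := papT tq @` Lw om.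
have e1 : Lw om `&` papT (tq ^+ BB om) @^-1` Z = Lw om.
  by apply/seteqP; split=> [f []//|f hf]; split=> //; exists f.
have e2 : Lw om `&` papT (tq ^+ BB om) @^-1` (papT tq @` Z) = tL.
  apply/seteqP; split=> [f [hf /= [_ [g hg <-] e]]|_ [g hg <-]].
  exists g => //; apply: (papT_inj2 (tqX (BB om))); [exact: papT_MX (LM hg)|exact: LM|].
  by rewrite papTC.
  split; first exact: Lw_pap.
  by exists (papT (tq ^+ BB om) g); [exists g|exact: papTC].
rewrite e1 e2 in f5.
have LLw := @Lw_LL om.
have stL : stab (PhiO Dp) tL by exact: (stab_papT _ LM Lw_Phi).
(* An element of weight [om] in (1 - u) [LL] comes from the component of weight [om] alone. *)
have ker f : Lw om f -> pi f = 0 -> tL f.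
  move=> hf /(sqpi0 (d := M1d) (LLw _ hf)) [_ [s [g [hg ->]]] ef].
  rewrite (linsT (papT_lin _)) // in ef.
  have hg' om' : MX (papT tq (g om')) /\ wsp Dp om' (papT tq (g om')).
  exact: (Mw_pap tq (hg om').1).
  rewrite (wsp_comp hr (LM hf) hf.1.2 hg' ef) -(linZT (papT_lin _)) //.
  by exists ((count_mem om s)%:R *: g om) => //; apply: (subspZ (Lw_sub om)).
have f6 := flag_push (Phi' := PhiO M1op) stL (linon_sub LLw (sqpi_lin (d := M1d)))
  (fun k f hf => esym (M1opE _ (LLw _ hf))) ker f5.
exists c3 => //; move: f6; rewrite -M1_wspE (_ : pi @` tL = [set 0]) //.
apply/seteqP; split=> [_ [_ [f hf <-] <-]|_ ->].
  by apply/(sqpi0); [apply: LLw; exact: Lw_pap|exists f => //; exact: LLw].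
by exists 0 => //; exact: subsp0 stL.1.
Qed.
End OneWeight.

(** * Integrability of the specialization *)

Lemma M1_weight om y : wsp M1op om y -> y != 0 ->
  exists ka, (exists2 v, wsp oV ka v & v != 0) /\ (exists2 w, wsp oW (om - ka) w & w != 0).
Proof.
rewrite M1_wspE => -[f hf <-] nz.
have hM : Mw om f by case: hf.
have f0 : f <> 0.
  move=> e; move/eqP: nz; apply; rewrite e; apply/(sqpi0 (d := M1d) (subsp0 LL_sub)).
  exact: subsp0 tLL_sub.
have [ka [v [k [Wv nz']]]] : exists ka v k, wsp oV ka v /\ f v k <> 0.
  apply: contrapT => no; apply: f0; apply: (span_ext hM.1.1) => [k c u v _ _|ka v k Wv].
  by rewrite scaler0 addr0.
  by apply: contrapT => nz'; apply: no; exists ka, v, k.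
exists ka; split.
  exists v => //; apply/eqP => e; apply: nz'.
  by rewrite e (lin0T (hM.1.1 k)).
by exists (f v k); [exact: MwP k hM Wv|exact/eqP].
Qed.
Lemma pair_cone : exists s : seq hdual, forall om ka, (exists2 v, wsp oV ka v & v != 0) ->
  (exists2 w, wsp oW (om - ka) w & w != 0) -> exists2 la, la \in s & leQ om la.
Proof.
have [s hs] := oi_cone hV; have [t ht] := oi_cone hW.
exists [seq a + b | a <- s, b <- t] => om ka /hs[la ls lo] /ht[la' lt' lo'].
exists (la + la'); first exact: allpairs_f.
by rewrite -[om](subrK ka) addrC; apply: leQD.
Qed.
Lemma cone_bound (mu la : hdual) i : exists N : int, forall z : int, leQ (mu + z%:~R *: sroot H i) la -> z <= N.
Proof.
have [[z0 [a0 e0]]|no] := pselect (exists z : int, leQ (mu + z%:~R *: sroot H i) la); last first.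
  by exists 0 => z hz; case: no; exists z.
exists (z0 + (a0 i)%:Z) => z [a e].
(* Adding K copies of the root makes both integers z and z0 nonnegative, so that independence of the
   simple roots can compare them. *)
pose K := (absz z + absz z0)%N.
have up (z' : int) (a' : 'I_n -> nat) : (0 <= z' + K%:Z) -> la - (mu + z'%:~R *: sroot H i) = \sum_j sroot H j *+ a' j ->
  la - mu + sroot H i *+ K = \sum_j sroot H j *+ (a' j + (j == i) * absz (z' + K%:Z)%R)%N.
  move=> z0' e'; under eq_bigr do rewrite mulrnDr; rewrite big_split /= -e'.
  have -> (m : nat) : \sum_j sroot H j *+ ((j == i) * m)%N = sroot H i *+ m.
  by rewrite (bigD1 i) //= eqxx mul1n big1 ?addr0 // => j /negbTE ->; rewrite mul0n.
  have -> : sroot H i *+ absz (z' + K%:Z) = (z' + K%:Z)%:~R *: sroot H i.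
  by rewrite -[in RHS](gez0_abs z0') -scaler_nat.
  rewrite -[sroot H i *+ K]scaler_nat.
  lmod_in rat.
have h1 := up z a _ e; have h2 := up z0 a0 _ e0.
have e3 := etrans (esym (h1 _)) (h2 _).
have := sroot_comb_inj (e3 _ _) i; rewrite eqxx; lia.
Qed.
(** Upward strings end by the cone condition. Downward ones are carried to upward ones by reflecting
    the weights of V and of W separately; reflection on the specialization itself would presuppose
    the finiteness of strings being proved. *)
Lemma M1_str (mu : hdual) i : exists N : nat, forall r : nat, (N <= r)%N ->
  wsp M1op (mu + sroot H i *+ r) `<=` [set 0] /\ wsp M1op (mu - sroot H i *+ r) `<=` [set 0].
Proof.
have [s hs] := pair_cone.
have [bd hbd] := choice (fun la => cone_bound mu la i).
(* The pairing of [mu] with the coroot. The default is harmless: when the string has a nonzero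
   vector, V and W force the pairing to be an integer. *)
pose c : int := xget 0 [set c : int | mu (scoroot H i) = c%:~R].
exists ((\max_(la <- s) absz (bd la)) + absz c).+1 => r hr'.
have bnd (z : int) : (absz (\max_(la <- s) absz (bd la))%N < absz z)%N -> 0 <= z ->
  forall ka, (exists2 v, wsp oV ka v & v != 0) ->
  (exists2 w, wsp oW (mu + z%:~R *: sroot H i - ka) w & w != 0) -> False.
  move=> hz z0 ka h1 h2; have [la ls lo] := hs _ _ h1 h2.
  have := hbd la z lo; have := @leq_bigmax_seq _ s xpredT (fun la => absz (bd la)) la ls isT.
  by move: hz; rewrite /=; lia.
have hZ (z : nat) : sroot H i *+ z = (z : int)%:~R *: sroot H i by rewrite -scaler_nat.
split=> y Wy; apply: contrapT => /eqP y0.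
  have [ka [h1 h2]] := M1_weight Wy y0; rewrite hZ in h2.
  by apply: (bnd r _ _ ka h1 h2); [move: hr'; lia|lia].
have [ka [[v Wv v0] [w Ww w0]]] := M1_weight Wy y0.
have [m em [u Wu u0]] := wsp_reflect rV (oi_str hV) i Wv v0.
have [m' em' [u' Wu' u0']] := wsp_reflect rW (oi_str hW) i Ww w0.
have ec : mu (scoroot H i) = (m + m' + 2 * r%:Z)%:~R.
  have : (mu - sroot H i *+ r) (scoroot H i) = (m + m')%:~R.
  by rewrite intrD -em -em' !(add_lfunE, opp_lfunE) addrCA addrN addr0.
  rewrite hZ -scaleNr hdualE sroot_scoroot cmat_diag => /eqP; rewrite mulNr subr_eq => /eqP ->.
  by rewrite [in RHS]intrD intrM mulrC.
have cE : c = m + m' + 2 * r%:Z.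
  have : mu (scoroot H i) = c%:~R by apply: (@xgetPex _ 0 [set c : int | mu (scoroot H i) = c%:~R]); exists (m + m' + 2 * r%:Z).
  by rewrite ec => /intr_inj.
(* The two reflected weights add up to mu + (r - c) times the simple root. *)
apply: (bnd (r%:Z - c) _ _ (ka - m%:~R *: sroot H i)); [move: hr'; lia|move: hr'; lia|by exists u|].
exists u' => //; move: Wu'; congr (wsp _ _ u').
rewrite cE hZ (_ : r%:Z - (m + m' + 2 * r%:Z) = - m - m' - r%:Z); last by lia.
rewrite !intrD; lmod_in rat.
Qed.
Lemma M1_oint : oint M1op.
Proof.
split.
- exact: M1_rep.
- move=> y; have [s [g [hg ->]]] := M1_span y; exists s, (fun om => pi (g om)); split=> // om.
  exact: Lw_pi.
- move=> om.
  have [csV fV] := choice (fun nu => PhiO_flag nu hV); have [csW fW] := choice (fun nu => PhiO_flag nu hW).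
  have [l [cs [_ _ fH _]]] := hom_flag_full om fV fW.
  have [c3 f3 _] := M1_flag fH.
  exact: flag_fd_ex (lsub0 _) f3.
- have [s hs] := pair_cone; exists s => om [y Wy y0].
  by have [ka [h1 h2]] := M1_weight Wy y0; exact: hs h1 h2.
- exact: M1_str.
Qed.
End Tensor.
End Representations.
Lemma qpow0 (R : realType) (lq : R[i]) : qpow lq 0 = 1.
Proof.
by rewrite /qpow rmorph0 mul0r /cexp expR0 cos0 sin0 mulr1 mulr0.
Qed.
Lemma cexpD (R : realType) (x y : R[i]) : cexp (x + y) = cexp x * cexp y.
Proof.
case: x y => [a b] [c d]; rewrite /cexp expRD cosD sinD.
by apply/eqP; rewrite eq_complex /=; apply/andP; split; apply/eqP; ring.
Qed.
Lemma qpowD (R : realType) (lq : R[i]) a b : qpow lq (a + b) = qpow lq a * qpow lq b.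
Proof. by rewrite /qpow rmorphD mulrDl cexpD. Qed.
Lemma qpow_data (R : realType) (q lq : R[i]) : cexp lq = q ->
  (forall m : nat, (0 < m)%N -> q ^+ m != 1) -> qdata q (qpow lq).
Proof.
move=> q_log q_not_root; have q1 : qpow lq 1 = q by rewrite /qpow rmorph1 mul1r.
split=> //; [|exact: qpow0|exact: qpowD].
apply/eqP => q0; have := qpowD lq 1 (-1); rewrite qpow0 q1 q0 mul0r => /eqP.
by rewrite oner_eq0.
Qed.

(** * Modules over the quantum affinization *)

Section QuantumAffine.
Variables (R : realType) (q lq : R[i]) (hq : qdata q (qpow lq)).
Variables (n : nat) (D : cartan_datum n) (H : realization D).
Local Notation C := R[i].
Local Notation qmod := (qmod q lq H).
Local Notation qp := (qpow lq).
Local Notation hdual := 'Hom(hh H, rat^o).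
Local Notation ld V l := (sdim (lspace (V := V) l)).

Section Interface.

Section ToRep.
Variables (V : lmodType C) (g : qgen H -> V -> V).
Hypothesis lg : forall x, linfun1 (g x).

(** The defining relations live in the free algebra, so they are tested by evaluation there;
    [rel6_rep] and [rep_rel6] pass to operators and back. *)
Definition rel6 : Prop := forall u w, qaff_rel q lq u w ->
  forall v, pev g (rel := fun _ _ => False) u v = pev g (rel := fun _ _ => False) w v.

Section Ev.
Variable rel : term C (qgen H) -> term C (qgen H) -> Prop.
Hypothesis hrel : forall a b, rel a b -> tev g a =1 tev g b.
Notation ev := (pev g (rel := rel)).

Lemma ev_x e i r v : ev (xg rel e i r) v = g (GenX H e i r) v.
Proof. exact: pev_gen. Qed.
Lemma ev_k a v : ev (kg rel a) v = g (GenK a) v.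
Proof. exact: pev_gen. Qed.
Lemma ev_h i m v : ev (hg rel i m) v = hop g i m v.
Proof.
rewrite /hg /hop; case: insubP => [m' _ _|_]; [exact: pev_gen|exact: pev0].
Qed.
Lemma ev_phi e i m v : ev (phi q rel e i m) v = gop q g (LP H e i m) v.
Proof.
rewrite pevM // pev_gen // pev_exp //; congr (g _ _).
apply: eq_bigr => k _; congr (_ *: _); apply: eq_opow => j w.
by rewrite pevZ // ev_h.
Qed.
Lemma ev_zext e i k v : ev (zext e (phi q rel e i) k) v = zp (gop q g) e i k v.
Proof. by rewrite /zext /zp; case: ifP => _; [exact: ev_phi|exact: pev0]. Qed.
End Ev.

Let hF : forall a b : term C (qgen H), False -> tev g a =1 tev g b.
Proof. by []. Qed.
Notation ev := (pev g (rel := fun _ _ => False)).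

Lemma rel6_rep : rel6 -> isrep q (qpow lq) (gop q g) setT.
Proof.
move=> hr.
have KK a b v : g (GenK a) (g (GenK b) v) = g (GenK (a + b)) v.
  by have := hr _ _ (R1_kk q lq a b) v; rewrite pevM // !ev_k.
have K0 v : g (GenK 0) v = v.
  by have := hr _ _ (R1_k0 q lq H) v; rewrite ev_k // pev1.
have KH a j m v : m != 0 -> g (GenK a) (hop g j m v) = hop g j m (g (GenK a) v).
  by move=> m0; have := hr _ _ (R1_kh q lq a j m0) v; rewrite !pevM // !ev_k // !ev_h.
have HH i j m m' v : m != 0 -> m' != 0 -> hop g i m (hop g j m' v) = hop g j m' (hop g i m v).
  by move=> m0 m1; have := hr _ _ (@R1_hh _ q lq _ _ H i m j m' m0 m1) v; rewrite !pevM // !ev_h.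
split=> //.
- by move=> l; exact: gop_lin.
- by move=> i v _; exact: hop0.
- by move=> a b v _; exact: KK.
- by move=> v _; exact: K0.
- by move=> a j m v _; exact: KH.
- by move=> i m j m' v _; exact: HH.
- move=> a e j r v _.
  have := hr _ _ (R2 q lq e a j r) (g (GenK a) v).
  by rewrite pevZ // !pevM // !ev_k // !ev_x // KK addNr K0.
- move=> i m e j r v _ m0; have := hr _ _ (@R3 _ q lq _ _ H e i j m r m0) v.
  by rewrite pevZ // pevB // !pevM // !ev_h // !ev_x.
- move=> i j r r' v _; have := hr _ _ (@R4 _ q lq _ _ H i j r r') v.
  rewrite pevB // !pevM // !ev_x // => ->; case: ifP => _; last exact: pev0.
  by rewrite pevZ // pevB // !ev_zext.
- move=> e i j r r' v _; have := hr _ _ (@R5 _ q lq _ _ H e i j r r') v.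
  by rewrite !pevB // !pevZ // !pevM // !ev_x.
- by move=> e i v _; exact: gop_P0.
- by move=> e i m v _; exact: gop_PS.
Qed.
Lemma rep_rel6 : isrep q (qpow lq) (gop q g) setT -> serre_rel q (gop q g) -> rel6.
Proof.
move=> hr hs u w; case.
- by move=> a b v; rewrite pevM // !ev_k //; apply: (rp_KK hr).
- by move=> v; rewrite ev_k // pev1 //; apply: (rp_K0 hr).
- by move=> a j m m0 v; rewrite !pevM // !ev_k // !ev_h //; apply: (rp_KH hr).
- by move=> i m j m' m0 m1 v; rewrite !pevM // !ev_h //; apply: (rp_HH hr).
- move=> e a j r v; rewrite pevZ // !pevM // !ev_k // !ev_x //.
  have := rp_KX hr a e j r (v := g (GenK (- a)) v) I; rewrite /= => ->; congr (_ *: g _ _).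
  by have := rp_KK hr a (- a) I; rewrite /= => ->; rewrite subrr; apply: (rp_K0 hr).
- by move=> e i j m r m0 v; rewrite pevZ // pevB // !pevM // !ev_h // !ev_x //; apply: (rp_HX hr).
- move=> i j r r' v; rewrite pevB // !pevM // !ev_x //.
  have := rp_XX hr i j r r' I; rewrite /= => ->; case: ifP => _; last by rewrite pev0.
  by rewrite pevZ // pevB // !ev_zext.
- by move=> e i j r r' v; rewrite !pevB // !pevZ // !pevM // !ev_x //; apply: (rp_R5 hr).
- move=> e i j s r r' ij es v; rewrite pev0 // -(hs e i j s r r' v ij es).
  rewrite pev_sum //; apply: eq_bigr => p _; rewrite pev_sum //; apply: eq_bigr => t _.
  rewrite pevZ // !pevM // !pev_prod //; congr (_ *: _).
  have fE (P : pred 'I_s) w' : xfold (gop q g) e i r p P w' =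
  foldr (fun u => ev (xg _ e i (r (p u)))) w' [seq u <- index_enum 'I_s | P u].
  by rewrite /xfold; elim: (seq.filter _ _) => //= u'' l ->; rewrite ev_x.
  by rewrite !fE ev_x.
Qed.
End ToRep.
Lemma tev_act (V : qmod) t v :
  tev (fun x => act (pgen _ x) : V -> V) t v = act (tclass _ t) v.
Proof.
elim: t v => [x|c|a IHa b IHb|a IHa b IHb] v //=.
- have := act_linearl c 1 0 v.
  rewrite act1 (_ : act 0 v = 0) ?addr0 => [<-|]; last first.
  by have := act_linearl (-1) 0 0 v; rewrite scaler0 addr0 scaleN1r addNr.
  by congr (act _ v); rewrite -[LHS]/(p_cst _ c * 1) mulr1.
- rewrite IHa IHb -[act _ v in X in X + _]scale1r -act_linearl scale1r.
  by congr (act _ v); apply: p_addE.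
- by rewrite IHb IHa -actM; congr (act _ v); apply: p_mulE.
Qed.
Definition qgens (V : qmod) (x : qgen H) : V -> V := act (pgen _ x).

Lemma pev_act (V : qmod) (u : qaff q lq H) (v : V) : pev (@qgens V) u v = act u v.
Proof. by rewrite /pev tev_act tclass_repr. Qed.
Lemma qgens_lin (V : qmod) x : linfun1 (@qgens V x).
Proof. exact: act_linear. Qed.
Lemma qgens_rel (V : qmod) a b :
  qaff_rel q lq (tclass (fun _ _ => False) a) (tclass _ b) ->
  tev (@qgens V) a =1 tev (@qgens V) b.
Proof.
move=> h v; rewrite !tev_act; congr (act _ v); apply/tclassP; exact: teq_rel.
Qed.
Lemma qgens_rel6 (V : qmod) : rel6 (@qgens V).
Proof. by move=> u w h v; apply: qgens_rel; rewrite !tclass_repr. Qed.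
Definition qop (V : qmod) : lab H -> V -> V := gop q (@qgens V).

Lemma qop_rep (V : qmod) : isrep q (qpow lq) (@qop V) setT.
Proof. exact: (rel6_rep (@qgens_lin V) (@qgens_rel6 V)). Qed.
Lemma act_phi (V : qmod) e i m (v : V) : act (phi q _ e i m) v = qop (LP H e i m) v.
Proof.
rewrite -pev_act ev_phi //; [exact: qgens_lin|exact: qgens_rel].
Qed.

Section MkQmod.
Variables (V : lmodType C) (op : lab H -> V -> V).
Hypotheses (hr : isrep q (qpow lq) op setT) (hs : serre_rel q op).

Let lg x : linfun1 (genop op x) := genop_lin hr x.

Let hrel a b :
  qaff_rel q lq (tclass (fun _ _ => False) a) (tclass _ b) ->
  tev (genop op) a =1 tev (genop op) b.
Proof.
move=> h v.
have hr' : rel6 (genop op).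
  by apply: (rep_rel6 lg); rewrite (gop_genop hr); [exact: hr|exact: hs].
have := hr' _ _ h v; rewrite !(pevE lg) //.
Qed.
Lemma mkqmod_lin (u : qaff q lq H) : linfun1 (pev (genop op) u).
Proof. exact: pev_lin. Qed.
Lemma mkqmod_linl c (u w : qaff q lq H) v :
  pev (genop op) (c *: u + w) v = c *: pev (genop op) u v + pev (genop op) w v.
Proof. by rewrite pevD // pevZ. Qed.
Lemma mkqmod1 v : pev (genop op) (1 : qaff q lq H) v = v.
Proof. exact: pev1. Qed.
Lemma mkqmodM (u w : qaff q lq H) v :
  pev (genop op) (u * w) v = pev (genop op) u (pev (genop op) w v).
Proof. exact: pevM. Qed.
Definition mkqmod : qmod := QMod mkqmod_lin mkqmod_linl mkqmod1 mkqmodM.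

Lemma mkqmod_op : @qop mkqmod = op.
Proof.
rewrite -[RHS](gop_genop hr); congr gop.
apply/funext => x; apply/funext => v.
by rewrite /= pev_gen.
Qed.
End MkQmod.
End Interface.

Section Modules.

Lemma act_lin (V : qmod) u : linon setT (act u : V -> V).
Proof. by move=> c v w _ _; rewrite (act_linear u). Qed.
Lemma act_0 (V : qmod) u : act u (0 : V) = 0.
Proof. exact: (lin0T (@act_lin V u)). Qed.
Lemma wspaceE (V : qmod) om : wspace (V := V) om = wsp qp (qop (V := V)) om.
Proof. by []. Qed.
Lemma wspace_sub (V : qmod) om : lsub (wspace (V := V) om).
Proof. by rewrite wspaceE; apply: (wsp_sub (qop_rep V)). Qed.
Lemma O_int_oint (V : qmod) : O_int V -> oint q qp (qop (V := V)).
Proof.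
move=> [[sp _] hfd hc hs]; split=> //; first exact: qop_rep.
by move=> om; have [d hd] := hfd om; exists d; apply: has_dim_fd.
Qed.
Lemma oint_O_int (V : qmod) : oint q qp (qop (V := V)) -> O_int V.
Proof.
move=> [hr sp hfd hc hs]; split=> //.
- split=> [v|s f Us hf e]; first by have [s [f [h1 h2]]] := sp v; exists s, f.
  move=> om os; apply: (@wsp_graded C q qp hq n D H V (qop (V := V)) setT [set 0] (lsub0 _) _ _ _ s f Us _ _ om os) => //.
  + by move=> a; apply: (rp_lin hr).
  + by move=> a v ->; apply: (lin0T (rp_lin hr (LK a))).
  + by move=> om' _; split=> //; apply: hf.
- move=> om; have [d hd] := hfd om; have [d' r] := fd_rdim (wspace_sub V om) hd.
  by exists d'; apply: rdim_has_dim.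
Qed.
Lemma sub_lsub (V : qmod) (W : set V) : submodule W -> lsub W.
Proof. by case. Qed.
Lemma sub_qop (V : qmod) (W : set V) g : submodule W -> forall v, W v -> W (qop (V := V) g v).
Proof.
move=> [W0 WD WA] v Wv; case: g => [e i r|a|i m|e i m].
- exact: WA.
- exact: WA.
- by rewrite /qop /gop /hop; case: insub => [m'|] //; apply: WA.
- by rewrite -act_phi; apply: WA.
Qed.
(** The weight [om0] is forced into the list, possibly with component 0, so that one prescribed
    component can be extracted. *)
Lemma sub_graded (V : qmod) (W : set V) v om0 : O_int V -> submodule W -> W v ->
  exists (s : seq hdual) (f : hdual -> V), [/\ uniq s /\ om0 \in s,
  v = \sum_(om <- s) f om,
  forall om, wspace om (f om) & forall om, om \in s -> W (f om)].
Proof.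
move=> oV sW Wv; have ho := O_int_oint oV; have hr := oi_rep ho.
have [s [f [hf ev]]] := oi_span ho v.
pose t := undup (om0 :: s); have Ut : uniq t := undup_uniq _.
pose g om := (count_mem om s)%:R *: f om.
have hg om : wspace om (g om) by exact: (subspZ (wspace_sub V om) _ (hf om)).
have st : {subset s <= t} by move=> om so; rewrite mem_undup inE so orbT.
have eg : v = \sum_(om <- t) g om by rewrite ev (wsum_seq f Ut st).
exists t, g; split=> //; first by rewrite mem_undup mem_head.
apply: (@wsp_graded C q qp hq n D H V (qop (V := V)) setT W (sub_lsub sW)) => //.
- by move=> a; apply: (rp_lin hr).
- by move=> a u; apply: sub_qop.
- by move=> om _; split=> //; apply: hg.
- by rewrite -eg.
Qed.
Definition morph (V S : qmod) (W : set V) (p : V -> S) :=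
  [/\ linon W p, forall a u, W u -> p (act a u) = act a (p u)
  & forall s, exists2 u, W u & p u = s].

(** A preimage is replaced by its component of weight [om]; the image is unchanged because weight
    vectors of distinct weights in S are independent. *)
Lemma morph_wspace (V S : qmod) (W : set V) (p : V -> S) om s : O_int V -> submodule W ->
  morph W p -> wspace om s -> exists2 x, W x /\ wspace om x & p x = s.
Proof.
move=> oV sW [lp ap sur] Ws; have [x Wx ex] := sur s.
have [t [f [[Ut ot] et hf Wf]]] := sub_graded om oV sW Wx.
have pf om' : om' \in t -> wspace om' (p (f om')).
  by move=> ot'; move=> a; rewrite -ap ?hf ?(linonZ (sub_lsub sW) lp) //; apply: Wf.
exists (f om); first by split; [exact: Wf|exact: hf].
pose g om' := p (f om') - (if om' == om then s else 0).
have sub om' := wspace_sub S om'.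
have hg om' : om' \in t -> wspace om' (g om').
  move=> ot'; apply: (subspB (sub om')); first exact: pf.
  by case: eqP => [->|_] //; apply: subsp0.
have Z : \sum_(om' <- t) g om' = 0.
  have e1 : \sum_(om' <- t) (if om' == om then s else 0) = s.
  by rewrite (bigD1_seq om) //= eqxx big1 ?addr0 // => om' /negbTE ->.
  rewrite sumrB e1 -ex {1}et [X in _ - p X]big_seq (linon_sum (sub_lsub sW) lp) //.
  by rewrite -big_seq subrr.
have hr := qop_rep S.
have := @wsp_graded C q qp hq n D H S (qop (V := S)) setT [set 0] (lsub0 _) (fun a => rp_lin hr (LK a))
  (lsubT _) _ t g Ut _ _ om ot.
rewrite /g eqxx => h; apply/eqP; rewrite -subr_eq0; apply/eqP; apply: h => //.
- by move=> a v ->; apply: (lin0T (rp_lin hr (LK a))).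
- by move=> om' ot'; split=> //; apply: hg.
Qed.
Definition Phi (V : qmod) (k : bool * 'I_n * nat) (v : V) : V :=
  act (phi q _ k.1.1 k.1.2 k.2) v.
Definition lchar (l : lweight R H) (k : bool * 'I_n * nat) : C := l.2 k.1.1 k.1.2 k.2.

Lemma lspaceE (V : qmod) (l : lweight R H) :
  lspace (V := V) l = geneig (@Phi V) (lchar l) (wspace l.1) [set 0].
Proof.
have actP (e : bool) i m p (v : V) :
  act ((phi q _ e i m - l.2 e i m *: (1 : qaff q lq H)) ^+ p) v =
  iter p (fun y => Phi (e, i, m) y - lchar l (e, i, m) *: y) v.
  elim: p => [|p IH]; first by rewrite act1.
  rewrite exprS actM IH -[X in X - _]scale1r.
  set w := iter _ _ _; rewrite addrC -scaleNr act_linearl act1 addrC scaleNr.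
  by rewrite scale1r.
apply/seteqP; split=> v [Wv [p hp]]; split=> //; exists p.
  by move=> [[e i] m]; rewrite -actP.
by move=> e i m; rewrite actP; apply: (hp (e, i, m)).
Qed.
Lemma Phi_wspace (V : qmod) om k (v : V) : wspace om v -> wspace om (Phi k v).
Proof. by rewrite /Phi act_phi; apply: (wsp_ph (qop_rep V)). Qed.
Lemma comfam_wspace (V : qmod) om : comfam (@Phi V) (wspace om).
Proof.
split; first by split; [exact: wspace_sub|move=> k v; apply: Phi_wspace].
- by move=> k c u v _ _; apply: act_lin.
- by move=> k k' v _; rewrite /Phi !act_phi (phph_comm (qop_rep V)).
Qed.
Lemma stab0 (V : qmod) : stab (@Phi V) [set 0].
Proof. by split; [exact: lsub0|move=> k v ->; apply: act_0]. Qed.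
(** Dimensions of l-weight spaces become multiplicities in a flag; later computations of characters
    go through this. *)
Lemma sdim_flag (V : qmod) l cs : flag (@Phi V) [set 0] (wspace l.1) cs ->
  sdim (lspace (V := V) l) = chcount (lchar l) cs.
Proof.
move=> fl; rewrite lspaceE; apply: sdim_rdim.
exact: (geneig_rdim (lchar l) (comfam_wspace V l.1) (@stab0 V) fl (@subset_refl _ _)).
Qed.
Lemma flag_nil (E : lmodType C) (I : Type) (P : I -> E -> E) Z X cs :
  flag P Z X cs -> X `<=` Z -> cs = [::].
Proof.
case=> // Y X' c cs' e fl _ Xe nYe _ _ _ XZ; case: nYe.
by apply: (flag_sub fl); apply: XZ.
Qed.
Lemma stab_sub (V : qmod) (W : set V) om : submodule W -> stab (@Phi V) (W `&` wspace om).
Proof.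
move=> sW; split; first by apply: lsubI; [exact: sub_lsub|exact: wspace_sub].
by move=> k v [Wv vom]; split; [case: sW => _ _; apply|apply: Phi_wspace].
Qed.
Lemma wsub0 (V : qmod) (W : set V) : submodule W -> [set 0] `<=` W.
Proof. by move=> [W0 _ _] x ->. Qed.
Lemma morph_flag (V S : qmod) (W : set V) (p : V -> S) om : O_int V -> submodule W ->
  morph W p -> exists cs, flag (@Phi S) [set 0] (wspace om) cs.
Proof.
move=> oV sW mp; have [d hd] := oi_fd (O_int_oint oV) om.
apply: (@flag_ex _ _ _ (@Phi S) [set 0] d); first exact: comfam_wspace.
- exact: stab0.
- by move=> x ->; apply: (subsp0 (wspace_sub S om)).
have [lp _ _] := mp.
apply: (fd_img (X := W `&` wspace om)).
- by apply: lsubI; [exact: sub_lsub|exact: wspace_sub].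
- exact: linon_sub lp => x [].
- exact: fd_sub hd _ _ => x [].
- by move=> s Ws; have [x hx ex] := morph_wspace oV sW mp Ws; exists x.
Qed.
Lemma subquot_morph (V S : qmod) (W W' : set V) : subquot_iso W W' S ->
  exists p : V -> S, morph W p /\ forall u, W u -> (p u = 0 <-> W' u).
Proof. by move=> [p [h1 h2 h3 h4]]; exists p; split. Qed.
Lemma piece_flag (V S : qmod) (W W' : set V) l : O_int V -> submodule W ->
  W' `<=` W -> subquot_iso W W' S ->
  exists cs, flag (@Phi V) (W' `&` wspace l.1) (W `&` wspace l.1) cs /\
  sdim (lspace (V := S) l) = chcount (lchar l) cs.
Proof.
move=> oV sW WW /subquot_morph [p [mp kp]]; have [lp ap sur] := mp.
have [cs fl] := morph_flag l.1 oV sW mp.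
exists cs; split; last exact: sdim_flag.
have sX := stab_sub l.1 sW.
have := @flag_pull _ _ _ _ (@Phi V) (@Phi S) p (W `&` wspace l.1) [set 0] (wspace l.1) cs sX _ _ (@stab0 S) fl _.
rewrite (_ : _ `&` p @^-1` [set 0] = W' `&` wspace l.1); last first.
  apply/seteqP; split=> x [] => [[Wx xl] /kp|W'x xl]; first by move=> /(_ Wx).
  by split; [split=> //; apply: WW|apply/kp => //; apply: WW].
rewrite (_ : W `&` wspace l.1 `&` p @^-1` wspace l.1 = W `&` wspace l.1); last first.
  apply/seteqP; split=> x [] // Wx xl; split=> // a.
  by rewrite -ap // xl (linonZ (sub_lsub sW) lp).
apply.
- exact: linon_sub lp => x [].
- by move=> k x [Wx _]; rewrite ap.
- by move=> s Ws; have [x hx ex] := morph_wspace oV sW mp Ws; exists x.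
Qed.
End Modules.

(** * Composition series and well-definedness of characters *)

Section Series.
Local Notation sof V := (@series_of R q lq n D H V).

(** A finite-dimensional weight space meets only finitely many terms of a filtration with zero
    intersection, so the infinite series is cut at a K depending on the weight. *)
Lemma series_formula (V : qmod) (F : nat -> set V) l : O_int V -> F 0%N = setT ->
  (forall k, submodule (F k) /\ F k.+1 `<=` F k) -> \bigcap_k F k = [set 0] ->
  exists K, (forall k, (K <= k)%N -> F k `&` wspace l.1 `<=` [set 0]) /\
  forall c : nat -> nat, (forall k, (k < K)%N -> exists cs,
  flag (@Phi V) (F k.+1 `&` wspace l.1) (F k `&` wspace l.1) cs /\
  c k = chcount (lchar l) cs) ->
  ld V l = (\sum_(k < K) c k)%N.
Proof.
move=> oV F0 hF capF; have [d hd] := oi_fd (O_int_oint oV) l.1.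
pose X k := F k `&` wspace l.1.
have [||||K hK] := @fd_chain0 _ V d X.
- by move=> k; apply: lsubI; [apply: sub_lsub (hF k).1|exact: wspace_sub].
- by move=> k x [Fx ?]; split=> //; apply: (hF k).2.
- by move=> x hx; rewrite -capF => k _; have [] := hx k I.
- by rewrite /X F0 setTI.
exists K; split=> // c hc.
have XK : X K = [set 0].
  apply/seteqP; split; first exact: hK.
  by move=> x ->; split; [apply: (wsub0 (hF K).1)|apply: (subsp0 (wspace_sub V l.1))].
have step j : (j <= K)%N -> exists cs, flag (@Phi V) [set 0] (X (K - j)%N) cs /\
  chcount (lchar l) cs = (\sum_(K - j <= k < K) c k)%N.
  elim: j => [|j IH] jK.
  exists [::]; rewrite subn0 XK big_geq //; split=> //; exact: flag0.
  have [cs [fl e]] := IH (ltnW jK).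
  have jK' : (K - j.+1 < K)%N by lia.
  have [cs' [fl' e']] := hc _ jK'.
  exists (cs' ++ cs); split.
  by apply: flag_cat fl _; rewrite -[(K - j)%N](_ : (K - j.+1).+1 = _) //; lia.
  rewrite chcount_cat [in RHS]big_ltn (_ : (K - j.+1).+1 = (K - j)%N); lia.
have [cs [fl e]] := step K (leqnn K).
rewrite subnn /X F0 setTI in fl.
by rewrite (sdim_flag fl) e subnn big_mkord.
Qed.

Section Iso.
Variables (S S' : qmod) (f : S -> S').
Definition qiso := [/\ linon setT f, forall a u, f (act a u) = act a (f u), injective f
  & forall y, exists x, f x = y].
Hypothesis hf : qiso.

Lemma qiso_ld l : ld S l = ld S' l.
Proof.
case: hf => lf af fi fs.
have f0 : f 0 = 0 by apply: (linon0 (lsubT S) lf).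
have LS v : lspace l (f v) <-> lspace l v.
  split=> -[Wv [p hp]]; split.
  - by move=> a; apply: fi; rewrite af (linonZ (lsubT S) lf).
  - by exists p => e i m; apply: fi; rewrite af hp.
  - by move=> a; rewrite -af Wv (linonZ (lsubT S) lf).
  - by exists p => e i m; rewrite -af hp.
rewrite /sdim; congr xget; apply/seteqP; split=> d [b [Wb hb]].
  exists (f \o b); split=> [i|v]; first by apply/LS/Wb.
  have [x <-] := fs v; move=> /LS /hb [c [ec uc]]; exists c; split.
  rewrite {1}ec (linon_sum (lsubT S) lf) //; apply: eq_bigr => i _.
  by rewrite (linonZ (lsubT S) lf).
  move=> c' ec'; apply: uc; apply: fi; rewrite ec' (linon_sum (lsubT S) lf) //.
  by apply: eq_bigr => i _; rewrite (linonZ (lsubT S) lf).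
have /choice [g hg] : forall i, exists x, f x = b i by move=> i; apply: fs.
exists g; split=> [i|v /LS /hb [c [ec uc]]]; first by apply/LS; rewrite hg.
have S0 (c' : 'rV[C]_d) : f (\sum_i c' 0 i *: g i) = \sum_i c' 0 i *: b i.
  rewrite (linon_sum (lsubT S) lf) //; apply: eq_bigr => i _.
  by rewrite (linonZ (lsubT S) lf) // hg.
exists c; split; first by apply: fi; rewrite S0.
by move=> c' ec'; apply: uc; rewrite ec'.
Qed.
End Iso.

Lemma subquot_iso2 (V S S' : qmod) (W W' : set V) : submodule W ->
  subquot_iso W W' S -> subquot_iso W W' S' ->
  exists f : S -> S', qiso f.
Proof.
move=> sW [p [lp ap sp kp]] [p' [lp' ap' sp' kp']].
have /choice [g hg] : forall s, exists u, W u /\ p u = s.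
  by move=> s; have [u Wu pu] := sp s; exists u.
have sWl := sub_lsub sW.
have E u : W u -> p' (g (p u)) = p' u.
  move=> Wu; have [Wg eg] := hg (p u); apply/eqP; rewrite -subr_eq0; apply/eqP.
  rewrite -(linonB sWl lp') //; apply/kp'; first exact: (subspB sWl).
  by apply/kp; [apply: (subspB sWl)|rewrite (linonB sWl lp) // eg subrr].
exists (p' \o g); split=> /=.
- move=> c u v _ _; have [Wu eu] := hg u; have [Wv ev] := hg v.
  by rewrite -{1}eu -{1}ev -lp // [LHS]E ?lp' //; apply: (subspD sWl) => //; apply: (subspZ sWl).
- move=> a u; have [Wu eu] := hg u; rewrite -{1}eu -ap // [LHS]E ?ap' //.
  by case: sW => _ _; apply.
- move=> u v e; have [Wu eu] := hg u; have [Wv ev] := hg v.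
  apply/eqP; rewrite -subr_eq0 -eu -ev -(linonB sWl lp) //; apply/eqP/kp; first exact: (subspB sWl).
  by apply/kp'; [apply: (subspB sWl)|rewrite (linonB sWl lp') // [p' (g u)]e subrr].
- by move=> y; have [u Wu <-] := sp' y; exists (p u); rewrite E.
Qed.
Lemma subquot_comp (V S S' : qmod) (W W' : set V) (f : S -> S') :
  subquot_iso W W' S -> qiso f -> subquot_iso W W' S'.
Proof.
move=> [p [lp ap sp kp]] [lf af fi fs]; exists (f \o p); split=> /=.
- by move=> c u v Wu Wv; rewrite lp // lf.
- by move=> a u Wu; rewrite ap.
- by move=> y; have [x <-] := fs y; have [u Wu <-] := sp x; exists u.
- move=> u Wu; rewrite -kp //; split=> [e|->]; last exact: (linon0 (lsubT S) lf).
  by apply: fi; rewrite (linon0 (lsubT S) lf).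
Qed.
Definition piece_iso (t : rep_mod q lq H * nat) (S : simple_mod q lq H) : Prop :=
  subquot_iso (sof t.1 t.2) (sof t.1 t.2.+1) S.

Definition piece_dim l (t : rep_mod q lq H * nat) : nat :=
  if pselect (exists S, piece_iso t S) is left h then ld (projT1 (cid h)) l else 0%N.

Lemma series_ofP (V : rep_mod q lq H) : composition_series (V := V) (sof V).
Proof. exact: (projT2 (cid (rmod_series V))). Qed.
Lemma series_sub (V : rep_mod q lq H) k : submodule (V := V) (sof V k).
Proof. by have [_ h _ _] := series_ofP V; apply: (h k).1. Qed.
Lemma piece_dimE l t S : piece_iso t S -> piece_dim l t = ld S l.
Proof.
move=> h; rewrite /piece_dim; case: pselect => [h'|]; last by case; exists S.
case: (cid h') => S' hS'; have [f hf] := subquot_iso2 (@series_sub t.1 t.2) hS' h.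
exact: qiso_ld hf l.
Qed.
Lemma rep_ld (V : rep_mod q lq H) l : exists K,
  (forall k S, piece_iso (V, k) S -> ld S l != 0%N -> (k < K)%N) /\
  ld V l = (\sum_(k < K) piece_dim l (V, val k))%N.
Proof.
have [F0 hF hS capF] := series_ofP V; have oV := rmod_int V.
have [K [hK h]] := series_formula l oV F0 hF capF.
exists K; split=> [k S hkS|].
  apply: contraR; rewrite -leqNgt => Kk.
  have [cs [fl ->]] := piece_flag l oV (hF k).1 (hF k).2 hkS.
  rewrite (flag_nil fl) // => x /(hK k Kk) ->; split; first exact: (wsub0 (hF k.+1).1).
  exact: (subsp0 (wspace_sub V l.1)).
apply: (h (fun k => piece_dim l (V, k))) => k kK; have [F00|[S sS hkS]] := hS k.
  exists [::]; have F10 : sof V k.+1 = [set 0].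
  apply/seteqP; split; last exact: (wsub0 (hF k.+1).1).
  by rewrite -F00; apply: (hF k).2.
  rewrite F00 F10; split; first exact: flag0.
  rewrite /piece_dim; case: pselect => // -[S [p [lp ap sp kp]]].
  case: (smod_simple S) => -[v v0] _; have [u Fu pu] := sp v.
  have : p u = 0 by apply/kp => //; rewrite F10 -F00.
  by rewrite pu => v00; rewrite v00 eqxx in v0.
have [cs [fl e]] := piece_flag l oV (hF k).1 (hF k).2 hkS.
by exists cs; split=> //; rewrite -e; apply: (@piece_dimE l (V, k) (SimpleMod sS)).
Qed.
Lemma mult_count (V : rep_mod q lq H) S K : (forall k, piece_iso (V, k) S -> (k < K)%N) ->
  mult V S = \sum_(0 <= k < K | `[< piece_iso (V, k) S >]) 1.
Proof.
move=> hK; rewrite /mult.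
set A := [set k | _]; have fA : finite_set A.
  exact: (sub_finite_set _ (finite_II K)) => k /hK.
rewrite (_ : fset_set A = [fset k in [seq k <- index_iota 0 K | `[< piece_iso (V, k) S >]]]%fset).
  rewrite card_fseq undup_id ?filter_uniq ?iota_uniq // size_filter -sum1_count.
  by rewrite (big_morph Posz PoszD (erefl _)).
apply/fsetP => k; rewrite in_fset_set // !inE mem_filter mem_index_iota.
apply/idP/andP => [/set_mem Ak|[/asboolP Ak _]]; last exact/mem_set.
by split; [apply/asboolP|apply: hK].
Qed.
(** Each module is expanded into its factors up to the bound K for l, beyond which l does not occur,
    and [wd_list] collects the isomorphic ones. *)
Lemma rep_class0 (c : seq (int * rep_mod q lq H)) l :
  (forall S, rep_class c S = 0) -> \sum_(p <- c) p.1 * (ld p.2 l)%:Z = 0.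
Proof.
move=> hc.
have /choice [K hK] V := rep_ld V l.
pose items := flatten [seq [seq (p.1, (p.2, k)) | k <- index_iota 0 (K p.2)] | p <- c].
have e0 : \sum_(p <- c) p.1 * (ld p.2 l)%:Z = \sum_(x <- items) x.1 * (piece_dim l x.2)%:Z.
  rewrite big_flatten big_map; apply: eq_bigr => p _.
  rewrite big_map (hK p.2).2 (big_morph Posz PoszD (erefl _)) mulr_sumr.
  by rewrite -(big_mkord xpredT (fun k => p.1 * (piece_dim l (p.2, k))%:Z)).
rewrite e0; apply: (@wd_list _ _ (piece_dim l) piece_iso (fun S => ld S l)).
- by move=> t S; apply: piece_dimE.
- by move=> t; rewrite /piece_dim; case: pselect => // -[S h] _; exists S.
- move=> t t' S S' h1 h2 h3.
  have [f hf] := subquot_iso2 (@series_sub t.1 t.2) h1 h2.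
  exact: subquot_comp h3 hf.
move=> S dS; rewrite -[RHS](hc S) big_flatten big_map; apply: eq_bigr => p _.
rewrite big_map (@mult_count p.2 S (K p.2)) => [|k hk]; last exact: (hK p.2).1 hk dS.
by rewrite mulr_sumr; apply: eq_bigr => k _; rewrite mulr1.
Qed.
End Series.

Let q0 := qd_neq0 hq.
Let qi0 i : qi q D i != 0. Proof. by rewrite expf_neq0. Qed.

(** * The correspondence between l-weights and monomials *)

Section Ymon.
Let nz := @c1_neq0 C.

Lemma size_pdeg (Q P Q' P' : {poly C}) : Q`_0 = 1 -> P`_0 = 1 -> Q'`_0 = 1 -> P'`_0 = 1 ->
  Q * P' = Q' * P -> pdeg Q - pdeg P = pdeg Q' - pdeg P'.
Proof.
move=> /nz Q0 /nz P0 /nz Q0' /nz P0' /(congr1 (fun p : {poly C} => size p)).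
rewrite !size_mul // => h.
have key a b c d : (0 < a)%N -> (0 < b)%N -> (0 < c)%N -> (0 < d)%N ->
  (a + b).-1 = (c + d).-1 -> a.-1%:Z - d.-1%:Z = c.-1%:Z - b.-1%:Z by lia.
by apply: key; rewrite ?size_poly_gt0.
Qed.
(** Equal exponents mean, after cross-multiplication, that Q P' and Q' P have the same multiplicity
    at every nonzero point, hence are equal; the expansions then agree. *)
Lemma Ymon_lweight l l' (m : mono R H) : is_Ymon q l m -> is_Ymon q l' m -> l = l'.
Proof.
case: l l' => [mu g] [mu' g'] [/= c1 [Q [P [h e]]]] [/= c2 [Q' [P' [h' e']]]].
have -> : mu = mu' by apply: (@nu_inj _ _ H); rewrite -c1.
congr pair; apply/funext => s; apply/funext => i.
have [q1 p1 hx] := h i; have [q1' p1' hx'] := h' i.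
have E : Q i * P' i = Q' i * P i.
  apply: (mup_eq_poly); [exact: c1_mul|exact: c1_mul|move=> x x0].
  rewrite !mupM ?nz //.
  have xV : x^-1 != 0 by rewrite invr_eq0.
  have := e i (exist _ x^-1 xV); rewrite e' invrK.
  have key (a b c d' : nat) : a%:Z - b%:Z = c%:Z - d'%:Z -> (c + b = a + d')%N by lia.
  exact: key.
apply: (expands_uniq _ _ _ (hx s) (hx' s)).
- by rewrite mulf_neq0 // pscale_eq0 ?invr_eq0 ?nz.
- by rewrite mulf_neq0 // pscale_eq0 ?invr_eq0 ?nz.
rewrite (size_pdeg q1 p1 q1' p1' E) -!scalerAl; congr (_ *: _).
transitivity (pscale (qi q D i)^-1 (Q i * P' i) * pscale (qi q D i) (Q' i * P i)).
  by rewrite !pscaleM; ring.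
by rewrite E -{2}E; ring.
Qed.
(** The orbit of a nonzero point under multiplication by a is infinite, so a function constant on it
    and of finite support vanishes there. *)
Lemma qshift_zero (d : C -> int) (a : C) : a != 0 -> (forall m, (0 < m)%N -> a ^+ m != 1) ->
  (exists s : seq C, forall x, d x != 0 -> x \in s) ->
  (forall x, x != 0 -> d x = d (a * x)) -> forall x, x != 0 -> d x = 0.
Proof.
move=> a0 ar [s hs] hd x x0; apply/eqP/negPn/negP => dx.
have it m : d (a ^+ m * x) = d x.
  elim: m => [|m IH]; first by rewrite mul1r.
  by rewrite exprS -mulrA -hd ?mulf_neq0 ?expf_neq0.
pose t := [seq a ^+ m * x | m <- iota 0 (size s).+1].
have Ut : uniq t.
  rewrite map_inj_in_uniq ?iota_uniq // => i j _ _ /(mulIf x0).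
  wlog ij : i j / (i <= j)%N.
  by move=> W; case: (leqP i j) => [|/ltnW] ij e; [apply: W|apply/esym/W].
  rewrite -{1}(subnKC ij) exprD -[LHS]mulr1 => /(mulfI (expf_neq0 i a0)) e.
  apply/eqP; rewrite eqn_leq ij leqNgt; apply/negP => lt.
  by have := ar (j - i)%N; rewrite subn_gt0 -e eqxx => /(_ lt).
have : (size t <= size s)%N.
  by apply: uniq_leq_size => // y /mapP[m _ ->]; apply: hs; rewrite it.
by rewrite size_map size_iota ltnn.
Qed.
Lemma mup_fin (p : {poly C}) : p != 0 -> exists s : seq C, forall x, mup x p != 0%N -> x \in s.
Proof.
move=> p0; have [s es] := closed_field_poly_normal p; exists s => x.
rewrite -lt0n => mx; have : root p x by rewrite -dvdp_XsubCl XsubC_dvd.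
by rewrite es rootZ ?lead_coef_eq0 // root_prod_XsubC.
Qed.
Lemma mup_shift (a x : C) (A B : {poly C}) : a != 0 -> x != 0 -> A`_0 = 1 -> B`_0 = 1 ->
  pscale a^-1 A * pscale a B = pscale a^-1 B * pscale a A ->
  (mup x A)%:Z - (mup x B)%:Z = (mup (a ^+ 2 * x) A)%:Z - (mup (a ^+ 2 * x) B)%:Z.
Proof.
move=> a0 x0 A1 B1 AB; have [y ey] : exists y, y = a * x by exists (a * x).
have e1 : a^-1 * y = x by rewrite ey mulKf.
have e2 : a * y = a ^+ 2 * x by rewrite ey mulrA.
have := congr1 (mup y) AB.
have aV0 : a^-1 != 0 by rewrite invr_eq0.
have sz (b : C) (p : {poly C}) : b != 0 -> p`_0 = 1 -> pscale b p != 0.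
  by move=> b0 hp; rewrite pscale_eq0 // nz.
rewrite (mupM _ (sz _ _ aV0 A1) (sz _ _ a0 B1)) (mupM _ (sz _ _ aV0 B1) (sz _ _ a0 A1)).
rewrite (mup_pscale _ aV0 (nz A1)) (mup_pscale _ a0 (nz B1)).
rewrite (mup_pscale _ aV0 (nz B1)) (mup_pscale _ a0 (nz A1)) e1 e2.
have key (a' b c d' : nat) : (a' + b)%N = (c + d')%N -> a'%:Z - c%:Z = d'%:Z - b%:Z by lia.
exact: key.
Qed.
(** The l-weight gives A(z/q_i) B(z q_i) = B(z/q_i) A(z q_i) for A = Q P' and B = Q' P. So the
    difference of their multiplicities is invariant under q_i^2 and vanishes by [qshift_zero], q not
    being a root of unity. *)
Lemma Ymon_mono l (m m' : mono R H) : is_Ymon q l m -> is_Ymon q l m' -> m = m'.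
Proof.
move=> [c1 [Q [P [h e]]]] [c2 [Q' [P' [h' e']]]].
suff E i a : expo m i a = expo m' i a.
  apply: val_inj; case: m m' c1 c2 {e e'} E => [[w u] ?] [[w' u'] ?]; rewrite /cowt /expo /= => -> -> E.
  by congr pair; apply/ffunP => i; apply/eqP/freeg_eqP => a; rewrite E.
have [q1 p1 hx] := h i; have [q1' p1' hx'] := h' i.
pose A := Q i * P' i; pose B := Q' i * P i.
have A1 : A`_0 = 1 by exact: c1_mul.
have B1 : B`_0 = 1 by exact: c1_mul.
have AB : pscale (qi q D i)^-1 A * pscale (qi q D i) B = pscale (qi q D i)^-1 B * pscale (qi q D i) A.
  have := expands_cross (F := C) (hx true) (hx' true); rewrite -!scalerAl.
  set c := _ ^ _; set c' := _ ^ _ => E.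
  have c0 : c != 0 by rewrite expfz_neq0.
  have c0' : c' != 0 by rewrite expfz_neq0.
  have E' : c *: (pscale (qi q D i)^-1 A * pscale (qi q D i) B) =
  c' *: (pscale (qi q D i)^-1 B * pscale (qi q D i) A).
  transitivity (c *: (pscale (qi q D i)^-1 (Q i) * pscale (qi q D i) (P i) *
  (pscale (qi q D i) (Q' i) * pscale (qi q D i)^-1 (P' i)))).
  by congr (_ *: _); rewrite !pscaleM; ring.
  by rewrite E; congr (_ *: _); rewrite !pscaleM; ring.
  have cc : c = c'.
  have := congr1 (fun p : {poly C} => p`_0) E'.
  by rewrite !coefZ -!horner_coef0 !hornerM !horner_coef0 !pscale0 A1 B1 !mulr1.
  by move: E'; rewrite cc => /(scalerI c0').
pose d x := (mup x A)%:Z - (mup x B)%:Z.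
have d0 : forall x, x != 0 -> d x = 0.
  apply: (@qshift_zero d (qi q D i ^+ 2)); first by rewrite expf_neq0.
  - by move=> k k0; rewrite -!exprM; apply: (qd_root hq); rewrite !muln_gt0 k0 symz_gt0.
  - have [s hs] := mup_fin (nz A1); have [t ht] := mup_fin (nz B1).
  exists (s ++ t) => x dx; rewrite mem_cat.
  have [eA|nA] := eqVneq (mup x A) 0%N; last by rewrite hs.
  have [eB|nB] := eqVneq (mup x B) 0%N; last by rewrite ht ?orbT.
  by rewrite /d eA eB eqxx in dx.
  by move=> x x0; apply: mup_shift.
have := d0 (val a)^-1; rewrite invr_eq0 => /(_ (valP a)).
rewrite /d e e' /A /B (mupM _ (nz q1) (nz p1')) (mupM _ (nz q1') (nz p1)).
have key (a' b c d' : nat) : (a' + b)%N%:Z - (c + d')%N%:Z = 0 -> a'%:Z - d'%:Z = c%:Z - b%:Z by lia.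
exact: key.
Qed.
End Ymon.

Section SubquotMod.
Variables (V : qmod) (W W' : set V) (sW : submodule W) (sW' : submodule W') (WW : W' `<=` W).

Definition sqm_data := SqData (sub_lsub sW) (sub_lsub sW') WW.
Local Notation pi := (sqpi sqm_data).
Let aW a v : W v -> W (act a v). Proof. by case: sW => _ _; apply. Qed.
Let aW' a v : W' v -> W' (act a v). Proof. by case: sW' => _ _; apply. Qed.
Let aL a : linon W (act a : V -> V). Proof. by move=> c u v _ _; apply: act_linear. Qed.
Definition sqm_act (a : qaff q lq H) : sqt sqm_data -> sqt sqm_data := sqf (act a).
Lemma sqm_actE a x : W x -> sqm_act a (pi x) = pi (act a x).
Proof. by apply: (@sqfE _ _ sqm_data); [apply: aW|apply: aW'|apply: aL]. Qed.
Lemma sqm_lin a : linear (sqm_act a).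
Proof. by move=> c u v; apply: (@sqf_lin _ _ sqm_data (act a)) => //; do ?[by move=> x; apply: aW|by move=> x; apply: aW'|exact: aL]. Qed.
Lemma sqm_linl c (u u' : qaff q lq H) v : sqm_act (c *: u + u') v = c *: sqm_act u v + sqm_act u' v.
Proof.
have [x Wx <-] := @sqpi_sur _ _ sqm_data v.
by rewrite !sqm_actE // act_linearl (@sqpi_lin _ _ sqm_data) //; apply: aW.
Qed.
Lemma sqm_1 v : sqm_act 1 v = v.
Proof. by have [x Wx <-] := @sqpi_sur _ _ sqm_data v; rewrite sqm_actE // act1. Qed.
Lemma sqm_M (u u' : qaff q lq H) v : sqm_act (u * u') v = sqm_act u (sqm_act u' v).
Proof.
have [x Wx <-] := @sqpi_sur _ _ sqm_data v.
by rewrite !sqm_actE ?actM //; apply: aW.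
Qed.
Definition sqm : qmod := QMod sqm_lin sqm_linl sqm_1 sqm_M.

Lemma sqm_morph : morph (V := V) (S := sqm) W (pi : V -> sqm).
Proof.
split; first exact: @sqpi_lin _ _ sqm_data.
  by move=> a u Wu; rewrite -sqm_actE.
exact: @sqpi_sur _ _ sqm_data.
Qed.
Lemma sqm_ker x : W x -> (pi x = 0 :> sqm) <-> W' x.
Proof. exact: (@sqpi0 _ _ sqm_data). Qed.
Lemma sqm_iso : subquot_iso (V := V) W W' sqm.
Proof. by have [h1 h2 h3] := sqm_morph; exists pi; split=> //; apply: sqm_ker. Qed.
End SubquotMod.

Section FunMod.
Variable V : qmod.
Definition fmod_act (a : qaff q lq H) (f : nat -> V) : nat -> V := fun j => act a (f j).
Lemma fmod_lin a : linear (fmod_act a).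
Proof. by move=> c f g; apply/funext => j; apply: act_linear. Qed.
Lemma fmod_linl c (u u' : qaff q lq H) f : fmod_act (c *: u + u') f = c *: fmod_act u f + fmod_act u' f.
Proof. by apply/funext => j; apply: act_linearl. Qed.
Lemma fmod_1 f : fmod_act 1 f = f.
Proof. by apply/funext => j; apply: act1. Qed.
Lemma fmod_M (u u' : qaff q lq H) f : fmod_act (u * u') f = fmod_act u (fmod_act u' f).
Proof. by apply/funext => j; apply: actM. Qed.
Definition fmod : qmod := QMod fmod_lin fmod_linl fmod_1 fmod_M.
End FunMod.

(** * Jumps of a maximal chain of submodules *)

Section Chain.
Variables (V : qmod) (oV : O_int V).

Definition chainp (Ch : set (set V)) : Prop :=
  (forall W, Ch W -> submodule W) /\ (forall W W', Ch W -> Ch W' -> W `<=` W' \/ W' `<=` W).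

Lemma max_chain : exists Ch, chainp Ch /\
  forall W, submodule W -> (forall W', Ch W' -> W `<=` W' \/ W' `<=` W) -> Ch W.
Proof.
have [F FP tF|Ch [cC mC]] := @Zorn_bigcup _ chainp.
  split=> [W [X FX XW]|W W' [X FX XW] [Y FY YW]]; first exact: (FP X FX).1.
  by case: (tF X Y FX FY) => sub; [apply: (FP Y FY).2 => //; apply: sub|apply: (FP X FX).2 => //; apply: sub].
exists Ch; split=> // W sW hW; apply: contrapT => nW.
apply: (mC (Ch `|` [set W])); first by split=> [x Cx|h]; [left|apply: nW; apply: h; right].
split=> [W' [/(cC.1) //|->//]|W1 W2 [C1|->] [C2|->]]; first exact: cC.2.
- by case: (hW _ C1); [right|left].
- exact: hW.
- by left.
Qed.

Variable (Ch : set (set V)).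
Hypotheses (cC : chainp Ch) (mC : forall W, submodule W ->
  (forall W', Ch W' -> W `<=` W' \/ W' `<=` W) -> Ch W).

Lemma subT : submodule [set: V]. Proof. by []. Qed.
Lemma sub0m : submodule [set (0 : V)].
Proof.
split=> // [c u v -> ->|a v ->]; first by rewrite scaler0 addr0.
exact: act_0.
Qed.
Lemma ChT : Ch setT. Proof. by apply: mC subT _ => W _; right. Qed.
Lemma Ch0 : Ch [set 0].
Proof. by apply: mC sub0m _ => W /(cC.1) [W0 _ _]; left => x ->. Qed.
(** The smallest member of the chain containing v; the set [jA (jB v)] is the union of the members
    that do not contain v, and for nonzero v the two are adjacent. *)
Definition jB (v : V) : set V := [set x | forall W, Ch W -> W v -> W x].
Definition jA (S : set V) : set V := [set x | exists W, [/\ Ch W, ~ S `<=` W & W x]].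

Lemma jB_sub v : submodule (jB v).
Proof.
split=> [W CW _|c u w hu hw W CW Wv|a u hu W CW Wv].
- by case: (cC.1 W CW).
- by case: (cC.1 W CW) => _ h _; apply: h; [apply: hu|apply: hw].
- by case: (cC.1 W CW) => _ _ h; apply: h; apply: hu.
Qed.
Lemma jB_v v : jB v v. Proof. by []. Qed.
Lemma jB_min v W : Ch W -> (jB v `<=` W <-> W v).
Proof. by move=> CW; split=> [h|Wv x h]; [exact: h v (@jB_v v)|exact: h W CW Wv]. Qed.
Lemma jB_Ch v : Ch (jB v).
Proof.
apply: mC (jB_sub v) _ => W CW; have [Wv|nWv] := pselect (W v); first by left; apply/jB_min.
right=> x Wx W' CW' W'v; case: (cC.2 W W' CW CW') => sub; first exact: sub.
by case: nWv; apply: sub.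
Qed.
Lemma jA_sub v : v != 0 -> submodule (jA (jB v)).
Proof.
move=> v0; split.
- exists [set 0]; split=> //; [exact: Ch0|move/jB_min => /(_ Ch0) e].
  by rewrite e eqxx in v0.
- move=> c x y [W [CW nW Wx]] [W' [CW' nW' Wy]].
  case: (cC.2 W W' CW CW') => sub.
  by exists W'; split=> //; case: (cC.1 W' CW') => _ h _; apply: h => //; apply: sub.
  by exists W; split=> //; case: (cC.1 W CW) => _ h _; apply: h => //; apply: sub.
- by move=> a x [W [CW nW Wx]]; exists W; split=> //; case: (cC.1 W CW) => _ _; apply.
Qed.
Lemma jA_nv v : ~ jA (jB v) v.
Proof. by move=> [W [CW nW Wv]]; apply: nW; apply/jB_min. Qed.
Lemma jump v W : Ch W -> jB v `<=` W \/ W `<=` jA (jB v).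
Proof.
move=> CW; have [h|h] := pselect (jB v `<=` W); first by left.
by right=> x Wx; exists W.
Qed.
Lemma jAB v : jA (jB v) `<=` jB v.
Proof.
move=> x [W [CW nW Wx]]; case: (cC.2 W (jB v) CW (jB_Ch v)) => sub; first exact: sub.
by case: nW.
Qed.
Lemma jA_Ch v : v != 0 -> Ch (jA (jB v)).
Proof.
move=> v0; apply: mC (jA_sub v0) _ => W CW; case: (jump v CW) => h; last by right.
by left; apply: subset_trans h; apply: jAB.
Qed.
Definition jm (v : V) (v0 : v != 0) : qmod := sqm (jB_sub v) (jA_sub v0) (@jAB v).

(** The preimage of a submodule lies between two adjacent members of the chain; it is comparable
    with all members, so by maximality it belongs to the chain and is one of the two. *)
Lemma jm_simple v (v0 : v != 0) : simple (jm v0).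
Proof.
pose d := sqm_data (jB_sub v) (jA_sub v0) (@jAB v).
have [lp ap sp] := sqm_morph (jB_sub v) (jA_sub v0) (@jAB v).
have kp := sqm_ker (jB_sub v) (jA_sub v0) (@jAB v).
split; first by exists (sqpi d v); apply/eqP => /kp h; apply: (@jA_nv v); apply: h.
move=> U [U0 UD UA]; pose W := [set x | jB v x /\ U (sqpi d x)].
have [B0 BD BA] := jB_sub v.
have sW : submodule W.
  split=> [|c x y [Bx Ux] [By Uy]|a x [Bx Ux]].
  - by split=> //; rewrite (linon0 (sub_lsub (jB_sub v)) lp).
  - by split; [apply: BD|rewrite lp //; apply: UD].
  - by split; [apply: BA|rewrite ap //; apply: UA].
have CW : Ch W.
  apply: mC sW _ => W' CW'; case: (jump v CW') => h; first by left=> x [Bx _]; apply: h.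
  right=> x W'x; have Ax := h x W'x; split; first exact: jAB.
  suff -> : sqpi d x = 0 by [].
  by apply/kp => //; apply: jAB.
case: (jump v CW) => h; [right|left]; apply/seteqP; split=> //.
- by move=> s _; have [x Bx <-] := sp s; apply: (h x Bx).2.
- move=> s Us; have [x Bx ex] := sp s; rewrite -ex; apply/kp => //; apply: h; split=> //.
  by rewrite ex.
- by move=> s ->.
Qed.
Lemma jm_iso v (v0 : v != 0) : subquot_iso (jB v) (jA (jB v)) (jm v0).
Proof. exact: sqm_iso. Qed.

(* The dimension of the jump of the chain whose upper end is S. *)
Definition jdim (l : lweight R H) (S : set V) : nat :=
  if pselect (exists v, exists v0 : v != 0, jB v = S) is left h
  then let: exist v h' := cid h in ld (jm (sval (cid h'))) l else 0%N.

Lemma jdimE l v (v0 : v != 0) : jdim l (jB v) = ld (jm v0) l.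
Proof.
rewrite /jdim; case: pselect => [h|]; last by case; exists v, v0.
case: (cid h) => u h'; case: (cid h') => u0 e.
have h1 : subquot_iso (jB v) (jA (jB v)) (jm u0) by rewrite -e; exact: jm_iso.
have [f hf] := subquot_iso2 (jB_sub v) h1 (jm_iso v0).
exact: qiso_ld hf l.
Qed.
(** v is chosen so that the lower end of its jump has the largest trace on the weight space; a
    vector outside [jB v] would give a larger one. *)
Lemma jB_top om W m : Ch W -> fd [set 0] (W `&` wspace om) m ->
  (exists v, (W `&` wspace om) v /\ v != 0) ->
  exists v, [/\ v != 0, (W `&` wspace om) v & W `&` wspace om `<=` jB v].
Proof.
move=> CW hf [v1 [Wv1 v10]].
have sX (W' : set V) : submodule W' -> lsub (W' `&` wspace om).
  by move=> sW'; apply: lsubI; [exact: sub_lsub|exact: wspace_sub].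
have jAW u : W u -> jA (jB u) `<=` W by move=> Wu; apply: subset_trans (@jAB u) _; apply/jB_min.
have fdA u : W u -> fd [set 0] (jA (jB u) `&` wspace om) m.
  by move=> Wu; apply: fd_sub hf _ _ => // x [Ax ?]; split=> //; apply: jAW Ax.
pose P k := `[< exists v, [/\ v != 0, (W `&` wspace om) v & sdim (jA (jB v) `&` wspace om) = k] >].
have exP : exists k, P k by exists (sdim (jA (jB v1) `&` wspace om)); apply/asboolP; exists v1.
have bP k : P k -> (k <= m)%N.
  move=> /asboolP [v [v0 [Wv _] <-]]; apply: sdim_le (fdA v Wv).
  exact/sX/jA_sub.
case: (ex_maxnP exP bP) => k /asboolP [v [v0 [Wv Xv] ek]] maxk.
exists v; split=> // u [Wu Xu]; apply: contrapT => nBu.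
have u0 : u != 0 by apply/eqP => u0; apply: nBu; rewrite u0; case: (jB_sub v).
have BA : jB v `<=` jA (jB u) by case: (jump u (jB_Ch v)) => // /jB_min => /(_ (jB_Ch v)).
have : (sdim (jA (jB u) `&` wspace om) <= k)%N by apply: maxk; apply/asboolP; exists u.
rewrite leqNgt => /negP; apply; rewrite -ek.
apply: (sdim_lt _ _ (fdA u Wu)); [exact/sX/jA_sub|exact/sX/jA_sub| | |].
- by move=> x [Ax ?]; split=> //; apply: BA; apply: jAB.
- by split=> //; exact: BA v (@jB_v v).
- by move=> [/jA_nv].
Qed.
(** Induction on the dimension: the top jump seen by the weight space is split off by [jB_top], and
    its lower end has a smaller trace. So a weight sees finitely many jumps, although the chain may
    be infinite and densely ordered. *)
Lemma jumps_list om m W : Ch W -> fd [set 0] (W `&` wspace om) m ->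
  exists vs : seq V, [/\ uniq (map jB vs),
  forall v, v \in vs -> [/\ v != 0, W v & wspace om v],
  forall u, W u -> wspace om u -> u != 0 -> exists2 v, v \in vs & jB u = jB v
  & forall l, l.1 = om -> exists cs, flag (@Phi V) [set 0] (W `&` wspace om) cs /\
  chcount (lchar l) cs = (\sum_(v <- vs) jdim l (jB v))%N].
Proof.
elim: m W => [|m IH] W CW hf.
  have h := fd0 (lsub0 V) hf; exists [::]; split=> // [u Wu Xu /eqP[]|l el].
  by have := h u (conj Wu Xu).
  exists [::]; rewrite big_nil; split=> //.
  have -> : W `&` wspace om = [set 0]; last exact: flag0.
  apply/seteqP; split=> // x ->; split; first by case: (cC.1 W CW).
  exact: subsp0 (wspace_sub V om).
have [ex|nex] := pselect (exists v, (W `&` wspace om) v /\ v != 0); last first.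
  have h : W `&` wspace om `<=` [set 0].
  by move=> x Wx; apply: contrapT => /eqP x0; apply: nex; exists x.
  exists [::]; split=> // [u Wu Xu /eqP[]|l el]; first by have := h u (conj Wu Xu).
  exists [::]; rewrite big_nil; split=> //.
  have -> : W `&` wspace om = [set 0]; last exact: flag0.
  apply/seteqP; split=> // x ->; split; first by case: (cC.1 W CW).
  exact: subsp0 (wspace_sub V om).
have [v [v0 [Wv Xv] WB]] := jB_top CW hf ex.
have AW : jA (jB v) `<=` W by apply: subset_trans (@jAB v) _; apply/jB_min.
have hf' : fd [set 0] (jA (jB v) `&` wspace om) m.
  apply: (fd_strict _ hf); last by move=> [/jA_nv].
  - by apply: lsubI; [exact/sub_lsub/jA_sub|exact: wspace_sub].
  - by move=> x [Ax ?]; split=> //; apply: AW.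
  - by split.
have [vs [Uvs hvs cvs fvs]] := IH _ (jA_Ch v0) hf'.
exists (v :: vs); split.
- rewrite /= Uvs andbT; apply/mapP => -[w /hvs [_ Aw _] e]; apply: (@jA_nv v).
  by move: (Aw); rewrite -(jB_min _ (jA_Ch v0)) -e => /(_ v); apply; exact: jB_v.
- move=> w; rewrite inE => /orP[/eqP ->|/hvs [? Aw ?]]; split=> //; exact: AW.
- move=> u Wu Xu u0; have [Au|nAu] := pselect (jA (jB v) u).
  by have [w wvs e] := cvs u Au Xu u0; exists w => //; rewrite inE wvs orbT.
  exists v; rewrite ?mem_head //; apply/seteqP; split.
  by apply/jB_min; [exact: jB_Ch|apply: WB].
  case: (jump v (jB_Ch u)) => // h; case: nAu; apply: h; exact: jB_v.
move=> l el; have [cs [fl e]] := fvs l el.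
have [cs' [fl' e']] := piece_flag l oV (jB_sub v) (@jAB v) (jm_iso v0).
exists (cs' ++ cs); split; last by rewrite chcount_cat e -e' big_cons (jdimE l v0).
apply: flag_cat fl _; rewrite el in fl'.
rewrite (_ : W `&` wspace om = jB v `&` wspace om) //.
apply/seteqP; split=> x [Wx Xx]; split=> //; first exact: WB.
exact: (jB_min v CW).2 Wv x Wx.
Qed.
End Chain.

(** * Direct sums of sequences of subquotients *)

Section DirectSum.
Variables (V : qmod) (oV : O_int V) (BB AA : nat -> set V).
Hypotheses (sB : forall j, submodule (BB j)) (sA : forall j, submodule (AA j))
  (AB : forall j, AA j `<=` BB j).
Hypothesis fin : forall om, exists K, forall j, (K <= j)%N -> BB j `&` wspace om `<=` AA j.
Local Notation fV := (fmod V).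
Let B0 j : BB j 0. Proof. by case: (sB j). Qed.
Let A0 j : AA j 0. Proof. by case: (sA j). Qed.
Let LA j := sub_lsub (sA j).
Let LB j := sub_lsub (sB j).

(** The direct sum is realized as a subquotient of the module of sequences in V, namely [dsX 0]
    modulo [dsY]; requiring the first k entries to lie in [AA] gives the tails of the sum, which
    form the filtration. *)
Definition dsX (k : nat) : set fV := [set f | (exists N, forall j, (N <= j)%N -> f j = 0) /\
  forall j, BB j (f j) /\ ((j < k)%N -> AA j (f j))].
Definition dsY : set fV := [set f | (exists N, forall j, (N <= j)%N -> f j = 0) /\
  forall j, AA j (f j)].

Lemma fin_sub (X : nat -> set V) : (forall j, submodule (X j)) ->
  submodule [set f : fV | (exists N, forall j, (N <= j)%N -> f j = 0) /\ forall j, X j (f j)].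
Proof.
move=> sX; split; first by split=> [|j]; [exists 0%N|case: (sX j)].
  move=> c f g [[N hN] hf] [[M hM] hg]; split; last by move=> j; exact: (sub_lsub (sX j)).2.
  exists (maxn N M) => j; rewrite geq_max => /andP[Nj Mj].
  by rewrite -[LHS]/(c *: f j + g j) hN // hM // scaler0 addr0.
move=> a f [[N hN] hf]; split; last by move=> j; case: (sX j) => _ _; apply.
by exists N => j Nj; rewrite -[LHS]/(act a (f j)) hN // act_0.
Qed.
Lemma dsX_sub k : submodule (dsX k).
Proof.
apply: (@fin_sub (fun j => [set v | BB j v /\ ((j < k)%N -> AA j v)])) => j.
have [[Bz BD Ba] [Az AD Aa]] := (sB j, sA j).
split=> //= [c x y [Bx hx] [By hy]|a x [Bx hx]]; split; try exact: BD; try exact: Ba => //.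
  by move=> jk; apply: AD; [exact: hx|exact: hy].
by move=> jk; apply: Aa; exact: hx.
Qed.
Lemma dsY_sub : submodule dsY.
Proof. exact: fin_sub. Qed.
Let LX0 := sub_lsub (dsX_sub 0).
Lemma dsYX : dsY `<=` dsX 0.
Proof. by move=> f [h1 h2]; split=> // j; split=> //; apply: AB. Qed.
Lemma dsXY k : dsY `<=` dsX k.
Proof. by move=> f [h1 h2]; split=> // j; split; [apply: AB; apply: h2|move=> _; apply: h2]. Qed.
Lemma dsX0 k : dsX k `<=` dsX 0.
Proof. by move=> f [h1 h2]; split=> // j; split=> //; have [] := h2 j. Qed.
Definition dsm : qmod := sqm (dsX_sub 0) dsY_sub dsYX.
Let dd := sqm_data (dsX_sub 0) dsY_sub dsYX.
Local Notation pi := (sqpi dd : fV -> dsm).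
Let mpi : morph (V := fV) (S := dsm) (dsX 0) pi := sqm_morph (dsX_sub 0) dsY_sub dsYX.
Let kpi : forall x, dsX 0 x -> (pi x = 0) <-> dsY x := sqm_ker (dsX_sub 0) dsY_sub dsYX.

Definition dsF (k : nat) : set dsm := [set s | exists2 f, dsX k f & pi f = s].

Lemma dsF_sub k : submodule (dsF k).
Proof.
have [lp ap sp] := mpi; have [X0 XD XA] := dsX_sub k.
split; first by exists 0 => //; rewrite (linon0 LX0 lp).
  move=> c _ _ [f Xf <-] [g Xg <-]; exists (c *: f + g); first exact: XD.
  by rewrite lp //; apply: dsX0; eassumption.
move=> a _ [f Xf <-]; exists (act a f); first exact: XA.
by rewrite ap //; apply: dsX0 Xf.
Qed.
Lemma dsF_dec k : submodule (dsF k) /\ dsF k.+1 `<=` dsF k.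
Proof.
split; first exact: dsF_sub.
move=> _ [f [h1 h2] <-]; exists f => //; split=> // j; have [fB fA] := h2 j.
by split=> // jk; apply: fA; apply: ltnW.
Qed.
Lemma dsF_0 : dsF 0 = setT.
Proof.
have [lp ap sp] := mpi; apply/seteqP; split=> // s _.
by have [f Xf <-] := sp s; exists f.
Qed.
Lemma dsF_mem k f : dsX 0 f -> dsF k (pi f) <-> dsX k f.
Proof.
move=> Xf; split=> [[g Xg e]|Xf']; last by exists f.
have [lp ap sp] := mpi.
have Xg0 := dsX0 Xg.
have : dsY (f - g).
  apply/kpi; first exact: (subspB LX0).
  by rewrite (linonB LX0 lp) // e subrr.
move=> Y; rewrite -(subrK g f); apply: (subspD (sub_lsub (dsX_sub k))) => //.
exact: dsXY.
Qed.
Lemma dsF_cap : \bigcap_k dsF k = [set 0].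
Proof.
have [lp ap sp] := mpi; apply/seteqP; split; last first.
  by move=> s -> k _; case: (dsF_sub k).
move=> s hs; have [f Xf ef] := sp s; rewrite -ef; apply/kpi => //.
split; first by case: Xf.
move=> j; have : dsF j.+1 (pi f) by rewrite ef; apply: hs.
by move=> /(dsF_mem _ Xf) [_ /(_ j) [_ h]]; apply: h.
Qed.
Definition dsp (k : nat) : qmod := sqm (sB k) (sA k) (@AB k).
Definition ds_delta (k : nat) (v : V) : fV := fun j => if j == k then v else 0.

Lemma ds_deltaX k v : BB k v -> dsX 0 (ds_delta k v).
Proof.
move=> Bv; split.
  by exists k.+1 => j kj; rewrite /ds_delta gtn_eqF.
by move=> j; split=> //; rewrite /ds_delta; case: eqP => [->|].
Qed.
Lemma dsp_iso k : subquot_iso (V := dsm) (dsF k) (dsF k.+1) (dsp k).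
Proof.
have [lp ap sp] := mpi; have [lk ak sk] := sqm_morph (sB k) (sA k) (@AB k).
have kk := sqm_ker (sB k) (sA k) (@AB k).
pose pk : V -> dsp k := sqpi (sqm_data (sB k) (sA k) (@AB k)).
pose lift (s : dsm) : fV := xget 0 [set f | dsX 0 f /\ pi f = s].
have liftP s : dsX 0 (lift s) /\ pi (lift s) = s.
  apply: (@xgetPex _ 0 [set f | dsX 0 f /\ pi f = s]).
  by have [f Xf ef] := sp s; exists f.
have P f : dsX 0 f -> pk (lift (pi f) k) = pk (f k).
  move=> Xf; have [Xl el] := liftP (pi f).
  have Bl : BB k (lift (pi f) k) by have [_ /(_ k) []] := Xl.
  have Bf : BB k (f k) by have [_ /(_ k) []] := Xf.
  apply/eqP; rewrite -subr_eq0 -(linonB (LB k) lk) //; apply/eqP/kk; first exact: (subspB (LB k)).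
  have : dsY (lift (pi f) - f).
  apply/kpi; first exact: (subspB LX0).
  by rewrite (linonB LX0 lp) // el subrr.
  by move=> [_ /(_ k)].
have Bk f : dsX 0 f -> BB k (f k) by move=> [_ /(_ k) []].
exists (fun s => pk (lift s k)); split.
- move=> c _ _ [f /dsX0 Xf <-] [g /dsX0 Xg <-]; rewrite -lp // !P //; last first.
  exact: LX0.2.
  by apply: (lk c (f k) (g k)); exact: Bk.
- move=> a _ [f /dsX0 Xf <-]; rewrite -ap // !P //; last by case: (dsX_sub 0) => _ _; apply.
  by apply: (ak a (f k)); exact: Bk.
- move=> s; have [x Bx ex] := sk s; exists (pi (ds_delta k x)); last first.
  by rewrite P ?/ds_delta ?eqxx //; apply: ds_deltaX.
  exists (ds_delta k x) => //; split.
  by exists k.+1 => j kj; rewrite /ds_delta gtn_eqF.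
  move=> j; rewrite /ds_delta; case: eqP => [->|_]; first by rewrite ltnn.
  by split.
move=> _ [f Xf <-]; have Xf0 := dsX0 Xf; rewrite P //; rewrite dsF_mem //.
rewrite kk; last exact: Bk.
split=> [Ak|[_ /(_ k) [_ h]]]; last exact: h.
case: Xf => h1 h2; split=> // j; have [fB fA] := h2 j; split=> //.
by rewrite ltnS leq_eqVlt => /orP[/eqP ->//|]; apply: fA.
Qed.
(** Each entry is replaced by a weight vector congruent to it modulo [AA j], and by 0 where the jump
    does not see the weight; weight spaces of the sum are thereby finite-dimensional. *)
Lemma ds_wspace om s : wspace (V := dsm) om s ->
  exists g, [/\ dsX 0 g, pi g = s, forall j, wspace om (g j) &
  forall j, BB j `&` wspace om `<=` AA j -> g j = 0].
Proof.
move=> Ws; have [lp ap sp] := mpi; have [f Xf ef] := sp s.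
have [[N hN] hf] := Xf.
have hY a : dsY (act (kg _ a) f - qpow lq (om a) *: f).
  have Xa : dsX 0 (act (kg _ a) f) by case: (dsX_sub 0) => _ _; apply.
  have XZ : dsX 0 (qpow lq (om a) *: f) by apply: (subspZ LX0).
  apply/kpi; first exact: (subspB LX0).
  rewrite (linonB LX0 lp) // ap // (linonZ LX0 lp) //.
  by rewrite ef Ws subrr.
have /choice [g hg] : forall j, exists y, [/\ BB j y, wspace om y, AA j (f j - y) &
  ((N <= j)%N \/ (BB j `&` wspace om `<=` AA j)) -> y = 0].
  move=> j; have [Bf _] := hf j.
  have [lk ak sk] := sqm_morph (sB j) (sA j) (@AB j).
  have kk := sqm_ker (sB j) (sA j) (@AB j).
  pose pk : V -> dsp j := sqpi (sqm_data (sB j) (sA j) (@AB j)).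
  have Wp : wspace om (pk (f j)).
  move=> a; rewrite -ak // -(linonZ (LB j) lk) //; apply/eqP; rewrite -subr_eq0.
  have Ba : BB j (act (kg _ a) (f j)) by case: (sB j) => _ _; apply.
  rewrite -(linonB (LB j) lk) //; last exact: (subspZ (LB j)).
  apply/eqP/kk; last by have [_ h] := hY a; apply: h.
  by apply: (subspB (LB j)) => //; apply: (subspZ (LB j)).
  have [y [By Wy] ey] := morph_wspace oV (sB j) (sqm_morph (sB j) (sA j) (@AB j)) Wp.
  have Afy : AA j (f j - y).
  apply/kk; first exact: (subspB (LB j)).
  by rewrite (linonB (LB j) lk) // ey subrr.
  have [h|nh] := pselect ((N <= j)%N \/ (BB j `&` wspace om `<=` AA j)); last by exists y; split.
  exists 0; split=> //; first exact: subsp0 (wspace_sub V om).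
  rewrite subr0; case: h => [/hN ->//|h].
  by rewrite -(subrK y (f j)); apply: (subspD (LA j)) => //; apply: h.
have Xg : dsX 0 (g : fV).
  split; first by exists N => j Nj; have [_ _ _ h] := hg j; apply: h; left.
  by move=> j; split=> //; have [] := hg j.
exists g; split=> //.
- rewrite -ef; apply/eqP; rewrite eq_sym -subr_eq0 -(linonB LX0 lp) //.
  apply/eqP/kpi; first exact: (subspB LX0).
  split; last by move=> j; have [] := hg j.
  exists N => j Nj; rewrite -[LHS]/(f j - g j) hN //.
  by have [_ _ _ h] := hg j; rewrite h ?subrr //; left.
- by move=> j; have [] := hg j.
- by move=> j hj; have [_ _ _ h] := hg j; apply: h; right.
Qed.
Lemma ds_sum (f : fV) N : (forall j, (N <= j)%N -> f j = 0) -> f = \sum_(k < N) ds_delta k (f k).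
Proof.
move=> hN; apply/funext => j; rewrite fct_sumE /ds_delta.
have [jN|Nj] := ltnP j N.
  rewrite (bigD1 (Ordinal jN)) //= eqxx big1 ?addr0 // => k kj.
  by case: eqP => // e; case/eqP: kj; apply: val_inj.
by rewrite hN // big1 // => k _; case: eqP => // e; move: (ltn_ord k); rewrite -e ltnNge Nj.
Qed.
Lemma ds_oint : O_int dsm.
Proof.
have [lp ap sp] := mpi; have ho := O_int_oint oV.
apply: oint_O_int => //; split.
- exact: qop_rep.
- move=> s; have [f Xf <-] := sp s; have [[N hN] hf] := Xf.
  have sW := wspan_sub (fun om => wspace_sub dsm om).
  change (wspan (fun om => wspace om) (pi f)).
  rewrite (ds_sum hN) (linon_sum LX0 lp); last first.
  by move=> k _; apply: ds_deltaX; have [] := hf k.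
  apply: (subsp_sum sW) => k _; have [Bk _] := hf k.
  have [t [g [_ -> Wg Bg]]] := sub_graded 0 oV (sB k) Bk.
  have -> : ds_delta k (\sum_(om <- t) g om) = \sum_(om <- t | om \in t) ds_delta k (g om).
  rewrite -big_seq; apply/funext => j; rewrite fct_sumE /ds_delta.
  by case: eqP => // _; rewrite big1.
  rewrite (linon_sum LX0 lp); last first.
  by move=> om /Bg; apply: ds_deltaX.
  apply: (subsp_sum sW) => om ot; apply: (wspan1 (fun om => wspace_sub dsm om)).
  move=> a; rewrite -ap; last by apply/ds_deltaX/Bg.
  rewrite -(linonZ LX0 lp); last by apply/ds_deltaX/Bg.
  congr sqpi; apply/funext => j; rewrite -[LHS]/(act _ (ds_delta k (g om) j)).
  rewrite -[RHS]/(_ *: ds_delta k (g om) j) /ds_delta; case: eqP => _; first exact: Wg.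
  by rewrite act_0 scaler0.
- move=> om; have [K hK] := fin om; have [d hd] := oi_fd ho om.
  have sX : lsub (dsX 0 `&` [set g : fV | (forall j, wspace om (g j)) /\ forall j, (K <= j)%N -> g j = 0]).
  apply: lsubI; first exact: LX0.
  split; first by split=> // j; apply: subsp0 (wspace_sub V om).
  move=> c f g [Wf Kf] [Wg Kg]; split=> j; first exact: (wspace_sub V om).2.
  by move=> Kj; rewrite -[LHS]/(c *: f j + g j) Kf // Kg // scaler0 addr0.
  have [k hk] := fd_fun K (wspace_sub V om) hd.
  exists k; apply: (fd_img sX).
  + exact: linon_sub lp => x [].
  + exact: fd_sub hk _ _ => g [].
  + move=> s' /ds_wspace [g [Xg eg Wg Zg]]; exists g => //; split=> //; split=> // j Kj.
  by apply: Zg; apply: hK.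
- have [t ht] := oi_cone ho; exists t => om [s Ws s0].
  have [g [Xg eg Wg _]] := ds_wspace Ws; apply: ht.
  have [[j gj]|no] := pselect (exists j, g j != 0); first by exists (g j) => //; exact: Wg.
  case/eqP: s0; rewrite -eg (_ : g = 0) //.
  by apply/funext => j; apply/eqP/negPn/negP => gj; apply: no; exists j.
- have Z om : wspace (V := V) om `<=` [set 0] -> wspace (V := dsm) om `<=` [set 0].
  move=> h s Ws; have [g [Xg eg Wg _]] := ds_wspace Ws.
  rewrite -eg (_ : g = 0) //.
  by apply/funext => j; apply: h.
  move=> mu i; have [N hN] := oi_str ho mu i; exists N => r Nr.
  by have [h1 h2] := hN r Nr; split; apply: Z.
Qed.
Lemma ld0 (S : qmod) l : wspace (V := S) l.1 `<=` [set 0] -> ld S l = 0%N.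
Proof.
move=> h; rewrite (@sdim_flag S l [::]) //.
have -> : wspace (V := S) l.1 = [set 0]; last exact: flag0.
by apply/seteqP; split=> // x ->; apply: subsp0 (wspace_sub S l.1).
Qed.
Lemma ds_ld l K : (forall j, (K <= j)%N -> BB j `&` wspace l.1 `<=` AA j) ->
  ld dsm l = (\sum_(k < K) ld (dsp k) l)%N.
Proof.
move=> hK; have oD := ds_oint.
have [K' [hK' hs]] := series_formula l oD dsF_0 dsF_dec dsF_cap.
rewrite (hs (fun k => ld (dsp k) l)); last first.
  move=> k _; have [cs [fl e]] := piece_flag l oD (dsF_sub k) (dsF_dec k).2 (dsp_iso k).
  by exists cs; split.
have z1 k : (K' <= k)%N -> ld (dsp k) l = 0%N.
  move=> Kk; apply: ld0 => s Ws.
  have [p [mp kp]] := subquot_morph (dsp_iso k).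
  have [x [Fx Wx] <-] := morph_wspace oD (dsF_sub k) mp Ws.
  have -> : x = 0 by apply: (hK' k Kk).
  by have [lp _ _] := mp; rewrite (linon0 (sub_lsub (dsF_sub k)) lp).
have z2 k : (K <= k)%N -> ld (dsp k) l = 0%N.
  move=> Kk; apply: ld0 => s Ws.
  have mp := sqm_morph (sB k) (sA k) (@AB k).
  have [x [Bx Wx] <-] := morph_wspace oV (sB k) mp Ws.
  by apply/(sqm_ker (sB k) (sA k) (@AB k)) => //; apply: (hK k Kk).
have ext M : (forall k, (M <= k)%N -> ld (dsp k) l = 0%N) -> forall M', (M <= M')%N ->
  (\sum_(k < M) ld (dsp k) l = \sum_(k < M') ld (dsp k) l)%N.
  move=> z M' MM; rewrite -!(big_mkord xpredT (fun k => ld (dsp k) l)).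
  rewrite [RHS](big_cat_nat _ (n := M)) //= [X in (_ + X)%N]big_nat_cond [X in (_ + X)%N]big1 ?addn0 //.
  by move=> k /andP[/andP[Mk _] _]; apply: z.
by rewrite (ext K' z1 (maxn K' K)) ?leq_maxl // (ext K z2 (maxn K' K)) ?leq_maxr.
Qed.
End DirectSum.

(** * From integrable modules to classes in the Grothendieck group *)

Section Assembly.

Lemma qchar_set (m : mono R H) :
  [set l : lweight R H | QPl q lq l /\ is_Ymon q l m] = set0 \/
  exists l0, [set l : lweight R H | QPl q lq l /\ is_Ymon q l m] = [set l0].
Proof.
have [[l0 [h1 h2]]|no] := pselect (exists l0, QPl q lq l0 /\ is_Ymon q l0 m); [right|left].
  exists l0; apply/seteqP; split=> [l [_ hl]|l ->] //.
  exact: Ymon_lweight hl h2.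
by rewrite -subset0 => l hl; apply: no; exists l.
Qed.
Lemma qchar_ext (V V' : qmod) m : (forall l, ld V l = ld V' l) -> qchar q lq V m = qchar q lq V' m.
Proof. by move=> h; apply: eq_fsbigr => l _; rewrite h. Qed.
Lemma qchar_comb (c : seq (int * rep_mod q lq H)) m :
  (forall l, \sum_(p <- c) p.1 * (ld p.2 l)%:Z = 0) -> \sum_(p <- c) p.1 * qchar q lq p.2 m = 0.
Proof.
move=> h; rewrite /qchar; case: (qchar_set m) => [->|[l0 ->]].
  by rewrite big1 // => p _; rewrite fsbig_set0 mulr0.
by rewrite -[RHS](h l0); apply: eq_bigr => p _; rewrite fsbig_set1.
Qed.
(** Two expressions of x differ by a combination of class 0, to which [rep_class0] applies l-weight
    by l-weight. *)
Lemma chi_qE (x : Rep q lq H) c m : rep_val x = rep_class c ->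
  chi_q q lq x m = \sum_(p <- c) p.1 * qchar q lq p.2 m.
Proof.
rewrite /chi_q; case: (cid (rep_valP x)) => c' e1 e2.
apply/eqP; rewrite -subr_eq0; apply/eqP.
pose cc := c' ++ [seq (- p.1, p.2) | p <- c].
transitivity (\sum_(p <- cc) p.1 * qchar q lq p.2 m).
  rewrite big_cat big_map -sumrN; congr (_ + _).
  by apply: eq_bigr => p _; rewrite mulNr.
apply: qchar_comb => l; apply: (rep_class0) => S.
rewrite /rep_class big_cat big_map /=.
have e3 : rep_class c' S = rep_class c S by rewrite -e1 e2.
move: e3; rewrite /rep_class => ->.
by rewrite -big_split big1 // => p _ /=; rewrite mulNr subrr.
Qed.
Lemma rep_of_mod (V : rep_mod q lq H) : exists x : Rep q lq H, forall m, chi_q q lq x m = qchar q lq V m.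
Proof.
have h : exists c, rep_class [:: (1, V)] = rep_class c :> (simple_mod q lq H -> int).
  by exists [:: (1, V)].
exists (MkRep h) => m; rewrite (@chi_qE (MkRep h) [:: (1, V)]) //.
by rewrite big_seq1 mul1r.
Qed.

Section One.
Variables (V : qmod) (oV : O_int V).
Variable (Ch : set (set V)).
Hypotheses (cC : chainp Ch) (mC : forall W, submodule W ->
  (forall W', Ch W' -> W `<=` W' \/ W' `<=` W) -> Ch W).
Local Notation jB := (jB Ch).

(** A weight vector chosen from the set [jB v] alone, so that jumps can be enumerated without
    repetition. *)
Definition jrep (S : set V) : V :=
  xget 0 [set w | [/\ w != 0, exists om, wspace om w & jB w = S]].
Definition jreps : set V :=
  [set jrep (jB v) | v in [set v : V | v != 0 /\ exists om, wspace om v]].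

Lemma jrepP v om : v != 0 -> wspace om v ->
  [/\ jrep (jB v) != 0, exists om, wspace om (jrep (jB v)) & jB (jrep (jB v)) = jB v].
Proof.
move=> v0 Wv; apply: (@xgetPex _ 0 [set w | [/\ w != 0, exists om, wspace om w & jB w = jB v]]).
by exists v; split=> //; exists om.
Qed.
Lemma weights_countable : countable [set om : hdual | exists2 v : V, wspace om v & v != 0].
Proof.
have [s hs] := oi_cone (O_int_oint oV).
apply: (@sub_countable _ _ _ (\bigcup_(la in [set` s])
  [set la - \sum_i sroot H i *+ a i | a in [set: {ffun 'I_n -> nat}]])).
  apply: subset_card_le => om /hs [la ls [a ea]]; exists la => //.
  exists [ffun i => a i] => //; under eq_bigr do rewrite ffunE.
  by rewrite -ea opprB addrC subrK.
apply: bigcup_countable => [|la _]; first exact: finite_set_countable.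
exact: sub_countable (card_image_le _ _) _.
Qed.
Lemma jumps_all om : exists vs : seq V, [/\ uniq (map jB vs),
  forall v, v \in vs -> v != 0 /\ wspace om v,
  forall u, wspace om u -> u != 0 -> exists2 v, v \in vs & jB u = jB v
  & forall l, l.1 = om -> ld V l = (\sum_(v <- vs) jdim cC mC l (jB v))%N].
Proof.
have [d hd] := oi_fd (O_int_oint oV) om.
have hd' : fd [set 0] (setT `&` wspace (V := V) om) d by rewrite setTI.
have [vs [h1 h2 h3 h4]] := jumps_list oV cC mC (ChT mC) hd'.
exists vs; split=> // [v /h2[]|u|l el] //; first exact: h3.
have [cs [fl <-]] := h4 l el; apply: sdim_flag.
by rewrite setTI -el in fl.
Qed.
(** There are countably many weights and each sees finitely many jumps; a series indexed by natural
    numbers needs this. *)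
Lemma jreps_countable : countable jreps.
Proof.
apply: (@sub_countable _ _ _ (\bigcup_(om in [set om : hdual | exists2 v : V, wspace om v & v != 0])
  [set jrep (jB v) | v in [set v | v != 0 /\ wspace om v]])).
  apply: subset_card_le => _ [v [v0 [om Wv]] <-]; exists om; first by exists v.
  by exists v.
apply: bigcup_countable => [|om _]; first exact: weights_countable.
apply: finite_set_countable.
have [vs [_ _ cvs _]] := jumps_all om.
apply: (@sub_finite_set _ _ [set jrep (jB v) | v in [set` vs]]); last exact: finite_image.
by move=> _ [v [v0 Wv] <-]; have [w wvs ->] := cvs v Wv v0; exists w.
Qed.
(** [Ix] is an initial segment of the natural numbers, finite or not, so that the filtration built
    on it has no gaps. *)
Lemma jumps_enum : exists (Ix : set nat) (e : nat -> V),
  [/\ forall j k, Ix k -> (j <= k)%N -> Ix j,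
  forall k, Ix k -> jreps (e k),
  forall v, jreps v -> exists2 k, Ix k & e k = v
  & forall j k, Ix j -> Ix k -> e j = e k -> j = k].
Proof.
have [Ix [dI /card_set_bijP [f bf]]] : exists Ix : set nat,
  (forall j k, Ix k -> (j <= k)%N -> Ix j) /\ (jreps #= Ix)%card.
  have [fin|inf] := pselect (finite_set jreps).
  have [N hN] := (finite_setP _).1 fin; exists `I_N; split=> // j k kN jk.
  exact: leq_ltn_trans kN.
  exists setT; split=> //; exact: eq_card_nat jreps_countable inf.
case: bf => fI finj fsur.
pose e k := xget 0 [set v | jreps v /\ f v = k].
have eP k : Ix k -> jreps (e k) /\ f (e k) = k.
  move=> Ik; apply: (@xgetPex _ 0 [set v | jreps v /\ f v = k]).
  by have [v jv fv] := fsur k Ik; exists v.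
exists Ix, e; split=> //; first by move=> k /eP [].
  move=> v jv; exists (f v); first exact: fI.
  have [je fe] := eP _ (fI v jv); by apply: finj => //; rewrite ?inE.
by move=> j k /eP [_ e1] /eP [_ e2] e3; rewrite -e1 e3.
Qed.
Lemma jB_eq v x : v != 0 -> jB v x -> ~ jA Ch (jB v) x -> jB x = jB v.
Proof.
move=> v0 Bx nAx; apply/seteqP; split; first by apply/(jB_min _ (jB_Ch cC mC v)).
by case: (jump v (jB_Ch cC mC x)) => // h; case: nAx; apply: h; exact: jB_v.
Qed.
Lemma chain_rep : exists W : rep_mod q lq H, forall l, ld W l = ld V l.
Proof.
have [Ix [e [dI je se ie]]] := jumps_enum.
have jP v : jreps v -> [/\ v != 0, exists om, wspace om v & jrep (jB v) = v].
  move=> [u [u0 [om Wu]] <-]; have [h1 h2 h3] := jrepP u0 Wu; split=> //.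
  by rewrite h3.
have inj j k : Ix j -> Ix k -> jB (e j) = jB (e k) -> j = k.
  move=> Ij Ik E; apply: ie => //; have [_ _ <-] := jP _ (je _ Ij).
  by have [_ _ <-] := jP _ (je _ Ik); rewrite E.
(* Outside [Ix] the quotient is 0; since [Ix] is an initial segment, the filtration is already 0
   from there on, as a composition series requires. *)
pose BB k : set V := if `[< Ix k >] then jB (e k) else [set 0].
pose AA k : set V := if `[< Ix k >] then jA Ch (jB (e k)) else [set 0].
have e0 k : Ix k -> e k != 0 by move=> /je/jP [].
have sB k : submodule (BB k).
  by rewrite /BB; case: asboolP => _; [exact: jB_sub|exact: sub0m].
have sA k : submodule (AA k).
  by rewrite /AA; case: asboolP => h; [apply: jA_sub => //; exact: e0|exact: sub0m].
have AB k : AA k `<=` BB k.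
  by rewrite /AA /BB; case: asboolP => h //; apply: jAB.
pose bounds om K := forall k v, Ix k -> v != 0 -> wspace om v -> jB v = jB (e k) -> (k < K)%N.
have idx om : exists K, bounds om K.
  have [vs [_ _ cvs _]] := jumps_all om.
  pose g (S : set V) : nat := xget 0%N [set k | Ix k /\ jB (e k) = S].
  exists (\max_(v <- vs) (g (jB v))).+1 => k v Ik v0 Wv ev.
  have [w wvs ew] := cvs v Wv v0.
  rewrite ltnS (_ : k = g (jB w)); first by apply: (@leq_bigmax_seq _ vs xpredT (fun v => g (jB v)) w).
  have [Ig eg] : [set k | Ix k /\ jB (e k) = jB w] (g (jB w)).
  by apply: (@xgetPex _ 0%N [set k | Ix k /\ jB (e k) = jB w]); exists k; rewrite -ew.
  by apply: inj => //; rewrite -ev ew eg.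
have fin0 om K : bounds om K -> forall k, (K <= k)%N -> BB k `&` wspace om `<=` AA k.
  move=> hK k Kk; rewrite /BB /AA; case: asboolP => Ik; last by move=> x [].
  move=> x [Bx Wx]; have [x0|x0] := eqVneq x 0.
  by rewrite x0; case: (jA_sub cC mC (e0 _ Ik)).
  apply: contrapT => nAx; have := hK k x Ik x0 Wx (jB_eq (e0 _ Ik) Bx nAx).
  by rewrite ltnNge Kk.
have fin om : exists K, forall j, (K <= j)%N -> BB j `&` wspace om `<=` AA j.
  by have [K hK] := idx om; exists K; exact: fin0.
have iso k (Ik : Ix k) : exists f : dsp sB sA AB k -> jm cC mC (e0 _ Ik), qiso f.
  have h3 : subquot_iso (BB k) (AA k) (jm cC mC (e0 _ Ik)).
  by rewrite /BB /AA; case: asboolP => // _; exact: jm_iso.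
  exact: (subquot_iso2 (sB k) (sqm_iso (sB k) (sA k) (@AB k)) h3).
have oD : O_int (dsm sB sA AB) := ds_oint oV sB sA AB fin.
have ser : exists F, composition_series (V := dsm sB sA AB) F.
  exists (@dsF _ _ _ sB sA AB); split.
  - exact: dsF_0.
  - by move=> k; apply: dsF_dec.
  - move=> k; have [Ik|nIk] := pselect (Ix k); [right|left].
  exists (jm cC mC (e0 _ Ik)); first exact: jm_simple.
  have [f hf] := iso k Ik; exact: subquot_comp (dsp_iso sB sA AB k) hf.
  have kpi := sqm_ker (dsX_sub sB sA 0) (dsY_sub sA) (dsYX AB).
  apply/seteqP; split; last by move=> s ->; case: (dsF_sub sB sA AB k).
  move=> _ [f Xf <-]; apply/kpi; first exact: dsX0 Xf.
  case: Xf => hf hj; split=> // j; have [Bj Aj] := hj j.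
  have [jk|kj] := ltnP j k; first exact: Aj.
  have nIj : ~ Ix j by move=> Ij; apply: nIk; apply: dI kj.
  by move: Bj; rewrite /BB /AA; case: asboolP.
  - exact: dsF_cap.
exists (RepMod oD ser) => l /=.
have [vs [U1 h1 c1 ->]] := jumps_all l.1; last by [].
have [K hK] := idx l.1.
rewrite (@ds_ld V oV BB AA sB sA AB fin l K); last exact: fin0.
have ldk k : ld (dsp sB sA AB k) l = (if `[< Ix k >] then jdim cC mC l (jB (e k)) else 0)%N.
  case: asboolP => Ik.
  by rewrite (jdimE cC mC l (e0 _ Ik)); have [f hf] := iso k Ik; exact: qiso_ld hf l.
  apply: ld0 => s _; have [_ _ sp] := sqm_morph (sB k) (sA k) (@AB k).
  have [x Bx <-] := sp s; apply/(sqm_ker (sB k) (sA k) (@AB k)) => //.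
  by move: Bx; rewrite /BB /AA; case: asboolP.
rewrite (eq_bigr _ (fun (k : 'I_K) _ => ldk k)) -big_mkcond /= -(big_map jB xpredT (jdim cC mC l)).
rewrite -(big_mkord (fun k => `[< Ix k >]) (fun k => jdim cC mC l (jB (e k)))) -big_filter.
rewrite -(big_map (fun k => jB (e k)) xpredT (jdim cC mC l)).
set L1 := [seq jB (e k) | k <- _]; set L2 := map jB vs.
have U2 : uniq L1.
  rewrite map_inj_in_uniq ?filter_uniq ?iota_uniq // => j k.
  by rewrite !mem_filter => /andP[/asboolP Ij _] /andP[/asboolP Ik _]; exact: inj.
have sub : {subset L2 <= L1}.
  move=> S /mapP[v vvs ->]; have [v0 Wv] := h1 v vvs.
  have [w0 [om Ww] ew] := jrepP v0 Wv.
  have jv : jreps (jrep (jB v)) by exists v => //; split=> //; exists l.1.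
  have [k Ik ek] := se _ jv.
  apply/mapP; exists k; last by rewrite ek ew.
  rewrite mem_filter mem_index_iota /=; apply/andP; split; first exact/asboolP.
  by apply: (hK k v) => //; rewrite ek ew.
rewrite (bigID (fun S => S \in L2)) /= [X in (_ + X)%N]big1_seq ?addn0.
  rewrite -big_filter; apply: perm_big; apply: uniq_perm; rewrite ?filter_uniq //.
  by move=> S; rewrite mem_filter; case: (boolP (S \in L2)) => //= /sub.
move=> S /andP[nS /mapP[k]]; rewrite mem_filter => /andP[/asboolP Ik _] eS.
rewrite eS (jdimE cC mC l (e0 _ Ik)); apply: ld0 => s Ws.
have [x [Bx Wx] <-] := morph_wspace oV (jB_sub cC (e k))
  (sqm_morph (jB_sub cC (e k)) (jA_sub cC mC (e0 _ Ik)) (jAB cC mC (v := e k))) Ws.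
apply/(sqm_ker (jB_sub cC (e k)) (jA_sub cC mC (e0 _ Ik)) (jAB cC mC (v := e k))) => //.
have [x0|x0] := eqVneq x 0; first by rewrite x0; case: (jA_sub cC mC (e0 _ Ik)).
apply: contrapT => nAx; have [v vvs ev] := c1 x Wx x0; case/negP: nS.
by rewrite eS -(jB_eq (e0 _ Ik) Bx nAx) ev; apply: map_f.
Qed.
End One.

Lemma int_rep (V : qmod) : O_int V -> exists x : Rep q lq H, forall m, chi_q q lq x m = qchar q lq V m.
Proof.
move=> oV; have [Ch [cC mC]] := max_chain V.
have [W hW] := chain_rep oV cC mC; have [x hx] := rep_of_mod W.
by exists x => m; rewrite hx; apply: qchar_ext.
Qed.
End Assembly.

(** * l-weights of integrable modules lie in QP_l^+ *)

Section LWeights.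
Variables (V : qmod) (oV : O_int V).
Let ho := O_int_oint oV.
Let hr := oi_rep ho.

(** The generalized eigenspace is nonzero and stable under phi, so it contains a common eigenvector,
    whose character can only be that of l. *)
Lemma lspace_eig l : ld V l != 0%N -> exists u : V, [/\ wspace l.1 u, u != 0 &
  forall k, Phi k u = lchar l k *: u].
Proof.
move=> nz.
have cX := comfam_wspace V l.1; have sZ := @stab0 V.
have sW : stab (@Phi V) (wspace l.1) by case: cX.
have sG : stab (@Phi V) (lspace l).
  rewrite lspaceE; split; first exact: (geneig_subsp _ cX sW sZ (@subset_refl _ _)).
  move=> k v [Wv [p hp]]; split; first exact: Phi_wspace.
  exists p => k'; have Wv' : wspace l.1 (Phi k v) by exact: Phi_wspace.
  have -> : Phi k v = iter 1 (fun y => Phi k y - lchar l k *: y) v + lchar l k *: v.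
  by rewrite subrK.
  have lin := linD (lchar l) cX k' p sW (@subset_refl _ _).
  have W1 : wspace l.1 (iter 1 (fun y => Phi k y - lchar l k *: y) v).
  exact: (stabD (lchar l) k 1 sW).
  rewrite (linonD lin) //; last exact: (subspZ (wspace_sub V l.1)).
  rewrite (linonZ (wspace_sub V l.1) lin) // hp scaler0 addr0.
  rewrite (comD (lchar l) cX k' k p 1 Wv) /= hp.
  by rewrite scaler0 subr0; case: sZ => _ h; apply: h.
have sub : lspace (V := V) l `<=` wspace l.1 by move=> v [].
have [d hd] := oi_fd ho l.1.
have [v Lv v0] : exists2 v, lspace (V := V) l v & ~ [set 0] v.
  apply: contrapT => no; case/eqP: nz; apply: sdim_rdim.
  have -> : lspace (V := V) l = [set 0]; last exact: rdim0.
  apply/seteqP; split=> [v Lv|v ->]; last exact: subsp0 sG.1.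
  by apply: contrapT => v0; apply: no; exists v.
have [e [Le e0] [c hc]] := eigenall (comfam_sub cX sG sub) sZ
  (fun x (ex : x = 0) => eq_ind_r (lspace l) (subsp0 sG.1) ex) (fd_sub hd sub (@subset_refl _ _))
  (ex_intro2 _ _ v Lv v0).
have e0' : e != 0 by apply/eqP.
exists e; split=> //; first exact: sub.
move=> k; have ek : Phi k e = c k *: e by apply/eqP; rewrite -subr_eq0; apply/eqP/hc.
rewrite ek; congr (_ *: _); apply/eqP; rewrite -subr_eq0; apply/negPn/negP => ne.
move: Le; rewrite lspaceE => -[_ [p hp]].
have it j : iter j (fun y => Phi k y - lchar l k *: y) e = (c k - lchar l k) ^+ j *: e.
  elim: j => [|j IH]; first by rewrite scale1r.
  rewrite iterS IH exprS /Phi (linonZ (lsubT V) (@act_lin V _)) // -/(Phi k e) ek.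
  by rewrite !scalerA -scalerBl; congr (_ *: _); ring.
have := hp k; rewrite it => /eqP; rewrite scaler_eq0 (negbTE e0').
by rewrite expf_eq0 (negbTE ne) andbF.
Qed.
(** Among the weights of V in om + Q^+ take one of maximal height; its vectors are killed by all
    x^+_{i,0}, so it is dominant by [wsp_sing]. *)
Lemma wt_above om v : wspace (V := V) om v -> v != 0 -> exists2 la, Pplus (H := H) la & leQ om la.
Proof.
move=> Wv v0; have [s hs] := oi_cone ho.
pose wt (a : 'I_n -> nat) := om + \sum_i sroot H i *+ a i.
pose P k := `[< exists a, (\sum_i a i)%N = k /\ exists2 u : V, wspace (wt a) u & u != 0 >].
have exP : exists k, P k.
  exists 0%N; apply/asboolP; exists (fun=> 0%N); split; first by rewrite big1.
  by exists v => //; rewrite /wt big1 ?addr0 // => i _; rewrite mulr0n.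
have [K bK] : exists K, forall k, P k -> (k <= K)%N.
  pose bd la := xget 0%N [set m | exists a, la - om = \sum_i sroot H i *+ a i /\ (\sum_i a i)%N = m].
  exists (\max_(la <- s) bd la) => k /asboolP [a [ek [u Wu u0]]].
  have [la ls [b eb]] := hs (wt a) (ex_intro2 _ _ u Wu u0).
  apply: leq_trans (@leq_bigmax_seq _ s xpredT bd la ls isT).
  have elo : la - om = \sum_i sroot H i *+ (a i + b i)%N.
  under eq_bigr do rewrite mulrnDr; rewrite big_split /= -eb.
  by rewrite opprD !addrA [_ + la]addrC addrAC addrK.
  have [c [ec em]] : [set m | exists a, la - om = \sum_i sroot H i *+ a i /\ (\sum_i a i)%N = m] (bd la).
  by apply: (@xgetPex _ 0%N [set m | exists a, la - om = \sum_i sroot H i *+ a i /\ (\sum_i a i)%N = m]);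
  exists (\sum_i (a i + b i))%N, (fun i => a i + b i)%N.
  rewrite -ek -em; apply: leq_sum => i _.
  have := sroot_comb_inj (etrans (esym ec) elo) => ->; exact: leq_addr.
case: (ex_maxnP exP bK) => k /asboolP [a [ek [u Wu u0]]] maxk.
exists (wt a); last by exists a; rewrite addrC addKr.
move=> i; apply: (wsp_sing hq hr (oi_str ho) Wu u0).
apply/eqP/negPn/negP => x0.
have : (k.+1 <= k)%N; last by rewrite ltnn.
apply: maxk; apply/asboolP; exists (fun j => a j + (j == i))%N; split.
  rewrite big_split ek -addn1; congr (_ + _)%N.
  by rewrite (bigD1 i) // eqxx big1 // => j /negbTE ->.
exists (qop (LX H true i 0) u) => //.
have := wsp_x hq hr true i 0 I Wu; rewrite /wt /wsh scale1r.
move=> Wx; rewrite (_ : om + \sum_j _ = om + \sum_i0 sroot H i0 *+ a i0 + sroot H i) // -addrA; congr (_ + _).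
under eq_bigr do rewrite mulrnDr.
rewrite big_split; congr (_ + _).
by rewrite (bigD1 i) //= eqxx big1 ?addr0 // => j /negbTE ->; rewrite mulr0n.
Qed.
(** At each node the eigenvalue series of a common eigenvector is rational by [eig_fits], its zeros
    and poles are matched orbit by orbit thanks to [count_orb], and [qrpair_ex] produces Q and P. *)
Lemma ld_QPl l : ld V l != 0%N -> QPl q lq l.
Proof.
move=> nz; have [u [Wu u0 hu]] := lspace_eig nz.
have hu' e i m : qop (LP H e i m) u = l.2 e i m *: u.
  by have := hu (e, i, m); rewrite /Phi act_phi.
have hPl : Pl lq l.
  move=> e i; have := hu' e i 0%N; rewrite (rp_P0 hr) // => e0.
  have {e0} := etrans (esym e0) (Wu _) => /eqP; rewrite -subr_eq0 -scalerBl scaler_eq0 (negbTE u0) orbF subr_eq0.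
  move=> /eqP ->; congr (qp _); rewrite linearZ /= rmorphM.
  by rewrite -[_ *: _]/(_ * _) -mulrA.
split=> //; first exact: wt_above Wu u0.
have per i : exists QP : {poly C} * {poly C}, [/\ QP.1`_0 = 1, QP.2`_0 = 1 &
  forall e, expands_as e (l.2 e i)
  (qi q D i ^ (pdeg QP.1 - pdeg QP.2) *:
  (pscale (qi q D i)^-1 QP.1 * pscale (qi q D i) QP.2))
  (pscale (qi q D i) QP.1 * pscale (qi q D i)^-1 QP.2)].
  have eu : eig qp (qop (V := V)) i l.1 u (fun e m => l.2 e i m) by split=> // *; exact: hu'.
  have [c [A [B ft]]] := eig_fits hq ho eu.
  have [c0 n0 sz _] := ft.
  have eb : q ^ bmat D i i = qi q D i ^+ 2.
  by rewrite /bmat cmat_diag -exprnP exprM.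
  have [Q [P [Q0 P0 eQP dAB]]] : exists Q P, qrpair (qi q D i) A B Q P.
  apply: (@qrpair_ex _ _ (qi0 i) (inorb q D i) A B sz n0) => [a y /asboolP|a|a x y /asboolP[k ->]|a a0].
  - by rewrite eb.
  - by apply/asboolP; exists 0; rewrite mulr1.
  - by rewrite mulrC (inorb_b hq).
  - exact: (count_orb hq ho eu ft a0).
  exists (Q, P); split=> // e.
  (* The matching gives c^2 only. Both c and q_i are values of [qp] at rational numbers, and
     injectivity of [qp] removes the sign ambiguity. *)
  have ec : c = qi q D i ^ (pdeg Q - pdeg P).
  have [gt gf] := fits_const ft.
  have ct : c = qp ((symz D i)%:R * l.1 (scoroot H i)) by rewrite -gt hPl mul1r.
  have cf : l.2 false i 0%N = c^-1 by rewrite hPl ct !mulNr mul1r (qpN hq).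
  have pA0 : \prod_(z <- A) z != 0.
  rewrite prodf_seq_neq0; apply/allP => z zA; apply: contraNN n0 => /eqP <-.
  by rewrite mem_cat zA.
  have c2 : c ^+ 2 = qi q D i ^ (2 * (pdeg Q - pdeg P)).
  apply: (mulfI pA0); rewrite -[RHS]dAB; move: gf; rewrite cf => gf.
  by rewrite mulrCA [_ * c]mulrC -gf mulrC mulfVK.
  have qE : qi q D i = qp (symz D i)%:R by rewrite (qp_nat hq).
  move: c2; rewrite ct qE -(qp_natM hq) -!(qp_intM hq) => /(qp_inj hq) e2.
  congr (qp _); apply: (@mulfI _ 2%:R) => //; rewrite e2.
  by rewrite rmorphM mulrA.
  have P1 : prz B != 0.
  by apply: c1_neq0; elim: (B) => [|z L IH]; rewrite /prz ?big_nil ?coef1 // big_cons c1_mul // lin1_0.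
  apply: expands_trans P1 _ (fits_expands e ft).
  rewrite -ec -!scalerAl; congr (_ *: _); rewrite [RHS]mulrC; exact: eQP.
have [QP hQP] := choice per.
by exists (fun i => (QP i).1), (fun i => (QP i).2) => i; exact: hQP.
Qed.
End LWeights.

(** The constant term 1 makes all roots nonzero; the divisor is the sum of their inverses. *)
Lemma freeg_roots (Q : {poly C}) : Q`_0 = 1 -> exists u : {freeg (Cstar R)},
  deg u = pdeg Q /\ forall a, coeff a u = (mup (val a)^-1 Q)%:Z.
Proof.
move=> Q1; have Q0 : Q != 0 by apply: c1_neq0.
have [s es] := closed_field_poly_normal Q.
have s0 z : z \in s -> z^-1 != 0.
  move=> zs; rewrite invr_eq0; apply/eqP => z0; move/eqP: Q1; apply/negP.
  rewrite -horner_coef0 es hornerZ -z0 (_ : _.[z] = 0) ?mulr0 1?eq_sym //.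
  by apply/eqP; rewrite -/(root _ _) root_prod_XsubC.
have ls : lead_coef Q != 0 by rewrite lead_coef_eq0.
have zs : size s = (size Q).-1.
  by rewrite es size_scale // size_prod_XsubC.
have mQ x : mup x Q = count_mem x s.
  by rewrite es -mul_polyC mupMr ?mu_prod_XsubC // /root hornerC.
pose one : Cstar R := exist _ 1 (oner_neq0 _).
pose c z : Cstar R := insubd one z^-1.
exists (\sum_(z <- s) << c z >>); split.
  rewrite raddf_sum /pdeg -zs (eq_bigr (fun _ => 1)) => [|z _]; last exact: degU.
  by rewrite big_const_seq iter_addr_0 natz.
move=> a; rewrite raddf_sum mQ -sum1_count [in RHS]big_mkcond /= -[RHS]natz natr_sum.
rewrite [LHS]big_seq [RHS]big_seq; apply: eq_bigr => z zs'; rewrite [LHS]coeffU mul1r.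
congr (_%:R); rewrite -(inj_eq val_inj) val_insubd s0 // eq_sym.
rewrite eq_sym -(inj_eq invr_inj) invrK; by case: eqP.
Qed.
(** Comparison of constant terms: q_i to the weight equals q_i to deg Q - deg P. This is the
    compatibility required of a coweight and exponents in a monomial. *)
Lemma lweight_coroot l Q P i : Pl lq l -> QR_for q l Q P ->
  l.1 (scoroot H i) = (pdeg (Q i) - pdeg (P i))%:~R :> rat.
Proof.
move=> hl /(_ i)[Q1 P1 /(_ true 0)].
have sD : (0 < size (pscale (qi q D i) (Q i) * pscale (qi q D i)^-1 (P i))%R)%N.
  rewrite size_poly_gt0 mulf_neq0 // pscale_eq0 ?invr_eq0 //; exact: c1_neq0.
rewrite -(prednK sD) big_ord_recl big1 ?addr0 => [|j _]; last first.
  by rewrite ?mulr0.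
have z0 : zext true (l.2 true i) 0 = l.2 true i 0%N by [].
have z1 (A : {poly C}) : zext true (nth 0 A) 0 = A`_0 by [].
rewrite z0 z1 hl.
rewrite coefZ !c1_mul ?pscale0 // mulr1 !mul1r.
rewrite /qi -(qp_nat hq) -(qp_intM hq) => /(qp_inj hq).
rewrite mulrC => /mulIf; apply; by rewrite pnatr_eq0 -lt0n symz_gt0.
Qed.
Lemma Ymon_ex l : QPl q lq l -> exists m : mono R H, is_Ymon q l m.
Proof.
move=> [hl _ [Q [P hQP]]].
have ex (A : 'I_n -> {poly C}) : (forall i, (A i)`_0 = 1) -> exists u : 'I_n -> {freeg (Cstar R)},
  forall i, deg (u i) = pdeg (A i) /\ forall a, coeff a (u i) = (mup (val a)^-1 (A i))%:Z.
  by move=> A1; have [u hu] := choice (fun i => freeg_roots (A1 i)); exists u.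
have [u hu] := ex Q (fun i => let: And3 h _ _ := hQP i in h).
have [v hv] := ex P (fun i => let: And3 _ h _ := hQP i in h).
pose w : hh H * {ffun 'I_n -> {freeg (Cstar R)}} := (nu H l.1, [ffun i => u i - v i]).
have hw : w \in @mono_pred R n D H.
  apply/forallP => i; apply/eqP; rewrite ffunE nuP form_sroot linearZ.
  by rewrite raddfB /= (hu i).1 (hv i).1 (lweight_coroot _ hl hQP).
exists (Mono hw); split=> //; exists Q, P; split=> // i a.
by rewrite /expo ffunE raddfB /= (hu i).2 (hv i).2.
Qed.
Definition lmul (l l' : lweight R H) : lweight R H :=
  (l.1 + l'.1, fun e i => cauchy_prod (l.2 e i) (l'.2 e i)).

Lemma QR_lmul l l' Q P Q' P' : QR_for q l Q P -> QR_for q l' Q' P' ->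
  QR_for q (lmul l l') (fun i => Q i * Q' i) (fun i => P i * P' i).
Proof.
move=> h h' i; have [Q1 P1 hx] := h i; have [Q1' P1' hx'] := h' i.
split; rewrite ?c1_mul // => e.
have nz := c1_neq0.
have := expands_mul (hx e) (hx' e); rewrite /lmul.
congr (expands_as e _ _ _); last by rewrite !pscaleM; ring.
rewrite -scalerAl -scalerAr scalerA -expfzDr //; congr (_ ^ _ *: _); last by rewrite !pscaleM; ring.
by rewrite /pdeg -!/(deg1 _) !deg1M ?nz //; ring.
Qed.
Lemma QPl_lmul l l' : QPl q lq l -> QPl q lq l' -> QPl q lq (lmul l l').
Proof.
move=> [h [la hla lla] [Q [P hQP]]] [h' [la' hla' lla'] [Q' [P' hQP']]]; split.
- move=> e i; rewrite /= /cauchy_prod big_ord1 h h' -(qd_D hq); congr qpow.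
  by rewrite add_lfunE mulrDr.
- exists (la + la'); last exact: leQD.
  by move=> i; rewrite add_lfunE rpredD.
- by exists (fun i => Q i * Q' i), (fun i => P i * P' i); exact: QR_lmul.
Qed.
Lemma Ymon_lmul l l' m m' : is_Ymon q l m -> is_Ymon q l' m' ->
  is_Ymon q (lmul l l') (m + m' : mono R H).
Proof.
move=> [c [Q [P [h e]]]] [c' [Q' [P' [h' e']]]]; split; first by rewrite cowtD c c' nuD.
exists (fun i => Q i * Q' i), (fun i => P i * P' i); split; first exact: QR_lmul.
move=> i a; have [Q1 P1 _] := h i; have [Q1' P1' _] := h' i.
have nz := c1_neq0.
rewrite /expo ffunE raddfD /= -/(expo m i a) -/(expo m' i a) e e' !mupM ?nz //; ring.
Qed.

(** * Multiplicativity of q-characters *)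

Section Characters.
Local Notation mono := (mono R H).
Local Notation kx := (bool * 'I_n * nat)%type.
Local Notation flags V cs := (forall om : hdual, flag (@Phi V) [set 0] (wspace om) (cs om)).

Definition lwc (om : hdual) (c : kx -> C) : lweight R H := (om, fun e i m => c (e, i, m)).
Lemma lcharK om c : lchar (lwc om c) = c.
Proof. by apply/funext => -[[e i] m]. Qed.
Lemma lwcK l : lwc l.1 (lchar l) = l. Proof. by case: l. Qed.
Lemma PhiE (V : qmod) : @Phi V = PhiO (qop (V := V)).
Proof. by apply/funext => k; apply/funext => v; rewrite /Phi act_phi. Qed.
Lemma flags_ex (V : qmod) : O_int V -> exists cs, flags V cs.
Proof.
move=> oV; have ex om : exists cs, flag (@Phi V) [set 0] (wspace om) cs.
  have [cs fl] := PhiO_flag om (O_int_oint oV); exists cs.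
  by rewrite PhiE.
by have [cs hcs] := choice ex; exists cs.
Qed.
Definition mon (l : lweight R H) : mono := xget 0 [set m | is_Ymon q l m].
Lemma monP l : QPl q lq l -> is_Ymon q l (mon l).
Proof. by move=> /(Ymon_ex) [m hm]; apply: (@xgetPex _ 0 [set m | is_Ymon q l m]); exists m. Qed.
Lemma mon_eq l m : QPl q lq l -> (mon l == m) = `[< is_Ymon q l m >].
Proof.
move=> hl; apply/eqP/asboolP => [<-|hm]; first exact: monP.
exact: Ymon_mono (monP hl) hm.
Qed.
Lemma mon_cowt l : QPl q lq l -> cowt (mon l) = nu H l.1.
Proof. by move=> /monP[]. Qed.

Section OneModule.
Variables (V : qmod) (oV : O_int V) (cs : hdual -> seq (kx -> C)) (fl : flags V cs).

Lemma ld_flags l : ld V l = chcount (lchar l) (cs l.1).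
Proof. exact: sdim_flag (fl l.1). Qed.
Lemma flags_QPl om c j : c = nth c (cs om) j -> (j < size (cs om))%N -> QPl q lq (lwc om c).
Proof.
move=> ec js; apply: (ld_QPl oV); rewrite ld_flags lcharK.
rewrite -lt0n -has_count; apply/(has_nthP c); exists j => //.
by apply/asboolP.
Qed.
Lemma flags_mon om (s : seq (kx -> C)) : (forall c j, c = nth c s j -> (j < size s)%N -> QPl q lq (lwc om c)) ->
  {in [seq mon (lwc om c) | c <- s], forall a, cowt a = nu H om}.
Proof.
elim: s => // c s IH h a; rewrite inE => /predU1P[->|].
  by rewrite mon_cowt //; exact: (h c 0%N).
apply: IH => c' j e js; exact: (h c' j.+1).
Qed.
(** A flag turns the sum over l-weights of weight [om] into this finite list of monomials with
    repetition. *)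
Definition mons (om : hdual) : seq mono := [seq mon (lwc om c) | c <- cs om].

Lemma mons_cowt om a : a \in mons om -> cowt a = nu H om.
Proof. by move=> h; apply: (flags_mon _ h) => c j; exact: flags_QPl. Qed.
Lemma qchar_mons om a : cowt a = nu H om -> qchar q lq V a = (count_mem a (mons om))%:Z.
Proof.
move=> ca; rewrite /qchar.
have allQ c j : c = nth c (cs om) j -> (j < size (cs om))%N -> QPl q lq (lwc om c) := @flags_QPl om c j.
have cntE (P : (kx -> C) -> bool) : (forall c, QPl q lq (lwc om c) -> (mon (lwc om c) == a) = P c) ->
  count_mem a (mons om) = count P (cs om).
  move=> hP; rewrite /mons; elim: (cs om) allQ => //= c s IH hs.
  rewrite hP; last exact: (hs c 0%N).
  by rewrite IH // => c' j e js; exact: (hs c' j.+1).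
have [[l0 [h1 h2]]|no] := pselect (exists l0, QPl q lq l0 /\ is_Ymon q l0 a).
  have -> : [set l | QPl q lq l /\ is_Ymon q l a] = [set l0].
  apply/seteqP; split=> [l [_ hl]|l ->] //.
  exact: Ymon_lweight hl h2.
  rewrite fsbig_set1 ld_flags; have e0 : l0.1 = om by apply: (@nu_inj _ _ H); rewrite -ca h2.1.
  congr Posz; rewrite e0; apply/esym/cntE => c hc; rewrite mon_eq //.
  apply/asboolP/asboolP => [hm|e].
  by rewrite -(Ymon_lweight hm h2) lcharK.
  by rewrite e -e0.
rewrite (_ : [set l | _] = set0) ?fsbig_set0; last first.
  by rewrite -subset0 => l hl; apply: no; exists l.
rewrite (cntE pred0) ?count_pred0 // => c hc; rewrite mon_eq //.
by apply/asboolP => hm; apply: no; exists (lwc om c).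
Qed.
Lemma qchar_supp a : qchar q lq V a != 0 -> exists om, a \in mons om /\
  exists2 v : V, wspace om v & v != 0.
Proof.
move=> h; have [om ca] : exists om, cowt a = nu H om.
  apply: contrapT => no; move: h; rewrite /qchar (_ : [set l | _] = set0) ?fsbig_set0 //.
  by rewrite -subset0 => l [_ [e _]]; apply: no; exists l.1.
exists om; move: h; rewrite (qchar_mons ca) -lt0n -has_count has_pred1 => am; split=> //.
apply: contrapT => no; have W0 : wspace (V := V) om `<=` [set 0].
  by move=> v Wv; apply: contrapT => /eqP v0; apply: no; exists v.
by move: am; rewrite /mons (flag_nil (fl om) W0).
Qed.
Lemma qchar_out a : (forall om, cowt a <> nu H om) -> qchar q lq V a = 0.
Proof.
move=> h; apply/eqP/negPn/negP => /qchar_supp[om [/mons_cowt e _]]; exact: (h om).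
Qed.
Lemma qchar_adm : adm (fsupp (qchar q lq V)).
Proof.
split.
  have [s hs] := oi_cone (O_int_oint oV); exists s => a /qchar_supp[om [/mons_cowt e [v Wv v0]]].
  have [|la ls lo] := hs om; first by exists v => //; rewrite -wspaceE.
  by exists la, om.
move=> w; have [[om ew]|no] := pselect (exists om, w = nu H om).
  apply: (@sub_finite_set _ _ [set` mons om]); last exact: finite_seq.
  move=> a [/qchar_supp[om' [am _]] ca].
  by rewrite (_ : om = om') //; apply: (@nu_inj _ _ H); rewrite -ew -ca (mons_cowt am).
apply: (@sub_finite_set _ _ set0) => // a [/qchar_supp[om' [am _]] ca].
by apply: no; exists om'; rewrite -ca (mons_cowt am).
Qed.
End OneModule.

Lemma lmul_lwc om om' c c' : lmul (lwc om c) (lwc om' c') = lwc (om + om') (chmul c c').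
Proof. by []. Qed.
Definition tens (M : qmod) (csV csW : hdual -> seq (kx -> C)) := forall om, exists L : seq hdual,
  [/\ uniq L, forall nu, nu \notin L -> csV nu = [::] \/ csW (om - nu) = [::] &
  forall g, ld M (lwc om g) = (\sum_(nu <- L) chcount g (cprod (csV nu) (csW (om - nu)%R)))%N].
(** The specialization is integrable by [M1_oint], so [oint_serre] supplies its Serre relations and
    it is a module; its characters come from [M1_flag] and [hom_flag_full]. *)
Lemma tensor_mod (V W : qmod) (csV csW : hdual -> seq (kx -> C)) : O_int V -> O_int W ->
  flags V csV -> flags W csW ->
  exists2 M : qmod, O_int M & tens M csV csW.
Proof.
move=> oV oW fV fW; have hV := O_int_oint oV; have hW := O_int_oint oW.
have hM := M1_oint hq hV hW.
have e0 := mkqmod_op (oi_rep hM) (oint_serre hq hM).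
pose M := mkqmod (oi_rep hM) (oint_serre hq hM).
exists M; first by apply: oint_O_int; rewrite e0.
move=> om.
have fO (X : qmod) c : flags X c -> forall nu,
  flag (PhiO (qop (V := X))) [set 0] (wsp qp (qop (V := X)) nu) (c nu).
  by move=> h nu; rewrite -wspaceE -PhiE.
have [L [cs [uL oL fH hL]]] := hom_flag_full hq hV hW om (fO _ _ fV) (fO _ _ fW).
have [cs' f' e'] := M1_flag hq hV hW fH.
exists L; split=> // g; rewrite (@sdim_flag M (lwc om g) cs').
  by rewrite lcharK e' hL.
by rewrite wspaceE PhiE e0.
Qed.
(** Both sides count, with multiplicity, the pairs of monomials of V and W with product m, a number
    called [A]; [Ymon_lmul] relates such pairs to products of l-weights, hence to the multiplicity
    in M. *)
Lemma tensor_qchar (V W M : qmod) (csV csW : hdual -> seq (kx -> C)) : O_int V -> O_int W -> O_int M ->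
  flags V csV -> flags W csW ->
  tens M csV csW ->
  qchar q lq M = Defs.conv (qchar q lq V) (qchar q lq W).
Proof.
move=> oV oW oM fV fW hM; apply/funext => m.
have [csM fM] := flags_ex oM.
have [[om em]|no] := pselect (exists om, cowt m = nu H om); last first.
  rewrite (qchar_out oM fM) => [|om e]; last by apply: no; exists om.
  apply/esym; rewrite /Defs.conv fsbig1 // => a _; apply: conv_term => -[].
  move=> /(qchar_supp oV fV)[om [/(mons_cowt oV fV) e1 _]].
  move=> /(qchar_supp oW fW)[om' [/(mons_cowt oW fW) e2 _]].
  by apply: no; exists (om + om'); rewrite nuD -e1 -e2 addrC subrK.
have [L [uL oL hL]] := hM om.
pose mV nu := mons csV nu; pose mW nu := mons csW nu.
pose A : nat := \sum_(nu <- L) \sum_(a <- mV nu) count_mem (m - a)%R (mW (om - nu)%R).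
transitivity (A%:Z).
  have allV := flags_QPl oV fV; have allW := flags_QPl oW fW.
  have cntE (P : (kx -> C) -> bool) :
  (forall nu c c', QPl q lq (lwc nu c) -> QPl q lq (lwc (om - nu) c') ->
  (mon (lwc (om - nu) c') == m - mon (lwc nu c)) = P (chmul c c')) ->
  A = (\sum_(nu <- L) count P (cprod (csV nu) (csW (om - nu)%R)))%N.
  move=> hP; apply: eq_bigr => nu _; rewrite /mV /mons.
  elim: (csV nu) (allV nu) => [|c s IH] hs; first by rewrite big_nil.
  rewrite big_cons count_cat IH; last by move=> c' j e js; exact: (hs c' j.+1).
  congr (_ + _)%N; rewrite !count_map.
  have hc : QPl q lq (lwc nu c) by exact: (hs c 0%N).
  elim: (csW (om - nu)) (allW (om - nu)) => //= c' s' IH' hs'.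
  rewrite hP //; last exact: (hs' c' 0%N).
  by rewrite IH' // => c2 j e js; exact: (hs' c2 j.+1).
  have sumE nu c c' : QPl q lq (lwc nu c) -> QPl q lq (lwc (om - nu) c') ->
  (mon (lwc (om - nu) c') == m - mon (lwc nu c)) = `[< is_Ymon q (lwc om (chmul c c')) m >].
  move=> hc hc'; rewrite eq_sym subr_eq addrC eq_sym.
  have eom : lmul (lwc nu c) (lwc (om - nu) c') = lwc om (chmul c c').
  by rewrite lmul_lwc addrC subrK.
  have hm := Ymon_lmul (monP hc) (monP hc'); rewrite eom in hm.
  apply/eqP/asboolP => [<-//|hm']; exact: Ymon_mono hm hm'.
  rewrite /qchar.
  have [[l0 [h1 h2]]|no] := pselect (exists l0, QPl q lq l0 /\ is_Ymon q l0 m).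
  have -> : [set l | QPl q lq l /\ is_Ymon q l m] = [set l0].
  apply/seteqP; split=> [l [_ hl]|l ->] //.
  exact: Ymon_lweight hl h2.
  have e0 : l0.1 = om by apply: (@nu_inj _ _ H); rewrite -em h2.1.
  rewrite fsbig_set1 -(lwcK l0) e0 hL; congr Posz; apply/esym/cntE => nu c c' hc hc'.
  rewrite sumE //; apply/asboolP/asboolP => [hm|e].
  by rewrite -(Ymon_lweight hm h2) lcharK.
  by rewrite e -e0.
  rewrite (_ : [set l | _] = set0) ?fsbig_set0; last first.
  by rewrite -subset0 => l hl; apply: no; exists l.
  rewrite (cntE pred0) => [|nu c c' hc hc'].
  by rewrite big1 // => nu _; rewrite count_pred0.
  rewrite sumE //; apply/asboolP => hm; apply: no; exists (lwc om (chmul c c')); split=> //.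
  have := QPl_lmul hc hc'; by rewrite lmul_lwc addrC subrK.
(* The convolution runs over distinct monomials, whereas the lists [mV] repeat them; [T] contains
   every contributing monomial once. *)
pose T := undup (flatten [seq mV nu | nu <- L]).
have hT nu a : nu \in L -> a \in mV nu -> a \in T.
  by move=> nL am; rewrite mem_undup; apply/flattenP; exists (mV nu) => //; exact: map_f.
have cW nu a : a \in mV nu -> cowt (m - a) = Defs.nu H (om - nu).
  move=> /(mons_cowt oV fV) e; rewrite cowtB em e.
  by apply/eqP; rewrite subr_eq -nuD subrK.
rewrite (@conv_sub _ [set` T]); last first.
  move=> a [/(qchar_supp oV fV)[nu [am _]] ha].
  apply: (hT nu) => //; apply: contraPT ha => nL.
  move: am; rewrite /fsupp /= => am; rewrite (qchar_mons oW fW (cW _ _ am)).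
  case: (oL nu nL) => e; first by move: am; rewrite /mons e.
  by rewrite /mons e.
rewrite -fsbig_seq ?undup_uniq // (big_morph Posz PoszD erefl).
have qV a : a \in T -> qchar q lq V a = \sum_(nu <- L) (count_mem a (mV nu))%:Z.
  rewrite mem_undup => /flattenP[_ /mapP[nu nL ->] am].
  have ca := mons_cowt oV fV am; rewrite (qchar_mons oV fV ca) (bigD1_seq nu) //= big1 ?addr0 // => nu' nn.
  apply/eqP; rewrite eqz_nat -leqn0 leqNgt -has_count has_pred1; apply: contra nn => am'.
  by apply/eqP/(@nu_inj _ _ H); rewrite -ca (mons_cowt oV fV am').
rewrite [RHS]big_seq; under [RHS]eq_bigr => a aT do rewrite qV // mulr_suml.
rewrite -big_seq exchange_big [LHS]big_seq [RHS]big_seq; apply: eq_bigr => nu nL.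
rewrite (sum_count_mem (fun a => qchar q lq W (m - a))) ?undup_uniq //; last by move=> a; exact: hT.
rewrite (big_morph Posz PoszD erefl) [LHS]big_seq [RHS]big_seq; apply: eq_bigr => a am.
by rewrite (qchar_mons oW fW (cW _ _ am)).
Qed.
End Characters.

(** * The image as a subring *)

Section Assembly.
Local Notation rmd := (rep_mod q lq H).
Local Notation Y := (Y R H).

Lemma triv_mod : exists2 M : qmod, O_int M & qchar q lq M = @delta0 (mono R H).
Proof.
have hT := triv_oint hq H; have e0 := mkqmod_op (oi_rep hT) (oint_serre hq hT).
pose M := mkqmod (oi_rep hT) (oint_serre hq hT).
have oM : O_int M by apply: oint_O_int; rewrite e0.
have Wsp om : wspace (V := M) om = wsp qp (@triv C n D H) om by rewrite wspaceE e0.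
pose c0 (k : bool * 'I_n * nat) : C := (k.2 == 0%N)%:R.
pose cs (om : hdual) := if om == 0 then [:: c0] else [::].
have fl om : flag (@Phi M) [set 0] (wspace om) (cs om).
  rewrite /cs; case: eqP => [->|om0]; last first.
  have -> : wspace (V := M) om = [set 0]; last exact: flag0.
  apply/seteqP; split=> v; last by move=> ->; exact: subsp0 (wspace_sub M om).
  rewrite Wsp => Wv; apply: contrapT => /eqP v0; apply: om0; exact: (triv_wsp hq Wv (v0 : (v : C^o) != 0)).
  have WT : wspace (V := M) 0 = setT by rewrite Wsp (triv_wsp0 hq).
  have m1 : (1 : C^o) != 0 by exact: oner_neq0.
  rewrite WT; apply: (@flagS _ _ _ _ [set 0] [set 0] [set: M] c0 [::] (1 : C^o)).
  - exact: flag0.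
  - by split=> //; exact: lsubT.
  - by [].
  - by move=> /eqP; rewrite (negbTE m1).
  - by [].
  - by move=> x _; exists x; rewrite -[_ *: _]/(x * 1) mulr1 subrr.
  - move=> k; rewrite PhiE e0 /PhiO /c0 /=; case: eqP => _.
  by rewrite scale1r subrr.
  by rewrite scale0r subrr.
exists M => //.
have Q0 : QPl q lq (lwc 0 c0 : lweight R H).
  by apply: (@flags_QPl _ oM cs fl 0 c0 0%N); rewrite /cs eqxx.
have y0 : is_Ymon q (lwc 0 c0) (0 : mono R H).
  split.
  have n0 : nu H 0 = 0 by apply: (addrI (nu H 0)); rewrite -nuD !addr0.
  by rewrite /=.
  exists (fun=> 1), (fun=> 1); split=> [i|i a]; last by rewrite /expo ffunE raddf0 subrr.
  split; rewrite ?coef1 // => e; rewrite subrr scale1r.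
  have p1 (a : C) : pscale a 1 = 1 by rewrite /pscale comp_polyC.
  rewrite !p1 mulr1 => k; rewrite size_poly1 big_ord1 coef1 /= mul1r subr0 /zext.
  rewrite /c0; case: ifP => k0; case: ifP => k1; rewrite ?coef1 //.
  - by rewrite absz_eq0; case: eqP => // e1; move: k1; rewrite e1.
  - by rewrite absz_eq0; case: eqP => // e1; move: k0; rewrite e1 mulr0.
apply/funext => a; rewrite /delta0.
have [[om ea]|no] := pselect (exists om, cowt a = nu H om); last first.
  rewrite (qchar_out oM fl) => [|om e]; last by apply: no; exists om.
  case: eqP => // a0; case: no; exists 0.
  by rewrite a0; exact: y0.1.
rewrite (qchar_mons oM fl ea) /mons /cs.
have m0 : mon (lwc 0 c0) = 0 :> mono R H.
  by apply/eqP; rewrite (mon_eq) //; apply/asboolP.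
case: (om =P 0) ea => [->|om0] ea; first by rewrite /= m0 eq_sym; case: eqP.
case: eqP => // a0; case: om0; apply: (@nu_inj _ _ H); rewrite -ea a0; exact: y0.1.
Qed.
Lemma qchar_Y (V : qmod) : O_int V -> qchar q lq V \in @Y_pred R n D H.
Proof.
move=> oV; have [cs fl] := flags_ex oV.
by apply/asboolP; exact: (qchar_adm oV fl).
Qed.
Definition yq (V : qmod) (oV : O_int V) : Y := MkY (qchar_Y oV).

Lemma yqE V oV : Y_val (@yq V oV) = qchar q lq V.
Proof. by []. Qed.
Definition rsum (c : seq (int * rmd)) : Y := \sum_(p <- c) yq (rmod_int p.2) *~ p.1.

Lemma Y_valD (y z : Y) m : Y_val (y + z) m = Y_val y m + Y_val z m. Proof. by []. Qed.
Lemma Y_valN (y : Y) m : Y_val (- y) m = - Y_val y m. Proof. by []. Qed.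
Lemma rsumE c m : Y_val (rsum c) m = \sum_(p <- c) p.1 * qchar q lq p.2 m.
Proof.
rewrite /rsum; elim: c => [|p c IH]; first by rewrite !big_nil.
rewrite !big_cons Y_valD IH; congr (_ + _).
rewrite -(yqE (rmod_int p.2)); move: (yq _) => y.
have vn (k : nat) : Y_val (y *+ k) m = k%:Z * Y_val y m.
  elim: k => [|k IHk]; first by rewrite mul0r.
  by rewrite mulrS Y_valD IHk -add1n PoszD mulrDl mul1r.
case: p.1 => k; first by rewrite -pmulrn.
by rewrite NegzE Y_valN vn mulNr.
Qed.

Local Notation ImY := (Im_chi_q q lq H).

(** Well-definedness of [chi_q] reduces membership to integral combinations of q-characters of
    modules, on which closure can be checked. *)
Lemma ImP (y : Y) : reflect (exists c, y = rsum c) (y \in ImY).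
Proof.
have hP : reflect (exists x : Rep q lq H, Y_val y = chi_q q lq x) (y \in ImY) by exact: asboolP.
apply: (iffP hP) => {hP} [[x ex]|[c ->]].
  have [c ec] := rep_valP x; exists c; apply: val_inj; rewrite /= ex; apply/funext => m.
  by rewrite (chi_qE m ec) -rsumE.
have h : exists c', rep_class c = rep_class c' :> (simple_mod q lq H -> int) by exists c.
exists (MkRep h); apply/funext => m.
by rewrite (@chi_qE (MkRep h) c) // rsumE.
Qed.
Lemma Im_mod V oV : @yq V oV \in ImY.
Proof.
have [x hx] := int_rep oV.
by apply/asboolP; exists x; rewrite yqE; apply/funext => m; rewrite hx.
Qed.
Lemma ImB (y z : Y) : y \in ImY -> z \in ImY -> y - z \in ImY.
Proof.
move=> /ImP[c ->] /ImP[d ->]; apply/ImP; exists (c ++ [seq (- p.1, p.2) | p <- d]).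
rewrite /rsum big_cat big_map -sumrN; congr (_ + _); apply: eq_bigr => p _.
by rewrite mulrNz.
Qed.
Lemma Im0 : 0 \in ImY.
Proof. by apply/ImP; exists [::]; rewrite /rsum big_nil. Qed.
Lemma ImD (y z : Y) : y \in ImY -> z \in ImY -> y + z \in ImY.
Proof. move=> hy hz; have -> : y + z = y - (0 - z) by rewrite sub0r opprK.
exact: ImB hy (ImB Im0 hz). Qed.
Lemma ImZ (y : Y) (k : int) : y \in ImY -> y *~ k \in ImY.
Proof.
move=> hy; have hn (j : nat) : y *+ j \in ImY.
  by elim: j => [|j IH]; rewrite ?mulrS; [exact: Im0|exact: ImD].
case: k => k; first by rewrite -pmulrn.
by rewrite NegzE mulrNz -[- _]sub0r; exact: ImB Im0 (hn _).
Qed.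
Lemma Im_yqM V W oV oW : @yq V oV * @yq W oW \in ImY.
Proof.
have [csV fV] := flags_ex oV; have [csW fW] := flags_ex oW.
have [M oM hM] := tensor_mod oV oW fV fW.
have -> : yq oV * yq oW = yq oM; last exact: Im_mod.
apply: val_inj; rewrite /=.
by rewrite (tensor_qchar oV oW oM fV fW hM).
Qed.
Lemma Im_sum (c : seq (int * rmd)) (f : int * rmd -> Y) :
  (forall p, f p \in ImY) -> \sum_(p <- c) f p \in ImY.
Proof.
move=> h; elim: c => [|p c IH]; first by rewrite big_nil Im0.
by rewrite big_cons; exact: ImD.
Qed.
Lemma Im_subring : GRing.subring_closed ImY.
Proof.
split; first 1 last.
- exact: ImB.
- move=> _ _ /ImP[c ->] /ImP[d ->]; rewrite mulr_suml; apply: Im_sum => p.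
  rewrite mulr_sumr; apply: Im_sum => p'.
  by rewrite mulrzAl mulrzAr; apply: ImZ; apply: ImZ; exact: Im_yqM.
- have [M oM eM] := triv_mod.
  have -> : 1 = yq oM :> Y; last exact: Im_mod.
  exact: val_inj; rewrite /=.
Qed.
End Assembly.
End QuantumAffine.

Theorem corollary6p1 (R : realType) (q lq : R[i])
  (q_log : cexp lq = q)
  (q_not_root : forall m : nat, (0 < m)%N -> q ^+ m != 1)
  (n : nat) (D : cartan_datum n) (H : realization D)
  (C_invertible : \det (qcartan D) != 0) :
  GRing.subring_closed (Im_chi_q q lq H).
Proof. exact: (Im_subring (qpow_data q_log q_not_root)). Qed.
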